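(* Let $E$ be a complete separable metric space, let $A\subset\overline C(E)\times\overline C(E)$, $m\in\mathbb N$, $Q\in\mathbb R^{(m+1)\times(m+1)}$ and $\xi^{(1)},\dots,\xi^{(m)}\in\mathbb R^{m+1}$, and set $E_0=\{0,1,\dots,m\}$. Suppose that $A$ satisfies the Mapping Condition (stated in the context) on $E$, and that $(A,m,Q,\xi^{(1)},\dots,\xi^{(m)})$ satisfies the Standing Setting (stated in the context), with associated measure $\varpi$, functions $\eta_k$, functions $\alpha_i$, probability measures $\alpha(i,\cdot)$ and operator $B$. Let $p_i\ge 0$, $i\in E_0$, with $\sum_{i=0}^m p_i=1$, and define the probability measure $\nu$ on $E\times E_0$ by $$\nu(\Gamma\times\{i\})=p_i\,\alpha(i,\Gamma),\qquad \Gamma\in\mathcal B(E),\ i\in E_0 .$$ If $\widetilde Y$ is a cadlag $E_0$-valued Markov chain with generator $Q$ and initial distribution $\{p_i\}$, then there exists a solution $(X,Y)$ of the martingale problem for $(B,\nu)$ such that $Y$ and $\widetilde Y$ have the same distribution on $D_{E_0}[0,\infty)$, and $$P(X(t)\in\Gamma\mid\mathcal F^Y_t)=\alpha(Y(t),\Gamma)\quad\text{for all } t\ge 0 \text{ and all }\Gamma\in\mathcal B(E).$$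
   Context: Notation. For a complete separable metric space $E$: $\mathcal B(E)$ is the Borel $\sigma$-algebra, $\mathcal P(E)$ the Borel probability measures, $B(E)$ the bounded Borel real functions with sup norm $\|\cdot\|_\infty$, $C(E)$ the continuous real functions, $\overline C(E)$ the bounded continuous real functions. $D_{E_0}[0,\infty)$ is the space of cadlag $E_0$-valued paths. $\mathcal F^Y_t=\sigma(Y(s):s\le t)$. An operator is identified with its graph, $A\subset\overline C(E)\times C(E)$, possibly multivalued; $\mathcal D(A)$ is its domain; when $A$ is multivalued, statements about $Af$ are meant for every $g$ with $(f,g)\in A$. A set $D\subset\overline C(E)$ is separating if $\mu,\nu\in\mathcal P(E)$ and $\int f\,d\mu=\int f\,d\nu$ for all $f\in D$ imply $\mu=\nu$. A process $X$ solves the (local) martingale problem for $A$ if there is a filtration such that for each $(f,g)\in A$, $f(X(t))-f(X(0))-\int_0^t g(X(s))\,ds$ is a (local) martingale; it solves the martingale problem for $(A,\nu)$ if in addition $X(0)$ has distribution $\nu$. Mapping Condition for an operator $G$ on $E$: (i) $G\subset\overline C(E)\times C(E)$ and $\mathcal D(G)$ is closed under multiplication and separating. (ii) There exists $\psi\in C(E)$, $\psi\ge1$, such that for each $f\in\mathcal D(G)$ there is a constant $c_f$ with $|Gf(x)|\le c_f\psi(x)$ for all $x\in E$. (iii) There is a countable subset $G_c\subset G$ such that every solution of the (local) martingale problem for $G_c$ is a solution of the (local) martingale problem for $G$. (iv) $G_0f\equiv\psi^{-1}Gf$ is a pre-generator, that is, $G_0$ is dissipative ($\|\lambda f-g\|_\infty\ge\lambda\|f\|_\infty$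 for all $\lambda>0$, $(f,g)\in G_0$) and there are sequences of functions $\mu_n:E\to\mathcal P(E)$ and $\lambda_n:E\to[0,\infty)$ such that for each $(f,g)\in G$ and each $x\in E$, $g(x)=\lim_{n\to\infty}\lambda_n(x)\int_E(f(y)-f(x))\,\mu_n(x,dy)$. Standing Setting. (1) $A\subset\overline C(E)\times\overline C(E)$ has a stationary distribution $\varpi\in\mathcal P(E)$ (which implies $\int_E Af\,d\varpi=0$ for all $f\in\mathcal D(A)$). There are signed measures $\varpi_1,\dots,\varpi_m$ on $E$ and positive reals $\lambda_1,\dots,\lambda_m$ such that for each $k\in\{1,\dots,m\}$ and $f\in\mathcal D(A)$: $\int_E Af\,d\varpi_k=-\lambda_k\int_E f\,d\varpi_k$; $\varpi_k(dx)=\eta_k(x)\varpi(dx)$ with $\eta_k\in\overline C(E)$; and $\varpi_k(E)=0$. Put $\varpi_0=\varpi$, $\eta_0=1$. (2) $Q$ is the generator of a continuous-time Markov chain with state space $E_0=\{0,1,\dots,m\}$ and eigenvalues $\{0,-\lambda_1,\dots,-\lambda_m\}$. (3) $\xi^{(1)},\dots,\xi^{(m)}$ are right eigenvectors of $Q$ corresponding to the eigenvalues $-\lambda_1,\dots,-\lambda_m$. (4) For each $i\in E_0$, the function $\alpha_i(x)=1+\sum_{k=1}^m\xi^{(k)}_i\eta_k(x)$ satisfies $\alpha_i(x)>0$ for all $x\in E$. Derived objects: $\alpha(i,\Gamma)=\int_\Gamma\alpha_i(x)\,\varpi(dx)$ for $\Gamma\in\mathcal B(E)$ (a probability measure); $q_{ij}(x)=Q_{ij}\,\alpha_j(x)/\alpha_i(x)$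 for $i\ne j$; $S=E\times E_0$; and $B\subset\overline C(S)\times C(S)$ is the operator $$Bf(x,i)=Af(x,i)+\sum_{j\ne i}q_{ij}(x)\,(f(x,j)-f(x,i)),$$ with domain $\mathcal D(B)=\{f(x,i)=f_1(x)f_2(i): f_1\in\mathcal D(A),\ f_2\in B(E_0)\}$, where $Af(x,i)=f_2(i)Af_1(x)$. *)

(* Defs.v *)
From HB Require Import structures.
From mathcomp Require Import all_boot all_order all_algebra.
From mathcomp Require Import all_classical all_reals all_analysis.
From mathcomp Require Import complex.

Set Implicit Arguments.
Unset Strict Implicit.
Unset Printing Implicit Defensive.

Import Order.TTheory GRing.Theory Num.Theory.
Import numFieldNormedType.Exports.

Local Open Scope classical_set_scope.
Local Open Scope ring_scope.

HB.instance Definition _ m := isPointed.Build 'I_m.+1 ord0.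
HB.instance Definition _ m := hasNbhs.Build 'I_m.+1 principal_filter.
HB.instance Definition _ m := Discrete_ofNbhs.Build 'I_m.+1 erefl.

HB.instance Definition _ (T U : ptopologicalType) := Topological.on (T * U)%type.

#[short(type="completeMetricType")]
HB.structure Definition CompleteMetric (R : numDomainType) :=
  { M of Metric R M & Complete M }.

Definition separable_space (T : topologicalType) :=
  exists2 D : set T, countable D & dense D.

Notation borel T := (g_sigma_algebraType (@open T)).

Section conditioning.
Context {R : realType} {d : measure_display} {Omega : measurableType d}.
Variable P : probability Omega R.

Definition measurable_wrt {d'} {T : measurableType d'}
    (G : set_system Omega) (f : Omega -> T) :=
  forall B, measurable B -> G (f @^-1` B).

(* [W] is a version of E[Z | G]. *)
Definition cond_expectation (G : set_system Omega) (Z W : Omega -> R) :=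
  [/\ measurable_wrt G (W : Omega -> measurableTypeR R),
      P.-integrable setT (EFin \o W) &
      forall A, G A ->
        (\int[P]_(w in A) (W w)%:E = \int[P]_(w in A) (Z w)%:E)%E].

Definition filtration (F : R -> set_system Omega) :=
  [/\ forall t, 0 <= t -> sigma_algebra setT (F t),
      forall t, 0 <= t -> F t `<=` measurable &
      forall s t, 0 <= s -> s <= t -> F s `<=` F t].

Definition martingale (F : R -> set_system Omega) (M : R -> Omega -> R) :=
  (forall t, 0 <= t ->
     measurable_wrt (F t) (M t : Omega -> measurableTypeR R) /\
     P.-integrable setT (EFin \o M t)) /\
  (forall s t, 0 <= s -> s <= t -> cond_expectation (F s) (M t) (M s)).

Definition stopping_time (F : R -> set_system Omega) (tau : Omega -> \bar R) :=
  (forall w, 0 <= tau w)%E /\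
  (forall t, 0 <= t -> F t [set w | (tau w <= t%:E)%E]).

Definition stopped (M : R -> Omega -> R) (tau : Omega -> \bar R) :
    R -> Omega -> R :=
  fun t w => M (fine (Order.min t%:E (tau w))) w.

Definition local_martingale (F : R -> set_system Omega)
    (M : R -> Omega -> R) :=
  (forall t, 0 <= t ->
     measurable_wrt (F t) (M t : Omega -> measurableTypeR R)) /\
  exists tau : nat -> Omega -> \bar R,
    [/\ forall n, stopping_time F (tau n),
        {ae P, forall w, nondecreasing_seq (fun n => tau n w) /\
                         tau n w @[n --> \oo] --> +oo%E} &
        forall n, martingale F (stopped M (tau n))].

End conditioning.

(* Stochastic processes are functions [R -> Omega -> T]; only their values at
   times [0 <= t] are ever used. *)
Section processes.
Context {R : realType} {d : measure_display} {Omega : measurableType d}.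
Context {T : ptopologicalType}.
Implicit Types (P : probability Omega R) (X : R -> Omega -> T).

Definition measurable_process X :=
  measurable_fun (`[0, +oo[ `*` setT : set (measurableTypeR R * Omega))
    (fun z => X z.1 z.2 : borel T).

Definition natural_filtration X (t : R) : set_system Omega :=
  <<s [set A | exists s (B : set (borel T)),
        [/\ 0 <= s, s <= t, measurable B & A = X s @^-1` B]] >>.

Definition stationary_process P X :=
  forall (n : nat) (s : 'I_n -> R) (B : 'I_n -> set (borel T)) (t : R),
    0 <= t -> (forall i, 0 <= s i) -> (forall i, measurable (B i)) ->
    P [set w | forall i, B i (X (t + s i) w)] =
    P [set w | forall i, B i (X (s i) w)].

End processes.

Section paths.
Context {R : realType} {T : ptopologicalType}.

Definition cadlag (w : R -> T) :=
  (forall t : R, 0 <= t -> w s @[s --> t^'+] --> w t) /\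
  (forall t : R, 0 < t -> exists l : T, w s @[s --> t^'-] --> l).

(* D_T[0, oo); a path carries irrelevant values at negative times, which the
   sigma-algebra below does not see. *)
Definition path_space : set (R -> T) := [set w | cadlag w].

(* The sigma-algebra on D_T[0, oo) generated by the evaluations at t >= 0 (for
   separable metric T, the Borel sigma-algebra of the Skorokhod topology). *)
Definition path_events : set (set (R -> T)) :=
  <<s path_space, [set C | exists t (B : set (borel T)),
        [/\ 0 <= t, measurable B & C = path_space `&` [set w | B (w t)]]] >>.

Definition same_path_law {d d'} {Omega : measurableType d}
    {Omega' : measurableType d'} (P : probability Omega R)
    (P' : probability Omega' R) (Y : R -> Omega -> T) (Y' : R -> Omega' -> T) :=
  forall C, path_events C ->
    P [set w | C (Y ^~ w)] = P' [set w | C (Y' ^~ w)].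

End paths.

Section martingale_problem.
Context {R : realType}.

(* An operator is its graph, possibly multivalued. *)
Definition operator (T : Type) := set ((T -> R) * (T -> R)).

Definition domain T (G : operator T) : set (T -> R) :=
  [set f | exists g, G (f, g)].

Context {T : ptopologicalType}.
Implicit Types G A : operator T.

Section solutions.
Context {d : measure_display} {Omega : measurableType d}.
Implicit Types (P : probability Omega R) (X : R -> Omega -> T).

Definition mp_process (f g : T -> R) X : R -> Omega -> R := fun t w =>
  f (X t w) - f (X 0 w) - \int[lebesgue_measure]_(s in `[0, t]) g (X s w).

(* Makes the time integral in [mp_process] meaningful: [Rintegral] is a junk
   value on non-integrable functions, and [g] need not be bounded. *)
Definition locally_integrable_along P (g : T -> R) X :=
  {ae P, forall w, forall t, 0 <= t ->
    lebesgue_measure.-integrable `[0, t] (fun s => (g (X s w))%:E)}.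

Definition solves_with
    (mg : (R -> set_system Omega) -> (R -> Omega -> R) -> Prop) P G X :=
  measurable_process X /\
  exists F : R -> set_system Omega,
    [/\ filtration F,
        forall t, 0 <= t -> measurable_wrt (F t) (X t : Omega -> borel T) &
        forall f g, G (f, g) ->
          locally_integrable_along P g X /\ mg F (mp_process f g X)].

Definition solves_mp P := solves_with (martingale P) P.

Definition solves_local_mp P := solves_with (local_martingale P) P.

Definition solves_mp_from P G (nu : set (borel T) -> \bar R) X :=
  solves_mp P G X /\
  (forall B : set (borel T), measurable B -> P (X 0 @^-1` B) = nu B).

End solutions.

Definition stationary_distribution A (mu : probability (borel T) R) :=
  exists (d : measure_display) (Omega : measurableType d)
         (P : probability Omega R) (X : R -> Omega -> T),
    solves_mp_from P A mu X /\ stationary_process P X.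

Definition bounded_continuous (f : T -> R) :=
  continuous f /\ exists M, forall x, `|f x| <= M.

Definition separating (D : set (T -> R)) :=
  forall mu nu : probability (borel T) R,
    (forall f, D f -> \int[mu]_x f x = \int[nu]_x f x) ->
    forall B : set (borel T), measurable B -> mu B = nu B.

Definition sup_norm (f : T -> R) : \bar R :=
  ereal_sup (range (fun x => `|f x|%:E)).

Definition dissipative G :=
  forall (c : R) f g, 0 < c -> G (f, g) ->
    (c%:E * sup_norm f <= sup_norm (fun x => c * f x - g x)%R)%E.

Definition rescaled (psi : T -> R) G : operator T :=
  [set fh | exists g, G (fh.1, g) /\ fh.2 = (fun x => (psi x)^-1 * g x)].

Definition mapping_condition G :=
  [/\ [/\ forall f g, G (f, g) -> bounded_continuous f /\ continuous g,
          forall f1 f2, domain G f1 -> domain G f2 ->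
            domain G (fun x => f1 x * f2 x) &
          separating (domain G)],
      exists Gc : operator T,
        [/\ Gc `<=` G, countable Gc,
            forall (d : measure_display) (Omega : measurableType d)
                   (P : probability Omega R) (X : R -> Omega -> T),
              solves_mp P Gc X -> solves_mp P G X &
            forall (d : measure_display) (Omega : measurableType d)
                   (P : probability Omega R) (X : R -> Omega -> T),
              solves_local_mp P Gc X -> solves_local_mp P G X] &
      exists psi : T -> R,
        [/\ continuous psi, forall x, 1 <= psi x,
            forall f, domain G f ->
              exists c, forall g, G (f, g) -> forall x, `|g x| <= c * psi x,
            dissipative (rescaled psi G) &
            exists (mu : nat -> T -> probability (borel T) R)
                   (lam : nat -> T -> R),
              (forall n x, 0 <= lam n x) /\
              forall f g, G (f, g) -> forall x,
                lam n x * (\int[mu n x]_y (f y - f x)) @[n --> \oo]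
                  --> g x]].

End martingale_problem.

(* Integral against a signed measure, through its Jordan decomposition (which
   does not depend on the Hahn decomposition chosen). *)
Definition charge_integral {d} {T : measurableType d} {R : realType}
    (nu : {charge set T -> \bar R}) (f : T -> R) : R :=
  let (P, exN) := cid (Hahn_decomposition nu) in
  let (N, nuPN) := cid exN in
  \int[jordan_pos nuPN]_x f x - \int[jordan_neg nuPN]_x f x.

Section finite_chain.
Context {R : realType} {m : nat}.
Implicit Types Q : 'M[R]_m.+1.

Definition chain_generator Q :=
  (forall i j, i != j -> 0 <= Q i j) /\ (forall i, \sum_j Q i j = 0).

Definition complex_spectrum Q : set (complex.complex (R : rcfType)) :=
  [set z | eigenvalue
    (map_mx (complex.real_complex R) Q : 'M[complex.complex (R : rcfType)]_m.+1)
    z].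

(* The (i, j) entry of exp(t Q). *)
Definition transition Q (t : R) (i j : 'I_m.+1) : R :=
  limn (fun n => \sum_(0 <= k < n) t ^+ k / k`!%:R * (Q ^+ k) i j).

Definition markov_chain {d} {Omega : measurableType d}
    (P : probability Omega R) Q (p : 'I_m.+1 -> R)
    (Y : R -> Omega -> 'I_m.+1) :=
  [/\ forall t, 0 <= t -> measurable_fun setT (Y t : Omega -> borel 'I_m.+1),
      forall i, P (Y 0 @^-1` [set i]) = (p i)%:E &
      forall s t j, 0 <= s -> 0 <= t ->
        cond_expectation P (natural_filtration Y t)
          (\1_(Y (t + s) @^-1` [set j]))
          (fun w => transition Q s (Y t w) j)].

End finite_chain.

Section setting.
Context {R : realType} {E : completeMetricType R} {m : nat}.
Variables (A : operator (R := R) E) (Q : 'M[R]_m.+1) (xi : 'I_m -> 'cV[R]_m.+1).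
(* [vark k], [lam k], [eta k], [xi k] for k : 'I_m stand for the objects of
   index k + 1, i.e., the index set {1, ..., m} is shifted by one. *)
Variables (varpi : probability (borel E) R)
  (vark : 'I_m -> {charge set (borel E) -> \bar R})
  (lam : 'I_m -> R) (eta : 'I_m -> E -> R).

Definition alpha_density (i : 'I_m.+1) (x : E) : R :=
  1 + \sum_k xi k i ord0 * eta k x.

Definition alpha (i : 'I_m.+1) (G : set (borel E)) : \bar R :=
  (\int[varpi]_(x in G) (alpha_density i x)%:E)%E.

Definition jump_rate (i j : 'I_m.+1) (x : E) : R :=
  Q i j * alpha_density j x / alpha_density i x.

Definition joint_operator : operator (R := R) (E * 'I_m.+1)%type :=
  [set FH | exists (f1 g1 : E -> R) (f2 : 'I_m.+1 -> R),
     let F := fun z : E * 'I_m.+1 => f1 z.1 * f2 z.2 in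
     [/\ A (f1, g1), FH.1 = F &
         FH.2 = fun z => f2 z.2 * g1 z.1 +
           \sum_(j | j != z.2) jump_rate z.2 j z.1 * (F (z.1, j) - F z)]].

Definition joint_law (p : 'I_m.+1 -> R) (C : set (borel (E * 'I_m.+1)%type)) :
    \bar R :=
  (\sum_i (p i)%:E * alpha i [set x | C (x, i)])%E.

Lemma joint_law_rectangle (p : 'I_m.+1 -> R) (G : set (borel E)) i :
  joint_law p (G `*` [set i]) = ((p i)%:E * alpha i G)%E.
Proof.
rewrite /joint_law (bigD1 i)//= big1 ?adde0 => [|j ji].
  by congr (_ * alpha i _)%E; apply/seteqP; split=> x //= [].
rewrite (_ : [set _ | _] = set0) /alpha ?integral_set0 ?mule0//.
by apply/seteqP; split=> // x [_ /= /eqP]; rewrite (negbTE ji).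
Qed.

Record standing_setting : Prop := {
  ss_operator : forall f g, A (f, g) ->
    bounded_continuous f /\ bounded_continuous g;
  ss_stationary : stationary_distribution A varpi;
  ss_lam_gt0 : forall k, 0 < lam k;
  ss_eigenmeasure : forall k f g, A (f, g) ->
    charge_integral (vark k) g = - lam k * charge_integral (vark k) f;
  ss_density : forall k (G : set (borel E)), measurable G ->
    vark k G = (\int[varpi]_(x in G) (eta k x)%:E)%E;
  ss_eta : forall k, bounded_continuous (eta k);
  ss_centered : forall k, vark k setT = 0%E;
  ss_generator : chain_generator Q;
  ss_spectrum : complex_spectrum Q =
    [set z | z = 0 \/ exists k, z = complex.real_complex R (- lam k)];
  ss_eigenvector : forall k, xi k != 0 /\ Q *m xi k = - lam k *: xi k;
  ss_alpha_gt0 : forall i x, 0 < alpha_density i x }.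

End setting.

(* Main.v *)
(* The pair (X, Y) is a limit of discrete-time couplings.  The
   eigenmeasure and eigenvector identities say that
   alpha_i (A f) = sum_j Q_ij alpha_j f, so that B maps the tilted measures
   consistently with Q.  On a dyadic grid of step eps, X is sampled backwards
   in time given Y, with X_t of law alpha (Y_t) at the last time; the backward
   kernels must satisfy sum_j P_ij alpha_j R_ij = alpha_i and have drift close
   to B.  By a finite Strassen lemma, such kernels exist as soon as
   sum_j P_ij alpha_j (max_a (z_a - eps B z_a)) >= alpha_i (max_a z_a) - o(eps),
   and this follows from the positive maximum principle for B: the limit formula
   in the mapping condition gives it for A, and closure of the domain under
   products allows a maximum to be approximated by polynomials.

   What converges along an ultrafilter is not X but the family of bits
   recording whether X_t lies in G: they define a probability on Omega x {bits} whose first marginal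
   is the given law of Y, so that Y keeps its law and its paths.  Since the
   domain is separating, its span is dense in L1 of each alpha_i; hence the bits
   are continuous in probability, and X_t is recovered from the bits of small
   balls at dyadic times just before t, which makes X progressively measurable.
   The limiting drift identities then give the martingale property. *)

Require Import Defs.
From HB Require Import structures.
From mathcomp Require Import all_boot all_order all_algebra.
From mathcomp Require Import all_classical all_reals all_analysis.
From mathcomp Require Import measurable_realfun polyrcf ring lra zify.

Set Implicit Arguments.
Unset Strict Implicit.
Unset Printing Implicit Defensive.

Import Order.TTheory GRing.Theory Num.Theory.
Import numFieldNormedType.Exports.

Local Open Scope classical_set_scope.
Local Open Scope ring_scope.

(** * Polynomial approximation of the absolute value *)

(** The condition on [P(X_t | F^Y_t)] dictates the backward sampling: once the cell at the last grid
    time has law [alpha(Y_t)] given [Y], the identity [sum_j P_ij alpha_j R_ij = alpha_i] carries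
    this law to all earlier grid times, and appending a later grid time does not disturb what was
    built before. No range condition is available for [B], so [1 - eps B] need not be invertible;
    the kernels come from an inequality on finitely many cells instead of a resolvent. The rates
    [q_ij] may be unbounded, as [alpha_i] may come close to 0, but [q_ij alpha_i = Q_ij alpha_j]
    makes them integrable. Hence all errors are measured in L1 of the measures [alpha_i], and [B f]
    is replaced by an L1-close element [G] of the span whenever its own motion in time has to be
    controlled. Until [X] exists, the limits of expectations of test functions are kept as a
    functional [D]; it is identified with expectations under the limit law only after [X] has been
    decoded from the bits. *)

Section convex_approximation_of_abs.
Variable R : rcfType.

Definition antideriv (q : {poly R}) : {poly R} :=
  \poly_(i < (size q).+1) (q`_i.-1 / i%:R).

Lemma deriv_antideriv q : deriv (antideriv q) = q.
Proof.
apply/polyP => i; rewrite coef_deriv coef_poly /= ltnS.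
case: ltnP => [_|qi]; last by rewrite mul0rn nth_default.
by rewrite -[_ *+ _]mulr_natr mulfVK// pnatr_eq0.
Qed.

Lemma antideriv0 q : (antideriv q).[0] = 0.
Proof. by rewrite horner_coef0 coef_poly /= invr0 mulr0. Qed.

(** The Newton-Schulz step for the sign function: it fixes -1, 0 and 1, and its slope
    [3/2 (1 - x^2)] is nonnegative on [[-1, 1]], so the iterates stay increasing there while they
    approach the sign. *)
Let step : {poly R} := (3 / 2) *: 'X - 2^-1 *: 'X^3.

Fixpoint sign_poly (k : nat) : {poly R} :=
  if k is k'.+1 then step \Po sign_poly k' else 'X.

Lemma sign_polyS k x : (sign_poly k.+1).[x] =
  (3 / 2) * (sign_poly k).[x] - 2^-1 * (sign_poly k).[x] ^+ 3.
Proof. by rewrite /= horner_comp /step !hornerE. Qed.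

Lemma sign_poly_bound k x : -1 <= x <= 1 -> -1 <= (sign_poly k).[x] <= 1.
Proof.
move=> x1; elim: k => [|k]; first by rewrite /= hornerX.
rewrite sign_polyS; set u := (_.[x]) => /andP[u1 u2].
(* The two products are [2 (1 + s)] and [2 (1 - s)] for the next iterate [s]. *)
have h1 : 0 <= (1 + u) ^+ 2 * (2 - u) by rewrite mulr_ge0 ?sqr_ge0//; lra.
have h2 : 0 <= (1 - u) ^+ 2 * (2 + u) by rewrite mulr_ge0 ?sqr_ge0//; lra.
by apply/andP; split; lra.
Qed.

Lemma sign_poly_ge k x : 0 <= x <= 1 -> x <= (sign_poly k).[x] <= 1.
Proof.
move=> /andP[x0 x1]; elim: k => [|k]; first by rewrite /= hornerX lexx.
rewrite sign_polyS; set u := (_.[x]) => /andP[u1 u2].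
have h1 : 0 <= u * ((1 - u) * (1 + u)) by rewrite !mulr_ge0//; lra.
have h2 : 0 <= (1 - u) ^+ 2 * (2 + u) by rewrite mulr_ge0 ?sqr_ge0//; lra.
by apply/andP; split; lra.
Qed.

Lemma sign_polyN k x : (sign_poly k).[- x] = - (sign_poly k).[x].
Proof.
elim: k => [|k IH]; first by rewrite /= !hornerX.
by rewrite !sign_polyS IH; ring.
Qed.

(** Monotonicity of the derivative is what makes the antiderivative convex. *)
Lemma sign_poly_le k x y : -1 <= x -> x <= y -> y <= 1 ->
  (sign_poly k).[x] <= (sign_poly k).[y].
Proof.
move=> x1 xy y1; elim: k => [|k]; first by rewrite /= !hornerX.
rewrite !sign_polyS.
have /andP[] : -1 <= (sign_poly k).[x] <= 1.
  by apply: sign_poly_bound; rewrite x1 (le_trans xy).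
have /andP[] : -1 <= (sign_poly k).[y] <= 1.
  by apply: sign_poly_bound; rewrite y1 (le_trans x1).
set u := (_.[x]); set v := (_.[y]) => v1 v2 u1 u2 uv.
rewrite -subr_ge0 (_ : _ - _ = (v - u) * (3 - (u ^+ 2 + u * v + v ^+ 2)) / 2).
  by rewrite divr_ge0// mulr_ge0 ?subr_ge0//; nra.
by field.
Qed.

(** One step multiplies the error [1 - u] by [1 - u/2 - u^2/2], and [u >= x] along the iteration, so
    each factor is at most [1 - x/2]. *)
Lemma sign_poly_err k x : 0 <= x <= 1 ->
  1 - (sign_poly k).[x] <= (1 - x / 2) ^+ k.
Proof.
move=> x01; have /andP[x0 x1] := x01; elim: k => [|k IH].
  by rewrite expr0 /= hornerX; lra.
rewrite sign_polyS [(1 - _) ^+ _]exprSr.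
have /andP[] := sign_poly_ge k x01; move: IH.
set u := (_.[x]) => IH xu u1; set e := (_ ^+ k) in IH *.
apply: (@le_trans _ _ ((1 - u) * (1 - x / 2))); last first.
  by rewrite ler_wpM2r//; lra.
rewrite -subr_ge0.
rewrite (_ : _ - _ = (1 - u) * ((u - x) + u ^+ 2) / 2); last by field.
by rewrite divr_ge0// mulr_ge0//; nra.
Qed.

(** The geometric error integrates to at most [2 / (k + 1)], uniformly in [x], although its ratio
    tends to 1 at 0. Only the derivative on [[0, 1]] is prescribed, so that the reflected polynomial
    [p \Po (- 'X)] is covered as well. *)
Lemma antideriv_sign_err k (p : {poly R}) (x : R) : p.[0] = 0 ->
  (forall t : R, 0 <= t <= 1 -> (deriv p).[t] = (sign_poly k).[t]) ->
  0 <= x <= 1 -> `|p.[x] - x| <= 2 / k.+1%:R.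
Proof.
move=> p0 dp /andP[x0 x1]; rewrite distrC.
have k0 : (k.+1%:R : R) != 0 by rewrite pnatr_eq0.
have dp1 (t : R) : t \in `]0, x[ -> (deriv p).[t] = (sign_poly k).[t] /\ 0 <= t <= 1.
  rewrite in_itv /= => /andP[t0 t1]; have t01 : 0 <= t <= 1.
    by rewrite ltW//= (le_trans (ltW t1)).
  by rewrite dp.
have mono (q : {poly R}) : (forall t : R, t \in `]0, x[ -> 0 <= (deriv q).[t]) ->
    q.[0] <= q.[x].
  by move=> h; apply: (ler_hornerW h) => //; rewrite in_itv /= lexx// x0.
have := @mono ('X - p); rewrite !hornerE p0 oppr0 => le1.
have {}le1 : 0 <= x - p.[x].
  apply: le1 => t /dp1[e t01]; rewrite derivB derivX !hornerE e subr_ge0.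
  by case/andP: (sign_poly_ge k t01).
rewrite ger0_norm//.
(* The derivative of [- 2 / (k + 1) * w^(k + 1)] is [w^k], the bound on the error of the derivative;
   the integral estimate becomes monotonicity of a polynomial. *)
pose w : {poly R} := 1 - 2^-1 *: 'X.
have := @mono (p - 'X - (2 / k.+1%:R) *: (w ^+ k.+1 - 1)).
rewrite /w !hornerE p0 !subr0 expr1n subrr mulr0 subr0 => le2.
have {le2} : 0 <= p.[x] - x - 2 / k.+1%:R * ((1 - 2^-1 * x) ^+ k.+1 - 1).
  apply: le2 => t /dp1[e t01].
  rewrite 2!derivB derivX derivZ derivB derivC subr0 deriv_exp derivB derivC derivZ derivX. rewrite !hornerE e hornerMn !hornerE /=.
  have := sign_poly_err k t01; rewrite (_ : 1 - 2^-1 * t = 1 - t / 2); last by ring.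
  set a : R := (_ ^+ k) => ea; rewrite -[(_ * a) *+ _]mulr_natr; rewrite [X in _ - _ - X](_ : _ = - a); first by rewrite opprK addrAC subr_ge0 -lerBlDl.
  by field.
have : 0 <= (1 - 2^-1 * x) ^+ k.+1 by rewrite exprn_ge0//; lra.
set b := (_ ^+ k.+1) => b0.
have c0 : 0 <= 2 / k.+1%:R :> R by rewrite divr_ge0.
move: c0; set c : R := _ / _ => c0; have := mulr_ge0 c0 b0; lra.
Qed.

(** Closeness alone would not do: the tangent inequality is what can be pushed through the
    generator, in [span_tangent], and the bound on the slope lets the tangents be extended beyond
    [[-1, 1]], in [tangent_abs]. *)
Lemma convex_poly_approx_abs (e : R) (k : nat) : 2 / k.+1%:R <= e ->
  exists p : {poly R},
  [/\ forall x y, -1 <= x <= 1 -> -1 <= y <= 1 ->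
        p.[x] + (deriv p).[x] * (y - x) <= p.[y],
      forall x, -1 <= x <= 1 -> `|(deriv p).[x]| <= 1 &
      forall x, -1 <= x <= 1 -> `|p.[x] - `|x| | <= e].
Proof.
move=> ke; pose p := antideriv (sign_poly k); exists p.
have dpE : deriv p = sign_poly k by exact: deriv_antideriv.
split.
- move=> x y x1 y1; rewrite dpE.
  pose D : {poly R} := p - (sign_poly k).[x] *: 'X.
  have DE z : D.[z] = p.[z] - (sign_poly k).[x] * z by rewrite /D !hornerE.
  have dDE z : (deriv D).[z] = (sign_poly k).[z] - (sign_poly k).[x].
    by rewrite /D derivB derivZ derivX dpE !hornerE.
  suff : D.[x] <= D.[y] by rewrite !DE; lra.
  case/andP: x1 => x0 x1; case/andP: y1 => y0 y1.
  have [xy|/ltW yx] := leP x y.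
    apply: (@ler_hornerW _ x y) => //; rewrite ?in_itv /= ?lexx ?xy// => z.
    rewrite in_itv /= dDE subr_ge0 => /andP[/ltW xz /ltW zy].
    by rewrite sign_poly_le// (le_trans zy).
  rewrite -lerN2 -!hornerN; apply: (@ler_hornerW _ y x) => //;
    rewrite ?in_itv /= ?lexx ?yx// => z.
  rewrite in_itv /= derivN hornerN dDE opprB subr_ge0 => /andP[/ltW yz /ltW zx].
  by rewrite sign_poly_le// (le_trans y0).
- by move=> x x1; rewrite dpE ler_norml sign_poly_bound.
- move=> x /andP[x0 x1]; apply: le_trans ke; have [x2|x2] := leP 0 x.
    rewrite (ger0_norm x2); apply: antideriv_sign_err; rewrite ?antideriv0 ?x2//.
    by move=> t _; rewrite dpE.
  rewrite (ltr0_norm x2).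
  have := @antideriv_sign_err k (p \Po (- 'X)) (- x).
  rewrite !horner_comp !hornerE /= opprK; apply.
  + by rewrite ?oppr0 antideriv0.
  + move=> t _; rewrite deriv_comp dpE derivN derivX !hornerE horner_comp !hornerE.
    by rewrite sign_polyN; ring.
  + by apply/andP; split; lra.
Qed.

End convex_approximation_of_abs.

(** * A finite Strassen lemma *)

Lemma cvg_finite_sum {R : realType} {T : Type} (F : set_system T) {FF : Filter F}
    (J : Type) (s : seq J) (P : pred J) (f : J -> T -> R) (l : J -> R) :
  (forall j, P j -> f j @ F --> l j) ->
  (fun i => \sum_(j <- s | P j) f j i) @ F --> \sum_(j <- s | P j) l j.
Proof.
move=> fl; elim: s => [|j s IH].
  rewrite big_nil; under eq_fun do rewrite big_nil; exact: cvg_cst.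
rewrite big_cons; under eq_fun do rewrite big_cons.
case: ifP => [Pj|_]; last exact: IH.
by apply: cvgD; [exact: fl|exact: IH].
Qed.

(** * Limits of real functions along an ultrafilter *)

Section ultralimits.
Context {R : realType} {I : Type} (U : set_system I) {UU : UltraFilter U}.

Lemma ultra_dec (A : set I) : U A \/ U (~` A).
Proof. exact: in_ultra_setVsetC. Qed.

Lemma ultra_fmap {T : Type} (f : I -> T) : UltraFilter (f @ U).
Proof.
split; first by apply: fmap_proper_filter.
move=> G GF FG; rewrite predeqE => A; split => [GA|]; last exact: FG.
have [//|UnA] := ultra_dec (f @^-1` A).
have : G (A `&` ~` A) by apply: filterI => //; apply: FG.
by rewrite setICr => /filter_not_empty.
Qed.

Lemma ultra_cvg (f : I -> R) (M : R) : (forall i, `|f i| <= M) ->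
  exists l : R, f @ U --> l.
Proof.
move=> fM; have := @segment_compact R (- M) M; rewrite compact_ultra.
move=> /(_ (f @ U) (ultra_fmap f)) []; last by move=> l [_ fl]; exists l.
by apply: (@filterE _ U) => i; rewrite /= in_itv /= -ler_norml.
Qed.

Lemma ultra_lim_le (f g : I -> R) (a b : R) : f @ U --> a -> g @ U --> b ->
  U [set i | f i <= g i] -> a <= b.
Proof.
move=> fa gb fg; rewrite leNgt; apply/negP => ba.
have e0 : 0 < (a - b) / 2 by rewrite divr_gt0// subr_gt0.
have {}fa : U [set i | `|a - f i| < (a - b) / 2] by move/cvgrPdist_lt : fa; exact.
have {}gb : U [set i | `|b - g i| < (a - b) / 2] by move/cvgrPdist_lt : gb; exact.
have : U ([set i | `|a - f i| < (a - b) / 2] `&`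
  [set i | `|b - g i| < (a - b) / 2] `&` [set i | f i <= g i]).
  by do 2 apply: filterI => //.
move=> /filter_ex[i [[/=]]].
by rewrite !ltr_norml => /andP[_ h1] /andP[h2 _] h3; lra.
Qed.

Lemma ultra_lim_eq (f g : I -> R) (a b : R) : f @ U --> a -> g @ U --> b ->
  U [set i | f i = g i] -> a = b.
Proof.
move=> fa gb fg; apply: le_anti; apply/andP; split.
  by apply: (ultra_lim_le fa gb); apply: filterS fg => i /= ->.
by apply: (ultra_lim_le gb fa); apply: filterS fg => i /= ->.
Qed.

End ultralimits.

Lemma ultrafilter_nat : exists U : set_system nat, UltraFilter U /\ \oo `<=` U.
Proof. exact: ultraFilterLemma. Qed.

Section finite_strassen.
Context {R : realType}.

(* Moving from [u] towards [v] with weight [1 / (k + 1)] multiplies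
   [k * |u| ^ 2] by at most 1 and adds at most [B / (k + 1)]. *)
Lemma approach_origin (X : finType) (C : set (X -> R)) (B : R) :
  C !=set0 ->
  (forall u v t, 0 <= t <= 1 -> C u -> C v ->
    C (fun x => (1 - t) * u x + t * v x)) ->
  (forall u, C u -> \sum_x u x ^+ 2 <= B) ->
  (forall u, C u -> exists2 v, C v & \sum_x u x * v x <= 0) ->
  forall k : nat, exists2 u, C u & \sum_x u x ^+ 2 <= B / k.+1%:R.
Proof.
move=> [u0 Cu0] Cconv CB Cv; elim=> [|k [u Cu IH]].
  by exists u0 => //; rewrite divr1 CB.
have [v vC uv] := Cv _ Cu; pose t : R := k.+2%:R^-1.
have t01 : 0 <= t <= 1 by rewrite invr_ge0 ler0n /= invf_le1 ?ltr0n// ler1n.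
exists (fun x => (1 - t) * u x + t * v x); first exact: Cconv.
rewrite (_ : \sum_x _ = (1 - t) ^+ 2 * (\sum_x u x ^+ 2) +
  2 * ((1 - t) * t) * (\sum_x u x * v x) + t ^+ 2 * \sum_x v x ^+ 2); last first.
  rewrite !mulr_sumr -!big_split /=; apply: eq_bigr => x _.
  by rewrite sqrrD !exprMn -[in LHS]mulr_natl; ring.
have h1 := ler_wpM2l (sqr_ge0 (1 - t)) IH.
have h2 : 2 * ((1 - t) * t) * (\sum_x u x * v x) <= 0.
  by case/andP: t01 => t0 t1; rewrite mulr_ge0_le0// !mulr_ge0// subr_ge0.
have h3 := ler_wpM2l (sqr_ge0 t) (CB _ vC).
apply: (@le_trans _ _ ((1 - t) ^+ 2 * (B / k.+1%:R) + t ^+ 2 * B)).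
  by apply: lerD h3; rewrite -[leRHS]addr0; exact: lerD.
have k1 : k.+1%:R != 0 :> R by rewrite pnatr_eq0.
have k2 : k.+2%:R != 0 :> R by rewrite pnatr_eq0.
rewrite le_eqVlt; apply/orP; left; apply/eqP.
have e : k.+2%:R = k.+1%:R + 1 :> R by rewrite -natr1.
rewrite /t e; rewrite e in k2; clear e h1 h2 h3 IH t01; clear t.
by move: (k.+1%:R : R) k1 k2 => c c1 c2; field; rewrite c1 c2.
Qed.

Variables (S A L : finType) (a0 : A) (l0 : L).
Variables (m : S -> R) (u : S -> L -> R) (n : A -> R) (w : A -> L -> R) (d : R).
Hypothesis d_ge0 : 0 <= d.
(** The dual of the problem of moving the mass [m] on [S] to [n] on [A] so that the point [a]
    receives the moments [w a] up to a total error [d]. The multipliers of the mass and moment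
    constraints are [k] and [h]; [eta] bounds the sup norm of [h], dual to the l1 norm in which [d]
    is measured. *)
Hypothesis dual : forall (k : A -> R) (h : A -> L -> R) (eta : R) (sel : S -> A),
  (forall a l, `|h a l| <= eta) ->
  (forall s a, k a + \sum_l h a l * u s l <=
               k (sel s) + \sum_l h (sel s) l * u s l) ->
  \sum_a (n a * k a + \sum_l h a l * w a l) - d * eta <=
  \sum_s m s * (k (sel s) + \sum_l h (sel s) l * u s l).

Let stoch (r : S -> A -> R) :=
  (forall s a, 0 <= r s a) /\ (forall s, \sum_a r s a = 1).

(** The residual of all constraints, with a slack [e] in the moment constraints; the kernel sought
    is a zero of it with slack of total size at most [d]. *)
Let gap (r : S -> A -> R) (e : A -> L -> R) (x : A + A * L) : R :=
  match x with
  | inl a => n a - \sum_s m s * r s a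
  | inr al => w al.1 al.2 + e al.1 al.2 - \sum_s m s * r s al.1 * u s al.2
  end.

Let C : set (A + A * L -> R) := [set v | exists r e,
  [/\ stoch r, \sum_a \sum_l `|e a l| <= d & v = gap r e]].

Let stoch_le1 r s a : stoch r -> `|r s a| <= 1.
Proof.
move=> [r0 r1]; rewrite ger0_norm// -(r1 s) (bigD1 a)//= lerDl.
by apply: sumr_ge0.
Qed.

Let C_bound : exists B, forall v, C v -> \sum_x v x ^+ 2 <= B.
Proof.
exists (\sum_x (match x with
  | inl a => `|n a| + \sum_s `|m s|
  | inr al => `|w al.1 al.2| + d + \sum_s `|m s * u s al.2| end) ^+ 2).
move=> _ [r [e [rs eL ->]]]; apply: ler_sum => -[a|[a l]] _ /=.
  rewrite -[leLHS]real_normK ?num_real// lerXn2r ?nnegrE ?addr_ge0 ?sumr_ge0//.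
  apply: (le_trans (ler_normB _ _)); rewrite lerD2l.
  apply: (le_trans (ler_norm_sum _ _ _)); apply: ler_sum => s _.
  by rewrite normrM ler_piMr// stoch_le1.
rewrite -[leLHS]real_normK ?num_real// lerXn2r ?nnegrE ?addr_ge0 ?sumr_ge0//.
apply: (le_trans (ler_normB _ _)); apply: lerD; last first.
  apply: (le_trans (ler_norm_sum _ _ _)); apply: ler_sum => s _.
  by rewrite mulrAC normrM ler_piMr// stoch_le1.
apply: (le_trans (ler_normD _ _)); rewrite lerD2l; apply: le_trans eL.
rewrite (bigD1 a)//= (bigD1 l)//= -addrA lerDl addr_ge0// sumr_ge0// => b _.
exact: sumr_ge0.
Qed.

Let C_convex v v' t : 0 <= t <= 1 -> C v -> C v' ->
  C (fun x => (1 - t) * v x + t * v' x).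
Proof.
move=> /andP[t0 t1] [r [e [[r0 r1] eL ->]]] [r' [e' [[r0' r1'] eL' ->]]].
have t1' : 0 <= 1 - t by rewrite subr_ge0.
exists (fun s a => (1 - t) * r s a + t * r' s a),
       (fun a l => (1 - t) * e a l + t * e' a l); split.
- split=> [s a|s]; first by rewrite addr_ge0// mulr_ge0.
  by rewrite big_split /= -!mulr_sumr r1 r1'; ring.
- apply: (@le_trans _ _ ((1 - t) * (\sum_a \sum_l `|e a l|) +
      t * (\sum_a \sum_l `|e' a l|))).
    rewrite !mulr_sumr -big_split /=; apply: ler_sum => a _.
    rewrite !mulr_sumr -big_split /=; apply: ler_sum => l _.
    apply: (le_trans (ler_normD _ _)).
    by rewrite !normrM (ger0_norm t0) (ger0_norm t1').
  have := ler_wpM2l t1' eL; have := ler_wpM2l t0 eL'; lra.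
- apply/funext => -[a|[a l]] /=.
    rewrite [in RHS](eq_bigr (fun s => (1 - t) * (m s * r s a) + t * (m s * r' s a))).
      by rewrite big_split /= -!mulr_sumr; ring.
    by move=> s _; ring.
  rewrite [in RHS](eq_bigr (fun s => (1 - t) * (m s * r s a * u s l) +
                               t * (m s * r' s a * u s l))).
    by rewrite big_split /= -!mulr_sumr; ring.
  by move=> s _; ring.
Qed.

Let sumX (f : A + A * L -> R) :
  \sum_x f x = \sum_a f (inl a) + \sum_a \sum_l f (inr (a, l)).
Proof. by rewrite big_sumType /= pair_bigA /=; congr (_ + _); apply: eq_bigr => -[]. Qed.

(** Against the direction [v], each source is sent to a maximizer of its gain and all the slack is
    spent on the largest coefficient of [h]; [dual] says exactly that the resulting point has a
    nonpositive product with [v]. *)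
Let C_descent v : C v -> exists2 v', C v' & \sum_x v x * v' x <= 0.
Proof.
move=> _; pose k a := v (inl a); pose h a l := v (inr (a, l)).
pose c s a := k a + \sum_l h a l * u s l.
pose sel s : A := [arg max_(a > a0) c s a]%O.
have selP s a : c s a <= c s (sel s).
  by rewrite /sel; case: arg_maxP => //= b _; apply.
pose al : A * L := [arg max_(x > (a0, l0)) `|h x.1 x.2| ]%O.
have alP a l : `|h a l| <= `|h al.1 al.2|.
  by rewrite /al; case: arg_maxP => //= b _ /(_ (a, l)); apply.
pose r s a : R := (a == sel s)%:R.
pose e a l : R := if (a, l) == al then - (d * Num.sg (h al.1 al.2)) else 0.
exists (gap r e).
  exists r, e; split=> //.
    split=> [s a|s]; first by rewrite ler0n.
    by rewrite (bigD1 (sel s))//= /r eqxx big1 ?addr0// => a /negbTE ->.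
  rewrite pair_bigA /= (bigD1 al)//= /e -surjective_pairing eqxx.
  rewrite big1 => [|[a l] /negbTE /= ->]; last by rewrite normr0.
  rewrite addr0 normrN normrM (ger0_norm d_ge0) ler_piMr//.
  by rewrite normr_sg lern1 leq_b1.
rewrite sumX.
have rsum (f : S -> A -> R) :
    \sum_a \sum_s m s * r s a * f s a = \sum_s m s * f s (sel s).
  rewrite exchange_big /=; apply: eq_bigr => s _.
  rewrite (bigD1 (sel s))//= /r eqxx mulr1 big1 ?addr0// => a /negbTE ->.
  by rewrite mulr0 mul0r.
have E1 : \sum_a v (inl a) * gap r e (inl a) =
    \sum_a n a * k a - \sum_s m s * k (sel s).
  rewrite -(rsum (fun _ a => k a)) -sumrB; apply: eq_bigr => a _ /=.
  by rewrite mulrBr mulrC -mulr_suml [X in _ - X]mulrC.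
have E2 : \sum_a \sum_l v (inr (a, l)) * gap r e (inr (a, l)) =
    \sum_a \sum_l h a l * w a l - d * `|h al.1 al.2| -
    \sum_s m s * \sum_l h (sel s) l * u s l.
  rewrite -(rsum (fun s a => \sum_l h a l * u s l)).
  have -> : - (d * `|h al.1 al.2|) = \sum_a \sum_l h a l * e a l.
    rewrite pair_bigA /= (bigD1 al)//= /e -surjective_pairing eqxx.
    rewrite big1 => [|[a l] /negbTE /= ->]; last by rewrite mulr0.
    by rewrite addr0 normrEsg; ring.
  rewrite -big_split -sumrB /=; apply: eq_bigr => a _.
  have -> : \sum_s m s * r s a * (\sum_l h a l * u s l) =
      \sum_l h a l * \sum_s m s * r s a * u s l.
    under [RHS]eq_bigr do rewrite mulr_sumr.
    rewrite [RHS]exchange_big /=; apply: eq_bigr => s _.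
    by rewrite mulr_sumr; apply: eq_bigr => l _; ring.
  rewrite -big_split -sumrB /=; apply: eq_bigr => l _.
  by rewrite /h; ring.
rewrite E1 E2; have := dual alP selP.
rewrite big_split /=.
under [X in _ <= X -> _]eq_bigr do rewrite mulrDr.
rewrite big_split /=; lra.
Qed.

Lemma finite_strassen : exists r : S -> A -> R,
  [/\ forall s a, 0 <= r s a, forall s, \sum_a r s a = 1,
      forall a, \sum_s m s * r s a = n a &
      \sum_a \sum_l `|\sum_s m s * r s a * u s l - w a l| <= d].
Proof.
have [B CB] := C_bound.
have Cne : C !=set0.
  exists (gap (fun _ a => (a == a0)%:R) (fun _ _ => 0)); exists (fun _ a => (a == a0)%:R), (fun _ _ => 0).
  split=> //.
    split=> [s a|s]; first by rewrite ler0n.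
    by rewrite (bigD1 a0)//= eqxx big1 ?addr0// => a /negbTE ->.
  by rewrite big1// => a _; rewrite big1// => l _; rewrite normr0.
have /choice[v /all_and2[Cv vB]] : forall k : nat, exists v, C v /\
    \sum_x v x ^+ 2 <= B / k.+1%:R.
  by move=> k; have [v] := approach_origin Cne C_convex CB C_descent k; exists v.
have /choice[r /choice[e re]] := Cv.
(* The gaps [v k] tend to 0; the kernels are bounded entry by entry, so they have a limit along an
   ultrafilter, and every constraint passes to that limit. *)
have [U [UU ooU]] := ultrafilter_nat.
have /choice[r' r'P] : forall s, exists r' : A -> R,
    forall a, (fun k => r k s a) @ U --> r' a.
  move=> s; have /choice[f fP] : forall a, exists l : R, (fun k => r k s a) @ U --> l; last by exists f.
  move=> a.
  by apply: (ultra_cvg (M := 1)) => k; have [rs _ _] := re k; exact: stoch_le1.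
have /choice[e' e'P] : forall a, exists e' : L -> R,
    forall l, (fun k => e k a l) @ U --> e' l.
  move=> a; have /choice[f fP] : forall l, exists z : R, (fun k => e k a l) @ U --> z; last by exists f.
  move=> l.
  apply: (ultra_cvg (M := d)) => k; have [_ eL _] := re k.
  apply: le_trans eL; rewrite (bigD1 a)//= (bigD1 l)//= -addrA lerDl.
  by rewrite addr_ge0// sumr_ge0// => b _; exact: sumr_ge0.
have vx x : (fun k => v k x) @ U --> (0 : R).
  apply/cvgr0Pnorm_le => eps eps0; apply: ooU.
  near=> k.
  have e2 : 0 < eps ^+ 2 by rewrite exprn_gt0.
  suff : `|v k x| ^+ 2 <= eps ^+ 2.
    by rewrite ler_pXn2r ?nnegrE// ltW.
  rewrite real_normK ?num_real//.
  apply: (@le_trans _ _ (\sum_x v k x ^+ 2)).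
    by rewrite (bigD1 x)//= lerDl sumr_ge0// => y _; rewrite sqr_ge0.
  apply: (le_trans (vB k)); rewrite ler_pdivrMr ?ltr0n// mulrC -ler_pdivrMr//.
  rewrite -natr1; apply: ltW; apply: (lt_trans (archi_boundP (_ : 0 <= B / eps ^+ 2))) => //.
    rewrite divr_ge0 ?(ltW e2)//; apply: le_trans (CB _ (Cv k)).
    by apply: sumr_ge0 => y _; rewrite sqr_ge0.
  rewrite natr1 ltr_nat ltnS; near: k; exact: nbhs_infty_ge.
have g0 x : gap r' e' x = 0.
  apply/esym; apply: (ultra_lim_eq (g := fun k => gap (r k) (e k) x) (vx x)); last first.
    by apply: (@filterE _ U) => k /=; have [_ _ ->] := re k.
  case: x => [a|[a l]] /=.
    apply: cvgB; first exact: cvg_cst.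
    by apply: cvg_finite_sum => s _; apply: cvgM; [exact: cvg_cst|exact: r'P].
  apply: cvgB; first by apply: cvgD; [exact: cvg_cst|exact: e'P].
  apply: cvg_finite_sum => s _; apply: cvgM; last exact: cvg_cst.
  by apply: cvgM; [exact: cvg_cst|exact: r'P].
exists r'; split.
- move=> s a; apply: (ultra_lim_le (cvg_cst 0) (r'P s a)).
  by apply: (@filterE _ U) => k /=; have [[]] := re k.
- move=> s; apply: (cvg_unique _ (cvg_finite_sum (fun a _ => r'P s a))) => //.
  have -> : (fun i => \sum_a r i s a) = cst 1; last exact: cvg_cst.
  by apply/funext => k; have [[_ ->]] := re k.
- by move=> a; have /eqP := g0 (inl a); rewrite subr_eq0 => /eqP.
- apply: (@le_trans _ _ (\sum_a \sum_l `|e' a l|)).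
    apply: ler_sum => a _; apply: ler_sum => l _.
    have /eqP := g0 (inr (a, l)); rewrite /= subr_eq0 => /eqP <-.
    by rewrite addrC addKr.
  apply: (ultra_lim_le (f := fun k => \sum_a \sum_l `|e k a l|) _ (cvg_cst d)).
    by apply: cvg_finite_sum => a _; apply: cvg_finite_sum => l _; apply: cvg_norm.
  by apply: (@filterE _ U) => k /=; have [] := re k.
Unshelve. all: by end_near.
Qed.

End finite_strassen.

(** * The positive maximum principle *)

Section bounded_functions.
Context {R : realType}.

Lemma continuous_borel_measurable (T : ptopologicalType) (f : T -> R) :
  continuous f -> measurable_fun setT (f : borel T -> R).
Proof.
move=> /continuousP cf; apply: (measurability _ (RGenOpens.measurableE R)).
move=> _ [_ [a [b ->] <-]]; rewrite setTI.
by apply: sub_sigma_algebra; apply: cf; exact: interval_open.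
Qed.

Lemma bounded_integrable d (T : measurableType d)
    (mu : {finite_measure set T -> \bar R}) (f : T -> R) (M : R) :
  measurable_fun setT f -> (forall x, `|f x| <= M) ->
  mu.-integrable setT (EFin \o f).
Proof.
move=> mf fM; apply: measurable_bounded_integrable => //.
  by rewrite ltey_eq fin_num_measure.
exists M; split; first by rewrite num_real.
by move=> x Mx y _; exact: (le_trans (fM y) (ltW Mx)).
Qed.

Lemma bounded_continuous_integrable (T : ptopologicalType)
    (mu : {finite_measure set (borel T) -> \bar R}) (f : T -> R) :
  bounded_continuous f -> mu.-integrable setT (EFin \o f).
Proof.
move=> [cf [M fM]]; apply: (@bounded_integrable _ _ mu f M) => //.
exact: continuous_borel_measurable.
Qed.

End bounded_functions.

Section operator_span.
Context {R : realType} {E : ptopologicalType}.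
Variable A : operator (R := R) E.

(** Constants are adjoined with image 0 because polynomials in a function of the domain have
    constant terms. The image is carried as a second index, since [A] may be multivalued. *)
Inductive span : (E -> R) -> (E -> R) -> Prop :=
| span_in f g : A (f, g) -> span f g
| span_one : span (cst 1) (cst 0)
| span_lin a f g f' g' : span f g -> span f' g' ->
    span (fun x => a * f x + f' x) (fun x => a * g x + g' x).

Lemma span_eq f g f' g' : span f g -> f =1 f' -> g =1 g' -> span f' g'.
Proof. by move=> fg /funext <- /funext <-. Qed.

Lemma spanZ a f g : span f g -> span (fun x => a * f x) (fun x => a * g x).
Proof.
move=> fg; have := span_lin a fg (span_lin (-1) span_one span_one).
by move/span_eq; apply=> x /=; ring.
Qed.

Lemma span_cst a : span (cst a) (cst 0).
Proof. by apply: (span_eq (spanZ a span_one)) => x /=; rewrite ?mulr1 ?mulr0. Qed.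

Lemma spanD f g f' g' : span f g -> span f' g' -> span (f \+ f') (g \+ g').
Proof.
by move=> fg fg'; apply: (span_eq (span_lin 1 fg fg')) => x /=; rewrite mul1r.
Qed.

Lemma span_sum (J : Type) (s : seq J) (c : J -> R) (f g : J -> E -> R) :
  (forall j, span (f j) (g j)) ->
  span (fun x => \sum_(j <- s) c j * f j x) (fun x => \sum_(j <- s) c j * g j x).
Proof.
move=> fg; elim: s => [|j s IH].
  by apply: (span_eq (span_cst 0)) => x /=; rewrite big_nil.
by apply: (span_eq (span_lin (c j) (fg j) IH)) => x; rewrite big_cons.
Qed.

Hypothesis A_bounded : forall f g, A (f, g) ->
  bounded_continuous f /\ bounded_continuous g.

Lemma span_bounded f g : span f g -> bounded_continuous f /\ bounded_continuous g.
Proof.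
have lin a (h h' : E -> R) : bounded_continuous h -> bounded_continuous h' ->
    bounded_continuous (fun x => a * h x + h' x).
  move=> [ch [M hM]] [ch' [M' hM']]; split.
    by move=> x; apply: cvgD; [apply: cvgM; [exact: cvg_cst|exact: ch]|exact: ch'].
  exists (`|a| * M + M') => x; apply: (le_trans (ler_normD _ _)).
  by rewrite normrM lerD// ler_wpM2l.
have cs a : bounded_continuous (cst a : E -> R).
  by split; [move=> x; exact: cvg_cst|exists `|a|].
elim=> [f' g' /A_bounded//| |a f' g' f'' g'' _ [bf bg] _ [bf' bg']].
  by split; exact: cs.
by split; exact: lin.
Qed.

Lemma span_bound f g : span f g -> exists2 M, 0 < M & forall x, `|f x| <= M.
Proof.
move=> /span_bounded[[_ [M fM]] _]; exists (`|M| + 1); first by rewrite ltr_wpDl.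
by move=> x; rewrite (le_trans (fM x))// (le_trans (ler_norm _))// lerDl.
Qed.

Hypothesis A_mul : forall f1 f2, domain A f1 -> domain A f2 ->
  domain A (fun x => f1 x * f2 x).

Lemma span_mul f g f' g' : span f g -> span f' g' ->
  exists g'', span (fun x => f x * f' x) g''.
Proof.
move=> + fg'; elim=> [{}f {}g fg| |a f1 g1 f2 g2 _ [h1 fh1] _ [h2 fh2]].
- elim: fg' => [{}f' {}g' fg'| |a f1 g1 f2 g2 _ [h1 fh1] _ [h2 fh2]].
  + have [h fh] := A_mul (ex_intro _ _ fg) (ex_intro _ _ fg').
    by exists h; exact: span_in.
  + by exists g; apply: (span_eq (span_in fg)) => x //=; rewrite mulr1.
  + exists (fun x => a * h1 x + h2 x).
    by apply: (span_eq (span_lin a fh1 fh2)) => x //; ring.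
- by exists g'; apply: (span_eq fg') => x //=; rewrite mul1r.
- exists (fun x => a * h1 x + h2 x).
  by apply: (span_eq (span_lin a fh1 fh2)) => x //; ring.
Qed.

(** The image [g'] is never computed: the inequality of [span_tangent] holds for any image. *)
Lemma span_poly (p : {poly R}) f g : span f g ->
  exists g', span (fun x => p.[f x]) g'.
Proof.
move=> fg; elim/poly_ind: p => [|p c [g' IH]].
  by exists (cst 0); apply: (span_eq (span_cst 0)) => x //=; rewrite horner0.
have [h fh] := span_mul IH fg.
exists (h \+ cst 0); apply: (span_eq (spanD fh (span_cst c))) => x //=.
by rewrite !hornerE.
Qed.

Variables (mu : nat -> E -> probability (borel E) R) (lam : nat -> E -> R).
Hypothesis lam_ge0 : forall n x, 0 <= lam n x.
Hypothesis A_lim : forall f g, A (f, g) -> forall x,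
  lam n x * (\int[mu n x]_y (f y - f x)) @[n --> \oo] --> g x.

Let span_integrable f g n x : span f g ->
  (mu n x).-integrable setT (EFin \o (fun y => f y - f x)).
Proof.
move=> fg; have := spanD fg (span_cst (- f x)).
by move=> /span_bounded[/(bounded_continuous_integrable (mu n x))].
Qed.

Lemma span_lim f g : span f g -> forall x,
  lam n x * (\int[mu n x]_y (f y - f x)) @[n --> \oo] --> g x.
Proof.
elim=> [{}f {}g /A_lim//| |a f1 g1 f2 g2 fg1 IH1 fg2 IH2] x.
  rewrite (_ : (fun n => _) = cst 0); first exact: cvg_cst.
  apply/funext => n /=; under eq_Rintegral do rewrite subrr.
  by rewrite Rintegral_cst// mul0r mulr0.
rewrite (_ : (fun n => _) = fun n => a * (lam n x * (\int[mu n x]_y (f1 y - f1 x)))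
    + lam n x * (\int[mu n x]_y (f2 y - f2 x))).
  by apply: cvgD => //; apply: cvgM => //; exact: cvg_cst.
apply/funext => n.
under eq_Rintegral do rewrite opprD addrACA -mulrBr.
have i1 := span_integrable n x fg1; have i2 := span_integrable n x fg2.
have i3 : (mu n x).-integrable setT (EFin \o (fun y => a * (f1 y - f1 x))).
  have := span_integrable n x (spanZ a fg1).
  by apply: eq_integrable => // y _ /=; rewrite mulrBr.
have /= e1 := RintegralZl a measurableT i1.
by rewrite RintegralD// e1; ring.
Qed.

(** The tangent inequality is integrated against [mu n x] and multiplied by [lam n x], and the limit
    formula turns both sides into images. It is the positive maximum principle for [p.[w]] minus its
    tangent at [w x], which is nonnegative and vanishes at [x]. *)
Lemma span_tangent (p : {poly R}) w gw g' x : span w gw ->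
  span (fun x => p.[w x]) g' ->
  (forall y, p.[w x] + (deriv p).[w x] * (w y - w x) <= p.[w y]) ->
  (deriv p).[w x] * gw x <= g' x.
Proof.
move=> wg pg tang; set c := (deriv p).[w x] in tang *.
have /= h1 := span_lim pg (x := x).
have h2 : c * (lam n x * (\int[mu n x]_y (w y - w x))) @[n --> \oo] --> c * gw x.
  by apply: cvgM; [exact: cvg_cst|exact: span_lim].
apply: (ler_cvg_to h2 h1); apply: nearW => n.
have /= e := RintegralZl c measurableT (span_integrable n x wg).
rewrite mulrCA ler_wpM2l// -e.
apply: le_Rintegral => //.
- have := span_integrable n x (spanZ c wg).
  by apply: eq_integrable => // y _ /=; rewrite mulrBr.
- exact: span_integrable pg.
- by move=> y _; rewrite lerBrDl.
Qed.

End operator_span.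

Section joint_span.
Context {R : realType} {E : ptopologicalType} {m : nat}.
Variables (A : operator (R := R) E) (q : 'I_m.+1 -> 'I_m.+1 -> E -> R).
Hypothesis A_bounded : forall f g, A (f, g) ->
  bounded_continuous f /\ bounded_continuous g.
Hypothesis A_mul : forall f1 f2, domain A f1 -> domain A f2 ->
  domain A (fun x => f1 x * f2 x).
Variables (mu : nat -> E -> probability (borel E) R) (lam : nat -> E -> R).
Hypothesis lam_ge0 : forall n x, 0 <= lam n x.
Hypothesis A_lim : forall f g, A (f, g) -> forall x,
  lam n x * (\int[mu n x]_y (f y - f x)) @[n --> \oo] --> g x.
Hypothesis q_ge0 : forall i j x, i != j -> 0 <= q i j x.

(** The operator [B] on the function with components [w j], where [gw j] is an image of [w j]; such
    functions need not be products. *)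
Definition jump (w gw : 'I_m.+1 -> E -> R) (j : 'I_m.+1) (x : E) : R :=
  gw j x + \sum_(k | k != j) q j k x * (w k x - w j x).

Definition jspan (w gw : 'I_m.+1 -> E -> R) := forall j, span A (w j) (gw j).

Lemma jspan_bound w gw : jspan w gw ->
  exists2 M, 0 < M & forall j x, `|w j x| <= M.
Proof.
move=> wg; have /choice[M MP] : forall j, exists M, 0 < M /\ forall x, `|w j x| <= M.
  by move=> j; have [M M0 wM] := span_bound A_bounded (wg j); exists M.
exists (\sum_j M j).
  rewrite (bigD1 ord0)//= ltr_wpDr ?(MP _).1//.
  by apply: sumr_ge0 => j _; rewrite ltW ?(MP _).1.
move=> j x; apply: (le_trans ((MP j).2 x)); rewrite (bigD1 j)//= lerDl.
by apply: sumr_ge0 => k _; rewrite ltW ?(MP _).1.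
Qed.

Lemma jump_lin a w gw w' gw' j x :
  jump (fun j x => a * w j x + w' j x) (fun j x => a * gw j x + gw' j x) j x =
  a * jump w gw j x + jump w' gw' j x.
Proof.
rewrite /jump mulrDr addrACA; congr (_ + _).
by rewrite mulr_sumr -big_split /=; apply: eq_bigr => k _; ring.
Qed.

Lemma jump_tangent (p : {poly R}) w gw g' j x : jspan w gw ->
  jspan (fun j x => p.[w j x]) g' ->
  (forall i y k z, p.[w i y] + (deriv p).[w i y] * (w k z - w i y) <= p.[w k z]) ->
  (deriv p).[w j x] * jump w gw j x <= jump (fun j x => p.[w j x]) g' j x.
Proof.
move=> wg pg tang; rewrite /jump mulrDr; apply: lerD.
  exact: (span_tangent A_bounded lam_ge0 A_lim (wg j) (pg j)).
rewrite mulr_sumr; apply: ler_sum => k kj.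
by rewrite mulrCA ler_wpM2l// ?q_ge0 1?eq_sym// lerBrDl.
Qed.

(** The point [y] will be [u - eps * jump u], which can leave [[-1, 1]]. Beyond that interval a
    tangent of slope at most 1 in absolute value cannot overtake [|y| + e]. *)
Let tangent_abs (p : {poly R}) (e u y : R) :
  (forall x y, -1 <= x <= 1 -> -1 <= y <= 1 ->
        p.[x] + (deriv p).[x] * (y - x) <= p.[y]) ->
  (forall x, -1 <= x <= 1 -> `|(deriv p).[x]| <= 1) ->
  (forall x, -1 <= x <= 1 -> `|p.[x] - `|x| | <= e) ->
  -1 <= u <= 1 -> p.[u] + (deriv p).[u] * (y - u) <= `|y| + e.
Proof.
move=> tang p1 pe u1; have := p1 _ u1; rewrite ler_norml => /andP[d1 d2].
have pa z : -1 <= z <= 1 -> p.[z] <= `|z| + e.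
  by move=> /pe; rewrite ler_norml => /andP[_]; rewrite lerBlDl.
have [y1|y1] := leP y 1; last first.
  have h : -1 <= (1:R) <= 1 by apply/andP; split; lra.
  have := tang _ _ u1 h; have := pa _ h; rewrite normr1.
  by rewrite gtr0_norm; [nra|lra].
have [y2|y2] := leP (-1) y; last first.
  have h : -1 <= (-1:R) <= 1 by apply/andP; split; lra.
  have := tang _ _ u1 h; have := pa _ h; rewrite normrN normr1.
  by rewrite ltr0_norm; [nra|lra].
have h : -1 <= y <= 1 by apply/andP.
exact: (le_trans (tang _ _ u1 h) (pa _ h)).
Qed.

(** With [v = w - z], the maximum is [(w + z) / 2 + |v| / 2], and [|v|] is replaced by [L *
    p.[v / L]], which has an image under the generator. Convexity of [p] bounds that image from
    below, so that [1 - eps B] of the result is at most the maximum of the two values of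
    [1 - eps B], up to [kap]. *)
Lemma jspan_max (w gw z gz : 'I_m.+1 -> E -> R) (eps kap : R) :
  0 <= eps -> 0 < kap -> jspan w gw -> jspan z gz -> exists G gG,
  [/\ jspan G gG, forall j x, `|G j x - Num.max (w j x) (z j x)| <= kap &
      forall j x, G j x - eps * jump G gG j x <=
        Num.max (w j x - eps * jump w gw j x) (z j x - eps * jump z gz j x) + kap].
Proof.
move=> eps0 kap0 wg zg.
pose v j x := (-1) * z j x + w j x; pose gv j x := (-1) * gz j x + gw j x.
have vg : jspan v gv by move=> j; exact: span_lin.
have [L L0 vL] := jspan_bound vg.
(* Accuracy [kap / L] for the polynomial becomes [kap / 2] after multiplication by [L / 2]. *)
pose k := Num.bound (2 / (kap / L)).
have kE : 2 / k.+1%:R <= kap / L.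
  have kL : 0 < kap / L by rewrite divr_gt0.
  rewrite ler_pdivrMr ?ltr0n// mulrC -ler_pdivrMr//.
  apply: ltW; apply: (lt_trans (archi_boundP _)); first by rewrite divr_ge0 ?ltW.
  by rewrite ltr_nat.
have [p [tang p1 pe]] := convex_poly_approx_abs kE.
pose u j x := L^-1 * v j x; pose gu j x := L^-1 * gv j x.
have ug : jspan u gu by move=> j; exact: spanZ.
have u1 j x : -1 <= u j x <= 1.
  rewrite -ler_norml normrM gtr0_norm ?invr_gt0// mulrC ler_pdivrMr// mul1r.
  exact: vL.
have /choice[g' pg] : forall j, exists g', span A (fun x => p.[u j x]) g'.
  by move=> j; exact: (span_poly A_mul p (ug j)).
pose s j x := 1 * w j x + z j x; pose gs j x := 1 * gw j x + gz j x.
pose G j x := 2^-1 * s j x + (L / 2 * p.[u j x]).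
pose gG j x := 2^-1 * gs j x + (L / 2 * g' j x).
have maxE (a b : R) : Num.max a b = (a + b) / 2 + `|a - b| / 2.
  by case: (ltrP a b) => ab; field.
have Lu j x : L * u j x = w j x - z j x.
  by rewrite /u mulrA divff ?gt_eqF// mul1r /v; ring.
exists G, gG; split.
- by move=> j; apply: span_lin; [exact: span_lin|exact: spanZ].
- move=> j x; rewrite maxE -Lu normrM (gtr0_norm L0) /G /s.
  rewrite (_ : _ - _ = L / 2 * (p.[u j x] - `|u j x|)); last by field.
  rewrite normrM gtr0_norm ?divr_gt0//.
  have L2 : 0 <= L / 2 by rewrite divr_ge0// ltW.
  apply: (le_trans (ler_wpM2l L2 (pe _ (u1 j x)))).
  have -> : L / 2 * (kap / L) = kap / 2 by field; rewrite gt_eqF.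
  by lra.
- move=> j x.
  have JG : jump G gG j x = 2^-1 * (jump w gw j x + jump z gz j x) +
      L / 2 * jump (fun j x => p.[u j x]) g' j x.
    rewrite /G /gG jump_lin /s /gs jump_lin mul1r; congr (_ + _).
    rewrite /jump mulrDr; congr (_ + _); rewrite mulr_sumr.
    by apply: eq_bigr => i _; ring.
  have Ju : L * jump u gu j x = jump w gw j x - jump z gz j x.
    have -> : jump w gw j x - jump z gz j x = jump v gv j x.
      by rewrite /v /gv jump_lin; ring.
    rewrite [X in L * X](_ : _ = L^-1 * jump v gv j x).
      by rewrite mulrA divff ?gt_eqF// mul1r.
    rewrite /jump [RHS]mulrDr mulr_sumr; congr (_ + _).
    by apply: eq_bigr => i _; rewrite /u; ring.
  have h1 := @jump_tangent p u gu g' j x ug pg (fun i y k z => tang _ _ (u1 i y) (u1 k z)).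
  have h2 := @tangent_abs p _ (u j x) (u j x - eps * jump u gu j x) tang p1 pe (u1 j x).
  rewrite maxE JG /G /s.
  have -> : w j x - eps * jump w gw j x - (z j x - eps * jump z gz j x) =
      L * (u j x - eps * jump u gu j x).
    by rewrite mulrBr Lu mulrCA Ju; ring.
  rewrite normrM (gtr0_norm L0).
  have h3 := ler_wpM2l eps0 h1.
  have L2 : 0 <= L / 2 by rewrite divr_ge0// ltW.
  have h4 : p.[u j x] - eps * jump (fun j x => p.[u j x]) g' j x <=
      `|u j x - eps * jump u gu j x| + kap / L by lra.
  have := ler_wpM2l L2 h4.
  have -> : L / 2 * (`|u j x - eps * jump u gu j x| + kap / L) =
      L * `|u j x - eps * jump u gu j x| / 2 + kap / 2.
    by field; rewrite gt_eqF.
  lra.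
Qed.

(** The family is headed by [a0] to be nonempty, and each further member takes half of the remaining
    accuracy. Membership is [List.In], as no decidable equality is at hand on the index type. *)
Lemma jspan_maxs (I : Type) (z gz : I -> 'I_m.+1 -> E -> R) (a0 : I) (s : seq I)
    (eps kap : R) : 0 <= eps -> 0 < kap -> (forall a, jspan (z a) (gz a)) ->
  exists G gG,
  [/\ jspan G gG, forall j x a, List.In a (a0 :: s) -> z a j x <= G j x + kap,
      forall j x, exists a, G j x <= z a j x + kap &
      forall j x, exists a, G j x - eps * jump G gG j x <=
        z a j x - eps * jump (z a) (gz a) j x + kap].
Proof.
move=> eps0 + zg; elim: s kap => [|b s IH] kap kap0.
  exists (z a0), (gz a0); split=> // j x.
  - by move=> a [<-|[]]; rewrite lerDl ltW.
  - by exists a0; rewrite lerDl ltW.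
  - by exists a0; rewrite lerDl ltW.
have k2 : 0 < kap / 2 by rewrite divr_gt0.
have [F [gF [Fg F1 F2 F3]]] := IH _ k2.
have [G [gG [Gg G1 G2]]] := jspan_max eps0 k2 Fg (zg b).
exists G, gG; split=> // j x.
- move=> a abs; have := G1 j x; rewrite ler_norml => /andP[+ _].
  case: abs => [<-|[<-|ai]].
  + have := F1 j x a0 (or_introl erefl).
    have : F j x <= Num.max (F j x) (z b j x) by rewrite le_max lexx.
    lra.
  + have : z b j x <= Num.max (F j x) (z b j x) by rewrite le_max lexx orbT.
    lra.
  + have := F1 j x a (or_intror ai).
    have : F j x <= Num.max (F j x) (z b j x) by rewrite le_max lexx.
    lra.
- have := G1 j x; rewrite ler_norml => /andP[_ h].
  have [a Fa] := F2 j x; have [c|/ltW c] := leP (F j x) (z b j x).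
    by rewrite (max_r c) in h; exists b; lra.
  by rewrite (max_l c) in h; exists a; lra.
- have h := G2 j x; have [a Fa] := F3 j x.
  have [c|/ltW c] := leP (F j x - eps * jump F gF j x)
      (z b j x - eps * jump (z b) (gz b) j x).
    by rewrite (max_r c) in h; exists b; lra.
  by rewrite (max_l c) in h; exists a; lra.
Qed.

End joint_span.

(** * Exchange of expectation and time integral *)

Section fubini_time.
Context {R : realType} {d : measure_display} {Om : measurableType d}.
Variable P : probability Om R.
Variables (a b K : R) (phi : R -> Om -> R).
Local Notation leb := (@lebesgue_measure R).
Hypothesis mphi : measurable_fun
  (`[a, b] `*` setT : set (measurableTypeR R * Om)) (fun z => phi z.1 z.2).
Hypothesis phiK : forall s, s \in `[a, b] ->
  (\int[P]_w `|phi s w|%:E <= K%:E)%E.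

Let D : set (measurableTypeR R * Om) := `[a, b] `*` setT.
(** Extended by 0 outside the time window, so that Fubini can be applied on the whole product. *)
Let f : measurableTypeR R * Om -> \bar R := (fun z => (phi z.1 z.2)%:E) \_ D.

Let mD : measurable D.
Proof. by apply: measurableX => //; exact: measurable_itv. Qed.

Let mf : measurable_fun setT f.
Proof. by apply/(measurable_restrictT _ mD)/measurable_EFinP. Qed.

Let fE s w : f (s, w) = ((fun s => (phi s w)%:E) \_ `[a, b]) s.
Proof. by rewrite /f /patch /D /= in_setX /= in_setT andbT. Qed.

Let int_f_w w (h : \bar R -> \bar R) : h 0%E = 0%E ->
  (\int[leb]_s h (f (s, w)) = \int[leb]_(s in `[a, b]) h (phi s w)%:E)%E.
Proof.
move=> h0; rewrite [RHS]integral_mkcond; apply: eq_integral => s _.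
by rewrite fE /patch; case: ifP.
Qed.

Let int_f_s s : (\int[P]_w f (s, w) =
  ((fun s => \int[P]_w (phi s w)%:E) \_ `[a, b]) s)%E.
Proof.
rewrite /patch; case: ifPn => sab.
  by apply: eq_integral => w _; rewrite fE /patch sab.
by rewrite -[RHS](integral0 P setT); apply: eq_integral => w _; rewrite fE /patch (negbTE sab).
Qed.

Let intf : (leb \x P)%E.-integrable setT f.
Proof.
apply/(integrable12ltyP _ _ mf).
apply: (@le_lt_trans _ _ (\int[leb]_(s in `[a, b]) K%:E)%E).
  rewrite [leRHS]integral_mkcond; apply: ge0_le_integral => //.
  - by move=> s _; exact: integral_ge0.
  - apply: (@measurable_fun_fubini_tonelli_F _ _ _ _ _ P (abse \o f)).
      by apply: measurableT_comp.
    by move=> x; exact: abse_ge0.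
  - by apply/(measurable_restrictT _ (measurable_itv _)).
  move=> s _; rewrite /patch; case: ifPn => [sab|sab].
    apply: le_trans (phiK (set_mem sab)); rewrite le_eqVlt; apply/orP; left.
    by apply/eqP; apply: eq_integral => w _; rewrite fE /patch sab.
  rewrite -[leRHS](integral0 P setT) le_eqVlt; apply/orP; left; apply/eqP.
  by apply: eq_integral => w _; rewrite fE /patch (negbTE sab) abse0.
rewrite integral_cst//=.
by rewrite lebesgue_measure_itv/=; case: ifP => _; rewrite ?mule0// -EFinB -EFinM ltry.
Qed.

Lemma fubini_time_ae : {ae P, forall w,
  leb.-integrable `[a, b] (fun s => (phi s w)%:E)}.
Proof.
have := ae_integrable2 intf; apply: filterS => w /= iw.
have [_ h] := @integrable_mkcond _ _ _ leb `[a, b]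
  (fun s => (phi s w)%:E) (measurable_itv _).
apply: h; by apply: eq_integrable iw => // s _; rewrite fE.
Qed.

Let G w := (\int[leb]_s f (s, w))%E.

Let GE w : G w = (\int[leb]_(s in `[a, b]) (phi s w)%:E)%E.
Proof. exact: (int_f_w w (h := id)). Qed.

Let intG : P.-integrable setT G.
Proof.
have mG : measurable_fun setT G by exact: measurable_fubini_G intf.
apply/integrableP; split=> //.
apply: le_lt_trans ((integrable21ltyP _ _ mf).1 intf).
apply: ge0_le_integral => //; first exact: measurableT_comp.
  apply: (@measurable_fun_fubini_tonelli_G _ _ _ _ _ leb (abse \o f)).
    by apply: measurableT_comp.
  by move=> x; exact: abse_ge0.
move=> w _; apply: le_abse_integral => //.
by apply: measurableT_comp => //; exact: pair2_measurable.
Qed.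

Lemma fubini_time_integrable :
  P.-integrable setT (fun w => (\int[leb]_(s in `[a, b]) phi s w)%:E).
Proof.
have mG := measurable_int _ intG.
apply: (le_integrable _ _ _ intG) => //.
  apply/measurable_EFinP.
  rewrite (_ : (fun w => _) = fine \o G); last by apply/funext => w /=; rewrite GE.
  exact: measurableT_comp.
move=> w _; rewrite /Rintegral -GE; case: (G w) => [r||] //=.
by rewrite normr0 leey.
by rewrite normr0 leey.
Qed.

Lemma fubini_time :
  \int[P]_w (\int[leb]_(s in `[a, b]) phi s w) =
  \int[leb]_(s in `[a, b]) (\int[P]_w phi s w).
Proof.
(* An infinite or undefined inner integral is turned into 0 by [fine], so the two inner integrals
   agree only off a null set. *)
rewrite {1}/Rintegral (_ : (\int[P]_w _ = \int[P]_w G w)%E); last first.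
  apply: ae_eq_integral => //.
  - exact: measurable_int fubini_time_integrable.
  - exact: measurable_int intG.
  - have := fubini_time_ae; apply: filterS => w iw _.
    by rewrite GE /Rintegral fineK// integrable_fin_num//; exact: measurable_itv.
have := Fubini intf; rewrite /fubini_F /fubini_G => /esym FE.
rewrite /G FE [RHS]/Rintegral; congr fine; rewrite [RHS]integral_mkcond.
apply: eq_integral => s _; rewrite int_f_s /patch; case: ifPn => // sab.
rewrite /Rintegral fineK// -integral_fin_num_abs.
  exact: le_lt_trans (phiK (set_mem sab)) (ltry _).
  by [].
apply/measurable_EFinP; rewrite (_ : EFin \o _ = (fun w => f (s, w))).
  by apply: measurableT_comp => //; exact: measurable_pair1.
by apply/funext => w; rewrite /= fE /patch sab.
Qed.

End fubini_time.

(** * The tilted stationary measures *)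

Section density.
Context {R : realType} {d : measure_display} {T : measurableType d}.
Variables (nu : {finite_measure set T -> \bar R})
  (mu : {sigma_finite_measure set T -> \bar R}) (a : T -> R).
Hypothesis ia : mu.-integrable setT (EFin \o a).
Hypothesis nuE : forall A, measurable A -> (nu A = \int[mu]_(x in A) (a x)%:E)%E.

Let ma : measurable_fun setT (EFin \o a).
Proof. exact: measurable_int ia. Qed.

Let dom : nu `<< mu.
Proof.
apply/null_content_dominatesP => A mA A0; rewrite nuE//.
by apply: null_set_integral => //; exact: measurable_funTS.
Qed.

(** The given density and the Radon-Nikodym derivative have the same integral over every measurable
    set; the change of variables known for the latter thus holds for [a]. *)
Let RNa : ae_eq mu setT (Radon_Nikodym_SigmaFinite.f nu mu) (EFin \o a).
Proof.
apply: integral_ae_eq => //.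
  exact: Radon_Nikodym_SigmaFinite.f_integrable.
by move=> A _ mA; rewrite -Radon_Nikodym_SigmaFinite.f_integral// nuE.
Qed.

Let mRN : measurable_fun setT (Radon_Nikodym_SigmaFinite.f nu mu).
Proof. exact: measurable_int (Radon_Nikodym_SigmaFinite.f_integrable dom). Qed.

Lemma density_integral_ge0 (f : T -> \bar R) : (forall x, 0 <= f x)%E ->
  measurable_fun setT f -> (\int[nu]_x f x = \int[mu]_x (f x * (a x)%:E))%E.
Proof.
move=> f0 mf; rewrite -(Radon_Nikodym_SigmaFinite.change_of_variables dom)//.
apply: ae_eq_integral => //; first exact: emeasurable_funM.
  exact: emeasurable_funM.
exact: ae_eqe_mul2l.
Qed.

Lemma density_integral (f : T -> \bar R) : nu.-integrable setT f ->
  (\int[nu]_x f x = \int[mu]_x (f x * (a x)%:E))%E.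
Proof.
move=> intf; have mf := measurable_int _ intf.
rewrite -(Radon_Nikodym_change_of_variables dom)//.
apply: ae_eq_integral => //; first by apply: emeasurable_funM.
  by apply: emeasurable_funM.
apply: ae_eqe_mul2l; apply: ae_eq_trans RNa.
exact/ae_eq_sym/ae_eq_Radon_Nikodym_SigmaFinite.
Qed.

End density.

Section density_measure.
Context {R : realType} {d : measure_display} {T : measurableType d}.
Variables (mu : {measure set T -> \bar R}) (a : T -> R).
Hypotheses (ma : measurable_fun setT a) (a_ge0 : forall x, 0 <= a x)
  (a_int1 : (\int[mu]_x (a x)%:E = 1)%E).

(** The proofs are arguments, though the value does not depend on them, so that the instances of
    measure and probability can be attached to the term. *)
Definition density_measure of (measurable_fun setT a) & (forall x, 0 <= a x) &
    (\int[mu]_x (a x)%:E = 1)%E :=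
  fun A : set T => (\int[mu]_(x in A) (a x)%:E)%E.

Local Notation nu := (density_measure ma a_ge0 a_int1).

Let nu0 : nu set0 = 0%E. Proof. exact: integral_set0. Qed.

Let nu_ge0 A : (0 <= nu A)%E.
Proof. by apply: integral_ge0 => x _; rewrite lee_fin. Qed.

Let nu_sigma : semi_sigma_additive nu.
Proof.
apply: semi_sigma_additive_nng_induced; first exact/measurable_EFinP.
by move=> x; rewrite lee_fin.
Qed.

HB.instance Definition _ := isMeasure.Build _ _ _ nu nu0 nu_ge0 nu_sigma.

Let nuT : nu setT = 1%E. Proof. exact: a_int1. Qed.

HB.instance Definition _ := Measure_isProbability.Build _ _ _ nu nuT.

End density_measure.

Section image_law.
Context {R : realType} {d d' : measure_display} {Om : measurableType d}
  {T : measurableType d'}.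
Variables (P : {measure set Om -> \bar R}) (mu : {measure set T -> \bar R})
  (X : Om -> T).
Hypotheses (mX : measurable_fun setT X)
  (lawX : forall B, measurable B -> P (X @^-1` B) = mu B).

Lemma ge0_integral_law (h : T -> \bar R) : measurable_fun setT h ->
  (forall x, 0 <= h x)%E -> (\int[P]_w h (X w) = \int[mu]_x h x)%E.
Proof.
move=> mh h0; have := @ge0_integral_pushforward _ _ _ _ _ _ mX P setT h measurableT mh.
rewrite preimage_setT => /(_ (fun y _ => h0 y)) <-.
by apply: eq_measure_integral => A mA _ /=; exact: lawX.
Qed.

Lemma integrable_law (h : T -> \bar R) : mu.-integrable setT h ->
  P.-integrable setT (h \o X).
Proof.
move=> /integrableP[mh ih]; apply/integrableP; split.
  exact: measurableT_comp.
have -> : (\int[P]_w `|(h \o X) w| = \int[mu]_x `|h x|)%E.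
  by apply: (ge0_integral_law (h := abse \o h)) => [|x]; [exact: measurableT_comp|exact: abse_ge0].
exact: ih.
Qed.

Lemma integral_law (h : T -> \bar R) : mu.-integrable setT h ->
  (\int[P]_w h (X w) = \int[mu]_x h x)%E.
Proof.
move=> ih; have mh := measurable_int _ ih.
have := @integral_pushforward _ _ _ _ _ _ mX P setT h mh.
rewrite preimage_setT => /(_ (integrable_law ih) measurableT) <-.
by apply: eq_measure_integral => A mA _ /=; exact: lawX.
Qed.

End image_law.

Section charge_integral.
Context {R : realType} {d : measure_display} {T : measurableType d}.
Variables (nu : {charge set T -> \bar R}) (mu : probability T R) (a : T -> R).
Hypothesis ma : measurable_fun setT a.
Variable K : R.
Hypothesis aK : forall x, `|a x| <= K.
Hypothesis nuE : forall A, measurable A -> (nu A = \int[mu]_(x in A) (a x)%:E)%E.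

(** On the Hahn sets [P] and [N] the Jordan parts have the densities [a * \1_P] and [- a * \1_N],
    whose difference is [a] for any choice of the decomposition. *)
Lemma charge_integralE (f : T -> R) (M : R) : measurable_fun setT f ->
  (forall x, `|f x| <= M) -> charge_integral nu f = \int[mu]_x (f x * a x).
Proof.
move=> mf fM; rewrite /charge_integral; case: cid => P exN; case: cid => N nuPN.
have [[mP _] [mN _] PNT PN0] := nuPN.
have bnd (D : set T) x : `|a x * \1_D x| <= K.
  rewrite indicE; case: (x \in D); rewrite ?mulr1 ?mulr0 ?normr0//.
  exact: le_trans (aK x).
have ind (D : set T) : measurable D -> mu.-integrable setT (EFin \o (fun x => a x * \1_D x)).
  move=> mD; apply: (@bounded_integrable _ _ _ mu _ K) => //.
  by apply: measurable_funM => //; exact: measurable_indic.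
have restr (D : set T) (A : set T) : measurable D -> measurable A ->
    (nu (A `&` D) = \int[mu]_(x in A) (a x * \1_D x)%:E)%E.
  move=> mD mA; rewrite nuE; last exact: measurableI.
  rewrite integral_mkcondr; apply: eq_integral => x _.
  by rewrite epatch_indic.
have fi (la : {finite_measure set T -> \bar R}) : la.-integrable setT (EFin \o f).
  exact: bounded_integrable fM.
have Epos : \int[jordan_pos nuPN]_x f x = \int[mu]_x (f x * (a x * \1_P x)).
  rewrite /Rintegral (@density_integral _ _ _ (jordan_pos nuPN) mu _ (ind _ mP)).
  - by congr fine; apply: eq_integral => x _; rewrite EFinM.
  - move=> A mA; transitivity (nu (A `&` P)); last exact: restr.
    by have := jordan_posE nuPN A; rewrite cjordan_posE /crestr0 mem_set.
  - exact: fi.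
have iN : mu.-integrable setT (EFin \o (fun x => - (a x * \1_N x))).
  by have := integrableN (ind _ mN); apply: (eq_integrable measurableT).
have Eneg : \int[jordan_neg nuPN]_x f x = \int[mu]_x (f x * (- (a x * \1_N x))).
  rewrite /Rintegral (@density_integral _ _ _ (jordan_neg nuPN) mu _ iN).
  - by congr fine; apply: eq_integral => x _; rewrite EFinM.
  - move=> A mA; transitivity (- nu (A `&` N))%E.
      by have := jordan_negE nuPN A; rewrite cjordan_negE /crestr0 mem_set.
    rewrite restr// -integralN//; apply: integrable_add_def.
      exact: mA.
    by apply: (integrableS measurableT mA) (ind _ mN).
  - exact: fi.
have fint (b : T -> R) : measurable_fun setT b -> (forall x, `|b x| <= K) ->
    mu.-integrable setT (EFin \o (fun x => f x * b x)).
  move=> mb bK; apply: (@bounded_integrable _ _ _ mu _ (M * K)).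
    exact: measurable_funM.
  by move=> x; rewrite normrM ler_pM.
rewrite Epos Eneg -RintegralB//.
- apply: eq_Rintegral => x _; rewrite mulrN opprK -mulrDr -mulrDr.
  suff -> : \1_P x + \1_N x = 1 :> R by rewrite mulr1.
  have := PNT => /seteqP[_ /(_ x I)]; have : ~ (P x /\ N x).
    by move=> PNx; have : (P `&` N) x by []; rewrite PN0.
  rewrite !indicE; case: (pselect (P x)) => Px; case: (pselect (N x)) => Nx.
  + by move=> /(_ (conj Px Nx)).
  + by rewrite mem_set// memNset//= addr0.
  + by rewrite memNset// mem_set//= add0r.
  + by move=> _ [].
- apply: fint => //; apply: measurable_funM => //; exact: measurable_indic.
- apply: fint => [|x]; last by rewrite normrN.
  by apply: measurableT_comp => //; apply: measurable_funM => //; exact: measurable_indic.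
Qed.

End charge_integral.

Section stationary.
Context {R : realType} {E : ptopologicalType}.

Lemma process_measurable {d} {Om : measurableType d} (X : R -> Om -> E) t :
  measurable_process X -> 0 <= t -> measurable_fun setT (X t : Om -> borel E).
Proof.
move=> mX t0 _ B mB.
have := mX _ B mB; rewrite setTI => mXB.
have /= := @measurable_xsection _ _ (measurableTypeR R) Om _ t
  (mXB (measurableX (measurable_itv _) measurableT)).
congr measurable; apply/seteqP; split=> w; rewrite /xsection /= inE.
  by move=> [].
by move=> Bw; split=> //; split=> //=; rewrite in_itv /= t0.
Qed.

Lemma bounded_process_time {d} {Om : measurableType d} (P : probability Om R)
    (X : R -> Om -> E) (g : E -> R) a b : 0 <= a ->
  measurable_process X -> measurable_fun setT (g : borel E -> R) ->
  measurable_fun (`[a, b] `*` setT : set (measurableTypeR R * Om))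
    (fun z => g (X z.1 z.2)).
Proof.
move=> a0 mX mg.
have mX' : measurable_fun (`[a, b] `*` setT : set (measurableTypeR R * Om))
    (fun z => X z.1 z.2 : borel E).
  apply: measurable_funS mX; first by apply: measurableX => //; exact: measurable_itv.
  move=> [s w] [/= + _]; rewrite !in_itv /= => /andP[s1 _]; split=> //=.
  by rewrite (le_trans a0 s1).
exact: (measurableT_comp mg mX').
Qed.

Variables (A : operator (R := R) E) (varpi : probability (borel E) R).
Hypothesis A_bounded : forall f g, A (f, g) ->
  bounded_continuous f /\ bounded_continuous g.

(** The martingale has the same mean at times 0 and 1, and so has [f (X t)] by stationarity; hence
    the time integral of [g] over [[0, 1]] has mean 0, and by Fubini this mean is the integral of
    [g] under [varpi]. *)
Lemma stationary_integral0 f g : stationary_distribution A varpi ->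
  A (f, g) -> \int[varpi]_x g x = 0.
Proof.
move=> [d [Om [P [X [[[mX [F [filtF adF mgF]]] init] stat]]]]] Afg.
have [bf bg] := A_bounded Afg.
have mXt t (t0 : 0 <= t) := process_measurable mX t0.
have lawX t : 0 <= t -> forall B : set (borel E), measurable B ->
    P (X t @^-1` B) = varpi B.
  move=> t0 B mB; rewrite -init//.
  have := stat 1%N (fun=> 0) (fun=> B) t t0 (fun=> lexx 0) (fun=> mB).
  rewrite addr0 => h.
  rewrite (_ : X t @^-1` B = [set w | 'I_1 -> B (X t w)]); last first.
    by apply/seteqP; split=> w /=; [|apply; exact: ord0].
  rewrite h; congr (P _); apply/seteqP; split=> w /=; [apply; exact: ord0|by []].
have int_X t (t0 : 0 <= t) (h : E -> R) : bounded_continuous h ->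
    P.-integrable setT (EFin \o (fun w => h (X t w))) /\
    \int[P]_w h (X t w) = \int[varpi]_x h x.
  move=> bh; have ih := bounded_continuous_integrable varpi bh; split.
    exact: integrable_law (mXt _ t0) (lawX _ t0) _ ih.
  by congr fine; exact: (integral_law (mXt _ t0) (lawX _ t0) ih).
have [_ [_ mg]] := mgF _ _ Afg.
have [sF _ _] := filtF.
have FT : F 0 setT.
  by have [F0 FC _] := sF _ (lexx 0); rewrite -[setT]setD0; exact: FC.
have [_ _ /(_ _ FT)] := mg 0 1 (lexx _) ler01.
have [cg [K gK]] := bg.
have mg' := continuous_borel_measurable cg.
have mphi := bounded_process_time P (lexx 0) mX mg' (b := 1).
have phiK s : s \in `[0, 1] -> (\int[P]_w `|g (X s w)|%:E <= K%:E)%E.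
  rewrite in_itv /= => /andP[s0 _].
  apply: (@le_trans _ _ (\int[P]_w (cst K%:E) w)%E).
    apply: ge0_le_integral => //.
    - by apply/measurable_EFinP; apply: measurableT_comp => //;
        exact: measurableT_comp (mXt _ s0).
    - by move=> w _; rewrite lee_fin.
  by rewrite integral_cst// [X in (_ * X)%E]probability_setT mule1.
have i3 := fubini_time_integrable mphi phiK.
have e3 := fubini_time mphi phiK.
have [i1 e1] := int_X 1 ler01 f bf; have [i0 e0] := int_X 0 (lexx _) f bf.
move=> h.
have {h} : \int[P]_w mp_process f g X 0 w = \int[P]_w mp_process f g X 1 w.
  by rewrite /Rintegral h.
rewrite /mp_process; under eq_Rintegral do rewrite subrr set_itv1 Rintegral_set1 subr0.
rewrite Rintegral_cst// mul0r => /esym.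
have i10 : P.-integrable setT (EFin \o (fun w => f (X 1 w) - f (X 0 w))).
  by have := integrableB measurableT i1 i0; apply: (eq_integrable measurableT).
rewrite (RintegralB measurableT i10 i3) (RintegralB measurableT i1 i0) e1 e0 subrr sub0r e3.
under eq_Rintegral => s.
  rewrite inE /= in_itv /= => /andP[s0 _].
  rewrite (int_X _ s0 g bg).2; over.
rewrite Rintegral_cst//.
have -> : fine (lebesgue_measure `[0, 1 : R]%classic) = 1.
  by rewrite lebesgue_measure_itv /= lte_fin ltr01 oppr0 addr0.
rewrite mulr1.
by move/eqP; rewrite oppr_eq0 => /eqP.
Qed.

End stationary.

Section alpha_measures.
Context {R : realType} {E : completeMetricType R} {m : nat}.
Variables (A : operator (R := R) E) (Q : 'M[R]_m.+1) (xi : 'I_m -> 'cV[R]_m.+1).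
Variables (varpi : probability (borel E) R)
  (vark : 'I_m -> {charge set (borel E) -> \bar R})
  (lam : 'I_m -> R) (eta : 'I_m -> E -> R).
Hypothesis setting : standing_setting A Q xi varpi vark lam eta.

Let al := alpha_density xi eta.

Lemma alpha_density_bounded i : bounded_continuous (al i).
Proof.
have /choice[K KP] k := (ss_eta setting k).2.
split.
  move=> x; apply: cvgD; first exact: cvg_cst.
  apply: cvg_finite_sum => k _; apply: cvgM; first exact: cvg_cst.
  exact: (ss_eta setting k).1.
exists (1 + \sum_k `|xi k i ord0| * K k) => x.
apply: (le_trans (ler_normD _ _)); rewrite normr1 lerD2l.
apply: (le_trans (ler_norm_sum _ _ _)); apply: ler_sum => k _.
by rewrite normrM ler_wpM2l.
Qed.

Let eta_int k (f : E -> R) : bounded_continuous f ->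
  varpi.-integrable setT (EFin \o (fun x => f x * eta k x)) /\
  charge_integral (vark k) f = \int[varpi]_x (f x * eta k x).
Proof.
move=> bf; have be := ss_eta setting k.
have [cf [M fM]] := bf; have [ce [K eK]] := be; split.
  apply: bounded_continuous_integrable; split.
    by move=> x; apply: cvgM; [exact: cf|exact: ce].
  by exists (M * K) => x; rewrite normrM ler_pM.
exact: (charge_integralE (continuous_borel_measurable ce) eK (ss_density setting k)
  (continuous_borel_measurable cf) fM).
Qed.

Let alE (f : E -> R) i : bounded_continuous f ->
  \int[varpi]_x (f x * al i x) =
  \int[varpi]_x f x + \sum_k xi k i ord0 * charge_integral (vark k) f.
Proof.
move=> bf; under eq_Rintegral => x _.
  rewrite /al /alpha_density mulrDr mulr1 mulr_sumr.
  under eq_bigr do rewrite mulrCA; over.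
have ifb := bounded_continuous_integrable varpi bf.
have isum (s : seq 'I_m) : varpi.-integrable setT
    (EFin \o (fun x => \sum_(k <- s) xi k i ord0 * (f x * eta k x))) /\
    \int[varpi]_x (\sum_(k <- s) xi k i ord0 * (f x * eta k x)) =
    \sum_(k <- s) xi k i ord0 * charge_integral (vark k) f.
  elim: s => [|k s [IHi IH]].
    under eq_Rintegral do rewrite big_nil.
    rewrite big_nil Rintegral_cst// mul0r; split=> //.
    rewrite (_ : EFin \o _ = cst 0%E); first exact: integrable0.
    by apply/funext => x /=; rewrite big_nil.
  have [ik ek] := eta_int k bf.
  have ik' : varpi.-integrable setT (EFin \o (fun x => xi k i ord0 * (f x * eta k x))).
    by have := integrableZl measurableT (xi k i ord0) ik; apply: (eq_integrable measurableT).
  under eq_Rintegral do rewrite big_cons.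
  rewrite big_cons RintegralD// IH; split.
    have := integrableD measurableT ik' IHi; apply: (eq_integrable measurableT) => x _ /=.
    by rewrite big_cons.
  by have /= -> := RintegralZl (xi k i ord0) measurableT ik; rewrite ek.
have [i1 e1] := isum (index_enum 'I_m).
by rewrite RintegralD// e1.
Qed.

Let charge_integral1 k : charge_integral (vark k) (cst 1) = 0.
Proof.
have b1 : bounded_continuous (cst 1 : E -> R).
  by split; [move=> x; exact: cvg_cst|exists 1 => x; rewrite normr1].
have [_ ->] := eta_int k b1.
have := ss_density setting k measurableT; rewrite (ss_centered setting).
rewrite /Rintegral => e; under eq_integral do rewrite /= mul1r.
by rewrite -e.
Qed.

(** The algebraic hypotheses are spent here. When [alpha_i] is expanded in the [eta_k], the
    eigenmeasure identity produces [- lam k], and the eigenvector identity rewrites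
    [- lam k * xi k i] as the sum of the [Q i j * xi k j]. The constant term drops on both sides, by
    stationarity on one and by zero row sums on the other. Both statements on the rates come from
    [q_ij alpha_i = Q_ij alpha_j]; integrability is recorded because the rates may be unbounded. *)
Lemma alpha_measures : exists pi : 'I_m.+1 -> probability (borel E) R,
  [/\ forall i (G : set (borel E)), measurable G ->
        (pi i G = alpha xi varpi eta i G)%E,
      forall i f g, A (f, g) ->
        \int[pi i]_x g x = \sum_j Q i j * \int[pi j]_x f x,
      forall i j, i != j -> (pi i).-integrable setT (EFin \o jump_rate Q xi eta i j) &
      forall i j f, i != j -> bounded_continuous f ->
        \int[pi i]_x (jump_rate Q xi eta i j x * f x) = Q i j * \int[pi j]_x f x].
Proof.
have mal i : measurable_fun setT (al i : borel E -> R).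
  exact: continuous_borel_measurable (alpha_density_bounded i).1.
have al0 i x : 0 <= al i x by exact/ltW/(ss_alpha_gt0 setting).
have ial i : varpi.-integrable setT (EFin \o al i).
  exact: bounded_continuous_integrable (alpha_density_bounded i).
have b1 : bounded_continuous (cst 1 : E -> R).
  by split; [move=> x; exact: cvg_cst|exists 1 => x; rewrite normr1].
have al1 i : (\int[varpi]_x (al i x)%:E = 1)%E.
  rewrite -(@fineK _ (\int[varpi]_x (al i x)%:E)%E).
    have := alE i b1; rewrite Rintegral_cst// mul1r.
    rewrite [fine (varpi _)]/= [varpi _]probability_setT big1 => [|k _]; last first.
      by rewrite charge_integral1 mulr0.
    under eq_Rintegral do rewrite mul1r.
    by rewrite /Rintegral addr0 => ->.
  by apply: integrable_fin_num => //; exact: ial.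
pose pi i : probability (borel E) R := density_measure (mal i) (al0 i) (al1 i).
have piE i (f : E -> R) : (pi i).-integrable setT (EFin \o f) ->
    \int[pi i]_x f x = \int[varpi]_x (f x * al i x).
  by move=> fi; congr fine; rewrite (density_integral (ial i) _ fi).
have piE' i (f : E -> R) : bounded_continuous f ->
    \int[pi i]_x f x = \int[varpi]_x (f x * al i x).
  by move=> bf; apply: piE; exact: bounded_continuous_integrable.
have q_al i j x : jump_rate Q xi eta i j x * al i x = Q i j * al j x.
  by rewrite /jump_rate mulfVK// gt_eqF// (ss_alpha_gt0 setting).
have mq i j : measurable_fun setT (jump_rate Q xi eta i j : borel E -> R).
  apply: continuous_borel_measurable => x; apply: cvgM.
    by apply: cvgM; [exact: cvg_cst|exact: (alpha_density_bounded j).1].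
  apply: cvgV; last exact: (alpha_density_bounded i).1.
  by rewrite gt_eqF// (ss_alpha_gt0 setting).
have q_ge0 i j x : i != j -> 0 <= jump_rate Q xi eta i j x.
  move=> ij; rewrite divr_ge0// mulr_ge0//.
  exact: (ss_generator setting).1.
have iq i j : i != j -> (pi i).-integrable setT (EFin \o jump_rate Q xi eta i j).
  move=> ij; apply/integrableP; split; first exact/measurable_EFinP.
  under eq_integral do rewrite /= ger0_norm ?q_ge0//.
  rewrite (density_integral_ge0 (ial i))//.
  - under eq_integral do rewrite -EFinM q_al EFinM.
    rewrite ge0_integralZl_EFin//.
    + by rewrite al1 mule1 ltry.
    + by move=> x _; rewrite lee_fin.
    + by apply/measurable_EFinP.
    + exact: (ss_generator setting).1.
  - by move=> x; rewrite lee_fin q_ge0.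
  - by apply/measurable_EFinP.
exists pi; split=> //.
- move=> i f g Afg; have [bf bg] := ss_operator setting Afg.
  rewrite piE'// alE// (stationary_integral0 _ (ss_stationary setting) Afg); last first.
    exact: ss_operator setting.
  under [RHS]eq_bigr do rewrite piE'// alE// mulrDr.
  rewrite big_split /= -mulr_suml (ss_generator setting).2 mul0r.
  congr (_ + _).
  under [RHS]eq_bigr do rewrite mulr_sumr.
  rewrite exchange_big /=; apply: eq_bigr => k _.
  rewrite (ss_eigenmeasure setting k Afg) mulrA.
  under [RHS]eq_bigr do rewrite mulrA.
  rewrite -mulr_suml; congr (_ * _).
  have [_ /matrixP/(_ i ord0)] := ss_eigenvector setting k.
  by rewrite !mxE => ->; rewrite mulrC.
- move=> i j f ij bf; have [cf [M fM]] := bf; rewrite piE.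
    under eq_Rintegral do rewrite mulrAC q_al -mulrA [al j _ * _]mulrC.
    have ifa : varpi.-integrable setT (EFin \o (fun x => f x * al j x)).
      have [ca [K aK]] := alpha_density_bounded j.
      apply: bounded_continuous_integrable; split.
        by move=> x; apply: cvgM; [exact: cf|exact: ca].
      by exists (M * K) => x; rewrite normrM ler_pM.
    by have /= -> := RintegralZl (Q i j) measurableT ifa; rewrite piE'.
  have := integrableZr measurableT M (iq _ _ ij); apply: le_integrable => //.
    apply/measurable_EFinP/measurable_funM => //.
    exact: continuous_borel_measurable.
  move=> x _ /=; rewrite lee_fin !normrM ler_wpM2l//.
  exact: le_trans (fM x) (ler_norm _).
Qed.

End alpha_measures.

(** * Finite partitions *)

Lemma In_mapP (A B : Type) (f : A -> B) (s : seq A) (y : B) :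
  List.In y [seq f x | x <- s] <-> exists x, List.In x s /\ f x = y.
Proof.
elim: s => [|a s IH] /=; first by split=> // -[x []].
split=> [[<-|/IH[x [xs <-]]]|[x [[->|xs] fx]]].
- by exists a; split=> //; left.
- by exists x; split=> //; right.
- by left.
- by right; apply/IH; exists x.
Qed.

Lemma InP (A : eqType) (s : seq A) (x : A) : List.In x s <-> x \in s.
Proof.
elim: s => [|a s IH] //=; rewrite inE; split=> [[->|/IH ->]|/predU1P[->|/IH]].
- by rewrite eqxx.
- by rewrite orbT.
- by left.
- by right.
Qed.

Section cells.
Context {R : realType} {d : measure_display} {T : measurableType d} {J : finType}.
Variables (pi : probability T R) (c : T -> J) (rep : J -> T).
Hypothesis mc : forall a, measurable (c @^-1` [set a]).
Hypothesis rep_c : forall x, c (rep (c x)) = c x.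

Definition cell_mass (a : J) : R := fine (pi (c @^-1` [set a])).
Definition cell_int (f : T -> R) (a : J) : R := \int[pi]_(x in c @^-1` [set a]) f x.
(* The value at [rep a] on null cells makes the average of an indicator
   function of a union of cells equal to its value at [rep a]. *)
Definition cell_avg (f : T -> R) (a : J) : R :=
  if cell_mass a == 0 then f (rep a) else cell_int f a / cell_mass a.

Local Notation integrable f := (pi.-integrable setT (EFin \o f)).

Lemma cell_mass_ge0 a : 0 <= cell_mass a.
Proof. exact: fine_ge0. Qed.

Lemma cell_massE a : pi (c @^-1` [set a]) = (cell_mass a)%:E.
Proof. by rewrite fineK// fin_num_measure. Qed.

Lemma cell_int_cst r a : cell_int (cst r) a = r * cell_mass a.
Proof. by rewrite /cell_int Rintegral_cst. Qed.

Let integrable_cell f a : integrable f -> pi.-integrable (c @^-1` [set a]) (EFin \o f).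
Proof. by move=> fi; apply: (integrableS measurableT (mc a)) fi. Qed.

Lemma cell_intD f g a : integrable f -> integrable g ->
  cell_int (fun x => f x + g x) a = cell_int f a + cell_int g a.
Proof. by move=> fi gi; rewrite /cell_int RintegralD//; exact: integrable_cell. Qed.

Lemma cell_intZ r f a : integrable f ->
  cell_int (fun x => r * f x) a = r * cell_int f a.
Proof. by move=> fi; exact: (RintegralZl r (mc a) (integrable_cell a fi)). Qed.

Lemma cell_int_norm f a : integrable f ->
  `|cell_int f a| <= cell_int (fun x => `|f x|) a.
Proof. by move=> fi; apply: le_normr_Rintegral => //; exact: integrable_cell. Qed.

Lemma cell_int_eq f g a : (forall x, c x = a -> f x = g x) ->
  cell_int f a = cell_int g a.
Proof. by move=> fg; apply: eq_Rintegral => x; rewrite inE => /fg. Qed.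

Lemma cell_mass_avg f a : integrable f -> cell_mass a * cell_avg f a = cell_int f a.
Proof.
move=> fi; rewrite /cell_avg; case: eqP => [m0|/eqP m0]; last by rewrite mulrCA divff ?mulr1.
rewrite m0 mul0r /cell_int /Rintegral null_set_integral//.
  exact: measurable_int (integrable_cell a fi).
exact: (etrans (cell_massE a) (congr1 EFin m0)).
Qed.

Lemma cell_avgD f g a : integrable f -> integrable g ->
  cell_avg (fun x => f x + g x) a = cell_avg f a + cell_avg g a.
Proof.
by move=> fi gi; rewrite /cell_avg; case: eqP => // _; rewrite cell_intD// mulrDl.
Qed.

Lemma cell_avgZ r f a : integrable f ->
  cell_avg (fun x => r * f x) a = r * cell_avg f a.
Proof. by move=> fi; rewrite /cell_avg; case: eqP => // _; rewrite cell_intZ// mulrA. Qed.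

Lemma cell_avg_const f a r : integrable f -> (forall x, c x = a -> f x = r) ->
  (exists x, c x = a) -> cell_avg f a = r.
Proof.
move=> fi fr [x xa]; rewrite /cell_avg; case: eqP => [_|/eqP m0].
  by apply: fr; rewrite -xa rep_c.
by rewrite (@cell_int_eq _ (cst r) _ fr) cell_int_cst mulfK.
Qed.

Lemma cell_avg_norm f a : integrable f ->
  `|cell_avg f a| <= cell_avg (fun x => `|f x|) a.
Proof.
move=> fi; rewrite /cell_avg; case: eqP => // _.
rewrite normrM normfV (ger0_norm (cell_mass_ge0 a)).
by rewrite ler_wpM2r ?invr_ge0 ?cell_mass_ge0// cell_int_norm.
Qed.

Lemma cell_int_sum f : integrable f -> \sum_a cell_int f a = \int[pi]_x f x.
Proof.
move=> fi.
have H (s : seq J) : uniq s -> \sum_(a <- s) cell_int f a =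
    \int[pi]_(x in c @^-1` [set` s]) f x.
  elim: s => [_|a s IH /= /andP[as_ us]].
    by rewrite big_nil (_ : _ @^-1` _ = set0) ?Rintegral_set0//; apply/seteqP; split.
  rewrite big_cons IH// [RHS](_ : _ = \int[pi]_(x in (c @^-1` [set a]) `|` (c @^-1` [set` s])) f x).
    have ms : measurable (c @^-1` [set` s]).
      rewrite (_ : _ @^-1` _ = \bigcup_(b in [set` s]) (c @^-1` [set b])).
        by apply: fin_bigcup_measurable => [|b _]; [exact: finite_seq|exact: mc].
      apply/seteqP; split=> x /=; first by exists (c x).
      by move=> [b /= bs cx]; rewrite cx.
    rewrite Rintegral_setU//.
      by apply: (integrableS measurableT) fi => //; exact: measurableU.
    apply/disj_setPS => x [/= -> /= as']; by rewrite as' in as_.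
  congr (Rintegral _ _ _); apply/seteqP; split=> x /=; rewrite inE.
    by move=> /orP[/eqP ->|]; [left|right].
  by move=> [->|->]; rewrite ?eqxx ?orbT.
rewrite H ?index_enum_uniq// (_ : _ @^-1` _ = setT)//.
by apply/seteqP; split=> x //= _; rewrite mem_index_enum.
Qed.

Lemma integrable_piecewise (f : J -> T -> R) : (forall a, integrable (f a)) ->
  integrable (fun x => f (c x) x).
Proof.
move=> fi.
have mf : measurable_fun setT (fun x => f (c x) x).
  rewrite (_ : (fun x => _) = fun x => \sum_a f a x * \1_(c @^-1` [set a]) x).
    apply: measurable_sum => a; apply: measurable_funM.
      exact/measurable_EFinP/(measurable_int _ (fi a)).
    exact: measurable_indic.
  apply/funext => x; rewrite (bigD1 (c x))//= big1 => [|a ac].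
    by rewrite addr0 indicE mem_set// mulr1.
  by rewrite indicE memNset ?mulr0//= => ca; rewrite ca eqxx in ac.
have is_ : integrable (fun x => \sum_a `|f a x|).
  have : pi.-integrable setT (fun x => \sum_(a <- index_enum J) `|f a x|%:E)%E.
    apply: integrable_sum => // a _.
    exact: (integrable_norm (fi a)).
  apply: (eq_integrable measurableT) => x _ /=.
  by rewrite sumEFin.
apply: (le_integrable measurableT) is_; first exact/measurable_EFinP.
move=> x _ /=; rewrite lee_fin [leRHS]ger0_norm ?sumr_ge0//.
by rewrite (bigD1 (c x))//= lerDl sumr_ge0.
Qed.

Lemma cell_int_piecewise (f : J -> T -> R) : (forall a, integrable (f a)) ->
  \sum_a cell_int (f a) a = \int[pi]_x f (c x) x.
Proof.
move=> fi; rewrite -cell_int_sum; last exact: integrable_piecewise.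
by apply: eq_bigr => a _; apply: cell_int_eq => x ->.
Qed.

Lemma integrable_cell_fun (g : J -> R) : integrable (fun x => g (c x)).
Proof.
apply: (@integrable_piecewise (fun a _ => g a)) => a.
apply: (@bounded_integrable _ _ _ pi _ `|g a|) => //.
Qed.

Lemma int_cell_avg f : integrable f -> \int[pi]_x cell_avg f (c x) = \int[pi]_x f x.
Proof.
move=> fi; rewrite -cell_int_sum; last exact: integrable_cell_fun.
rewrite -cell_int_sum//; apply: eq_bigr => a _.
transitivity (cell_avg f a * cell_mass a); last by rewrite mulrC cell_mass_avg.
by rewrite -cell_int_cst; apply: cell_int_eq => x ->.
Qed.

(** Since [s] is its own cell average, [f - avg f] equals [(f - s) - avg (f - s)], and averaging
    does not increase the L1 norm. *)
Lemma cell_avg_L1 f s : integrable f -> integrable s ->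
  (forall x y, c x = c y -> s x = s y) ->
  \int[pi]_x `|f x - cell_avg f (c x)| <= 2 * \int[pi]_x `|f x - s x|.
Proof.
move=> fi si sc.
have fsi : integrable (fun x => f x - s x).
  by have := integrableB measurableT fi si; apply: (eq_integrable measurableT).
have nfsi : integrable (fun x => `|f x - s x|).
  by have := integrable_norm fsi; apply: (eq_integrable measurableT).
have ai : integrable (fun x => cell_avg (fun x => `|f x - s x|) (c x)).
  exact: integrable_cell_fun.
apply: (@le_trans _ _ (\int[pi]_x (`|f x - s x| + cell_avg (fun x => `|f x - s x|) (c x)))).
  apply: le_Rintegral => //.
  - have := integrable_norm (integrableB measurableT fi (integrable_cell_fun (cell_avg f))).
    by apply: (eq_integrable measurableT).
  - by have := integrableD measurableT nfsi ai; apply: (eq_integrable measurableT).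
  move=> x _; have -> : f x - cell_avg f (c x) = (f x - s x) - (cell_avg f (c x) - s x) by ring.
  apply: (le_trans (ler_normB _ _)); rewrite lerD2l.
  have <- : cell_avg s (c x) = s x by apply: cell_avg_const => // [y /sc//|]; exists x.
  apply: le_trans (cell_avg_norm _ fsi).
  rewrite (_ : (fun x => f x - s x) = (fun x => f x + (-1) * s x)); last first.
    by apply/funext => y; rewrite mulN1r.
  have Nsi : integrable (fun x => -1 * s x).
    by have := integrableZl measurableT (-1) si; apply: (eq_integrable measurableT).
  by rewrite cell_avgD// cell_avgZ// mulN1r.
by rewrite RintegralD// int_cell_avg//; lra.
Qed.

End cells.

Section partitions.
Import HBSimple.
Context {R : realType} {d : measure_display} {T : measurableType d}.

Definition same_side (Bs : seq (set T)) (x y : T) :=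
  forall B, List.In B Bs -> (B x <-> B y).

(** A cell records which of the sets contain a point. Signatures that no point attains get the dummy
    representative [x0]. *)
Lemma signature_cells (x0 : T) (Bs : seq (set T)) :
  (forall B, List.In B Bs -> measurable B) ->
  exists (J : finType) (c : T -> J) (rep : J -> T),
  [/\ forall a, measurable (c @^-1` [set a]), forall x, c (rep (c x)) = c x &
      forall x y, c x = c y -> same_side Bs x y].
Proof.
move=> mB; suff [J [c [mc cB]]] : exists (J : finType) (c : T -> J),
    (forall a, measurable (c @^-1` [set a])) /\
    (forall x y, c x = c y -> same_side Bs x y).
  exists J, c, (fun a => if pselect (exists x, c x = a) is left h
    then projT1 (cid h) else x0); split=> // x.
  case: pselect => [h|[]]; last by exists x.
  by case: (cid h).
elim: Bs mB => [_|B Bs IH mB].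
  by exists unit, (fun=> tt); split=> // -[]; rewrite (_ : _ @^-1` _ = setT)//; apply/seteqP; split.
have [J [c [mc cB]]] := IH (fun B' h => mB B' (or_intror h)).
have mB0 := mB B (or_introl erefl).
exists (bool * J)%type, (fun x => (`[< B x >], c x)); split.
  move=> [b a]; rewrite (_ : _ @^-1` _ = (if b then B else ~` B) `&` (c @^-1` [set a])).
    by apply: measurableI => //; case: b => //; exact: measurableC.
  apply/seteqP; split=> x /=; first by move=> [<- <-]; split=> //; case: asboolP.
  by move=> [+ ->]; case: b => h; congr (_, _); [apply/asboolP|apply/asboolPn].
move=> x y [Bxy cxy] B' [<-|h]; last exact: cB.
by split=> h; [apply/asboolP; rewrite -Bxy|apply/asboolP; rewrite Bxy]; apply/asboolP.
Qed.

(** The sets are the sublevel sets at heights spaced by [e] over the range of [f]: two values more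
    than [e] apart are separated by one of these heights. *)
Lemma osc_sets (f : T -> R) (M e : R) : measurable_fun setT f ->
  (forall x, `|f x| <= M) -> 0 < e ->
  exists Bs : seq (set T), (forall B, List.In B Bs -> measurable B) /\
    forall x y, same_side Bs x y -> `|f x - f y| <= e.
Proof.
move=> mf fM e0; pose K := Num.bound (2 * M / e).
pose F k := f @^-1` `]-oo, - M + e * k%:R].
exists [seq F k | k <- iota 0 K.+1]; split.
  move=> B h; have [k [_ <-]] := (In_mapP _ _ _).1 h; rewrite -[F k]setTI.
  by apply: mf => //; exact: measurable_itv.
move=> x y; wlog xy : x y / f x <= f y.
  move=> h; have [xy|/ltW xy] := leP (f x) (f y); first exact: h.
  by move=> s; rewrite distrC; apply: h => // B hB; apply: iff_sym; exact: s.
move=> s; rewrite distrC ger0_norm ?subr_ge0// leNgt; apply/negP => fe.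
have fx0 : 0 <= (f x + M) / e.
  rewrite divr_ge0// ?(ltW e0)//; have := fM x; rewrite ler_norml => /andP[]; lra.
(* The first height strictly above [f x]; it is at most [f x + e], hence below [f y]. *)
pose k := (Num.truncn ((f x + M) / e)).+1.
have /andP[k1 k2] := truncn_itv fx0.
rewrite ler_pdivlMr// in k1; rewrite ltr_pdivrMr// in k2.
have kK : (k < K.+1)%N.
  rewrite ltnS -(ltr_nat R); apply: (@le_lt_trans _ _ (2 * M / e)).
    rewrite ler_pdivlMr//; apply: (le_trans k1).
    by have := fM x; rewrite ler_norml => /andP[_]; lra.
  apply: archi_boundP; rewrite divr_ge0 ?(ltW e0)// mulr_ge0//.
  exact: le_trans (fM x).
have Fin : List.In (F k) [seq F k | k <- iota 0 K.+1].
  by apply/In_mapP; exists k; split=> //; apply/InP; rewrite mem_iota.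
have [/(_ _)/= Fxy _] := s _ Fin.
have : F k x by rewrite /F /= in_itv /= /k; lra.
move=> /Fxy; rewrite /F /= in_itv /= /k -natr1.
by move: k1; lra.
Qed.

Lemma L1_sets (pi : probability T R) (f : T -> R) (e : R) :
  pi.-integrable setT (EFin \o f) -> 0 < e ->
  exists (Bs : seq (set T)) (s : T -> R),
    [/\ forall B, List.In B Bs -> measurable B,
        forall x y, same_side Bs x y -> s x = s y,
        pi.-integrable setT (EFin \o s) & \int[pi]_x `|f x - s x| <= e].
Proof.
move=> fi e0; have [g [gi _ gl]] := approximation_sfun_integrable measurableT fi.
have /fine_cvgP[_ /cvgr0Pnorm_le/(_ _ e0)[n _ /(_ n (leqnn _)) /= ne]] := gl.
have fr : finite_set (range (g n)) by exact: fimfunP.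
exists [seq g n @^-1` [set v] | v <- finmap.enum_fset (fset_set (range (g n)))], (g n).
split.
- by move=> B h; have [v [_ <-]] := (In_mapP _ _ _).1 h; rewrite -[_ @^-1` _]setTI; exact: measurable_funP.
- move=> x y xy; have [|/(_ erefl) <-//] := xy (g n @^-1` [set g n x]).
  apply/In_mapP; exists (g n x); split=> //; apply/InP.
  by have := @in_fset_set _ _ fr (g n x); rewrite mem_set//; exists x.
- exact: gi.
- by move: ne; rewrite ger0_norm ?fine_ge0 ?integral_ge0//.
Qed.

End partitions.

(** * One step of the coupled chain *)

Lemma probability_Rintegral_cst {R : realType} {d} {T : measurableType d}
  (P : probability T R) (r : R) : \int[P]_x r = r.
Proof.
transitivity (r * fine (P setT)); first exact: Rintegral_cst.
by rewrite (congr1 fine (probability_setT P)) mulr1.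
Qed.

Section one_step.
Context {R : realType} {E : ptopologicalType} {m : nat}.
Variables (A : operator (R := R) E) (q : 'I_m.+1 -> 'I_m.+1 -> E -> R).
Hypothesis A_bounded : forall f g, A (f, g) ->
  bounded_continuous f /\ bounded_continuous g.
Hypothesis A_mul : forall f1 f2, domain A f1 -> domain A f2 ->
  domain A (fun x => f1 x * f2 x).
Variables (mu : nat -> E -> probability (borel E) R) (lam : nat -> E -> R).
Hypothesis lam_ge0 : forall n x, 0 <= lam n x.
Hypothesis A_lim : forall f g, A (f, g) -> forall x,
  lam n x * (\int[mu n x]_y (f y - f x)) @[n --> \oo] --> g x.
Hypothesis q_ge0 : forall i j x, i != j -> 0 <= q i j x.
Variables (Q : 'M[R]_m.+1) (pi : 'I_m.+1 -> probability (borel E) R).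
Hypothesis Q_row : forall i, \sum_j Q i j = 0.
Hypothesis pi_A : forall i f g, A (f, g) ->
  \int[pi i]_x g x = \sum_j Q i j * \int[pi j]_x f x.
Hypothesis q_int : forall i j, i != j -> (pi i).-integrable setT (EFin \o q i j).
Hypothesis pi_q : forall i j f, i != j -> bounded_continuous f ->
  \int[pi i]_x (q i j x * f x) = Q i j * \int[pi j]_x f x.

Local Notation J := (jump q).
Local Notation integrable i f := ((pi i).-integrable setT (EFin \o f)).

Lemma span_pi i f g : span A f g ->
  \int[pi i]_x g x = \sum_j Q i j * \int[pi j]_x f x.
Proof.
elim=> [{}f {}g /pi_A//| |a f1 g1 f2 g2 fg1 IH1 fg2 IH2].
  rewrite probability_Rintegral_cst.
  under eq_bigr do rewrite probability_Rintegral_cst mulr1.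
  by rewrite Q_row.
have bi k h : bounded_continuous h -> integrable k h.
  exact: bounded_continuous_integrable.
have lin k h h' : bounded_continuous h -> bounded_continuous h' ->
    \int[pi k]_x (a * h x + h' x) = a * \int[pi k]_x h x + \int[pi k]_x h' x.
  move=> bh bh'; have ih : integrable k (fun x => a * h x).
    by have := integrableZl measurableT a (bi k _ bh); apply: (eq_integrable measurableT).
  rewrite RintegralD//; last exact: bi.
  by have /= -> := RintegralZl a measurableT (bi k _ bh).
have [bf1 bg1] := span_bounded A_bounded fg1.
have [bf2 bg2] := span_bounded A_bounded fg2.
rewrite lin// IH1 IH2 mulr_sumr -big_split /=.
by apply: eq_bigr => j _; rewrite lin//; ring.
Qed.

Lemma jspan_integrable (w gw : 'I_m.+1 -> E -> R) j k : jspan A w gw -> integrable k (w j).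
Proof.
move=> wg; apply: bounded_continuous_integrable.
exact: (span_bounded A_bounded (wg j)).1.
Qed.

Let integrable_finsum i (I : Type) (s : seq I) (P : pred I) (f : I -> E -> R) :
  (forall k, P k -> integrable i (f k)) ->
  integrable i (fun x => \sum_(k <- s | P k) f k x) /\
  \int[pi i]_x (\sum_(k <- s | P k) f k x) = \sum_(k <- s | P k) \int[pi i]_x f k x.
Proof.
move=> fi; elim: s => [|k s [IH1 IH2]].
  rewrite big_nil; under eq_Rintegral do rewrite big_nil.
  rewrite Rintegral_cst// mul0r; split=> //.
  rewrite (_ : EFin \o _ = cst 0%E); first exact: integrable0.
  by apply/funext => x /=; rewrite big_nil.
have [Pk|Pk] := boolP (P k); last first.
  rewrite big_cons (negbTE Pk); under eq_Rintegral do rewrite big_cons (negbTE Pk).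
  split=> //; apply: (eq_integrable measurableT) IH1 => x _ /=.
  by rewrite big_cons (negbTE Pk).
rewrite big_cons Pk; under eq_Rintegral do rewrite big_cons Pk.
rewrite RintegralD ?IH2//; last exact: fi.
split=> //; have := integrableD measurableT (fi _ Pk) IH1.
by apply: (eq_integrable measurableT) => x _ /=; rewrite big_cons Pk.
Qed.

Let jump_term (w gw : 'I_m.+1 -> E -> R) j k : jspan A w gw -> k != j ->
  integrable j (fun x => q j k x * (w k x - w j x)) /\
  \int[pi j]_x (q j k x * (w k x - w j x)) =
    Q j k * (\int[pi k]_x w k x - \int[pi k]_x w j x).
Proof.
move=> wg kj; have wkj : span A (fun x => w k x + (-1) * w j x)
    (fun x => gw k x + (-1) * gw j x).
  exact: (spanD (wg k) (spanZ (-1) (wg j))).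
have E1 : (fun x => q j k x * (w k x - w j x)) =
    (fun x => q j k x * (w k x + (-1) * w j x)).
  by apply/funext => x; rewrite mulN1r.
have [[cf [M fM]] _] := span_bounded A_bounded wkj.
rewrite E1 pi_q 1?eq_sym//; last by split=> //; exists M.
split.
  have := integrableZr measurableT M (q_int (i := j) (j := k) _); rewrite eq_sym.
  move=> /(_ kj); apply: le_integrable => //.
    apply/measurable_EFinP/measurable_funM.
      by apply/measurable_EFinP; apply: measurable_int (q_int _); rewrite eq_sym.
    exact: continuous_borel_measurable.
  move=> x _ /=; rewrite lee_fin !normrM ler_wpM2l//.
  exact: le_trans (fM x) (ler_norm _).
congr (_ * _); rewrite -RintegralB//; [|exact: (jspan_integrable _ _ wg)..].
by apply: eq_Rintegral => x _; rewrite mulN1r.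
Qed.

(** The [A] part contributes the integrals of [w j] against every [pi k], and the jump terms
    exchange [w j] for [w k] there; what is left is [Q] acting on the vector of integrals. This is
    the invariance that the coupling discretizes. *)
Lemma jump_pi (w gw : 'I_m.+1 -> E -> R) j : jspan A w gw ->
  integrable j (J w gw j) /\
  \int[pi j]_x J w gw j x = \sum_k Q j k * \int[pi k]_x w k x.
Proof.
move=> wg.
have [i1 e1] := @integrable_finsum j _ (index_enum 'I_m.+1) (fun k => k != j) _
  (fun k kj => (jump_term wg kj).1).
have ig : integrable j (gw j).
  by apply: bounded_continuous_integrable; exact: (span_bounded A_bounded (wg j)).2.
split.
  have := integrableD measurableT ig i1; apply: (eq_integrable measurableT) => x _ //.
rewrite RintegralD// e1 (span_pi j (wg j)) (bigD1 j)//=.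
rewrite [RHS](bigD1 j)//= -addrA -big_split /=; congr (_ + _).
apply: eq_bigr => k kj; rewrite (jump_term wg kj).2; ring.
Qed.

Section duality.
Variables (i : 'I_m.+1) (Pr : 'I_m.+1 -> R) (eps C0 : R).
Hypotheses (Pr_ge0 : forall j, 0 <= Pr j) (Pr1 : \sum_j Pr j = 1).
Hypotheses (eps_ge0 : 0 <= eps) (eps_le1 : eps <= 1) (C0_ge0 : 0 <= C0).
Hypothesis PrE : forall j,
  `|Pr j - (i == j)%:R - eps * Q i j| <= C0 * eps ^+ 2.

Let q1 := \sum_j \sum_k `|Q j k|.
(** If [r] is the remainder of [Pr] after [1 + eps Q], then [Pr (1 - eps Q)] misses the unit row at
    [i] by [r - eps r Q] minus [eps^2] times row [i] of [Q^2]. The summands bound the entries of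
    these terms, and the outer factor sums over the states. *)
Definition defect_cst : R := m.+1%:R * (C0 + q1 ^+ 2 + m.+1%:R * C0 * q1).

Let q1_ge j k : `|Q j k| <= q1.
Proof.
rewrite /q1 (bigD1 j)//= (bigD1 k)//= -addrA lerDl addr_ge0// ?sumr_ge0// => l _.
exact: sumr_ge0.
Qed.

Let q1_ge0 : 0 <= q1. Proof. exact: le_trans (q1_ge ord0 ord0). Qed.

Let defect k := Pr k - eps * (\sum_j Pr j * Q j k) - (i == k)%:R.

Let defect_sum : \sum_k defect k = 0.
Proof.
rewrite /defect !sumrB Pr1 -mulr_sumr exchange_big /=.
under eq_bigr do rewrite -mulr_sumr Q_row mulr0.
rewrite big1// mulr0 subr0 (bigD1 i)//= eqxx big1 ?addr0 ?subrr// => k ki.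
by rewrite eq_sym (negbTE ki).
Qed.

Let defect_le k : `|defect k| <= (C0 + q1 ^+ 2 + m.+1%:R * C0 * q1) * eps ^+ 2.
Proof.
pose r j := Pr j - (i == j)%:R - eps * Q i j.
have PE j : Pr j = r j + (i == j)%:R + eps * Q i j by rewrite /r; ring.
have S1 : \sum_j Pr j * Q j k = \sum_j r j * Q j k + Q i k + eps * \sum_j Q i j * Q j k.
  have -> : Q i k = \sum_j (i == j)%:R * Q j k.
    rewrite (bigD1 i)//= eqxx mul1r big1 ?addr0// => j ji.
    by rewrite eq_sym (negbTE ji) mul0r.
  by rewrite mulr_sumr -!big_split /=; apply: eq_bigr => j _; rewrite [Pr j]PE; ring.
rewrite /defect S1 [Pr k]PE.
have -> : r k + (i == k)%:R + eps * Q i k - eps *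
   (\sum_j r j * Q j k + Q i k + eps * (\sum_j Q i j * Q j k)) - (i == k)%:R =
   r k - eps * (\sum_j r j * Q j k) - eps ^+ 2 * (\sum_j Q i j * Q j k) by ring.
have e2 : 0 <= eps ^+ 2 by rewrite sqr_ge0.
have h1 : `|r k| <= C0 * eps ^+ 2 by exact: PrE.
have h2 : `|eps * (\sum_j r j * Q j k)| <= m.+1%:R * C0 * q1 * eps ^+ 2.
  rewrite normrM (ger0_norm eps_ge0).
  have h : `|\sum_j r j * Q j k| <= m.+1%:R * (C0 * eps ^+ 2 * q1).
    apply: (le_trans (ler_norm_sum _ _ _)).
    apply: (@le_trans _ _ (\sum_(j < m.+1) C0 * eps ^+ 2 * q1)).
      by apply: ler_sum => j _; rewrite normrM ler_pM//; exact: PrE.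
    by rewrite sumr_const card_ord mulr_natl.
  apply: (@le_trans _ _ (1 * (m.+1%:R * (C0 * eps ^+ 2 * q1)))).
    by apply: ler_pM.
  by rewrite mul1r le_eqVlt; apply/orP; left; apply/eqP; ring.
have h3 : `|eps ^+ 2 * (\sum_j Q i j * Q j k)| <= q1 ^+ 2 * eps ^+ 2.
  rewrite normrM (ger0_norm e2) mulrC ler_wpM2r//.
  apply: (le_trans (ler_norm_sum _ _ _)).
  apply: (@le_trans _ _ (\sum_j `|Q i j| * q1)).
    by apply: ler_sum => j _; rewrite normrM ler_wpM2l.
  rewrite -mulr_suml expr2 ler_wpM2r// [leRHS](bigD1 i)//= lerDl.
  by apply: sumr_ge0 => l _; exact: sumr_ge0.
apply: (le_trans (ler_normB _ _)); apply: (le_trans (lerD (ler_normB _ _) (lexx _))).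
by lra.
Qed.

Lemma defect_cst_ge0 : 0 <= defect_cst.
Proof. by rewrite mulr_ge0// !addr_ge0 ?mulr_ge0 ?sqr_ge0. Qed.

(** By [jump_pi] the integrals on the right are [g - eps Q g], with [g] the vector of means of [G],
    so the discrepancy is [defect] applied to [g]. As [defect] has sum 0, a constant [c0] can be
    subtracted: only the oscillation of [G] is charged, not its size. *)
Lemma resolvent_defect (G gG : 'I_m.+1 -> E -> R) (c0 B : R) : jspan A G gG ->
  (forall j x, `|G j x - c0| <= B) ->
  \int[pi i]_x G i x <= \sum_j Pr j *
     (\int[pi j]_x (G j x - eps * J G gG j x)) + defect_cst * eps ^+ 2 * B.
Proof.
move=> Gg GB; pose g k := \int[pi k]_x G k x.
have iG k : integrable k (G k) by exact: jspan_integrable Gg.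
have B0 : 0 <= B by exact: le_trans (GB ord0 point).
have gB k : `|g k - c0| <= B.
  have -> : g k - c0 = \int[pi k]_x (G k x - c0).
    have ic : integrable k (cst c0) by exact: (@bounded_integrable _ _ _ (pi k) _ `|c0|).
    by rewrite (RintegralB measurableT (iG k) ic) probability_Rintegral_cst.
  have iGc : integrable k (fun x => G k x - c0).
    have := @spanD _ _ A _ _ _ _ (Gg k) (span_cst A (- c0)).
    by move=> /(span_bounded A_bounded)[/(bounded_continuous_integrable (pi k))].
  apply: (le_trans (le_normr_Rintegral measurableT iGc)).
  apply: (@le_trans _ _ (\int[pi k]_x (cst B x))).
    apply: le_Rintegral => //.
      by have := integrable_norm iGc; apply: (eq_integrable measurableT).
    by apply: (@bounded_integrable _ _ _ (pi k) _ `|B|).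
  by rewrite probability_Rintegral_cst.
have E1 j : \int[pi j]_x (G j x - eps * J G gG j x) = g j - eps * \sum_k Q j k * g k.
  have [iJ eJ] := jump_pi j Gg.
  have iJ' : integrable j (fun x => eps * J G gG j x).
    by have := integrableZl measurableT eps iJ; apply: (eq_integrable measurableT).
  rewrite (RintegralB measurableT (iG j) iJ').
  by have /= -> := RintegralZl eps measurableT iJ; rewrite eJ.
under eq_bigr do rewrite E1.
have -> : \sum_j Pr j * (g j - eps * (\sum_k Q j k * g k)) =
    g i + \sum_k defect k * (g k - c0).
  under [X in _ = _ + X]eq_bigr do rewrite mulrBr.
  rewrite sumrB -[X in _ - X]mulr_suml defect_sum mul0r subr0.
  have -> : g i = \sum_k (i == k)%:R * g k.
    rewrite (bigD1 i)//= eqxx mul1r big1 ?addr0// => j ji.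
    by rewrite eq_sym (negbTE ji) mul0r.
  rewrite -big_split /=; under eq_bigr do rewrite mulrBr.
  have -> : \sum_k ((i == k)%:R * g k + defect k * g k) =
      \sum_k (Pr k * g k - (eps * \sum_j Pr j * Q j k) * g k).
    by apply: eq_bigr => k _; rewrite /defect; ring.
  rewrite !sumrB; congr (_ - _).
  under eq_bigr do rewrite mulrCA !mulr_sumr.
  rewrite exchange_big /=; apply: eq_bigr => k _.
  rewrite mulr_sumr mulr_suml; apply: eq_bigr => j _; ring.
have : `|\sum_k defect k * (g k - c0)| <= defect_cst * eps ^+ 2 * B.
  apply: (le_trans (ler_norm_sum _ _ _)).
  apply: (@le_trans _ _ (\sum_(k < m.+1) (C0 + q1 ^+ 2 + m.+1%:R * C0 * q1) * eps ^+ 2 * B)).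
    by apply: ler_sum => k _; rewrite normrM ler_pM.
  rewrite sumr_const card_ord -mulr_natl /defect_cst.
  by rewrite le_eqVlt; apply/orP; left; apply/eqP; ring.
by rewrite ler_norml => /andP[h _]; rewrite -/(g i); lra.
Qed.

Section cell_coupling.
Variables (T : finType) (c : E -> T) (rep : T -> E).
Hypothesis mc : forall a, measurable (c @^-1` [set a] : set (borel E)).
Hypothesis rep_c : forall x, c (rep (c x)) = c x.
Variables (N : nat) (w gw : 'I_N.+1 -> 'I_m.+1 -> E -> R).
Hypothesis wg : forall l, jspan A (w l) (gw l).
Variables (M Dl : R).
Hypotheses (M_ge0 : 0 <= M) (Dl_ge0 : 0 <= Dl).
Hypothesis wM : forall j x, \sum_l `|w l j x| <= M.

Let U l j x := w l j x - eps * J (w l) (gw l) j x.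
Let avg j (f : E -> R) a := cell_avg (pi j) c rep f a.
Let pm j a := cell_mass (pi j) c a.

Hypothesis UD : \sum_l \sum_j Pr j * \int[pi j]_x `|U l j x - avg j (U l j) (c x)| <= Dl.

Let iw l j k : integrable k (w l j).
Proof. exact: jspan_integrable (wg l). Qed.

Let iU l j : integrable j (U l j).
Proof.
have [iJ _] := jump_pi j (wg l).
have iJ' : integrable j (fun x => eps * J (w l) (gw l) j x).
  by have := integrableZl measurableT eps iJ; apply: (eq_integrable measurableT).
by have := integrableB measurableT (iw l j j) iJ'; apply: (eq_integrable measurableT).
Qed.

(** The maximum of the potentials [z a] is replaced by an element [G] of the span. The target side
    is at most the mean of [G] under [pi i]; [resolvent_defect] moves it one step ahead; and there
    [1 - eps B] of [G] is at most the best [1 - eps B] of some [z a], hence the value chosen by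
    [sel], up to averaging over cells. *)
Let dual_ineq (k : T -> R) (h : T -> 'I_N.+1 -> R) (et : R)
    (sel : 'I_m.+1 * T -> T) : (forall a l, `|h a l| <= et) ->
  (forall s a, k a + \sum_l h a l * avg s.1 (U l s.1) s.2 <=
     k (sel s) + \sum_l h (sel s) l * avg s.1 (U l s.1) s.2) ->
  \sum_a (pm i a * k a + \sum_l h a l * cell_int (pi i) c (w l i) a) -
     (2 * Dl + defect_cst * M * eps ^+ 2) * et <=
  \sum_s Pr s.1 * pm s.1 s.2 *
     (k (sel s) + \sum_l h (sel s) l * avg s.1 (U l s.1) s.2).
Proof.
move=> het selP; have et0 : 0 <= et by exact: le_trans (het (c point) ord0).
pose z a j x := 1 * k a + \sum_l h a l * w l j x.
pose gz a j x := 1 * cst 0 x + \sum_l h a l * gw l j x.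
have zg a : jspan A (z a) (gz a).
  move=> j; apply: (span_lin 1 (span_cst A (k a))).
  by apply: (span_sum _ (fun l => h a l)) => l; exact: wg.
have JzE a j x : J (z a) (gz a) j x = \sum_l h a l * J (w l) (gw l) j x.
  rewrite /jump /gz /z mulr0 add0r.
  under [RHS]eq_bigr do rewrite mulrDr mulr_sumr.
  rewrite big_split /= exchange_big /=; congr (_ + _); apply: eq_bigr => b _.
  rewrite opprD addrACA subrr add0r -sumrB mulr_sumr.
  by apply: eq_bigr => l _; ring.
have zU a j x : z a j x - eps * J (z a) (gz a) j x = k a + \sum_l h a l * U l j x.
  rewrite JzE /z mul1r -addrA; congr (_ + _).
  by rewrite mulr_sumr -sumrB; apply: eq_bigr => l _; rewrite /U; ring.
have zk a j x : `|z a j x - k a| <= et * M.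
  rewrite /z mul1r addrC addKr; apply: (le_trans (ler_norm_sum _ _ _)).
  apply: (@le_trans _ _ (\sum_l et * `|w l j x|)).
    by apply: ler_sum => l _; rewrite normrM ler_wpM2r.
  by rewrite -mulr_sumr ler_wpM2l.
(* Each [z a] is within [et * M] of [k a], so the maximum is within that distance of the largest
   [k a]. The defect is then proportional to [et] however large [k] is, as the dual condition
   requires. *)
pose c0 := k [arg max_(a > c point) k a]%O.
have c0P a : k a <= c0 by rewrite /c0; case: arg_maxP => //= b _; apply.
apply/ler_addgt0Pr => kap kap0.
(* [ka] is paid once in [L2], once in [L6], and once more through the oscillation of [G], with
   factor [defect_cst * eps ^+ 2]. *)
pose ka := kap / (2 + defect_cst * eps ^+ 2).
have den0 : 0 < 2 + defect_cst * eps ^+ 2.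
  by rewrite ltr_pwDl// mulr_ge0 ?sqr_ge0// defect_cst_ge0.
have ka0 : 0 < ka by rewrite divr_gt0.
have [G [gG [Gg G1 G2 G3]]] := @jspan_maxs _ _ _ A q A_bounded A_mul mu lam
  lam_ge0 A_lim q_ge0 T z gz (c point) (enum T) eps ka eps_ge0 ka0 zg.
have Gc0 j x : `|G j x - c0| <= et * M + ka.
  have [a Ga] := G2 j x; have := zk a j x; have := c0P a.
  pose b := [arg max_(a > c point) k a]%O.
  have := G1 j x b (or_intror _); have := zk b j x.
  rewrite -/c0 !ler_norml => /andP[h1 h2] h3 h4 /andP[h5 h6].
  have {}h3 : z b j x <= G j x + ka.
    by apply: h3; apply/InP; rewrite mem_enum.
  by apply/andP; split; rewrite -/c0 in h1 h2 *; lra.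
have RD := resolvent_defect Gg Gc0.
have izi j a : integrable j (z a j) by exact: jspan_integrable (zg a).
have L1 : \sum_a (pm i a * k a + \sum_l h a l * cell_int (pi i) c (w l i) a) =
    \int[pi i]_x z (c x) i x.
  rewrite -(cell_int_piecewise mc (fun a => izi i a)); apply: eq_bigr => a _.
  have [is_ es] : integrable i (fun x => \sum_l h a l * w l i x) /\ True.
    split=> //; have := span_sum (index_enum 'I_N.+1) (fun l => h a l) (fun l => wg l i).
    by move=> /(span_bounded A_bounded)[/(bounded_continuous_integrable (pi i))].
  have Hs (s : seq 'I_N.+1) : integrable i (fun x => \sum_(l <- s) h a l * w l i x) /\
      cell_int (pi i) c (fun x => \sum_(l <- s) h a l * w l i x) a =
      \sum_(l <- s) h a l * cell_int (pi i) c (w l i) a.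
    elim: s => [|l s [IH1 IH2]].
      rewrite big_nil; under cell_int_eq => x _ do rewrite big_nil.
      rewrite (cell_int_cst (pi i) mc 0 a) mul0r; split=> //.
      rewrite (_ : EFin \o _ = cst 0%E); first exact: integrable0.
      by apply/funext => x /=; rewrite big_nil.
    have il : integrable i (fun x => h a l * w l i x).
      by have := integrableZl measurableT (h a l) (iw l i i); apply: (eq_integrable measurableT).
    split.
      have := integrableD measurableT il IH1; apply: (eq_integrable measurableT) => x _ /=.
      by rewrite big_cons.
    under cell_int_eq => x _ do rewrite big_cons.
    by rewrite cell_intD// cell_intZ// IH2 big_cons.
  rewrite /z cell_intD//; last first.
    by apply: (@bounded_integrable _ _ _ (pi i) _ `|1 * k a|).
  have -> : cell_int (pi i) c (fun=> 1 * k a) a = 1 * k a * pm i a by exact: cell_int_cst.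
  by rewrite (Hs _).2 mul1r [k a * _]mulrC.
rewrite L1.
have L2 : \int[pi i]_x z (c x) i x <= \int[pi i]_x G i x + ka.
  rewrite -[X in _ + X](probability_Rintegral_cst (pi i)) -RintegralD//; last first.
  - by apply: (@bounded_integrable _ _ _ (pi i) _ `|ka|).
  - exact: jspan_integrable Gg.
  apply: le_Rintegral => //.
  - exact: (integrable_piecewise mc (fun a => izi i a)).
  - have := spanD (Gg i) (span_cst A ka).
    by move=> /(span_bounded A_bounded)[/(bounded_continuous_integrable (pi i))].
  - by move=> x _; apply: G1; right; apply/InP; rewrite mem_enum.
pose V a j x := k a + \sum_l h a l * U l j x.
have iV a j : integrable j (V a j).
  have [iJ _] := jump_pi j (zg a).
  have iJ' : integrable j (fun x => eps * J (z a) (gz a) j x).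
    by have := integrableZl measurableT eps iJ; apply: (eq_integrable measurableT).
  have := integrableB measurableT (izi j a) iJ'; apply: (eq_integrable measurableT) => x _ /=.
  by rewrite -EFinB (zU a j x).
have iVs j : integrable j (fun x => V (sel (j, c x)) j x).
  exact: (integrable_piecewise mc (f := fun b => V (sel (j, b)) j)).
pose err l j x := `|U l j x - avg j (U l j) (c x)|.
have ierr l j : integrable j (err l j).
  have := integrable_norm (integrableB measurableT (iU l j)
     (integrable_cell_fun (pi j) mc (avg j (U l j)))).
  by apply: (eq_integrable measurableT).
have Vavg a j x : `|V a j x - (k a + \sum_l h a l * avg j (U l j) (c x))| <=
    et * \sum_l err l j x.
  rewrite /V opprD addrACA subrr add0r -sumrB mulr_sumr.
  apply: (le_trans (ler_norm_sum _ _ _)); apply: ler_sum => l _.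
  by rewrite -mulrBr normrM ler_wpM2r.
(* [sel] is optimal for cell averages only; passing from values to averages and back costs two
   averaging errors, hence the factor 2. *)
have L3 j x : G j x - eps * J G gG j x <=
    V (sel (j, c x)) j x + (2 * et) * (\sum_l err l j x) + ka.
  have [a Ga] := G3 j x; rewrite zU -/(V a j x) in Ga.
  have := selP (j, c x) a => /= s1.
  have := Vavg a j x; have := Vavg (sel (j, c x)) j x.
  rewrite !ler_norml => /andP[h1 h2] /andP[h3 h4].
  lra.
have L4 j : \int[pi j]_x (G j x - eps * J G gG j x) <=
    \int[pi j]_x V (sel (j, c x)) j x + (2 * et) * (\sum_l \int[pi j]_x err l j x) + ka.
  have [is_ es] := @integrable_finsum j _ (index_enum 'I_N.+1) xpredT (fun l => err l j)
    (fun l _ => ierr l j).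
  have is2 : integrable j (fun x => 2 * et * \sum_l err l j x).
    by have := integrableZl measurableT (2 * et) is_; apply: (eq_integrable measurableT).
  have ik : integrable j (cst ka) by apply: (@bounded_integrable _ _ _ (pi j) _ `|ka|).
  have i12 : integrable j (fun x => V (sel (j, c x)) j x + 2 * et * \sum_l err l j x).
    by have := integrableD measurableT (iVs j) is2; apply: (eq_integrable measurableT).
  have <- : \int[pi j]_x (V (sel (j, c x)) j x + 2 * et * (\sum_l err l j x) + cst ka x) =
     \int[pi j]_x V (sel (j, c x)) j x + 2 * et * (\sum_l \int[pi j]_x err l j x) + ka.
    rewrite (RintegralD measurableT i12 ik) (RintegralD measurableT (iVs j) is2) -es.
    have -> : \int[pi j]_x cst ka x = ka by exact: probability_Rintegral_cst.
    by have /= -> := RintegralZl (2 * et) measurableT is_.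
  apply: le_Rintegral => //.
  - have [iJ _] := jump_pi j Gg.
    have iJ' : integrable j (fun x => eps * J G gG j x).
      by have := integrableZl measurableT eps iJ; apply: (eq_integrable measurableT).
    have := integrableB measurableT (jspan_integrable j j Gg) iJ'.
    exact: (eq_integrable measurableT).
  - by have := integrableD measurableT i12 ik; apply: (eq_integrable measurableT).
have L5 : \sum_s Pr s.1 * pm s.1 s.2 *
     (k (sel s) + \sum_l h (sel s) l * avg s.1 (U l s.1) s.2) =
   \sum_j Pr j * \int[pi j]_x V (sel (j, c x)) j x.
  transitivity (\sum_j \sum_b Pr j * pm j b * (k (sel (j, b)) +
      \sum_l h (sel (j, b)) l * avg j (U l j) b)).
    by rewrite pair_bigA; apply: eq_bigr => -[].
  apply: eq_bigr => j _; under eq_bigr do rewrite -mulrA.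
  rewrite -mulr_sumr; congr (_ * _).
  rewrite -(cell_int_piecewise mc (f := fun b => V (sel (j, b)) j))//.
  apply: eq_bigr => b _.
  have Hs (s : seq 'I_N.+1) a : integrable j (fun x => \sum_(l <- s) h a l * U l j x) /\
      cell_int (pi j) c (fun x => \sum_(l <- s) h a l * U l j x) b =
      pm j b * \sum_(l <- s) h a l * avg j (U l j) b.
    elim: s => [|l s [IH1 IH2]].
      rewrite big_nil mulr0; under cell_int_eq => x _ do rewrite big_nil.
      rewrite (cell_int_cst (pi j) mc 0 b) mul0r; split=> //.
      rewrite (_ : EFin \o _ = cst 0%E); first exact: integrable0.
      by apply/funext => x /=; rewrite big_nil.
    have il : integrable j (fun x => h a l * U l j x).
      by have := integrableZl measurableT (h a l) (iU l j); apply: (eq_integrable measurableT).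
    split.
      have := integrableD measurableT il IH1; apply: (eq_integrable measurableT) => x _ /=.
      by rewrite big_cons.
    under cell_int_eq => x _ do rewrite big_cons.
    rewrite cell_intD// cell_intZ// IH2 big_cons mulrDr.
    have <- : pm j b * avg j (U l j) b = cell_int (pi j) c (U l j) b by exact: cell_mass_avg.
    by rewrite mulrCA.
  rewrite /V cell_intD//; last first.
    exact: (Hs _ _).1.
    by apply: (@bounded_integrable _ _ _ (pi j) _ `|k (sel (j, b))|).
  have -> : cell_int (pi j) c (fun=> k (sel (j, b))) b = k (sel (j, b)) * pm j b.
    exact: cell_int_cst.
  by rewrite (Hs _ _).2 mulrDr [k _ * _]mulrC.
rewrite L5.
have L6 : \sum_j Pr j * \int[pi j]_x (G j x - eps * J G gG j x) <=
    \sum_j Pr j * \int[pi j]_x V (sel (j, c x)) j x + 2 * et * Dl + ka.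
  apply: (@le_trans _ _ (\sum_j (Pr j * \int[pi j]_x V (sel (j, c x)) j x +
     2 * et * (Pr j * \sum_l \int[pi j]_x err l j x) + Pr j * ka))).
    apply: ler_sum => j _; apply: (le_trans (ler_wpM2l (Pr_ge0 j) (L4 j))).
    by rewrite le_eqVlt; apply/orP; left; apply/eqP; ring.
  rewrite !big_split /= -mulr_suml Pr1 mul1r lerD2r lerD2l -mulr_sumr.
  rewrite ler_wpM2l ?mulr_ge0//; apply: le_trans UD.
  rewrite exchange_big /=; apply: ler_sum => j _.
  by rewrite mulr_sumr.
have kaE : ka * (2 + defect_cst * eps ^+ 2) = kap by rewrite /ka divfK// gt_eqF.
have M2 : defect_cst * eps ^+ 2 * (et * M + ka) =
   defect_cst * M * eps ^+ 2 * et + defect_cst * eps ^+ 2 * ka by ring.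
rewrite M2 in RD; rewrite mulrDr in kaE.
have M3 : (2 * Dl + defect_cst * M * eps ^+ 2) * et =
   2 * et * Dl + defect_cst * M * eps ^+ 2 * et by ring.
rewrite M3.
have M4 : ka * (defect_cst * eps ^+ 2) = defect_cst * eps ^+ 2 * ka by ring.
by rewrite M4 in kaE; lra.
Qed.

(** The kernel runs backwards: [r j b a] is the probability of cell [a] now, given state [j] and
    cell [b] one step later. The last property says that [w - eps B w] at the later time predicts
    [w] now, as in an implicit Euler scheme. *)
Lemma one_step : exists r : 'I_m.+1 -> T -> T -> R,
  [/\ forall j b a, 0 <= r j b a, forall j b, \sum_a r j b a = 1,
      forall a, \sum_j \sum_b Pr j * pm j b * r j b a = pm i a &
      forall l, \sum_a `|\sum_j \sum_b Pr j * pm j b * r j b a * avg j (U l j) b -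
         pm i a * avg i (w l i) a| <= 2 * Dl + defect_cst * M * eps ^+ 2].
Proof.
have [||r [r0 r1 rn rL]] := @finite_strassen R ('I_m.+1 * T)%type T 'I_N.+1 (c point) ord0
  (fun s => Pr s.1 * pm s.1 s.2) (fun s l => avg s.1 (U l s.1) s.2) (pm i)
  (fun a l => cell_int (pi i) c (w l i) a) (2 * Dl + defect_cst * M * eps ^+ 2).
- apply: addr_ge0; first exact: mulr_ge0.
  apply: mulr_ge0; last exact: sqr_ge0.
  by apply: mulr_ge0 => //; exact: defect_cst_ge0.
- exact: dual_ineq.
exists (fun j b a => r (j, b) a); split=> //.
- by move=> a; rewrite -rn pair_bigA /=; apply: eq_bigr => -[].
- move=> l; apply: le_trans rL; apply: ler_sum => a _.
  rewrite [leRHS](bigD1 l)//= pair_bigA /=.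
  have -> : pm i a * avg i (w l i) a = cell_int (pi i) c (w l i) a by exact: cell_mass_avg.
  rewrite [X in `|X - _|](_ : _ = \sum_s Pr s.1 * pm s.1 s.2 * r s a * avg s.1 (U l s.1) s.2).
    by rewrite lerDl sumr_ge0.
  by apply: eq_bigr => -[].
Qed.

End cell_coupling.
End duality.
End one_step.

(** * The transition matrix at small times *)

Section transition.
Context {R : realType} {m : nat}.
Variable Q : 'M[R]_m.+1.

Let q := \sum_i \sum_j `|Q i j|.

Let q_ge i j : `|Q i j| <= q.
Proof.
rewrite /q (bigD1 i)//= (bigD1 j)//= -addrA lerDl addr_ge0// ?sumr_ge0// => l _.
exact: sumr_ge0.
Qed.

Let q_ge0 : 0 <= q. Proof. exact: le_trans (q_ge ord0 ord0). Qed.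

Let Qpow_le k i j : `|(Q ^+ k) i j| <= q ^+ k.
Proof.
elim: k i j => [|k IH] i j.
  by rewrite expr0 mxE expr0; case: eqP => _; rewrite ?normr1 ?normr0.
rewrite exprS mxE exprS; apply: (le_trans (ler_norm_sum _ _ _)).
apply: (@le_trans _ _ (\sum_l `|Q i l| * q ^+ k)).
  by apply: ler_sum => l _; rewrite normrM ler_wpM2l.
rewrite -mulr_suml ler_wpM2r ?exprn_ge0// /q [leRHS](bigD1 i)//= lerDl.
by apply: sumr_ge0 => l _; exact: sumr_ge0.
Qed.

Let term t i j k := t ^+ k / k`!%:R * (Q ^+ k) i j.

Let term_le t i j k : `|term t i j k| <= exp_coeff (`|t| * q) k.
Proof.
rewrite /term /exp_coeff /= !normrM normrX normfV normr_nat.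
by rewrite exprMn mulrAC ler_wpM2r ?invr_ge0// ler_wpM2l ?exprn_ge0.
Qed.

Let transition_cvg t i j :
  \sum_(0 <= k < n) term t i j k @[n --> \oo] --> transition Q t i j.
Proof.
have : cvgn (series (term t i j)).
  apply: normed_cvg; apply: (series_le_cvg _ _ (term_le t i j)) => //.
    by move=> k; rewrite exp_coeff_ge0// mulr_ge0.
  exact: is_cvg_series_exp_coeff.
by [].
Qed.

Lemma transition_row t i : (forall i, \sum_j Q i j = 0) ->
  \sum_j transition Q t i j = 1.
Proof.
move=> Q0; have Qk k l : \sum_j (Q ^+ k.+1) l j = 0.
  elim: k l => [|k IH] l; first by rewrite expr1.
  rewrite exprS; under eq_bigr do rewrite mxE.
  by rewrite exchange_big/= big1// => j _; rewrite -mulr_sumr IH mulr0.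
have h : (\sum_j \sum_(0 <= k < n) term t i j k @[n --> \oo] -->
    \sum_j transition Q t i j).
  by apply: cvg_finite_sum => j _; exact: transition_cvg.
apply/esym; apply: (cvg_unique _ _ h) => //; apply: (@cvg_trans _ (cst 1 @ \oo)); last exact: cvg_cst.
apply: near_eq_cvg; exists 1%N => //= n /= n1.
rewrite exchange_big /= big_ltn// [X in 1 = _ + X]big_nat [X in 1 = _ + X]big1 ?addr0.
  under eq_bigr do rewrite /term expr0 mxE divr1 mul1r.
  by rewrite (bigD1 i)//= eqxx big1 ?addr0// => j ji; rewrite eq_sym (negbTE ji).
by move=> [|k] _ //; rewrite /term -mulr_sumr Qk mulr0.
Qed.

(** As [eps <= 1], the exponential series beyond its first two terms is at most [eps ^+ 2] times the
    exponential series of [q]. *)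
Lemma transition_small : exists2 C0, 0 <= C0 & forall eps i j, 0 <= eps -> eps <= 1 ->
  `|transition Q eps i j - (i == j)%:R - eps * Q i j| <= C0 * eps ^+ 2.
Proof.
exists (expR q); first exact: expR_ge0.
move=> eps i j e0 e1.
have h : (`|\sum_(0 <= k < n) term eps i j k - (i == j)%:R - eps * Q i j|
    @[n --> \oo] --> `|transition Q eps i j - (i == j)%:R - eps * Q i j|).
  apply: cvg_norm; apply: cvgB; last exact: cvg_cst.
  by apply: cvgB; [exact: transition_cvg|exact: cvg_cst].
rewrite -(cvg_lim _ h)//; apply: limr_le; first by apply/cvg_ex; eexists; exact: h.
exists 2%N => //= n /= n2.
rewrite -(subnKC n2) add2n big_ltn// big_ltn// {1 2}/term expr0 expr1 mxE fact0 invr1 mulr1.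
rewrite mul1r mulr1 expr1.
have -> : forall a b S : R, a + (b + S) - a - b = S by move=> *; ring.
apply: (le_trans (ler_norm_sum _ _ _)).
apply: (@le_trans _ _ (\sum_(2 <= k < (n - 2).+2) exp_coeff q k * eps ^+ 2)).
  rewrite !big_nat; apply: ler_sum => k /andP[k2 _].
  apply: (le_trans (term_le _ _ _ _)); rewrite ger0_norm//.
  have -> : exp_coeff (eps * q) k = exp_coeff q k * eps ^+ k.
    by rewrite /exp_coeff /= exprMn mulrAC mulrC mulrA mulrAC.
  apply: ler_wpM2l; first exact: exp_coeff_ge0.
  by rewrite -(subnK k2) exprD ler_piMl ?sqr_ge0// exprn_ile1.
rewrite -mulr_suml ler_wpM2r ?sqr_ge0//.
apply: (@le_trans _ _ (series (exp_coeff q) (n - 2).+2)).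
  rewrite /series /= [leRHS](big_cat_nat (n := 2%N))//= lerDr sumr_ge0// => k _.
  by rewrite exp_coeff_ge0.
apply: (nondecreasing_cvgn_le _ (is_cvg_series_exp_coeff q)).
by apply: nondecreasing_series => k *; apply: exp_coeff_ge0.
Qed.

End transition.

Section markov.
Context {R : realType} {m : nat} {d} {Omega : measurableType d}.
Variables (P : probability Omega R) (Q : 'M[R]_m.+1) (p : 'I_m.+1 -> R).
Variable Y : R -> Omega -> 'I_m.+1.
Hypothesis Y_markov : markov_chain P Q p Y.

Lemma measurable_state i : measurable ([set i] : set (borel 'I_m.+1)).
Proof. by apply: sub_sigma_algebra; exact: discrete_open. Qed.

Lemma natural_filtration_measurable t C : natural_filtration Y t C -> measurable C.
Proof.
have [mY _ _] := Y_markov; apply: smallest_sub; first exact: sigma_algebra_measurable.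
by move=> _ [s [B [s0 st mB ->]]]; rewrite -[X in measurable X]setTI; exact: mY.
Qed.

Lemma natural_filtration_sigma t : sigma_algebra setT (natural_filtration Y t).
Proof. exact: smallest_sigma_algebra. Qed.

Lemma natural_filtration_state s t i : 0 <= s -> s <= t ->
  natural_filtration Y t (Y s @^-1` [set i]).
Proof.
move=> s0 st; apply: sub_sigma_algebra; exists s, [set i].
by split=> //; exact: measurable_state.
Qed.

Lemma natural_filtrationS s t : s <= t ->
  natural_filtration Y s `<=` natural_filtration Y t.
Proof.
move=> st; apply: sub_smallest2r; first exact: smallest_sigma_algebra.
move=> _ [r [B [r0 rs mB ->]]].
by exists r, B; split=> //; exact: le_trans st.
Qed.

Lemma natural_filtrationI t C D : natural_filtration Y t C ->
  natural_filtration Y t D -> natural_filtration Y t (C `&` D).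
Proof.
move=> FC FD; have [F0 FC' FU] := natural_filtration_sigma t.
have -> : C `&` D = setT `\` ((setT `\` C) `|` (setT `\` D)).
  by rewrite !setTD setCU !setCK.
by apply: (FC' _); rewrite -bigcup2E; apply: FU => -[|[|k]] /=; [exact: FC'..|].
Qed.

Lemma state_measurable t i : 0 <= t -> measurable (Y t @^-1` [set i]).
Proof. by move=> t0; apply: (@natural_filtration_measurable t); exact: natural_filtration_state. Qed.

Lemma markov_step s t C i j : 0 <= s -> 0 <= t ->
  natural_filtration Y t C -> C `<=` Y t @^-1` [set i] ->
  fine (P (C `&` Y (t + s) @^-1` [set j])) = transition Q s i j * fine (P C).
Proof.
move=> s0 t0 FC Ci; have [mY _ YM] := Y_markov.
have mC := natural_filtration_measurable FC.
have [_ _ /(_ _ FC)] := YM s t j s0 t0.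
have -> : (\int[P]_(w in C) (transition Q s (Y t w) j)%:E =
    (transition Q s i j)%:E * P C)%E.
  rewrite -integral_cst//; apply: eq_integral => w; rewrite inE => Cw.
  by rewrite (Ci _ Cw).
have -> : (\int[P]_(w in C) (\1_(Y (t + s) @^-1` [set j]) w)%:E =
    P (C `&` Y (t + s) @^-1` [set j]))%E.
  by rewrite (integral_indic P mC (state_measurable j (addr_ge0 t0 s0))) setIC.
by move=> <-; rewrite fineM// fin_num_measure.
Qed.

(** Nonnegativity of a row of the matrix exponential is read off the chain, at states charged at
    some time; the other rows only meet events of probability 0. *)
Lemma transition_ge0 s t i j : 0 <= s -> 0 <= t ->
  P (Y t @^-1` [set i]) != 0%E -> 0 <= transition Q s i j.
Proof.
move=> s0 t0 Pi; have Fi := natural_filtration_state i t0 (lexx t).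
have mi := state_measurable i t0.
have := @markov_step s t _ i j s0 t0 Fi (fun _ h => h).
set b := fine (P (Y t @^-1` _)) => h.
have b0 : 0 < b.
  rewrite lt_neqAle fine_ge0// andbT eq_sym fine_eq0//.
  exact: fin_num_measure.
have : 0 <= transition Q s i j * b by rewrite -h fine_ge0.
by rewrite pmulr_lge0.
Qed.

End markov.

(** * Chains sampled backwards in time *)

Section list_sums.
Context {R : realType} {Z : finType}.
Implicit Types (f g : seq Z -> R) (n : nat).

(** The sum over all lists of length [n], with the head as innermost variable: the latest time can
    be summed while the past is held fixed. *)
Fixpoint lsum n f : R :=
  if n is n'.+1 then lsum n' (fun l => \sum_z f (z :: l)) else f [::].

Lemma eq_lsum n f g : (forall l, size l = n -> f l = g l) -> lsum n f = lsum n g.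
Proof.
elim: n f g => [|n IH] f g fg /=; first exact: fg.
by apply: IH => l ln; apply: eq_bigr => z _; apply: fg; rewrite /= ln.
Qed.

Lemma ler_lsum n f g : (forall l, size l = n -> f l <= g l) -> lsum n f <= lsum n g.
Proof.
elim: n f g => [|n IH] f g fg /=; first exact: fg.
by apply: IH => l ln; apply: ler_sum => z _; apply: fg; rewrite /= ln.
Qed.

Lemma lsum0 n : lsum n (fun=> 0) = 0.
Proof.
elim: n => [//|n IH] /=; rewrite -[RHS]IH.
by apply: eq_lsum => l _; rewrite big1.
Qed.

Lemma lsumD n f g : lsum n (fun l => f l + g l) = lsum n f + lsum n g.
Proof.
elim: n f g => [//|n IH] f g /=; rewrite -IH.
by apply: eq_lsum => l _; rewrite big_split.
Qed.

Lemma lsumZ n r f : lsum n (fun l => r * f l) = r * lsum n f.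
Proof.
elim: n f => [//|n IH] f /=; rewrite -IH.
by apply: eq_lsum => l _; rewrite mulr_sumr.
Qed.

Lemma lsum_sum n (I : Type) (s : seq I) (F : I -> seq Z -> R) :
  lsum n (fun l => \sum_(i <- s) F i l) = \sum_(i <- s) lsum n (F i).
Proof.
elim: s => [|i s IH].
  by rewrite big_nil -[RHS](lsum0 n); apply: eq_lsum => l _; rewrite big_nil.
by rewrite big_cons -IH -lsumD; apply: eq_lsum => l _; rewrite big_cons.
Qed.

Lemma ler_norm_lsum n f : `|lsum n f| <= lsum n (fun l => `|f l|).
Proof.
elim: n f => [//|n IH] f /=; apply: (le_trans (IH _)).
by apply: ler_lsum => l _; exact: ler_norm_sum.
Qed.

End list_sums.

Section chain.
Context {R : realType} {m : nat} {d} {Omega : measurableType d}.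
Variables (P : probability Omega R) (Q : 'M[R]_m.+1) (p : 'I_m.+1 -> R).
Variable Y : R -> Omega -> 'I_m.+1.
Hypothesis Y_markov : markov_chain P Q p Y.
Variable eps : R.
Hypothesis eps_ge0 : 0 <= eps.
Variable J : finType.
Variables (z0 : 'I_m.+1 * J) (pm : 'I_m.+1 -> J -> R).
Variable (Rk : 'I_m.+1 -> 'I_m.+1 -> J -> J -> R).
Hypotheses (pm_ge0 : forall i a, 0 <= pm i a) (pm1 : forall i, \sum_a pm i a = 1).
Hypotheses (Rk_ge0 : forall i j b a, 0 <= Rk i j b a)
  (Rk1 : forall i j b, \sum_a Rk i j b a = 1).
Local Notation Pm := (transition Q eps).
Hypothesis Rk_pm : forall i, (forall j, 0 <= Pm i j) ->
  forall a, \sum_j \sum_b Pm i j * pm j b * Rk i j b a = pm i a.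

Local Notation Z := ('I_m.+1 * J)%type.
Implicit Types (l : seq Z) (C D : set Omega) (n k : nat) (Phi : seq Z -> R).
Local Notation FY k := (natural_filtration Y (k%:R * eps)).
Local Notation At k i := (Y (k%:R * eps) @^-1` [set i]).
Local Notation pr C := (fine (P C)).

(* Lists carry the latest state first. *)
Definition state_at l k := nth z0 (rev l) k.

Definition adapted_to k (T : Type) (Phi : seq Z -> T) := forall l l',
  (forall i, (i <= k)%N -> state_at l i = state_at l' i) -> Phi l = Phi l'.

Fixpoint hist l : set Omega :=
  if l is z :: l' then hist l' `&` At (size l') z.1 else setT.

(* Given the chain Y, the cells are sampled backwards in time. *)
Fixpoint backward_weight l : R :=
  if l is z :: l' then
    if l' is z' :: _ then Rk z'.1 z.1 z.2 z'.2 * backward_weight l' else 1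
  else 1.

Local Notation rw := backward_weight.

Definition head_mass l := if l is z :: _ then pm z.1 z.2 else 1.

(** The expectation of [\1_C * Phi] when, given [Y], the last cell is drawn from [pm] and the
    earlier ones by the kernels. No probability space is built for the cells: [Y] stays on its own
    space and the cells are summed over. *)
Definition chain_exp n C Phi :=
  lsum n.+1 (fun l => pr (C `&` hist l) * head_mass l * rw l * Phi l).

Let tk_ge0 k : 0 <= k%:R * eps. Proof. by rewrite mulr_ge0. Qed.

Let mAt k i : measurable (At k i).
Proof. exact: (state_measurable Y_markov). Qed.

Let mC k C : FY k C -> measurable C.
Proof. exact: (natural_filtration_measurable Y_markov). Qed.

Let FYS k n : (k <= n)%N -> FY k `<=` FY n.
Proof. by move=> kn; apply: natural_filtrationS; rewrite ler_wpM2r// ler_nat. Qed.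

Let hist_FY l k : (size l <= k.+1)%N -> FY k (hist l).
Proof.
elim: l => [_|z l IH /= lk].
  have [F0 FC _] := natural_filtration_sigma Y (k%:R * eps).
  by have := FC _ F0; rewrite setD0.
apply: natural_filtrationI; first by apply: IH; exact: ltnW.
by apply: natural_filtration_state => //; rewrite ler_wpM2r// ler_nat.
Qed.

Let mhist l : measurable (hist l).
Proof. by apply: (@mC (size l)); apply: hist_FY. Qed.

Let prU C k : measurable C -> \sum_i pr (C `&` At k i) = pr C.
Proof.
move=> mc; transitivity (fine (P (\big[setU/set0]_(i < m.+1) (C `&` At k i)))); last first.
  congr (fine (P _)); apply/seteqP; split=> w.
    by rewrite -(bigcup_mkord_ord (fun i => C `&` At k i)) => -[i _ []].
  move=> Cw; rewrite -(bigcup_mkord_ord (fun i => C `&` At k i)).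
  by exists (nat_of_ord (Y (k%:R * eps) w)) => //=; rewrite inord_val.
rewrite measure_bigsetU_ord.
- by rewrite sum_fine// => i _; apply: fin_num_measure; exact: measurableI.
- by move=> i; exact: measurableI.
- by move=> i j _ _ [w [[_ /= <-] [_ /= <-]]].
Qed.

Let rw_ge0 l : 0 <= rw l.
Proof.
elim: l => [//|z l IH] /=; case: l IH => [//|z' l] IH.
by rewrite mulr_ge0.
Qed.

Let pr_ge0 C : 0 <= pr C. Proof. exact: fine_ge0. Qed.

Let pr_le C D : measurable C -> measurable D -> C `<=` D -> pr C <= pr D.
Proof.
move=> mc md CD; rewrite fine_le ?fin_num_measure//.
by apply: le_measure => //; rewrite inE.
Qed.

(** Given the latest state and cell, the earlier cells come from probability kernels, so they sum
    out and leave only the event of [Y]. *)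
Let backward_sum n z D : measurable D ->
  lsum n (fun l => pr (D `&` hist l) * rw (z :: l)) = pr D.
Proof.
elim: n z D => [|n IH] z D mD; first by rewrite /= setIT mulr1.
rewrite [LHS]/=.
transitivity (lsum n (fun l => \sum_z' Rk z'.1 z.1 z.2 z'.2 *
    (pr ((D `&` At n z'.1) `&` hist l) * rw (z' :: l)))).
  apply: eq_lsum => l ln; apply: eq_bigr => z' _.
  by rewrite -ln mulrCA -setIA [At _ _ `&` _]setIC.
rewrite lsum_sum; under eq_bigr => z' _ do rewrite lsumZ (IH _ _ (measurableI _ _ mD (mAt _ _))).
rewrite -(@pair_bigA _ _ _ _ _ (fun i a => Rk i z.1 z.2 a * pr (D `&` At n i)))/=.
under eq_bigr do rewrite -mulr_suml Rk1 mul1r.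
exact: prU.
Qed.

Let state_at_head z l k : size l = k -> state_at (z :: l) k = z.
Proof. by move=> <-; rewrite /state_at rev_cons nth_rcons size_rev ltnn eqxx. Qed.

Let state_at_behead z l k : (k < size l)%N -> state_at (z :: l) k = state_at l k.
Proof. by move=> kl; rewrite /state_at rev_cons nth_rcons size_rev kl. Qed.

Lemma chain_exp_single n C (Psi : Z -> R) : measurable C ->
  chain_exp n C (fun l => Psi (state_at l n)) =
  \sum_z pm z.1 z.2 * pr (C `&` At n z.1) * Psi z.
Proof.
move=> mc; rewrite /chain_exp [LHS]/=.
transitivity (lsum n (fun l => \sum_z (pm z.1 z.2 * Psi z) *
    (pr ((C `&` At n z.1) `&` hist l) * rw (z :: l)))).
  apply: eq_lsum => l ln; apply: eq_bigr => z _.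
  rewrite (state_at_head z ln) -setIA -[At _ _ `&` _]setIC.
  rewrite ln /=; ring.
rewrite lsum_sum; apply: eq_bigr => z _.
by rewrite lsumZ (backward_sum _ _ (measurableI _ _ mc (mAt n z.1))) mulrAC.
Qed.

(** The Markov property makes the weight of the new head a transition probability times the weight
    of the past. [head_mass] leaves the past, whose head is no longer the last state. *)
Let chain_exp_step k C Phi (Psi : Z -> R) : FY k C -> adapted_to k Phi ->
  chain_exp k.+1 C (fun l => Phi l * Psi (state_at l k.+1)) =
  lsum k.+1 (fun l => pr (C `&` hist l) * rw l * Phi l *
    \sum_j \sum_b Pm (state_at l k).1 j * pm j b *
       Rk (state_at l k).1 j b (state_at l k).2 * Psi (j, b)).
Proof.
move=> FC aP; rewrite /chain_exp; set N := k.+1.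
change (lsum N (fun l => \sum_z pr (C `&` hist (z :: l)) * head_mass (z :: l) *
  rw (z :: l) * (Phi (z :: l) * Psi (state_at (z :: l) k.+1))) = 
  lsum N (fun l => pr (C `&` hist l) * rw l * Phi l *
    \sum_j \sum_b Pm (state_at l k).1 j * pm j b *
       Rk (state_at l k).1 j b (state_at l k).2 * Psi (j, b))).
apply: eq_lsum => -[//|z' l] [lk].
rewrite (state_at_head z' lk) pair_bigA mulr_sumr; apply: eq_bigr => z _.
rewrite (@state_at_head z (z' :: l)); last by rewrite /= lk.
rewrite [head_mass _]/= [hist (z :: _)]/= [rw (z :: _)]/= -/(rw (z' :: l)) -/(hist (z' :: l)).
have -> : Phi (z :: z' :: l) = Phi (z' :: l).
  by apply: aP => i ik; rewrite state_at_behead//= lk.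
have h1 : (size l).+1%:R * eps = k%:R * eps + eps by rewrite lk -natr1 mulrDl mul1r.
have -> : pr (C `&` (hist (z' :: l) `&` At (size l).+1 z.1)) =
    Pm z'.1 z.1 * pr (C `&` hist (z' :: l)).
  rewrite setIA h1; apply: (markov_step Y_markov) => //.
    by apply: natural_filtrationI => //; apply: (@hist_FY (z' :: l)); rewrite /= lk.
  by rewrite /= lk => w [_ []].
by case: z => j b; rewrite [(j, b).1]/= [(j, b).2]/=; ring.
Qed.

Let good_state k i : pr (At k i) != 0 -> forall j, 0 <= Pm i j.
Proof.
move=> h j; apply: (transition_ge0 Y_markov j eps_ge0 (tk_ge0 k) (i := i)).
by apply: contra_neq h => ->.
Qed.

Let hist_bad k C z l : FY k C -> size l = k -> pr (At k z.1) = 0 ->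
  pr (C `&` hist (z :: l)) = 0.
Proof.
move=> FC lk h; apply/eqP; rewrite eq_le pr_ge0 andbT -h.
apply: pr_le => //; first by apply: measurableI; [exact: mC FC|exact: mhist].
by rewrite /= lk => w [_ []].
Qed.

(** Consistency in the horizon: summing out the later step turns [pm] there into [pm] at the time
    before, by [Rk_pm]. States without a nonnegative row carry no probability, so their histories
    contribute 0. *)
Let chain_exp_marg1 k C Phi : FY k C -> adapted_to k Phi ->
  chain_exp k.+1 C Phi = chain_exp k C Phi.
Proof.
move=> FC aP.
transitivity (chain_exp k.+1 C (fun l => Phi l * 1)).
  by apply: eq_lsum => l _; rewrite mulr1.
rewrite (@chain_exp_step k C Phi (fun=> 1))//.
apply: eq_lsum => -[//|z l] [lk]; rewrite (state_at_head z lk).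
have [h|/good_state h] := eqVneq (pr (At k z.1)) 0.
  by rewrite (hist_bad FC lk h) !mul0r.
under eq_bigr => j _ do under eq_bigr => b _ do rewrite mulr1.
by rewrite Rk_pm// [head_mass _]/=; ring.
Qed.

Lemma chain_exp_marg k n C Phi : (k <= n)%N -> FY k C -> adapted_to k Phi ->
  chain_exp n C Phi = chain_exp k C Phi.
Proof.
move=> kn FC aP; rewrite -(subnK kn); elim: (n - k)%N => [//|r <-].
rewrite addSn chain_exp_marg1//; first by apply: FYS FC; exact: leq_addl.
by move=> l l' ll'; apply: aP => i ik; apply: ll'; exact: leq_trans (leq_addl _ _).
Qed.

Lemma chain_exp_residual k C Phi (U W : Z -> R) dl : FY k C -> adapted_to k Phi ->
  (forall l, `|Phi l| <= 1) ->
  (forall i, (forall j, 0 <= Pm i j) -> \sum_a `|\sum_j \sum_b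
     Pm i j * pm j b * Rk i j b a * U (j, b) - pm i a * W (i, a)| <= dl) ->
  `|chain_exp k.+1 C (fun l => Phi l * U (state_at l k.+1)) -
    chain_exp k C (fun l => Phi l * W (state_at l k))| <= dl.
Proof.
move=> FC aP Phi1 res_le.
pose res (z : Z) := `|\sum_j \sum_b Pm z.1 j * pm j b * Rk z.1 j b z.2 * U (j, b) -
  pm z.1 z.2 * W z|.
rewrite chain_exp_step// /chain_exp -mulN1r -lsumZ -lsumD.
apply: (le_trans (ler_norm_lsum _ _)).
apply: (@le_trans _ _ (chain_exp k setT (fun l => 0) + lsum k.+1 (fun l =>
    pr (setT `&` hist l) * rw l * res (state_at l k)))).
  rewrite /chain_exp; under [X in X + _]eq_lsum => l _ do rewrite mulr0.
  rewrite lsum0 add0r; apply: ler_lsum => -[//|z l] [lk].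
  rewrite !(state_at_head z lk) setTI.
  set S := \sum_j _.
  have -> : pr (C `&` hist (z :: l)) * rw (z :: l) * Phi (z :: l) * S +
      -1 * (pr (C `&` hist (z :: l)) * head_mass (z :: l) * rw (z :: l) *
        (Phi (z :: l) * W z)) =
      pr (C `&` hist (z :: l)) * rw (z :: l) * (Phi (z :: l) * (S - pm z.1 z.2 * W z)).
    by rewrite [head_mass _]/=; ring.
  rewrite normrM ger0_norm ?mulr_ge0//; apply: ler_pM; rewrite ?mulr_ge0//.
    apply: ler_wpM2r => //; apply: pr_le => //.
    by apply: measurableI; [exact: mC FC|exact: mhist].
  by rewrite normrM /res -/S -[leRHS]mul1r ler_wpM2r.
rewrite /chain_exp; under [X in X + _]eq_lsum => l _ do rewrite mulr0.
rewrite lsum0 add0r [leLHS]/=.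
have -> : lsum k (fun l => \sum_z pr (setT `&` hist (z :: l)) * rw (z :: l) *
    res (state_at (z :: l) k)) = \sum_z res z * pr (At k z.1).
  rewrite -[RHS](_ : lsum k (fun l => \sum_z res z *
      (pr (At k z.1 `&` hist l) * rw (z :: l))) = _).
    apply: eq_lsum => l lk; apply: eq_bigr => z _.
    by rewrite (state_at_head z lk) setTI [hist _]/= lk setIC mulrC.
  by rewrite lsum_sum; apply: eq_bigr => z _; rewrite lsumZ backward_sum.
have -> : \sum_z res z * pr (At k z.1) = \sum_i \sum_a res (i, a) * pr (At k i).
  by rewrite pair_bigA; apply: eq_bigr => -[].
apply: (@le_trans _ _ (\sum_i dl * pr (setT `&` At k i))).
  apply: ler_sum => i _; rewrite setTI -mulr_suml.
  have [->|h] := eqVneq (pr (At k i)) 0; first by rewrite !mulr0.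
  by apply: ler_wpM2r => //; apply: res_le; exact: good_state h.
by rewrite -mulr_sumr prU// probability_setT mulr1.
Qed.

Let hm_ge0 l : 0 <= head_mass l. Proof. by case: l => [|z l] /=. Qed.

Let weight_ge0 C l : 0 <= pr (C `&` hist l) * head_mass l * rw l.
Proof. by apply: mulr_ge0 => //; apply: mulr_ge0. Qed.

Lemma eq_chain_exp n C Phi Phi' : (forall l, size l = n.+1 -> Phi l = Phi' l) ->
  chain_exp n C Phi = chain_exp n C Phi'.
Proof. by move=> h; apply: eq_lsum => l ln; rewrite h. Qed.

Lemma chain_expD n C Phi Phi' :
  chain_exp n C (fun l => Phi l + Phi' l) = chain_exp n C Phi + chain_exp n C Phi'.
Proof. by rewrite /chain_exp -lsumD; apply: eq_lsum => l _; rewrite mulrDr. Qed.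

Lemma chain_expZ n C r Phi : chain_exp n C (fun l => r * Phi l) = r * chain_exp n C Phi.
Proof. by rewrite /chain_exp -lsumZ; apply: eq_lsum => l _; rewrite mulrCA. Qed.

Lemma chain_exp_sum n C (I : Type) (s : seq I) (F : I -> seq Z -> R) :
  chain_exp n C (fun l => \sum_(i <- s) F i l) = \sum_(i <- s) chain_exp n C (F i).
Proof.
by rewrite /chain_exp -lsum_sum; apply: eq_lsum => l _; rewrite mulr_sumr.
Qed.

Lemma ler_chain_exp n C Phi Phi' : (forall l, Phi l <= Phi' l) ->
  chain_exp n C Phi <= chain_exp n C Phi'.
Proof. by move=> h; apply: ler_lsum => l _; apply: ler_wpM2l; [exact: weight_ge0|exact: h]. Qed.

Lemma ler_norm_chain_exp n C Phi :
  `|chain_exp n C Phi| <= chain_exp n C (fun l => `|Phi l|).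
Proof.
apply: (le_trans (ler_norm_lsum _ _)); apply: ler_lsum => l _.
by rewrite normrM (ger0_norm (weight_ge0 C l)).
Qed.

Lemma chain_exp_cst n C : measurable C -> chain_exp n C (fun=> 1) = pr C.
Proof.
move=> mc; rewrite (@chain_exp_single n C (fun=> 1))//.
transitivity (\sum_i \sum_a pm i a * pr (C `&` At n i)).
  by rewrite pair_bigA; apply: eq_bigr => -[i a] _; rewrite mulr1.
by under eq_bigr do rewrite -mulr_suml pm1 mul1r; exact: prU.
Qed.

Lemma chain_exp_le n C Phi : measurable C -> (forall l, `|Phi l| <= 1) ->
  `|chain_exp n C Phi| <= pr C.
Proof.
move=> mc h; rewrite -(chain_exp_cst n mc).
by apply: (le_trans (ler_norm_chain_exp _ _ _)); exact: ler_chain_exp.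
Qed.

Lemma chain_exp_setT n C Phi : measurable C -> (forall l, 0 <= Phi l) ->
  chain_exp n C Phi <= chain_exp n setT Phi.
Proof.
move=> mc h; apply: ler_lsum => l _; apply: ler_wpM2r => //.
apply: ler_wpM2r => //; apply: ler_wpM2r => //.
apply: pr_le; [exact: measurableI|by rewrite setTI|by move=> w []].
Qed.

Lemma chain_exp_setU n C D Phi : measurable C -> measurable D -> C `&` D = set0 ->
  chain_exp n (C `|` D) Phi = chain_exp n C Phi + chain_exp n D Phi.
Proof.
move=> mc md CD; rewrite /chain_exp -lsumD; apply: eq_lsum => l _.
have -> : pr ((C `|` D) `&` hist l) = pr (C `&` hist l) + pr (D `&` hist l).
  rewrite setIUl measureU; first by rewrite fineD// fin_num_measure//; exact: measurableI.
  - exact: measurableI.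
  - exact: measurableI.
  - by apply/seteqP; split=> // w [[Cw _] [Dw _]]; rewrite -CD.
ring.
Qed.

Lemma chain_exp_diff n C C' D Phi : measurable C -> measurable C' -> measurable D ->
  (forall w, ~ D w -> (C w <-> C' w)) -> (forall l, `|Phi l| <= 1) ->
  `|chain_exp n C Phi - chain_exp n C' Phi| <= 2 * pr D.
Proof.
move=> mc mc' mD CC' h.
have split (A B : set Omega) : measurable A -> measurable B ->
    chain_exp n A Phi = chain_exp n (A `&` B) Phi + chain_exp n (A `\` B) Phi.
  move=> mA mB; rewrite -chain_exp_setU; first by rewrite setUIDK.
  - exact: measurableI.
  - exact: measurableD.
  - by apply/seteqP; split=> // w [[_ Bw] [_]].
rewrite (split C C')// (split C' C)// [C' `&` C]setIC.
have h1 : `|chain_exp n (C `\` C') Phi| <= pr D.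
  apply: (le_trans (chain_exp_le n (measurableD mc mc') h)).
  apply: pr_le => //; first exact: measurableD.
  by move=> w [Cw C'w]; apply: contrapT => /CC' [/(_ Cw)].
have h2 : `|chain_exp n (C' `\` C) Phi| <= pr D.
  apply: (le_trans (chain_exp_le n (measurableD mc' mc) h)).
  apply: pr_le => //; first exact: measurableD.
  by move=> w [C'w Cw]; apply: contrapT => /CC' [_ /(_ C'w)].
move: h1 h2; set a := chain_exp n (C `\` C') Phi; set b := chain_exp n (C' `\` C) Phi.
by rewrite !ler_norml => /andP[? ?] /andP[? ?]; apply/andP; split; lra.
Qed.

Lemma chain_exp_state n C k i Phi : (k <= n)%N ->
  chain_exp n (C `&` At k i) Phi =
  chain_exp n C (fun l => ((state_at l k).1 == i)%:R * Phi l).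
Proof.
move=> kn; apply: eq_lsum => l ln.
have hk : (k < size l)%N by rewrite ln ltnS.
have hE : forall l, (k < size l)%N -> hist l `<=` At k (state_at l k).1.
  elim=> [//|z l' IH] /=; rewrite ltnS leq_eqVlt => /predU1P[kl|kl] w [hw zw].
    by rewrite (state_at_head z (esym kl)) kl.
  by rewrite state_at_behead//; exact: IH.
case: eqP => [hi|hi].
  rewrite mul1r; congr (pr _ * _ * _ * _); apply/seteqP; split=> w [].
    by move=> [].
  by move=> Cw hw; split=> //; split=> //; rewrite -hi; exact: (hE l).
rewrite mul0r mulr0 (_ : _ `&` _ = set0) ?measure0 ?mul0r//.
apply/seteqP; split=> // w [[_ Yw] hw]; apply: hi.
by have /= <- := hE _ hk _ hw; exact: Yw.
Qed.

(** [C] may look beyond time [k], so the horizon cannot be lowered while it is present; positivity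
    first replaces it by the sure event. *)
Lemma chain_exp_mass n k C Phi (V : Z -> R) : (k <= n)%N -> measurable C ->
  (forall l, `|Phi l| <= 1) ->
  `|chain_exp n C (fun l => Phi l * V (state_at l k))| <= \sum_z pm z.1 z.2 * `|V z|.
Proof.
move=> kn mc Phi1; apply: (le_trans (ler_norm_chain_exp _ _ _)).
apply: (@le_trans _ _ (chain_exp n C (fun l => `|V (state_at l k)|))).
  by apply: ler_chain_exp => l; rewrite normrM ler_piMl.
apply: (le_trans (chain_exp_setT n mc _)) => //.
rewrite (chain_exp_marg kn).
- rewrite (@chain_exp_single k setT (fun z => `|V z|))//; apply: ler_sum => z _.
  rewrite -mulrA ler_wpM2l// ler_piMl//.
  have := @probability_le1 _ _ _ P _ (measurableI _ _ measurableT (mAt k z.1)).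
  by rewrite -[X in _ -> is_true X]lee_fin fineK// fin_num_measure//; exact: measurableI.
- by have [F0 FC _] := natural_filtration_sigma Y (k%:R * eps); have := FC _ F0; rewrite setD0.
- by move=> l l' ll'; rewrite ll'.
Qed.

(** The one-step residuals telescope. [V] is taken at the right end of each step because the
    residual compares [W - eps V] one step later with [W] now. *)
Lemma chain_exp_drift n k r C Phi (W V : Z -> R) dl : (k + r <= n)%N -> FY k C ->
  adapted_to k Phi -> (forall l, `|Phi l| <= 1) ->
  (forall i, (forall j, 0 <= Pm i j) -> \sum_a `|\sum_j \sum_b
     Pm i j * pm j b * Rk i j b a * (W (j, b) - eps * V (j, b)) - pm i a * W (i, a)| <= dl) ->
  `|chain_exp n C (fun l => Phi l * W (state_at l (k + r))) -
    chain_exp n C (fun l => Phi l * W (state_at l k)) -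
    eps * \sum_(i < r) chain_exp n C (fun l => Phi l * V (state_at l (k + i.+1)))| <=
  r%:R * dl.
Proof.
move=> + FC aP Phi1 res; elim: r => [|r IH] krn.
  by rewrite addn0 big_ord0 mulr0 subr0 subrr normr0 mul0r.
have {}IH := IH (leq_trans (leq_add (leqnn k) (leqnSn r)) krn).
have aPr : adapted_to (k + r) Phi.
  by move=> l l' h; apply: aP => i ik; apply: h; exact: leq_trans (leq_addr _ _).
have FCr : FY (k + r) C by apply: FYS FC; exact: leq_addr.
have := @chain_exp_residual (k + r) C Phi (fun z => W z - eps * V z) W dl FCr aPr Phi1 res.
rewrite -(@chain_exp_marg (k + r) n) //; last 2 first.
- by apply: leq_trans krn; rewrite leq_add.
- by move=> l l' h; rewrite (aPr l l' h) h.
rewrite -(@chain_exp_marg (k + r).+1 n) //; last 3 first.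
- by rewrite -addnS.
- by apply: FYS FCr.
- move=> l l' h; rewrite h// (aPr l l')// => i ik; apply: h; exact: leqW.
have -> : chain_exp n C (fun l => Phi l * (W (state_at l (k + r).+1) -
      eps * V (state_at l (k + r).+1))) =
   chain_exp n C (fun l => Phi l * W (state_at l (k + r).+1)) -
   eps * chain_exp n C (fun l => Phi l * V (state_at l (k + r).+1)).
  rewrite -mulNr -chain_expZ -chain_expD; apply: eq_chain_exp => l _; ring.
rewrite big_ord_recr /= mulrDr -addnS -natr1 mulrDl mul1r.
move: IH; set a := chain_exp n C (fun l => Phi l * W (state_at l (k + r))).
set S := eps * \sum_i _; set b := chain_exp n C (fun l => Phi l * W (state_at l k)).
set c := chain_exp n C _; set e := eps * _.
rewrite !ler_norml => /andP[h1 h2] /andP[h3 h4].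
by apply/andP; split; rewrite /= in h1 h2 h3 h4 *; lra.
Qed.

Definition chain_pr n (A : seq Z -> set Omega) :=
  lsum n.+1 (fun l => pr (A l `&` hist l) * head_mass l * rw l).

Lemma chain_pr_ge0 n A : 0 <= chain_pr n A.
Proof. by rewrite -(@lsum0 R Z n.+1); apply: ler_lsum => l _; exact: weight_ge0. Qed.

Lemma chain_prU n A B : (forall l, measurable (A l)) -> (forall l, measurable (B l)) ->
  (forall l, A l `&` B l = set0) ->
  chain_pr n (fun l => A l `|` B l) = chain_pr n A + chain_pr n B.
Proof.
move=> mA mB AB; rewrite /chain_pr -lsumD; apply: eq_lsum => l _.
have -> : pr ((A l `|` B l) `&` hist l) = pr (A l `&` hist l) + pr (B l `&` hist l).
  rewrite setIUl measureU; first by rewrite fineD// fin_num_measure//; exact: measurableI.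
  - exact: measurableI.
  - exact: measurableI.
  - by apply/seteqP; split=> // w [[Aw _] [Bw _]]; rewrite -(AB l).
ring.
Qed.

Lemma chain_pr_le n A C : (forall l, measurable (A l)) -> measurable C ->
  (forall l, A l `<=` C) -> chain_pr n A <= pr C.
Proof.
move=> mA mc AC; rewrite -(chain_exp_cst n mc); apply: ler_lsum => l _; rewrite mulr1.
rewrite ler_wpM2r// ler_wpM2r//.
apply: pr_le; [exact: measurableI..|by move=> w [Aw hw]; split=> //; exact: AC Aw].
Qed.

Lemma chain_pr_exp n C (Phi : seq Z -> bool) :
  chain_pr n (fun l => [set w | C w /\ Phi l]) = chain_exp n C (fun l => (Phi l)%:R).
Proof.
apply: eq_lsum => l _; case: (Phi l).
  by rewrite mulr1; congr (pr _ * _ * _); apply/seteqP; split=> w [] => [[]|].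
rewrite mulr0 (_ : _ `&` _ = set0) ?measure0 ?mul0r//.
by apply/seteqP; split=> // w [[]].
Qed.

End chain.

(** * Extension of contents *)

Section continuous_content.
Context {R : realType} {d} {T : algebraOfSetsType d}.
Variable mu : set T -> R.
Hypotheses (mu_ge0 : forall A, measurable A -> 0 <= mu A).
Hypothesis muU : forall A B, measurable A -> measurable B -> A `&` B = set0 ->
  mu (A `|` B) = mu A + mu B.
Hypothesis mu_cvg0 : forall A : nat -> set T, (forall n, measurable (A n)) ->
  (forall n, A n.+1 `<=` A n) -> \bigcap_n A n = set0 ->
  forall e, 0 < e -> exists n, mu (A n) <= e.

(* Extended by 0 because a measure is nonnegative on every set. *)
Definition content_ext (A : set T) : \bar R := (if `[< measurable A >] then mu A else 0)%:E.

Lemma content_extE A : measurable A -> content_ext A = (mu A)%:E.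
Proof. by move=> aA; rewrite /content_ext asboolT. Qed.

Lemma content_ext0 : content_ext set0 = 0%E.
Proof.
rewrite content_extE//; congr EFin.
have := muU measurable0 measurable0 (setI0 set0); rewrite setU0 => h.
by apply: (addrI (mu set0)); rewrite -h addr0.
Qed.

Lemma content_ext_ge0 A : (0 <= content_ext A)%E.
Proof. by rewrite lee_fin; case: asboolP => // /mu_ge0. Qed.

Let alg_bigU (F : nat -> set T) n : (forall i, measurable (F i)) ->
  measurable (\big[setU/set0]_(i < n) F i).
Proof. by move=> aF; apply: bigsetU_measurable => i _; exact: aF. Qed.

Let mu_bigU (F : nat -> set T) n : (forall i, measurable (F i)) -> trivIset setT F ->
  mu (\big[setU/set0]_(i < n) F i) = \sum_(i < n) mu (F i).
Proof.
move=> aF tF; elim: n => [|n IH].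
  by rewrite !big_ord0; have := content_ext0; rewrite content_extE// => -[].
rewrite !big_ord_recr /= muU ?IH//; first exact: alg_bigU.
apply/seteqP; split=> // x [].
rewrite -bigcup_mkord => -[i /= lin Fix Fnx].
have := tF i n I I; move=> /(_ (ex_intro _ x (conj Fix Fnx))) iE.
by rewrite iE ltnn in lin.
Qed.

Lemma content_ext_sigma_additive : semi_sigma_additive content_ext.
Proof.
move=> F aF tF aUF; rewrite (content_extE aUF).
rewrite (_ : (fun n => _) = EFin \o (fun n => \sum_(0 <= i < n) mu (F i))); last first.
  apply/funext => n /=; rewrite -sumEFin; apply: eq_bigr => i _.
  exact: (content_extE (aF i)).
apply: cvg_EFin; first by apply: nearW.
pose D n := (\bigcup_i F i) `\` \big[setU/set0]_(i < n) F i.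
have aD n : measurable (D n) by apply: measurableD => //; exact: alg_bigU.
have muD n : mu (\bigcup_i F i) = \sum_(i < n) mu (F i) + mu (D n).
  rewrite -mu_bigU// -(muU (alg_bigU n aF) (aD n)); last by rewrite /D setIDA setIC setDE -setIA setICr setI0.
  congr mu; rewrite /D; apply/seteqP; split=> x.
    by move=> Ux; have [h|h] := pselect ((\big[setU/set0]_(i < n) F i) x); [left|right].
  by case=> [|[]//]; rewrite -bigcup_mkord => -[i _ Fix]; exists i.
have D0 : \bigcap_n D n = set0.
  apply/seteqP; split=> // x Dx; have [[i _ Fix] _] := Dx 0%N I.
  have [_] := Dx i.+1 I; apply; rewrite -bigcup_mkord; exists i => //=.
have DS n : D n.+1 `<=` D n.
  by move=> x [Ux nx]; split=> // h; apply: nx; rewrite big_ord_recr /=; left.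
have mono n k : (n <= k)%N -> mu (D k) <= mu (D n).
  move=> nk; have := muD k; rewrite (muD n) -(subnKC nk).
  rewrite big_split_ord /= -addrA => /addrI ->.
  by rewrite lerDr sumr_ge0// => i _; apply: mu_ge0; exact: aF.
apply/cvgrPdist_le => e e0.
have [n Dn] := mu_cvg0 aD DS D0 e0.
exists n => //= k /= nk; rewrite big_mkord (muD k) addrC addKr.
by rewrite ger0_norm ?mu_ge0//; exact: le_trans (mono _ _ nk) Dn.
Qed.

End continuous_content.

Section content_probability.
Context {R : realType} {d} {T : measurableType d}.
Variable mu : set T -> R.
Hypotheses (mu_ge0 : forall A, measurable A -> 0 <= mu A) (muT : mu setT = 1).
Hypothesis muU : forall A B, measurable A -> measurable B -> A `&` B = set0 ->
  mu (A `|` B) = mu A + mu B.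
Hypothesis mu_cvg0 : forall A : nat -> set T, (forall n, measurable (A n)) ->
  (forall n, A n.+1 `<=` A n) -> \bigcap_n A n = set0 ->
  forall e, 0 < e -> exists n, mu (A n) <= e.

Definition content_measure := content_ext mu.

HB.instance Definition _ := isMeasure.Build _ T R content_measure
  (content_ext0 muU) (content_ext_ge0 mu_ge0)
  (content_ext_sigma_additive mu_ge0 muU mu_cvg0).

Let content_measureT : content_measure setT = 1%E.
Proof. by rewrite /content_measure content_extE// muT. Qed.

HB.instance Definition _ :=
  Measure_isProbability.Build _ _ _ content_measure content_measureT.

Lemma content_probability :
  exists P : probability T R, forall A, measurable A -> P A = (mu A)%:E.
Proof. by exists content_measure => A mA; exact: content_extE. Qed.

End content_probability.

Section caratheodory.
Context {R : realType} {T : pointedType}.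

(** An alias of [T] whose type carries the algebra, so that the structure of an algebra of sets can
    be declared on it. *)
Definition algebra_space (alg : set (set T)) (alg0 : alg set0)
  (algU : setU_closed alg) (algC : setC_closed alg) : Type := T.

Variables (alg : set (set T)) (alg0 : alg set0) (algU : setU_closed alg)
  (algC : setC_closed alg).

Local Notation AT := (algebra_space alg0 algU algC).

HB.instance Definition _ := Pointed.on AT.

Fact algebra_space_display : measure_display. Proof. exact: default_measure_display. Qed.

HB.instance Definition _ := isAlgebraOfSets.Build algebra_space_display AT alg0 algU algC.

Variable mu : set T -> R.
Hypotheses (mu_ge0 : forall A, alg A -> 0 <= mu A) (muT : mu setT = 1).
Hypothesis muU : forall A B, alg A -> alg B -> A `&` B = set0 ->
  mu (A `|` B) = mu A + mu B.
Hypothesis mu_cvg0 : forall A : nat -> set T, (forall n, alg (A n)) ->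
  (forall n, A n.+1 `<=` A n) -> \bigcap_n A n = set0 ->
  forall e, 0 < e -> exists n, mu (A n) <= e.

Definition premeasure : set AT -> \bar R := @content_ext R _ AT mu.

Let premeasureE A : alg A -> premeasure A = (mu A)%:E.
Proof. exact: (@content_extE R _ AT mu). Qed.

Let premeasure0 : premeasure set0 = 0%E.
Proof. exact: (@content_ext0 R _ AT mu muU). Qed.

Let premeasure_ge0 A : (0 <= premeasure A)%E.
Proof. exact: (@content_ext_ge0 R _ AT mu mu_ge0). Qed.

Let premeasure_sigma_additive : semi_sigma_additive premeasure.
Proof. exact: (@content_ext_sigma_additive R _ AT mu mu_ge0 muU mu_cvg0). Qed.

HB.instance Definition _ := isMeasure.Build _ AT R premeasure
  premeasure0 premeasure_ge0 premeasure_sigma_additive.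

Definition algebra_extension : set (g_sigma_algebraType alg) -> \bar R :=
  measure_extension premeasure.

Let extension0 : algebra_extension set0 = 0%E.
Proof. exact: (measure0 (measure_extension premeasure)). Qed.

Let extension_ge0 A : (0 <= algebra_extension A)%E.
Proof. exact: (measure_ge0 (measure_extension premeasure)). Qed.

Let extension_sigma_additive : semi_sigma_additive algebra_extension.
Proof. exact: (@measure_semi_sigma_additive _ _ _ (measure_extension premeasure)). Qed.

HB.instance Definition _ := isMeasure.Build _ (g_sigma_algebraType alg) R
  algebra_extension extension0 extension_ge0 extension_sigma_additive.

Let extensionE A : alg A -> algebra_extension A = (mu A)%:E.
Proof.
move=> aA; rewrite -premeasureE// /algebra_extension /measure_extension.
by rewrite measurable_mu_extE.
Qed.

Let extensionT : algebra_extension setT = 1%E.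
Proof. by rewrite extensionE ?muT// -setC0; exact: algC. Qed.

HB.instance Definition _ := Measure_isProbability.Build _ _ _ algebra_extension extensionT.

Lemma caratheodory_probability : exists P : probability (g_sigma_algebraType alg) R,
  forall A, alg A -> P A = (mu A)%:E.
Proof. by exists algebra_extension => A aA; exact: extensionE. Qed.

End caratheodory.

Section bit_space.
Context {R : realType} {d} {Omega : measurableType d} {I : choiceType}.
Variable P : probability Omega R.

Local Notation T := (Omega * (I -> bool))%type.

Definition depends_on (s : seq I) (A : set T) := forall w b b',
  {in s, b =1 b'} -> A (w, b) -> A (w, b').

Definition bit_algebra : set (set T) := [set A |
  (forall b, measurable [set w | A (w, b)]) /\ exists s, depends_on s A].

Lemma bit_algebra0 : bit_algebra set0.
Proof.
split; last by exists [::].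
by move=> b; rewrite (_ : [set w | _] = set0)//; apply/seteqP; split.
Qed.

Lemma bit_algebraU : setU_closed bit_algebra.
Proof.
move=> A B [mA [s sA]] [mB [s' sB]]; split.
  by move=> b; have := measurableU _ _ (mA b) (mB b).
exists (s ++ s') => w b b' bb' [Ab|Bb]; [left|right].
  by apply: sA Ab => i is_; apply: bb'; rewrite mem_cat is_.
by apply: sB Bb => i is_; apply: bb'; rewrite mem_cat is_ orbT.
Qed.

Lemma bit_algebraC : setC_closed bit_algebra.
Proof.
move=> A [mA [s sA]]; split; first by move=> b; have := measurableC (mA b).
exists s => w b b' bb' nA Ab'; apply: nA; apply: sA Ab' => i is_.
by rewrite bb'.
Qed.

(** Only the bits in a finite list matter, so the projection is a countable union of sections, one
    for each list of values of these bits. *)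
Lemma bit_algebra_proj A : bit_algebra A -> measurable [set w | exists b, A (w, b)].
Proof.
move=> [mA [s sA]].
pose bm (t : seq bool) := fun i => nth false t (index i s).
rewrite (_ : [set w | _] = \bigcup_(t in [set: seq bool]) [set w | A (w, bm t)]).
  apply: countable_bigcupT_measurable => [|t]; first exact: countableP.
  exact: mA.
apply/seteqP; split=> [w [b Ab]|w [t _ At]]; last by exists (bm t).
exists (map b s) => //=; apply: sA Ab => i is_.
by rewrite /bm (nth_map i) ?index_mem// nth_index.
Qed.

(** If the contents stayed above [e], so would the probabilities of the projections to [Omega], and
    some [w] would lie in all of them. The bits above this [w] range over a compact space: an
    ultrafilter limit of witnesses lies in every [A n], as each depends on finitely many bits.
    Countable additivity is thus drawn from [P] alone, and no tightness in [E] enters. *)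
Lemma bit_algebra_cvg0 (mu : set T -> R) (A : nat -> set T) :
  (forall A C, bit_algebra A -> measurable C -> (forall w b, A (w, b) -> C w) ->
     mu A <= fine (P C)) ->
  (forall n, bit_algebra (A n)) -> (forall n, A n.+1 `<=` A n) ->
  \bigcap_n A n = set0 -> forall e, 0 < e -> exists n, mu (A n) <= e.
Proof.
move=> muP aA AS A0 e e0; apply: contrapT => nA.
have {}nA n : e < mu (A n) by rewrite ltNge; apply/negP => h; apply: nA; exists n.
pose B n := [set w | exists b, A n (w, b)].
have mB n : measurable (B n) by exact: bit_algebra_proj.
have BS n k : (n <= k)%N -> B k `<=` B n.
  move=> nk; rewrite -(subnK nk); elim: (k - n)%N => [//|r IH] w [b Ab].
  by apply: IH; exists b; apply: AS.
have cB : P \o B @ \oo --> P (\bigcap_n B n).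
  apply: nonincreasing_cvg_mu => //.
  - by rewrite ltey_eq fin_num_measure.
  - exact: bigcapT_measurable.
  - by move=> n k nk; apply/subsetPset; exact: BS.
have : (e%:E <= P (\bigcap_n B n))%E.
  have <- := cvg_lim _ cB => //.
  apply: lime_ge; first by apply: cvgP cB.
  apply: nearW => n /=; rewrite -(@fineK _ (P (B n))) ?fin_num_measure// lee_fin.
  apply: (le_trans (ltW (nA n))); apply: muP => //.
  by move=> w b Ab; exists b.
case: (pselect (\bigcap_n B n = set0)) => [->|/eqP/set0P[w Bw] _].
  by rewrite measure0 lee_fin leNgt e0.
have /choice[b Ab] n : exists b, A n (w, b) by exact: Bw.
have [U [UU Uoo]] := ultrafilter_nat.
have FU : ProperFilter U by exact: ultra_proper.
pose bb i := `[< U [set n | b n i] >].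
have bbU i : U [set n | b n i = bb i].
  rewrite /bb; case: asboolP => // nU.
  have [//|] := ultra_dec [set n | b n i]; apply: filterS => n /= bn.
  by apply/negP.
suff : (\bigcap_n A n) (w, bb) by rewrite A0.
move=> n _; have [_ [s sA]] := aA n.
have : U [set k | (n <= k)%N /\ {in s, b k =1 bb}].
  apply: filterI; first by apply: Uoo; exists n.
  elim: s {sA} => [|i s IH]; first by apply: filterE.
  apply: filterS2 (bbU i) IH => k bi bs j; rewrite inE => /predU1P[->//|].
  exact: bs.
case/filter_ex => k [nk bk]; apply: (sA w (b k) bb bk).
have AnS r : A (r + n)%N `<=` A n by elim: r => [//|r IH] x /AS; exact: IH.
by apply: (AnS (k - n)%N); rewrite subnK.
Qed.

End bit_space.

(** * The ultralimit of the coupled chains *)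

Section ticks.
Context {R : realType}.
Implicit Types (s t : R) (n : nat).

Definition tick n : R := (2 ^+ n)^-1.
(** Rounded up: the past of [Y] at [t] is then contained in the past at the grid time, and [Y] at
    the grid times converges to [Y t] by right continuity. *)
Definition time_index n t := `|Num.ceil (t * 2 ^+ n)|%N.

Lemma tick_gt0 n : 0 < tick n.
Proof. by rewrite invr_gt0 exprn_gt0. Qed.

Lemma tick_le1 n : tick n <= 1.
Proof. by rewrite invf_le1 ?exprn_gt0// exprn_ege1// ler1n. Qed.

Lemma tick_small e : 0 < e -> exists n0, forall n, (n0 <= n)%N -> tick n <= e.
Proof.
move=> e0; exists (Num.bound e^-1) => n nb.
rewrite invf_ple ?posrE ?exprn_gt0//.
apply: le_trans (ltW (archi_boundP _)) _; first by rewrite invr_ge0 ltW.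
apply: (@le_trans _ _ n%:R); first by rewrite ler_nat.
by rewrite -natrX ler_nat ltnW// ltn_expl.
Qed.

Lemma time_indexE n t : 0 <= t -> (time_index n t)%:R = (Num.ceil (t * 2 ^+ n))%:~R :> R.
Proof.
move=> t0; rewrite /time_index natr_absz ger0_norm// ceil_ge0//.
by apply: lt_le_trans (mulr_ge0 t0 (exprn_ge0 _ _)).
Qed.

Lemma time_index_ge n t : 0 <= t -> t <= (time_index n t)%:R * tick n.
Proof.
by move=> t0; rewrite time_indexE// ler_pdivlMr ?exprn_gt0//; exact: ceil_ge.
Qed.

Lemma time_index_lt n t : 0 <= t -> (time_index n t)%:R * tick n < t + tick n.
Proof.
move=> t0; rewrite time_indexE// ltr_pdivrMr ?exprn_gt0// mulrDl mulVf ?gt_eqF ?exprn_gt0//.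
by have := ceilB1_lt (t * 2 ^+ n); rewrite intrD ltrBlDr.
Qed.

Lemma time_indexS n s t : 0 <= s -> s <= t -> (time_index n s <= time_index n t)%N.
Proof.
move=> s0 st; rewrite -(@ler_nat R) !time_indexE//; last exact: le_trans st.
by rewrite ler_int le_ceil// ler_wpM2r// exprn_ge0.
Qed.

Lemma time_index_horizon n t : 0 <= t -> t <= n%:R -> (time_index n t <= n * 2 ^ n)%N.
Proof.
move=> t0 tn; rewrite -(@ler_nat R) time_indexE// [leRHS]pmulrn ler_int.
by rewrite ceil_le_int -pmulrn natrM natrX ler_wpM2r// exprn_ge0.
Qed.

End ticks.

(** [G n] collects the disagreements from level [n] on. The intersection is empty, because a
    right-continuous path in a discrete space is constant just after [t]. *)
Lemma state_right_continuous {R : realType} {m : nat} {d} {Omega : measurableType d}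
    (P : probability Omega R) Q p (Y : R -> Omega -> 'I_m.+1) t e :
  markov_chain P Q p Y -> (forall w, cadlag (Y ^~ w)) -> 0 <= t -> 0 < e ->
  exists n0, forall n, (n0 <= n)%N ->
    let D := [set w | Y ((time_index n t)%:R * tick n) w <> Y t w] in
    measurable D /\ fine (P D) <= e.
Proof.
move=> YM Yc t0 e0; pose tn n : R := (time_index n t)%:R * tick n.
pose D n := [set w | Y (tn n) w <> Y t w].
have tn0 n : 0 <= tn n by rewrite mulr_ge0// ltW// tick_gt0.
have mD n : measurable (D n).
  rewrite (_ : D n = \bigcup_(i in [set: 'I_m.+1]) (Y t @^-1` [set i] `\` Y (tn n) @^-1` [set i])).
    apply: countable_bigcupT_measurable => [|i]; first exact: countableP.
    by apply: measurableD; exact: (state_measurable YM).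
  apply/seteqP; split=> [w Dw|w [i _ [/= <-]]//].
  by exists (Y t w).
pose G n := \bigcup_(k in [set k | (n <= k)%N]) D k.
have mG n : measurable (G n) by apply: bigcup_measurable => k _; exact: mD.
have G0 : \bigcap_n G n = set0.
  apply/seteqP; split=> // w Gw; have [Yr _] := Yc w.
  have : \forall s \near t^'+, Y s w = Y t w.
    by apply: (Yr t t0 [set Y t w]).
  case=> del /= del0 h; have del2 : 0 < del / 2 by rewrite divr_gt0.
  have [n0 n0P] := tick_small del2.
  have [k /= n0k] := Gw n0 I; apply.
  have := time_index_ge k t0; rewrite le_eqVlt => /predU1P[tE|tk].
    by rewrite /tn -tE.
  apply: h => //=; rewrite ltr0_norm ?subr_lt0// opprB.
  have := time_index_lt k t0; have := n0P k n0k; rewrite -/(tn k); lra.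
have GS n k : (n <= k)%N -> G k `<=` G n.
  by move=> nk w [l /= kl Dl]; exists l => //=; exact: leq_trans kl.
have cG : P \o G @ \oo --> P (\bigcap_n G n).
  apply: nonincreasing_cvg_mu => //.
  - by rewrite ltey_eq fin_num_measure.
  - exact: bigcapT_measurable.
  - by move=> n k nk; apply/subsetPset; exact: GS.
rewrite G0 measure0 in cG.
have /fine_cvgP[_ /cvgrPdist_le/(_ _ e0)[n0 _ n0P]] := cG.
exists n0 => n n0n; split; first exact: mD.
apply: (@le_trans _ _ (fine (P (G n)))).
  rewrite fine_le ?fin_num_measure//; first exact: mD.
  by apply: le_measure; rewrite ?inE//; [exact: mD|move=> w Dw; exists n => /=].
have := n0P n n0n; rewrite /= sub0r normrN; exact: le_trans (ler_norm _).
Qed.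

Lemma In_nth (T : Type) (x0 : T) (s : seq T) i : (i < size s)%N -> List.In (nth x0 s i) s.
Proof.
elim: s i => [//|x s IH] [|i] /=; first by left.
by rewrite ltnS => /IH; right.
Qed.

Lemma nth_In (T : Type) (x0 x : T) (s : seq T) : List.In x s ->
  exists2 i, (i < size s)%N & nth x0 s i = x.
Proof.
elim: s => [//|y s IH] /= [->|/IH[i is_ ix]]; first by exists 0%N.
by exists i.+1.
Qed.

Lemma In_flatten_map (A B : Type) (f : A -> seq B) (s : seq A) (y : B) :
  List.In y (flatten [seq f x | x <- s]) <-> exists x, List.In x s /\ List.In y (f x).
Proof.
elim: s => [|a s IH] /=; first by split=> // -[x []].
have catP (u v : seq B) : List.In y (u ++ v) <-> List.In y u \/ List.In y v.
  by elim: u => [|b u IHu] /=; [split=> [|[]//]; right|rewrite IHu; tauto].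
rewrite catP IH; split=> [[h|[x [h1 h2]]]|[x [[->|h1] h2]]].
- by exists a; split=> //; left.
- by exists x; split=> //; right.
- by left.
- by right; exists x.
Qed.

Section coupled_chains.
Context {R : realType} {E : ptopologicalType} {m : nat}.
Variables (A : operator (R := R) E) (q : 'I_m.+1 -> 'I_m.+1 -> E -> R).
Hypothesis A_bounded : forall f g, A (f, g) ->
  bounded_continuous f /\ bounded_continuous g.
Hypothesis A_mul : forall f1 f2, domain A f1 -> domain A f2 ->
  domain A (fun x => f1 x * f2 x).
Variables (mu : nat -> E -> probability (borel E) R) (lam : nat -> E -> R).
Hypothesis lam_ge0 : forall n x, 0 <= lam n x.
Hypothesis A_lim : forall f g, A (f, g) -> forall x,
  lam n x * (\int[mu n x]_y (f y - f x)) @[n --> \oo] --> g x.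
Hypothesis q_ge0 : forall i j x, i != j -> 0 <= q i j x.
Variables (Q : 'M[R]_m.+1) (pi : 'I_m.+1 -> probability (borel E) R).
Hypothesis Q_row : forall i, \sum_j Q i j = 0.
Hypothesis pi_A : forall i f g, A (f, g) ->
  \int[pi i]_x g x = \sum_j Q i j * \int[pi j]_x f x.
Hypothesis q_int : forall i j, i != j -> (pi i).-integrable setT (EFin \o q i j).
Hypothesis pi_q : forall i j f, i != j -> bounded_continuous f ->
  \int[pi i]_x (q i j x * f x) = Q i j * \int[pi j]_x f x.

Local Notation J := (jump q).
Local Notation integrable i f := ((pi i).-integrable setT (EFin \o f)).
Local Notation vfun := ('I_m.+1 -> E -> R).

(** One approximation: time step [2 ^- c_level], a partition of [E] indexed by ['I_c_size], and
    backward kernels whose arguments are the state now, the state later, the cell later and the cell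
    now. *)
Record coupling := Coupling {
  c_level : nat;
  c_size : nat;
  c_map : E -> 'I_c_size;
  c_rep : 'I_c_size -> E;
  c_kernel : 'I_m.+1 -> 'I_m.+1 -> 'I_c_size -> 'I_c_size -> R }.

Local Notation c_cell o := 'I_(c_size o).

Local Notation eps o := (@tick R (c_level o)).
Local Notation Pm o := (transition Q (eps o)).

Definition c_mass o j := cell_mass (pi j) (@c_map o).
Definition c_avg o (w : vfun) (z : 'I_m.+1 * c_cell o) :=
  cell_avg (pi z.1) (@c_map o) (@c_rep o) (w z.1) z.2.

(** By [transition_ge0] this holds at every state that the chain charges; the marginal and residual
    conditions on the kernels are imposed only there. *)
Definition good o i := forall j, 0 <= Pm o i j.

Definition valid o := [/\
  forall a, measurable (@c_map o @^-1` [set a] : set (borel E)),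
  forall x, @c_map o (c_rep (@c_map o x)) = @c_map o x,
  forall i j b a, 0 <= @c_kernel o i j b a,
  forall i j b, \sum_a @c_kernel o i j b a = 1 &
  forall i, good o i -> forall a,
    \sum_j \sum_b Pm o i j * @c_mass o j b * @c_kernel o i j b a = @c_mass o i a].

(** Finitely many demands: a minimal level, an accuracy, sets that must be unions of cells, and
    functions whose one-step residual must be small. Two requirements have a common strengthening,
    so they direct the couplings; a sequence would not serve all Borel sets and all functions at
    once. *)
Record requirement := Requirement {
  r_level : nat;
  r_acc : R;
  r_sets : seq (set E);
  r_funs : seq (vfun * vfun) }.

Definition admissible r := [/\ 0 < r_acc r,
  forall B, List.In B (r_sets r) -> measurable (B : set (borel E)) &
  forall w, List.In w (r_funs r) -> jspan A w.1 w.2].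

Definition meets (r : requirement) o := [/\ valid o, (r_level r <= c_level o)%N,
  forall x y, @c_map o x = @c_map o y -> forall B, List.In B (r_sets r) -> (B x <-> B y) &
  forall w, List.In w (r_funs r) -> forall i, good o i ->
    \sum_a `|\sum_j \sum_b Pm o i j * @c_mass o j b * @c_kernel o i j b a *
        (@c_avg o w.1 (j, b) - eps o * @c_avg o (J w.1 w.2) (j, b)) -
      @c_mass o i a * @c_avg o w.1 (i, a)| <= r_acc r * eps o].

Let iJ (w gw : vfun) j : jspan A w gw -> integrable j (J w gw j).
Proof. by move=> wg; have [] := jump_pi A_bounded Q_row pi_A q_int pi_q j wg. Qed.

Let iw (w gw : vfun) j k : jspan A w gw -> integrable k (w j).
Proof. exact: (jspan_integrable A_bounded). Qed.

Lemma coupling_exists r : admissible r -> exists o, meets r o.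
Proof.
(* The zero pair is appended because [one_step] indexes its test functions by a nonempty ordinal. *)
move=> [acc0 mB wg]; pose d : vfun * vfun := (fun _ => cst 0, fun _ => cst 0).
pose ws := rcons (r_funs r) d; pose N := size (r_funs r).
pose w (l : 'I_N.+1) := (nth d ws l).1; pose gw (l : 'I_N.+1) := (nth d ws l).2.
have wgl l : jspan A (w l) (gw l).
  rewrite /w /gw /ws nth_rcons; case: ltnP => h; first by apply: wg; exact: In_nth.
  by case: eqP => _ j; exact: span_cst.
have /choice[M MP] l : exists M, 0 < M /\ forall j x, `|w l j x| <= M.
  by have [M M0 wM] := jspan_bound A_bounded (wgl l); exists M.
pose Mt := \sum_l M l.
have M0 : 0 <= Mt by apply: sumr_ge0 => l _; rewrite ltW ?(MP l).1.
have wM j x : \sum_l `|w l j x| <= Mt by apply: ler_sum => l _; exact: (MP l).2.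
have [C0 C00 C0P] := transition_small Q.
(* With averaging error [e ^+ 2] the residual given by [one_step] is [K * e ^+ 2]; the level is
   chosen so that [e * K] is at most the accuracy. *)
pose K := 2 + defect_cst Q C0 * Mt.
have K0 : 0 < K by rewrite ltr_pwDl// mulr_ge0// defect_cst_ge0.
have [n0 n0P] := tick_small (divr_gt0 acc0 K0).
pose n := maxn (r_level r) n0; pose e : R := tick n.
have e0 : 0 < e by exact: tick_gt0.
have eK : e * K <= r_acc r by rewrite -ler_pdivlMr//; apply: n0P; exact: leq_maxr.
pose U l j x := w l j x - e * J (w l) (gw l) j x.
have iU l j : integrable j (U l j).
  have iJ' : integrable j (fun x => e * J (w l) (gw l) j x).
    have := integrableZl measurableT e (iJ j (wgl l)); exact: (eq_integrable measurableT).
  by have := integrableB measurableT (iw j j (wgl l)) iJ'; apply: (eq_integrable measurableT).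
(* Doubled by [cell_avg_L1], averaged over the row and summed over the [N.+1] functions, this yields
   [e ^+ 2]. *)
have L0 : 0 < e ^+ 2 / (2 * N.+1%:R) by rewrite divr_gt0// ?exprn_gt0// mulr_gt0.
have /choice[F FP] (lj : 'I_N.+1 * 'I_m.+1) : exists Bs, exists s,
   [/\ forall B, List.In B Bs -> measurable (B : set (borel E)),
        forall x y, same_side Bs x y -> s x = s y,
        (pi lj.2).-integrable setT (EFin \o s) &
        \int[pi lj.2]_x `|U lj.1 lj.2 x - s x| <= e ^+ 2 / (2 * N.+1%:R)].
  by have [Bs [s]] := L1_sets (iU lj.1 lj.2) L0; exists Bs, s.
pose Bs := flatten [:: r_sets r; flatten [seq F lj | lj <- enum {: 'I_N.+1 * 'I_m.+1}]].
have BsE B : List.In B Bs <-> List.In B (r_sets r) \/ exists lj, List.In B (F lj).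
  have -> : Bs = flatten [seq f | f <- [:: r_sets r;
    flatten [seq F lj | lj <- enum {: 'I_N.+1 * 'I_m.+1}]]] by rewrite map_id.
  rewrite In_flatten_map /=; split.
    move=> [x [[<-|[<-|//]]]]; first by left.
    by rewrite In_flatten_map => -[lj [_ h]]; right; exists lj.
  move=> [h|[lj h]]; first by exists (r_sets r); split=> //; left.
  eexists; split; first by right; left; reflexivity.
  by apply/In_flatten_map; exists lj; split=> //; apply/InP; rewrite mem_enum.
have [B|J0 [c0 [rep0 [mc0 rep_c0 cB0]]]] := @signature_cells _ (borel E) point Bs.
  by move/BsE => [/mB//|[lj]]; have [s [h _ _ _]] := FP lj; exact: h.
pose T := 'I_#|J0|; pose c x : T := enum_rank (c0 x); pose rep (a : T) := rep0 (enum_val a).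
have mc a : measurable (c @^-1` [set a] : set (borel E)).
  rewrite (_ : _ @^-1` _ = c0 @^-1` [set enum_val a])//.
  apply/seteqP; split=> x /=; first by move=> <-; rewrite /c enum_rankK.
  by move=> c0a; rewrite /c c0a enum_valK.
have rep_c x : c (rep (c x)) = c x by rewrite /c /rep enum_rankK rep_c0.
have cB (x y : borel E) : c x = c y -> forall B, List.In B Bs -> (B x <-> B y).
  by move=> cxy; exact: (cB0 x y (enum_rank_inj cxy)).
pose avg j f a := cell_avg (pi j) c rep f a.
have UD i : \sum_l \sum_j transition Q e i j *
    \int[pi j]_x `|U l j x - avg j (U l j) (c x)| <= e ^+ 2 \/ ~ (forall j, 0 <= transition Q e i j).
  have [g|] := pselect (forall j, 0 <= transition Q e i j); [left|by right].
  apply: (@le_trans _ _ (\sum_(l < N.+1) \sum_j transition Q e i j * (e ^+ 2 / N.+1%:R))).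
    apply: ler_sum => l _; apply: ler_sum => j _; apply: ler_wpM2l => //.
    have [s [_ sc is_ sL]] := FP (l, j).
    have := cell_avg_L1 mc rep_c (iU l j) is_.
    move=> /(_ _)/le_trans; apply.
      move=> x y cxy; have h := cB x y cxy; apply: sc => B BF; apply: h.
      by apply/BsE; right; exists (l, j).
    apply: le_trans (ler_wpM2l _ sL) _ => //.
    by rewrite invfM mulrCA (mulrA 2) divff ?mul1r.
  under eq_bigr do rewrite -mulr_suml transition_row// mul1r.
  by rewrite sumr_const card_ord -(mulr_natl (e ^+ 2 / _)) mulrCA divff ?mulr1.
have /choice[k kP] i : exists k : 'I_m.+1 -> T -> T -> R,
   [/\ forall j b a, 0 <= k j b a, forall j b, \sum_a k j b a = 1 &
     (forall j, 0 <= transition Q e i j) ->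
      (forall a, \sum_j \sum_b transition Q e i j * cell_mass (pi j) c b * k j b a =
         cell_mass (pi i) c a) /\
      forall l, \sum_a `|\sum_j \sum_b transition Q e i j * cell_mass (pi j) c b *
            k j b a * avg j (U l j) b - cell_mass (pi i) c a * avg i (w l i) a| <=
          2 * e ^+ 2 + defect_cst Q C0 * Mt * e ^+ 2].
  have [g|ng] := pselect (forall j, 0 <= transition Q e i j).
    have [UDi|//] := UD i.
    have [k [k1 k2 k3 k4]] := one_step A_bounded A_mul lam_ge0 A_lim q_ge0 Q_row
      pi_A q_int pi_q g (transition_row e i Q_row) (ltW e0) (tick_le1 n) C00
      (fun j => C0P e i j (ltW e0) (tick_le1 n)) mc wgl M0 (exprn_ge0 2 (ltW e0)) wM UDi.
    by exists k; split=> // _; split.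
  (* A row with a negative entry is subject to no marginal condition; any stochastic kernel will
     do. *)
  exists (fun _ b a => (a == b)%:R); split=> //.
  by move=> _ b; rewrite (bigD1 b)//= eqxx big1 ?addr0// => a /negbTE ->.
exists (@Coupling n #|J0| c rep k); split.
- split=> //=.
  + by move=> i; have [] := kP i.
  + by move=> i; have [] := kP i.
  + by move=> i g a; have [_ _ /(_ g)[]] := kP i.
- exact: leq_maxl.
- by move=> x y cxy B BF; apply: (cB x y cxy); apply/BsE; left.
- move=> u uin i g; have [l0 l0N lu] := nth_In d uin.
  have [_ _ /(_ g)[_ kl]] := kP i.
  have l0N1 : (l0 < N.+1)%N by exact: ltnW.
  have lE : nth d ws (Ordinal l0N1) = u by rewrite /ws nth_rcons l0N.
  have := kl (Ordinal l0N1); rewrite /w /gw lE => klu.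
  have wgu := wg _ uin.
  rewrite [leLHS](_ : _ = \sum_a `|\sum_j \sum_b transition Q e i j *
      cell_mass (pi j) c b * k i j b a * avg j (U (Ordinal l0N1) j) b -
      cell_mass (pi i) c a * avg i (u.1 i) a|).
    apply: le_trans klu _; rewrite -/e in eK *.
    apply: (@le_trans _ _ (e * K * e)); last by rewrite ler_wpM2r // ltW.
    by rewrite le_eqVlt; apply/orP; left; apply/eqP; rewrite /K; ring.
  apply: eq_bigr => a _; congr (`| _ - _ |).
  apply: eq_bigr => j _; apply: eq_bigr => b _; congr (_ * _).
  rewrite /c_avg /= /avg /U /w /gw lE -mulNr -cell_avgZ; last exact: iJ.
  rewrite -cell_avgD//; last 2 first.
  + exact: iw wgu.
  + by have := integrableZl measurableT (- e) (iJ j wgu); apply: (eq_integrable measurableT).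
  by congr cell_avg; apply/funext => x; rewrite mulNr.
  exact: mc.
Qed.

Definition meet_req r r' := Requirement (maxn (r_level r) (r_level r'))
  (Num.min (r_acc r) (r_acc r')) (r_sets r ++ r_sets r') (r_funs r ++ r_funs r').

Let In_cat (X : Type) (x : X) s s' : List.In x (s ++ s') <-> List.In x s \/ List.In x s'.
Proof. by elim: s => [|b u IHu] /=; [split=> [|[]//]; right|rewrite IHu; tauto]. Qed.

Lemma meet_req_admissible r r' : admissible r -> admissible r' -> admissible (meet_req r r').
Proof.
move=> [a0 mB wg] [a0' mB' wg']; split=> /=.
- by rewrite lt_min a0.
- by move=> B /In_cat[/mB|/mB'].
- by move=> w /In_cat[/wg|/wg'].
Qed.

Lemma meets_meet_req r r' o : meets (meet_req r r') o -> meets r o /\ meets r' o.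
Proof.
have eps0 : 0 <= eps o by apply: ltW; exact: tick_gt0.
move=> [vo /=]; rewrite geq_max => /andP[l1 l2] s f; split; split=> //.
- by move=> x y cxy B BF; apply: (s x y cxy); apply/In_cat; left.
- move=> w wi i g; apply: le_trans (f w _ i g) _; first by apply/In_cat; left.
  by rewrite ler_wpM2r// ge_min lexx.
- by move=> x y cxy B BF; apply: (s x y cxy); apply/In_cat; right.
- move=> w wi i g; apply: le_trans (f w _ i g) _; first by apply/In_cat; right.
  by rewrite ler_wpM2r// ge_min lexx orbT.
Qed.

Lemma ultra_coupling : exists U : set_system coupling, UltraFilter U /\
  forall r, admissible r -> U [set o | meets r o].
Proof.
pose F : set_system coupling := [set S | exists r, admissible r /\ [set o | meets r o] `<=` S].
have FF : ProperFilter F.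
  split.
    move=> [r [ar]]; have [c cm] := coupling_exists ar; move=> /(_ c cm) //.
  split.
  - exists (Requirement 0 1 [::] [::]); split=> //.
  - move=> S S' [r [ar rS]] [r' [ar' rS']]; exists (meet_req r r'); split.
      exact: meet_req_admissible.
    by move=> o /meets_meet_req[/rS ? /rS' ?].
  - by move=> S S' SS' [r [ar rS]]; exists r; split=> //; exact: subset_trans rS SS'.
have [U [UU FU]] := @ultraFilterLemma _ F FF.
by exists U; split=> // r ar; apply: FU; exists r; split.
Qed.

Definition norm1 (f : vfun) := \sum_j \int[pi j]_x `|f j x|.

Section one_coupling.
Variable o : coupling.
Hypothesis o_valid : valid o.

Let mass_ge0 j a : 0 <= @c_mass o j a. Proof. exact: cell_mass_ge0. Qed.

Lemma c_mass1 j : \sum_a @c_mass o j a = 1.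
Proof.
have [mc _ _ _ _] := o_valid.
transitivity (\sum_a cell_int (pi j) (@c_map o) (cst 1) a).
  by apply: eq_bigr => a _; rewrite cell_int_cst ?mul1r.
rewrite cell_int_sum//; first exact: probability_Rintegral_cst.
exact: (@bounded_integrable _ _ _ (pi j) _ `|1|).
Qed.

Lemma c_avgB (f g : vfun) z : (forall j, integrable j (f j)) -> (forall j, integrable j (g j)) ->
  @c_avg o (fun j x => f j x - g j x) z = @c_avg o f z - @c_avg o g z.
Proof.
have [mc _ _ _ _] := o_valid; move=> fi gi.
rewrite /c_avg -mulN1r -cell_avgZ// -cell_avgD//; last first.
  by have := integrableZl measurableT (-1) (gi z.1); apply: (eq_integrable measurableT).
by congr cell_avg; apply/funext => x; rewrite mulN1r.
Qed.

Lemma c_avg_norm1 (f : vfun) : (forall j, integrable j (f j)) ->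
  \sum_z @c_mass o z.1 z.2 * `|@c_avg o f z| <= norm1 f.
Proof.
have [mc _ _ _ _] := o_valid; move=> fi.
have -> : \sum_z @c_mass o z.1 z.2 * `|@c_avg o f z| =
    \sum_j \sum_a @c_mass o j a * `|@c_avg o f (j, a)|.
  by rewrite pair_bigA; apply: eq_bigr => -[].
apply: ler_sum => j _; have fni : integrable j (fun x => `|f j x|).
  by have := integrable_norm (fi j); apply: (eq_integrable measurableT).
rewrite -(cell_int_sum mc fni); apply: ler_sum => a _.
have <- : @c_mass o j a * cell_avg (pi j) (@c_map o) (@c_rep o) (fun x => `|f j x|) a =
    cell_int (pi j) (@c_map o) (fun x => `|f j x|) a by exact: cell_mass_avg.
by rewrite ler_wpM2l// cell_avg_norm.
Qed.

Context {d : measure_display} {Omega : measurableType d}.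
Variables (P : probability Omega R) (p : 'I_m.+1 -> R) (Y : R -> Omega -> 'I_m.+1).
Hypothesis Y_markov : markov_chain P Q p Y.

(** The default of [nth], not read at times within the horizon. *)
Definition c_origin : 'I_m.+1 * c_cell o := (ord0, @c_map o point).

(** [c_level o] units of time in steps of [2 ^- c_level o]: the horizon grows with the level and
    passes every fixed time. *)
Definition c_horizon := (c_level o * 2 ^ c_level o)%N.

Definition c_exp (C : set Omega) (Phi : seq ('I_m.+1 * c_cell o) -> R) :=
  chain_exp P Y (eps o) (@c_mass o) (@c_kernel o) c_horizon C Phi.

Let eps0 : 0 <= eps o. Proof. by apply: ltW; exact: tick_gt0. Qed.

Let rkh : [/\ forall i j b a, 0 <= @c_kernel o i j b a,
  forall i j b, \sum_a @c_kernel o i j b a = 1 &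
  forall i, good o i -> forall a,
    \sum_j \sum_b Pm o i j * @c_mass o j b * @c_kernel o i j b a = @c_mass o i a].
Proof. by have [_ _ ? ? ?] := o_valid. Qed.

Section drift.
Variables (k : nat) (C : set Omega) (Phi : seq ('I_m.+1 * c_cell o) -> R).
Hypotheses (FC : natural_filtration Y (k%:R * eps o) C)
  (aP : adapted_to c_origin k Phi) (Phi1 : forall l, `|Phi l| <= 1).
Variable acc : R.
Hypothesis acc0 : 0 <= acc.
Local Notation ev f r :=
  (c_exp C (fun l => Phi l * @c_avg o f (state_at c_origin l (k + r)))).

Definition small_residual (w gw : vfun) := forall i, good o i ->
    \sum_a `|\sum_j \sum_b Pm o i j * @c_mass o j b * @c_kernel o i j b a *
        (@c_avg o w (j, b) - eps o * @c_avg o (J w gw) (j, b)) -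
      @c_mass o i a * @c_avg o w (i, a)| <= acc * eps o.

Let mC : measurable C. Proof. exact: (natural_filtration_measurable Y_markov) FC. Qed.

Let evB (f g : vfun) r : (forall j, integrable j (f j)) -> (forall j, integrable j (g j)) ->
  ev (fun j x => f j x - g j x) r = ev f r - ev g r.
Proof.
move=> fi gi; rewrite -mulN1r /c_exp -chain_expZ -chain_expD.
by apply: eq_chain_exp => l _; rewrite c_avgB//; ring.
Qed.

Let ev_le (f : vfun) r : (forall j, integrable j (f j)) -> (k + r <= c_horizon)%N ->
  `|ev f r| <= norm1 f.
Proof.
move=> fi kr; have [h1 h2 h3] := rkh.
exact: le_trans (chain_exp_mass Y_markov eps0 c_origin mass_ge0 h1 h2 h3
  (@c_avg o f) kr mC Phi1) (c_avg_norm1 fi).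
Qed.

Let drift (w gw : vfun) r : small_residual w gw -> (k + r <= c_horizon)%N ->
  `|ev w r - ev w 0 - eps o * \sum_(i < r) ev (J w gw) i.+1| <= r%:R * (acc * eps o).
Proof.
move=> res kr; have [h1 h2 h3] := rkh; rewrite addn0.
exact: (chain_exp_drift Y_markov eps0 h1 h2 h3 (W := @c_avg o w)
  (V := @c_avg o (J w gw)) kr FC aP Phi1 res).
Qed.

Lemma coupling_drift1 (w gw : vfun) r : jspan A w gw -> small_residual w gw ->
  (k + r <= c_horizon)%N ->
  `|ev w r - ev w 0| <= r%:R * eps o * (norm1 (J w gw) + acc).
Proof.
move=> wg res kr; have := drift res kr.
have : `|eps o * \sum_(i < r) ev (J w gw) i.+1| <= r%:R * eps o * norm1 (J w gw).
  rewrite normrM (ger0_norm eps0) [r%:R * _]mulrC -mulrA ler_wpM2l//.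
  apply: (le_trans (ler_norm_sum _ _ _)).
  apply: (@le_trans _ _ (\sum_(i < r) norm1 (J w gw))).
    apply: ler_sum => i _; apply: ev_le => [j|]; first exact: iJ.
    by apply: leq_trans kr; rewrite leq_add2l.
  by rewrite sumr_const card_ord mulr_natl.
have -> : r%:R * eps o * (norm1 (J w gw) + acc) =
  r%:R * eps o * norm1 (J w gw) + r%:R * (acc * eps o) by ring.
have tri : forall a b c x y : R, `|c| <= x -> `|a - b - c| <= y -> `|a - b| <= x + y.
  by move=> a b c x y; rewrite !ler_norml => /andP[? ?] /andP[? ?]; apply/andP; split; lra.
exact: tri.
Qed.

(** [J w gw] need not be bounded nor in the span, so its motion in time cannot be estimated
    directly. It is compared with a span element [G], whose motion is bounded by [coupling_drift1];
    this reduces the Riemann sum to its initial value. *)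
Lemma coupling_drift2 (w gw G gG : vfun) r : jspan A w gw -> small_residual w gw ->
  jspan A G gG -> small_residual G gG -> (k + r <= c_horizon)%N ->
  `|ev w r - ev w 0 - r%:R * eps o * ev G 0| <=
  r%:R * eps o * (norm1 (fun j x => J w gw j x - G j x) +
    r%:R * eps o * (norm1 (J G gG) + acc) + acc).
Proof.
move=> wg wres Gg Gres kr; have := drift wres kr.
set L := r%:R * eps o * (norm1 (J G gG) + acc).
set kap := norm1 (fun j x => J w gw j x - G j x).
have acc' : 0 <= norm1 (J G gG) + acc.
  by rewrite addr_ge0// sumr_ge0// => j _; apply: Rintegral_ge0.
have : `|eps o * \sum_(i < r) ev (J w gw) i.+1 - r%:R * eps o * ev G 0| <=
    r%:R * eps o * (kap + L).
  have -> : eps o * \sum_(i < r) ev (J w gw) i.+1 - r%:R * eps o * ev G 0 =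
      eps o * \sum_(i < r) (ev (J w gw) i.+1 - ev G 0).
    rewrite sumrB mulrBr sumr_const card_ord -[ev G 0 *+ r]mulr_natl.
    by congr (_ - _); ring.
  rewrite normrM (ger0_norm eps0) [r%:R * _]mulrC -mulrA ler_wpM2l//.
  apply: (le_trans (ler_norm_sum _ _ _)).
  apply: (@le_trans _ _ (\sum_(i < r) (kap + L))).
    apply: ler_sum => i _.
    have ki : (k + i.+1 <= c_horizon)%N by apply: leq_trans kr; rewrite leq_add2l.
    have h1 := coupling_drift1 Gg Gres ki.
    have Gi j : integrable j (G j) by exact: iw Gg.
    have Ji j : integrable j (J w gw j) by exact: iJ.
    have h2 : `|ev (J w gw) i.+1 - ev G i.+1| <= kap.
      rewrite -evB//; apply: ev_le => // j.
      by have := integrableB measurableT (Ji j) (Gi j); apply: (eq_integrable measurableT).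
    have h3 : i.+1%:R * eps o * (norm1 (J G gG) + acc) <= L.
      rewrite ler_wpM2r// ler_wpM2r// ler_nat; exact: ltn_ord.
    move: h1 h2 h3; set a := ev (J w gw) i.+1; set b := ev G i.+1; set c := ev G 0.
    by rewrite !ler_norml => /andP[? ?] /andP[? ?] ?; apply/andP; split; lra.
  by rewrite sumr_const card_ord mulr_natl.
have -> : r%:R * eps o * (kap + L + acc) = r%:R * eps o * (kap + L) + r%:R * (acc * eps o) by ring.
have tri : forall a b c z x y : R, `|c - z| <= x -> `|a - b - c| <= y -> `|a - b - z| <= x + y.
  by move=> a b c z x y; rewrite !ler_norml => /andP[? ?] /andP[? ?]; apply/andP; split; lra.
exact: tri.
Qed.

End drift.

End one_coupling.

Section limit.
Context {d : measure_display} {Omega : measurableType d}.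
Variables (P : probability Omega R) (p : 'I_m.+1 -> R) (Y : R -> Omega -> 'I_m.+1).
Hypothesis Y_markov : markov_chain P Q p Y.
Hypothesis Y_cadlag : forall w, cadlag (Y ^~ w).
Variable U : set_system coupling.
Hypotheses (UU : UltraFilter U) (U_meets : forall r, admissible r -> U [set o | meets r o]).

Local Notation bit := (R * set E)%type.
Local Notation path := (Omega * (bit -> bool))%type.
Local Notation cexp o := (@c_exp o _ _ P Y).
Local Notation pr C := (fine (P C)).
Local Notation idx o t := (@time_index R (c_level o) t).

Let FU : ProperFilter U. Proof. exact: ultra_proper. Qed.

(** The set is tested on the representative of the cell, which decides for the whole cell once the
    set is a union of cells. *)
Definition c_bits o (l : seq ('I_m.+1 * c_cell o)) (tB : bit) : bool :=
  `[< tB.2 (c_rep (state_at (c_origin o) l (idx o tB.1)).2) >].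

Definition c_test o (rects : seq bit) (l : seq ('I_m.+1 * c_cell o)) : R :=
  (all (@c_bits o l) rects)%:R.

Definition c_pr o (A : set path) := chain_pr P Y (eps o) (@c_mass o) (@c_kernel o)
  (c_horizon o) (fun l => [set w | A (w, @c_bits o l)]).

Definition bit_event (C : set Omega) (rects : seq bit) : set path :=
  [set z : path | C z.1 /\ all z.2 rects].

Definition ulim (f : coupling -> R) : R := lim (f @ U).

Let ulim_cvg f M : U [set o | `|f o| <= M] -> f @ U --> ulim f.
Proof.
move=> fM; have [c|l gl] := @ultra_cvg _ _ U UU (fun o => if `|f o| <= M then f o else 0) `|M|.
  case: ifP => [h|_]; first exact: le_trans h (ler_norm _).
  by rewrite normr0.
suff fl : f @ U --> l by exact: (cvgP l fl).
apply: cvg_trans gl; apply: near_eq_cvg; apply: filterS fM => o /= -> //.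
Qed.

Let U_valid n0 : U [set o | valid o /\ (n0 <= c_level o)%N].
Proof.
have ar : admissible (Requirement n0 1 [::] [::]) by split.
by apply: filterS (U_meets ar) => o [].
Qed.

Let U_time (t : R) : U [set o | valid o /\ (t <= (c_level o)%:R)].
Proof.
apply: filterS (U_valid (Num.bound `|t|)) => o /= [vo no]; split=> //.
apply: (le_trans (ler_norm t)); apply: (le_trans (ltW (archi_boundP (normr_ge0 t)))).
by rewrite ler_nat.
Qed.

Let span_cvg s t : 0 <= s -> s <= t ->
  (fun o => (idx o t - idx o s)%:R * eps o) @ U --> t - s.
Proof.
move=> s0 st; apply/cvgrPdist_le => e e0; have [n0 n0P] := tick_small e0.
apply: filterS (U_valid n0) => o /= [_ no]; apply: le_trans (n0P _ no).
have t0 := le_trans s0 st.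
rewrite natrB ?time_indexS// mulrBl.
have := time_index_ge (c_level o) s0; have := time_index_lt (c_level o) s0.
have := time_index_ge (c_level o) t0; have := time_index_lt (c_level o) t0.
by rewrite ler_norml => *; apply/andP; split; lra.
Qed.

Let pD o t := pr [set w | Y ((idx o t)%:R * eps o) w <> Y t w].

Let pD_cvg t : 0 <= t -> (fun o => pD o t) @ U --> (0 : R).
Proof.
move=> t0; apply/cvgrPdist_le => e e0.
have [n0 n0P] := state_right_continuous Y_markov Y_cadlag t0 e0.
apply: filterS (U_valid n0) => o /= [_ no]; rewrite sub0r normrN ger0_norm.
  by have [] := n0P _ no.
exact: fine_ge0.
Qed.

Let mD o t : 0 <= t -> measurable [set w | Y ((idx o t)%:R * eps o) w <> Y t w].
Proof.
move=> t0; rewrite (_ : [set w | _] = \bigcup_(i in [set: 'I_m.+1])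
   (Y t @^-1` [set i] `\` Y ((idx o t)%:R * eps o) @^-1` [set i])).
  apply: countable_bigcupT_measurable => [|i]; first exact: countableP.
  apply: measurableD; apply: (state_measurable Y_markov) => //.
  by rewrite mulr_ge0// ltW// tick_gt0.
apply/seteqP; split=> [w Dw|w [i _ [/= <-]]//].
by exists (Y t w).
Qed.

Section at_coupling.
Variable o : coupling.
Hypothesis o_valid : valid o.

Let eps0 : 0 <= eps o. Proof. by apply: ltW; exact: tick_gt0. Qed.

Let mass_ge0 j a : 0 <= @c_mass o j a. Proof. exact: cell_mass_ge0. Qed.

Let mass1 j : \sum_a @c_mass o j a = 1. Proof. exact: c_mass1. Qed.

Let test1 rects l : `|@c_test o rects l| <= 1.
Proof. by rewrite /c_test; case: all; rewrite ?normr1 ?normr0. Qed.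

Lemma c_pr_event C rects : c_pr o (bit_event C rects) = cexp o C (@c_test o rects).
Proof.
by rewrite /c_pr /c_exp /c_test -(chain_pr_exp P Y (eps o) (@c_mass o)).
Qed.

Lemma c_test_adapted s rects : (forall tB, tB \in rects -> 0 <= tB.1 /\ tB.1 <= s) ->
  adapted_to (c_origin o) (idx o s) (@c_test o rects).
Proof.
move=> h l l' ll'; rewrite /c_test; congr (nat_of_bool _)%:R.
apply: eq_in_all => tB /h[t0 ts]; rewrite /c_bits; congr (`[< tB.2 (c_rep (_ : _ * _).2) >]).
by apply: ll'; exact: time_indexS.
Qed.

(** Exchanges the true state at [t] for the state on the list, which is that of the grid time; they
    differ on an event whose probability vanishes in the limit. *)
Lemma cexp_diff C j t Phi : measurable C -> 0 <= t -> t <= (c_level o)%:R ->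
  (forall l, `|Phi l| <= 1) ->
  `|cexp o (C `&` Y t @^-1` [set j]) Phi -
    cexp o C (fun l => ((state_at (c_origin o) l (idx o t)).1 == j)%:R * Phi l)| <=
  2 * pD o t.
Proof.
move=> mC t0 tl Phi1; have [_ _ h1 h2 _] := o_valid.
have tk0 : 0 <= (idx o t)%:R * eps o by rewrite mulr_ge0.
rewrite /c_exp -chain_exp_state; last exact: time_index_horizon.
apply: (chain_exp_diff Y_markov eps0 (c_origin o) mass_ge0 mass1 h1 h2) => //.
- by apply: measurableI => //; exact: (state_measurable Y_markov).
- by apply: measurableI => //; exact: (state_measurable Y_markov).
- exact: mD.
- move=> w /= nD; have {nD} -> : Y ((idx o t)%:R * eps o) w = Y t w by exact: contrapT.
  by [].
Qed.

Lemma c_avg_rep (f : vfun) z : (forall j, integrable j (f j)) ->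
  (forall x y, @c_map o x = @c_map o y -> forall j, f j x = f j y) ->
  @c_avg o f z = f z.1 (c_rep z.2).
Proof.
have [mc rep_c _ _ _] := o_valid; move=> fi fc; rewrite /c_avg.
have [m0|m0] := eqVneq (cell_mass (pi z.1) (@c_map o) z.2) 0.
  by rewrite /cell_avg m0 eqxx.
have [x xz] : exists x, @c_map o x = z.2.
  apply: contrapT => nx; move/eqP: m0; apply; rewrite /cell_mass.
  rewrite (_ : _ @^-1` _ = set0) ?measure0//.
  by apply/seteqP; split=> // x xz; apply: nx; exists x.
apply: cell_avg_const => //; last by exists x.
by move=> y yz; apply: fc; rewrite yz -xz rep_c.
Qed.

Lemma c_mass_rep j B : measurable (B : set (borel E)) ->
  (forall x y, @c_map o x = @c_map o y -> (B x <-> B y)) ->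
  \sum_a @c_mass o j a * \1_B (c_rep a) = fine (pi j B).
Proof.
move=> mB Bc; have [mc _ _ _ _] := o_valid.
have i1 k : integrable k (\1_B : E -> R).
  apply: (@bounded_integrable _ _ _ (pi k) _ 1) => [|x]; first exact: measurable_indic.
  by rewrite indicE; case: (_ \in _); rewrite ?normr1 ?normr0.
have -> : fine (pi j B) = \int[pi j]_x \1_B x.
  by rewrite /Rintegral integral_indic// setIT.
rewrite -(cell_int_sum mc (i1 j)); apply: eq_bigr => a _.
have <- : @c_mass o j a * cell_avg (pi j) (@c_map o) (@c_rep o) \1_B a =
    cell_int (pi j) (@c_map o) \1_B a by apply: cell_mass_avg => //; exact: i1.
congr (_ * _).
rewrite -(@c_avg_rep (fun _ => \1_B : E -> R) (j, a))// => x y /Bc xy _.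
by rewrite !indicE; congr (nat_of_bool _)%:R; apply/idP/idP; rewrite !inE => /xy.
Qed.

End at_coupling.

Definition past (s : R) (C : set Omega) (rects : seq bit) := [/\ 0 <= s, natural_filtration Y s C &
  forall tB, tB \in rects -> 0 <= tB.1 /\ tB.1 <= s].

Local Notation test_exp o C rects t w :=
  (cexp o C (fun l => @c_test o rects l * @c_avg o w (state_at (c_origin o) l (idx o t)))).

Definition limit_pr A := ulim (fun o => c_pr o A).

(** Stands for the expectation of [w] at the state and position at time [t], on the event given by
    [C] and [rects], before there is any position; [limit_exp_step] ties it to the limit law of the
    bits. *)
Definition limit_exp C rects (t : R) (w : vfun) := ulim (fun o => test_exp o C rects t w).

Let test1 o rects l : `|@c_test o rects l| <= 1.
Proof. by rewrite /c_test; case: all; rewrite ?normr1 ?normr0. Qed.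

Let limit_exp_cvg C rects (t : R) (w : vfun) : measurable C -> 0 <= t -> (forall j, integrable j (w j)) ->
  (fun o => test_exp o C rects t w) @ U --> limit_exp C rects t w.
Proof.
move=> mC t0 wi; apply: (@ulim_cvg _ (norm1 w)); apply: filterS (U_time t) => o /= [vo tl].
apply: le_trans (c_avg_norm1 vo wi); have [_ _ h1 h2 h3] := vo.
have e0 : 0 <= eps o by apply: ltW; exact: tick_gt0.
apply: (chain_exp_mass Y_markov e0 (c_origin o) _ h1 h2 h3) => //.
- by move=> j a; exact: cell_mass_ge0.
- exact: time_index_horizon.
Qed.

Let U_resid (w gw : vfun) (t acc : R) : 0 < acc -> jspan A w gw ->
  U [set o | [/\ valid o, t <= (c_level o)%:R & small_residual o acc w gw]].
Proof.
move=> acc0 wg; have ar : admissible (Requirement 0 acc [::] [:: (w, gw)]).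
  by split=> //= _ [<-|//].
apply: filterS2 (U_time t) (U_meets ar) => o [vo tl] [_ _ _ res]; split=> // i g.
exact: (res (w, gw) (or_introl erefl) i g).
Qed.

Let past_idx o s C rects : past s C rects -> natural_filtration Y ((idx o s)%:R * eps o) C.
Proof. by move=> [s0 FC _]; apply: natural_filtrationS FC; exact: time_index_ge. Qed.

Let past_measurable s C rects : past s C rects -> measurable C.
Proof. by move=> [_ FC _]; exact: (natural_filtration_measurable Y_markov FC). Qed.

Lemma limit_drift1 (w gw : vfun) s t C rects : jspan A w gw -> past s C rects -> s <= t ->
  `|limit_exp C rects t w - limit_exp C rects s w| <= (t - s) * norm1 (J w gw).
Proof.
move=> wg sC st; have [s0 FC rs] := sC; have mC := past_measurable sC.
have t0 := le_trans s0 st; have wi j : integrable j (w j) by exact: iw wg.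
have ct := @limit_exp_cvg C rects t w mC t0 wi; have cs := @limit_exp_cvg C rects s w mC s0 wi.
(* Any accuracy [acc] can be demanded of the couplings, so it is removed after the passage to the
   limit. *)
suff H acc : 0 < acc -> `|limit_exp C rects t w - limit_exp C rects s w| <=
    (t - s) * (norm1 (J w gw) + acc).
  apply/ler_addgt0Pr => e e0; have ts : 0 < t - s + 1 by rewrite ltr_wpDl// subr_ge0.
  apply: le_trans (H _ (divr_gt0 e0 ts)) _; rewrite mulrDr lerD2l mulrCA ler_piMr//.
    exact: ltW.
  by rewrite ler_pdivrMr// mul1r lerDl.
move=> acc0.
have cL : (fun o => `|test_exp o C rects t w - test_exp o C rects s w|) @ U -->
    `|limit_exp C rects t w - limit_exp C rects s w|.
  by apply: cvg_norm; exact: (cvgB ct cs).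
have cR : (fun o => (idx o t - idx o s)%:R * eps o * (norm1 (J w gw) + acc)) @ U -->
    (t - s) * (norm1 (J w gw) + acc).
  by apply: (cvgM (span_cvg s0 st)); exact: cvg_cst.
apply: (ultra_lim_le cL cR).
apply: filterS (U_resid t acc0 wg) => o /= [vo tl res].
have sE : (idx o s + (idx o t - idx o s) = idx o t)%N by rewrite subnKC// time_indexS.
have := coupling_drift1 vo Y_markov (@past_idx o s C rects sC) (c_test_adapted rs)
  (@test1 o rects)
  wg res (r := (idx o t - idx o s)%N).
by rewrite sE addn0; apply; exact: time_index_horizon.
Qed.

Lemma limit_drift2 (w gw G gG : vfun) s t C rects : jspan A w gw -> jspan A G gG ->
  past s C rects -> s <= t ->
  `|limit_exp C rects t w - limit_exp C rects s w - (t - s) * limit_exp C rects s G| <=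
  (t - s) * (norm1 (fun j x => J w gw j x - G j x) + (t - s) * norm1 (J G gG)).
Proof.
move=> wg Gg sC st; have [s0 FC rs] := sC; have mC := past_measurable sC.
have t0 := le_trans s0 st; have wi j : integrable j (w j) by exact: iw wg.
have Gi j : integrable j (G j) by exact: iw Gg.
have ct := @limit_exp_cvg C rects t w mC t0 wi; have cs := @limit_exp_cvg C rects s w mC s0 wi.
have cG := @limit_exp_cvg C rects s G mC s0 Gi; have sp := span_cvg s0 st.
set kap := norm1 (fun j x => J w gw j x - G j x).
suff H acc : 0 < acc -> `|limit_exp C rects t w - limit_exp C rects s w -
    (t - s) * limit_exp C rects s G| <=
    (t - s) * (kap + (t - s) * (norm1 (J G gG) + acc) + acc).
  apply/ler_addgt0Pr => e e0.
  have ts0 : 0 <= t - s by rewrite subr_ge0.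
  have ts : 0 < (t - s) * ((t - s) + 1) + 1 by rewrite ltr_wpDl// mulr_ge0// addr_ge0.
  apply: le_trans (H _ (divr_gt0 e0 ts)) _; set a := e / _.
  have aE : a * ((t - s) * ((t - s) + 1) + 1) = e by rewrite divfK// gt_eqF.
  have a0 : 0 < a by exact: divr_gt0.
  rewrite -aE; have -> : (t - s) * (kap + (t - s) * (norm1 (J G gG) + a) + a) =
    (t - s) * (kap + (t - s) * norm1 (J G gG)) + a * ((t - s) * ((t - s) + 1)) by ring.
  by rewrite lerD2l ler_pM2l// lerDl.
move=> acc0.
have cL : (fun o => `|test_exp o C rects t w - test_exp o C rects s w -
      (idx o t - idx o s)%:R * eps o * test_exp o C rects s G|) @ U -->
    `|limit_exp C rects t w - limit_exp C rects s w - (t - s) * limit_exp C rects s G|.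
  by apply: cvg_norm; exact: (cvgB (cvgB ct cs) (cvgM sp cG)).
have cR : (fun o => (idx o t - idx o s)%:R * eps o * (kap +
      (idx o t - idx o s)%:R * eps o * (norm1 (J G gG) + acc) + acc)) @ U -->
    (t - s) * (kap + (t - s) * (norm1 (J G gG) + acc) + acc).
  apply: (cvgM sp); apply: cvgD; last exact: cvg_cst.
  apply: cvgD; first exact: cvg_cst.
  by apply: (cvgM sp); exact: cvg_cst.
apply: (ultra_lim_le cL cR).
apply: filterS2 (U_resid t acc0 wg) (U_resid t acc0 Gg) => o /= [vo tl res] [_ _ Gres].
have sE : (idx o s + (idx o t - idx o s) = idx o t)%N by rewrite subnKC// time_indexS.
have := coupling_drift2 vo Y_markov (@past_idx o s C rects sC) (c_test_adapted rs)
  (@test1 o rects)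
  (ltW acc0) wg res Gg Gres (r := (idx o t - idx o s)%N).
by rewrite sE addn0; apply; exact: time_index_horizon.
Qed.

Definition step_fun (S : seq (R * 'I_m.+1 * set E)) (j : 'I_m.+1) (x : E) : R :=
  \sum_(u <- S) u.1.1 * (j == u.1.2)%:R * \1_(u.2) x.

Let asbool_mem (B : set E) x : `[< B x >] = (x \in B).
Proof. by apply/asboolP/idP; rewrite inE. Qed.

Let indic_integrable j (B : set (borel E)) : measurable B -> integrable j (\1_B : E -> R).
Proof.
move=> mB; apply: (@bounded_integrable _ _ _ (pi j) _ 1) => [|x].
  exact: measurable_indic.
by rewrite indicE; case: (_ \in _); rewrite ?normr1 ?normr0.
Qed.

Lemma step_fun_integrable S j : (forall u, List.In u S -> measurable (u.2 : set (borel E))) ->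
  integrable j (step_fun S j).
Proof.
elim: S => [_|u S IH mS].
  rewrite (_ : EFin \o _ = cst 0%E); first exact: integrable0.
  by apply/funext => x /=; rewrite /step_fun big_nil.
have i1 := indic_integrable j (mS u (or_introl erefl)).
have i2 := IH (fun v vS => mS v (or_intror vS)).
have := integrableD measurableT (integrableZl measurableT (u.1.1 * (j == u.1.2)%:R) i1) i2.
by apply: (eq_integrable measurableT) => x _ /=; rewrite /step_fun big_cons.
Qed.

Let limit_pr_event_cvg C rects : measurable C ->
  (fun o => c_pr o (bit_event C rects)) @ U --> limit_pr (bit_event C rects).
Proof.
move=> mC; apply: (@ulim_cvg _ (pr C)); apply: filterS (U_valid 0) => o /= [vo _].
have e0 : 0 <= eps o by apply: ltW; exact: tick_gt0.
have [_ _ h1 h2 h3] := vo; rewrite c_pr_event.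
apply: (chain_exp_le Y_markov e0 (c_origin o) _ (c_mass1 vo) h1 h2) => //.
by move=> j b; exact: cell_mass_ge0.
Qed.

(** If the sets of [S] are unions of cells, the cell average of the step function is its value at
    the representative, hence a combination of bits. The remainder [w - step_fun S] is bounded in L1
    by [chain_exp_mass], and the error between the state at [t] and at its grid time vanishes along
    [U]. *)
Lemma limit_exp_step C rects t (w : vfun) S : measurable C -> 0 <= t ->
  (forall j, integrable j (w j)) ->
  (forall u, List.In u S -> measurable (u.2 : set (borel E))) ->
  `|limit_exp C rects t w - \sum_(u <- S) u.1.1 *
      limit_pr (bit_event (C `&` Y t @^-1` [set u.1.2]) ((t, u.2) :: rects))| <=
  norm1 (fun j x => w j x - step_fun S j x).
Proof.
move=> mC t0 wi mS; set K := norm1 _; pose a := \sum_(u <- S) `|u.1.1|.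
have mCt j : measurable (C `&` Y t @^-1` [set j]).
  by apply: measurableI => //; exact: (state_measurable Y_markov).
have ct := @limit_exp_cvg C rects t w mC t0 wi.
have cS : (fun o => \sum_(u <- S) u.1.1 *
    c_pr o (bit_event (C `&` Y t @^-1` [set u.1.2]) ((t, u.2) :: rects))) @ U -->
    \sum_(u <- S) u.1.1 *
      limit_pr (bit_event (C `&` Y t @^-1` [set u.1.2]) ((t, u.2) :: rects)).
  apply: cvg_finite_sum => u _; apply: cvgM; first exact: cvg_cst.
  exact: limit_pr_event_cvg.
have cL : (fun o => `|test_exp o C rects t w - \sum_(u <- S) u.1.1 *
      c_pr o (bit_event (C `&` Y t @^-1` [set u.1.2]) ((t, u.2) :: rects))|) @ U -->
    `|limit_exp C rects t w - \sum_(u <- S) u.1.1 *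
      limit_pr (bit_event (C `&` Y t @^-1` [set u.1.2]) ((t, u.2) :: rects))|.
  by apply: cvg_norm; exact: (cvgB ct cS).
have cR : (fun o => K + a * (2 * pD o t)) @ U --> K + a * (2 * 0).
  apply: cvgD; first exact: cvg_cst.
  by apply: cvgM; [exact: cvg_cst|apply: cvgM; [exact: cvg_cst|exact: pD_cvg]].
rewrite !mulr0 addr0 in cR; apply: (ultra_lim_le cL cR).
have ar : admissible (Requirement 0 1 [seq u.2 | u <- S] [::]).
  by split=> //= B /In_mapP[u [uS <-]]; exact: mS.
apply: filterS2 (U_time t) (U_meets ar) => o /= [vo tl] [_ _ Sc _].
have [_ _ h1 h2 h3] := vo.
have e0 : 0 <= eps o by apply: ltW; exact: tick_gt0.
have wsi j : integrable j (fun x => w j x - step_fun S j x).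
  have := integrableB measurableT (wi j) (step_fun_integrable j mS).
  exact: (eq_integrable measurableT).
pose W l := @c_test o rects l * @c_avg o (fun j x => w j x - step_fun S j x)
  (state_at (c_origin o) l (idx o t)).
have WK : `|cexp o C W| <= K.
  apply: le_trans (c_avg_norm1 vo wsi).
  apply: (chain_exp_mass Y_markov e0 (c_origin o) _ h1 h2 h3) => //.
  - by move=> j b; exact: cell_mass_ge0.
  - exact: time_index_horizon.
pose T (u : R * 'I_m.+1 * set E) l := ((state_at (c_origin o) l (idx o t)).1 == u.1.2)%:R *
  @c_test o ((t, u.2) :: rects) l.
have WE : cexp o C W = test_exp o C rects t w - \sum_(u <- S) u.1.1 * cexp o C (T u).
  rewrite /c_exp; under eq_bigr do rewrite -chain_expZ.
  rewrite -chain_exp_sum -mulN1r -chain_expZ -chain_expD.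
  apply: eq_chain_exp => l _; rewrite /W c_avgB//; last first.
    by move=> j; exact: step_fun_integrable.
  rewrite mulrBr; congr (_ + _); rewrite mulN1r; congr (- _).
  rewrite c_avg_rep//; last 2 first.
  - by move=> j; exact: step_fun_integrable.
  - move=> x y cxy j; apply: eq_big_seq => u /InP uS; congr (_ * _).
    have := Sc x y cxy u.2 (iffRL (In_mapP _ _ _) (ex_intro _ u (conj uS erefl))).
    by move=> xy; rewrite !indicE; congr (nat_of_bool _)%:R; apply/idP/idP; rewrite !inE => /xy.
  rewrite /step_fun mulr_sumr; apply: eq_bigr => u _; rewrite /T /c_test /=.
  set z := state_at _ _ _.
  rewrite indicE [c_bits _ _]/c_bits -/z mulrCA !mulrA -mulrA; congr (_ * _).
  by rewrite mulrC -natrM mulnb /= asbool_mem.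
have TE u : `|c_pr o (bit_event (C `&` Y t @^-1` [set u.1.2]) ((t, u.2) :: rects)) -
    cexp o C (T u)| <= 2 * pD o t.
  by rewrite c_pr_event//; exact: cexp_diff.
move: WK; rewrite WE => WK.
set x := test_exp o C rects t w in WK *; set y := \sum_(u <- S) u.1.1 * cexp o C (T u) in WK.
set z := \sum_(u <- S) _.
have -> : x - z = (x - y) + (y - z) by ring.
apply: (le_trans (ler_normD _ _)); apply: lerD => //.
rewrite /y /z -sumrB /a mulr_suml; apply: (le_trans (ler_norm_sum _ _ _)).
apply: ler_sum => u _; rewrite -mulrBr normrM ler_wpM2l// distrC; exact: TE.
Qed.

(** As [C] belongs to the past of [t], the horizon can be lowered to the grid time of [t], where the
    cell is drawn from the tilted measure of the current state. This is the conditional law required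
    of the process, at the level of bits. *)
Lemma limit_pr_state C t B : 0 <= t -> natural_filtration Y t C ->
  measurable (B : set (borel E)) ->
  limit_pr (bit_event C [:: (t, B)]) =
    \sum_j pr (C `&` Y t @^-1` [set j]) * fine (pi j B).
Proof.
move=> t0 FC mB; have mC := natural_filtration_measurable Y_markov FC.
have mCt j : measurable (C `&` Y t @^-1` [set j]).
  by apply: measurableI => //; exact: (state_measurable Y_markov).
apply/eqP; rewrite -subr_eq0 -normr_le0.
have cL : (fun o => `|c_pr o (bit_event C [:: (t, B)]) -
      \sum_j pr (C `&` Y t @^-1` [set j]) * fine (pi j B)|) @ U -->
    `|limit_pr (bit_event C [:: (t, B)]) -
      \sum_j pr (C `&` Y t @^-1` [set j]) * fine (pi j B)|.
  by apply: cvg_norm; apply: cvgB; [exact: limit_pr_event_cvg|exact: cvg_cst].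
pose a : R := \sum_j fine (pi j B).
have cR : (fun o => a * (2 * pD o t)) @ U --> a * (2 * 0).
  by apply: cvgM; [exact: cvg_cst|apply: cvgM; [exact: cvg_cst|exact: pD_cvg]].
rewrite !mulr0 in cR; apply: (ultra_lim_le cL cR).
have ar : admissible (Requirement 0 1 [:: B] [::]) by split=> //= B' [<-|].
apply: filterS2 (U_time t) (U_meets ar) => o /= [vo tl] [_ _ Sc _].
have {}Sc x y : @c_map o x = @c_map o y -> (B x <-> B y).
  by move=> cxy; apply: (Sc x y cxy); left.
have [_ _ h1 h2 h3] := vo.
have e0 : 0 <= eps o by apply: ltW; exact: tick_gt0.
have tk0 : 0 <= (idx o t)%:R * eps o by rewrite mulr_ge0.
have mk j : measurable (C `&` Y ((idx o t)%:R * eps o) @^-1` [set j]).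
  by apply: measurableI => //; exact: (state_measurable Y_markov).
rewrite c_pr_event.
have -> : cexp o C (@c_test o [:: (t, B)]) =
    \sum_j pr (C `&` Y ((idx o t)%:R * eps o) @^-1` [set j]) * fine (pi j B).
  rewrite /c_exp (chain_exp_marg Y_markov e0 h3 (k := idx o t) (z0 := c_origin o)); last 3 first.
  - exact: time_index_horizon.
  - by apply: natural_filtrationS FC; exact: time_index_ge.
  - by apply: c_test_adapted => tB; rewrite inE => /eqP ->.
  pose Psi (z : 'I_m.+1 * c_cell o) : R := \1_B (c_rep z.2).
  rewrite (@eq_chain_exp _ _ _ _ P Y _ _ _ _ (idx o t) C _
    (fun l => Psi (state_at (c_origin o) l (idx o t)))); last first.
    move=> l _; rewrite /c_test /= andbT /Psi indicE /c_bits /=.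
    by rewrite asbool_mem.
  rewrite (chain_exp_single Y_markov e0 (c_origin o) (@c_mass o) h2)//.
  transitivity (\sum_j \sum_a pr (C `&` Y ((idx o t)%:R * eps o) @^-1` [set j]) *
      (@c_mass o j a * \1_B (c_rep a))).
    rewrite pair_bigA; apply: eq_bigr => -[j b] _ /=; rewrite /Psi /=; ring.
  by apply: eq_bigr => j _; rewrite -mulr_sumr c_mass_rep.
rewrite -sumrB /a mulr_suml; apply: (le_trans (ler_norm_sum _ _ _)).
apply: ler_sum => j _; rewrite -mulrBl normrM mulrC (ger0_norm (fine_ge0 _))//.
apply: ler_wpM2l; first exact: fine_ge0.
have := cexp_diff vo j mC t0 tl (Phi := fun=> 1) _; rewrite normr1.
move=> /(_ (fun=> lexx _)); rewrite /c_exp -chain_exp_state; last exact: time_index_horizon.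
have mass0 j' b : 0 <= @c_mass o j' b by exact: cell_mass_ge0.
by rewrite !(chain_exp_cst Y_markov e0 (c_origin o) (c_mass1 vo) h2)// distrC.
Qed.

(** Exact for each coupling already, since all bits at one time read the same representative. *)
Lemma limit_pr_merge C rects t B B' :
  limit_pr (bit_event C [:: (t, B), (t, B') & rects]) =
  limit_pr (bit_event C ((t, B `&` B') :: rects)).
Proof.
have c_prE V V' : (forall o l w, V (w, @c_bits o l) <-> V' (w, @c_bits o l)) ->
    limit_pr V = limit_pr V'.
  move=> VV'; rewrite /limit_pr (_ : c_pr^~ V = c_pr^~ V')//.
  apply/funext => o; rewrite /c_pr (_ : (fun l => _) =
    (fun l => [set w | V' (w, @c_bits o l)]))//.
  by apply/funext => l; apply/seteqP; split=> w /VV'.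
apply: c_prE => o l w; split=> -[Cw] /=; rewrite /c_bits /= => h; split=> //=.
  by case/and3P: h => /asboolP h1 /asboolP h2 h3; apply/andP; split=> //; apply/asboolP.
by case/andP: h => /asboolP[h1 h2] h3; apply/and3P; split=> //; apply/asboolP.
Qed.

Let c_pr_measurable o V : @bit_algebra _ Omega bit V ->
  forall l, measurable [set w | V (w, @c_bits o l)].
Proof. by move=> [mV _] l; exact: mV. Qed.

Let c_pr_le o V C : valid o -> @bit_algebra _ Omega bit V -> measurable C ->
  (forall w b, V (w, b) -> C w) -> c_pr o V <= pr C.
Proof.
move=> vo aV mC AC; have [_ _ h1 h2 _] := vo.
have e0 : 0 <= eps o by apply: ltW; exact: tick_gt0.
apply: (chain_pr_le Y_markov e0 (c_origin o) _ (c_mass1 vo) h1 h2) => //.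
- by move=> j a; exact: cell_mass_ge0.
- exact: c_pr_measurable.
- by move=> l w; exact: AC.
Qed.

Let c_pr_ge0 o V : valid o -> 0 <= c_pr o V.
Proof.
move=> [_ _ h1 _ _]; apply: chain_pr_ge0 => // j a; exact: cell_mass_ge0.
Qed.

Let limit_pr_cvg V : @bit_algebra _ Omega bit V -> (fun o => c_pr o V) @ U --> limit_pr V.
Proof.
move=> aV; apply: (@ulim_cvg _ (pr setT)); apply: filterS (U_valid 0) => o /= [vo _].
by rewrite ger0_norm ?c_pr_ge0//; apply: c_pr_le.
Qed.

Lemma bit_event_algebra C rects : measurable C -> bit_algebra (bit_event C rects).
Proof.
move=> mC; split.
  move=> b; case Eb: (all b rects).
    by rewrite (_ : [set w | _] = C)//; apply/seteqP; split=> [w []|].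
  by rewrite (_ : [set w | _] = set0)//; apply/seteqP; split=> // w [] _ /=; rewrite Eb.
exists rects => w b b' bb' [Cw h]; split=> //=.
by rewrite -(eq_in_all bb').
Qed.

Lemma limit_pr_probability :
  exists P' : probability (g_sigma_algebraType (@bit_algebra _ Omega bit)) R,
    (forall C rects, measurable C ->
       P' (bit_event C rects) = (limit_pr (bit_event C rects))%:E) /\
    forall C, measurable C -> P' (bit_event C [::]) = P C.
Proof.
have le0 V C : @bit_algebra _ Omega bit V -> measurable C ->
    (forall w b, V (w, b) -> C w) -> limit_pr V <= pr C.
  move=> aV mC AC; apply: (ultra_lim_le (limit_pr_cvg aV) (cvg_cst (pr C))).
  by apply: filterS (U_valid 0) => o /= [vo _]; exact: c_pr_le.
have exp_event C : measurable C -> limit_pr (bit_event C [::]) = pr C.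
  move=> mC; have g1 : (fun o => c_pr o (bit_event C [::])) @ U -->
      limit_pr (bit_event C [::]) by exact: limit_pr_event_cvg.
  have g2 : (fun=> pr C) @ U --> pr C by exact: cvg_cst.
  apply: (ultra_lim_eq g1 g2).
  apply: filterS (U_valid 0) => o /= [vo _]; have [_ _ h1 h2 _] := vo.
  have e0 : 0 <= eps o by apply: ltW; exact: tick_gt0.
  rewrite c_pr_event; exact: (chain_exp_cst Y_markov e0 (c_origin o) (c_mass1 vo) h2).
have setTE : [set: path] = bit_event setT [::] by apply/seteqP; split.
have [||V B aV aB AB|V aV AS A0 e e0|P' P'E] := @caratheodory_probability R path
    bit_algebra (@bit_algebra0 _ Omega bit) (@bit_algebraU _ Omega bit)
    (@bit_algebraC _ Omega bit) limit_pr.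
- move=> V aV; apply: (ultra_lim_le (cvg_cst 0) (limit_pr_cvg aV)).
  by apply: filterS (U_valid 0) => o /= [vo _]; exact: c_pr_ge0.
- by rewrite setTE exp_event// probability_setT.
- have cU : (fun o => c_pr o V + c_pr o B) @ U --> limit_pr V + limit_pr B.
    by apply: cvgD; exact: limit_pr_cvg.
  apply: (ultra_lim_eq (limit_pr_cvg (bit_algebraU aV aB)) cU).
  apply: filterS (U_valid 0) => o /= [vo _]; have [_ _ h1 h2 _] := vo.
  have e0 : 0 <= eps o by apply: ltW; exact: tick_gt0.
  rewrite /c_pr -(chain_prU Y_markov e0); first by [].
  - exact: c_pr_measurable.
  - exact: c_pr_measurable.
  move=> l; apply/seteqP; split=> // w [Aw Bw]; have : (V `&` B) (w, c_bits l) by []; rewrite AB => -[].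
- exact: (bit_algebra_cvg0 le0 aV AS A0 e0).
exists P'; split=> [C rects mC|C mC].
  by rewrite P'E//; exact: bit_event_algebra.
by rewrite P'E ?exp_event ?fineK ?fin_num_measure//; exact: bit_event_algebra.
Qed.

End limit.

(** Everything that is used of the couplings later on; the ultrafilter is forgotten from here. *)
Theorem coupled_limit {d : measure_display} {Omega : measurableType d}
    (P : probability Omega R) (p : 'I_m.+1 -> R) (Y : R -> Omega -> 'I_m.+1) :
  markov_chain P Q p Y -> (forall w, cadlag (Y ^~ w)) ->
  exists (P' : probability (g_sigma_algebraType (@bit_algebra _ Omega (R * set E)%type)) R)
         (D : set Omega -> seq (R * set E) -> R -> vfun -> R),
  [/\ (forall C, measurable C -> P' (bit_event C [::]) = P C) /\
      (forall C t B B' rects, measurable C ->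
        P' (bit_event C [:: (t, B), (t, B') & rects]) =
        P' (bit_event C ((t, B `&` B') :: rects))),
      forall C t B, 0 <= t -> natural_filtration Y t C -> measurable (B : set (borel E)) ->
        fine (P' (bit_event C [:: (t, B)])) =
        \sum_j fine (P (C `&` Y t @^-1` [set j])) * fine (pi j B),
      forall w gw s t C rects, jspan A w gw -> past Y s C rects -> s <= t ->
        `|D C rects t w - D C rects s w| <= (t - s) * norm1 (J w gw),
      forall w gw G gG s t C rects, jspan A w gw -> jspan A G gG ->
        past Y s C rects -> s <= t ->
        `|D C rects t w - D C rects s w - (t - s) * D C rects s G| <=
        (t - s) * (norm1 (fun j x => J w gw j x - G j x) + (t - s) * norm1 (J G gG)) &
      forall C rects t w S, measurable C -> 0 <= t -> (forall j, integrable j (w j)) ->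
        (forall u, List.In u S -> measurable (u.2 : set (borel E))) ->
        `|D C rects t w - \sum_(u <- S) u.1.1 *
            fine (P' (bit_event (C `&` Y t @^-1` [set u.1.2]) ((t, u.2) :: rects)))| <=
        norm1 (fun j x => w j x - step_fun S j x)].
Proof.
move=> YM Yc; have [U [UU Um]] := ultra_coupling.
have [P' [P'E P'0]] := limit_pr_probability YM UU Um.
exists P', (limit_exp P Y U); split.
- split; first exact: P'0.
  by move=> C t B B' rects mC; rewrite !P'E// (limit_pr_merge P Y U).
- move=> C t B t0 FC mB; rewrite P'E; first exact: (limit_pr_state YM Yc UU Um).
  exact: (natural_filtration_measurable YM FC).
- by move=> w gw s t C rects; exact: (limit_drift1 YM UU Um).
- by move=> w gw G gG s t C rects; exact: (limit_drift2 YM UU Um).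
- move=> C rects t w S mC t0 wi mS.
  under eq_bigr => u _.
    rewrite P'E; last by apply: measurableI => //; exact: (state_measurable YM).
    over.
  exact: (limit_exp_step YM Yc UU Um).
Qed.

End coupled_chains.

(** * Density of the span in L1 *)

Section bounded_measurable.
Context {R : realType} {E : ptopologicalType}.

Definition bounded_measurable (f : borel E -> R) :=
  measurable_fun setT f /\ exists M, forall x, `|f x| <= M.

Local Notation bm := bounded_measurable.

Variable pi : probability (borel E) R.

Local Notation integrable f := (pi.-integrable setT (EFin \o f)).
Local Notation I f := (\int[pi]_x f x).

Lemma bm_integrable f : bm f -> integrable f.
Proof. by move=> [mf [M fM]]; exact: (@bounded_integrable _ _ _ pi _ M). Qed.

Lemma bmM f g : bm f -> bm g -> bm (fun x => f x * g x).
Proof.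
move=> [mf [M fM]] [mg [N gN]]; split; first exact: measurable_funM.
by exists (M * N) => x; rewrite normrM ler_pM.
Qed.

Lemma bmD f g : bm f -> bm g -> bm (fun x => f x + g x).
Proof.
move=> [mf [M fM]] [mg [N gN]]; split; first exact: measurable_funD.
by exists (M + N) => x; apply: le_trans (ler_normD _ _) _; exact: lerD.
Qed.

Lemma bm_cst r : bm (cst r).
Proof. by split=> //; exists `|r|. Qed.

Lemma bmZ r f : bm f -> bm (fun x => r * f x).
Proof. exact: bmM (bm_cst r). Qed.

Lemma bmB f g : bm f -> bm g -> bm (fun x => f x - g x).
Proof.
move=> bf /(bmZ (-1)) /(bmD bf); congr bm.
by apply/funext => x; rewrite mulN1r.
Qed.

Lemma bm_pos f : bm f -> bm (fun x => Num.max (f x) 0).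
Proof.
move=> [mf [M fM]]; split; first exact: measurable_maxr.
exists M => x; apply: le_trans (fM x).
by case: (leP (f x) 0) => h; rewrite ?normr0.
Qed.

Lemma bm_indic B : measurable B -> bm \1_B.
Proof.
move=> mB; split; first exact: measurable_indic.
by exists 1 => x; rewrite indicE; case: (_ \in _); rewrite ?normr1 ?normr0.
Qed.

Lemma bm_continuous f : bounded_continuous f -> bm f.
Proof. by move=> [cf Mf]; split=> //; exact: continuous_borel_measurable. Qed.

Lemma bm_intD f g : bm f -> bm g -> I (fun x => f x + g x) = I f + I g.
Proof. by move=> bf bg; rewrite RintegralD//; exact: bm_integrable. Qed.

Lemma bm_intZ r f : bm f -> I (fun x => r * f x) = r * I f.
Proof. by move=> bf; have /= -> := RintegralZl r measurableT (bm_integrable bf). Qed.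

Lemma bm_intB f g : bm f -> bm g -> I (fun x => f x - g x) = I f - I g.
Proof. by move=> bf bg; rewrite RintegralB//; exact: bm_integrable. Qed.

Lemma bm_le f g : bm f -> bm g -> (forall x, f x <= g x) -> I f <= I g.
Proof.
by move=> bf bg fg; apply: le_Rintegral => //; exact: bm_integrable.
Qed.

Lemma bm_int_norm f M : bm f -> (forall x, `|f x| <= M) -> `|I f| <= M.
Proof.
move=> bf fM; apply: (le_trans (le_normr_Rintegral measurableT (bm_integrable bf))).
rewrite -[leRHS](probability_Rintegral_cst pi); apply: le_Rintegral => //.
- by have := integrable_norm (bm_integrable bf); apply: (eq_integrable measurableT).
- exact: (bm_integrable (bm_cst M)).
Qed.

Lemma bm_sum (X : Type) (s : seq X) (f : X -> borel E -> R) : (forall k, bm (f k)) ->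
  bm (fun x => \sum_(k <- s) f k x) /\
  I (fun x => \sum_(k <- s) f k x) = \sum_(k <- s) I (f k).
Proof.
move=> bf; elim: s => [|k s [IH1 IH2]].
  have -> : (fun x => \sum_(k <- [::]) f k x) = cst 0.
    by apply/funext => x; rewrite big_nil.
  by split; [exact: bm_cst|rewrite big_nil probability_Rintegral_cst].
have -> : (fun x => \sum_(k <- k :: s) f k x) = (fun x => f k x + \sum_(k <- s) f k x).
  by apply/funext => x; rewrite big_cons.
by split; [exact: bmD|rewrite bm_intD// IH2 big_cons].
Qed.

Lemma bm_indicI B : measurable B -> I \1_B = fine (pi B).
Proof. by move=> mB; rewrite /Rintegral integral_indic// setIT. Qed.

End bounded_measurable.

Section weak_limit.
Context {R : realType} {E : ptopologicalType}.
Variables (pi : probability (borel E) R) (r : nat -> borel E -> R) (C c : R).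
Local Notation bm := (@bounded_measurable R E).
Local Notation I f := (\int[pi]_x f x).
Hypotheses (br : forall k, bm (r k)) (r_ge0 : forall k x, 0 <= r k x)
  (rC : forall k, I (fun x => r k x * r k x) <= C).
Variable U : set_system nat.
Hypothesis UU : UltraFilter U.
Hypotheses (c0 : 0 < c) (Uc : (fun k => I (r k)) @ U --> c).

Let FU : ProperFilter U. Proof. exact: ultra_proper. Qed.

(** From [2 * \1_B * r <= dl * r ^+ 2 + \1_B / dl]: a bound in L2 gives uniform integrability. *)
Let set_bound k B dl : measurable B -> 0 < dl ->
  I (fun x => \1_B x * r k x) <= (dl * C + fine (pi B) / dl) / 2.
Proof.
move=> mB dl0; have bB : bm \1_B by exact: bm_indic.
apply: (@le_trans _ _ (I (fun x => (dl / 2) * (r k x * r k x) + (2 * dl)^-1 * \1_B x))).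
  apply: bm_le; [exact: bmM|by apply: bmD; apply: bmZ => //; exact: bmM|move=> x].
  have e1 : (dl / 2) * (r k x * r k x) + (2 * dl)^-1 * \1_B x - \1_B x * r k x =
      (dl / 2) * (r k x - \1_B x / dl) ^+ 2 + (\1_B x - \1_B x ^+ 2) * (2 * dl)^-1.
    by field; rewrite gt_eqF.
  have e2 : \1_B x - \1_B x ^+ 2 = 0 :> R.
    by rewrite indicE; case: (_ \in _); rewrite ?expr1n ?expr0n /= ?subrr.
  by rewrite -subr_ge0 e1 e2 mul0r addr0 mulr_ge0 ?sqr_ge0// divr_ge0// ltW.
rewrite bm_intD; [|by apply: bmZ; exact: bmM|exact: bmZ].
rewrite bm_intZ; last exact: bmM.
rewrite bm_intZ// bm_indicI// [leRHS]mulrDl; apply: lerD.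
  by rewrite mulrAC ler_wpM2r// ler_wpM2l// ltW.
by rewrite (_ : (2 * dl)^-1 * _ = fine (pi B) / dl / 2)//; field; exact: lt0r_neq0.
Qed.

Let prod_ge0 k g : bm g -> (forall x, 0 <= g x) -> 0 <= I (fun x => g x * r k x).
Proof. by move=> _ g0; apply: Rintegral_ge0 => x _; rewrite mulr_ge0. Qed.

Let r_le k : I (r k) <= (C + 1) / 2.
Proof.
have := set_bound k measurableT ltr01; rewrite probability_setT /= mul1r divr1.
by congr (_ <= _); apply: eq_Rintegral => x _; rewrite indicT mul1r.
Qed.

Let prod_le k g M : bm g -> (forall x, `|g x| <= M) ->
  `|I (fun x => g x * r k x)| <= M * ((C + 1) / 2).
Proof.
move=> bg gM; have M0 : 0 <= M by exact: le_trans (normr_ge0 _) (gM point).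
have h : I (fun x => M * r k x) <= M * ((C + 1) / 2) by rewrite bm_intZ// ler_wpM2l.
have bgr : bm (fun x => g x * r k x) by exact: bmM.
have bMr : bm (fun x => M * r k x) by exact: bmZ.
rewrite ler_norml; apply/andP; split.
  apply: (@le_trans _ _ (I (fun x => (-1) * (M * r k x)))).
    by rewrite bm_intZ// mulN1r lerN2.
  apply: bm_le => // [|x]; first exact: bmZ.
  rewrite mulN1r -mulNr ler_wpM2r//; have := gM x; by rewrite ler_norml => /andP[].
apply: le_trans h; apply: bm_le => // x.
by rewrite ler_wpM2r//; exact: le_trans (ler_norm _) (gM x).
Qed.

Let lim_prod g : bm g -> exists l : R, (fun k => I (fun x => g x * r k x)) @ U --> l.
Proof.
move=> bg; have [_ [M gM]] := bg.
by apply: ultra_cvg => k; exact: prod_le.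
Qed.

Let nu B : R := lim ((fun k => I (fun x => \1_B x * r k x)) @ U) / c.

Let nu_cvg B : measurable B ->
  (fun k => I (fun x => \1_B x * r k x)) @ U --> c * nu B.
Proof.
move=> mB; rewrite /nu mulrC divfK ?gt_eqF//.
by have [l ll] := lim_prod (bm_indic mB); exact: cvgP ll.
Qed.

Let nu_ge0 B : measurable B -> 0 <= nu B.
Proof.
move=> mB; rewrite -(pmulr_rge0 _ c0).
apply: (ultra_lim_le (cvg_cst 0) (nu_cvg mB)).
apply: filterE => k /=; apply: prod_ge0; first exact: bm_indic.
by move=> x; rewrite indicE.
Qed.

Let nuT : nu setT = 1.
Proof.
apply: (mulfI (lt0r_neq0 c0)); rewrite mulr1.
apply: (ultra_lim_eq (nu_cvg measurableT) Uc); apply: filterE => k /=.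
by apply: eq_Rintegral => x _; rewrite indicT mul1r.
Qed.

Let nuU B D : measurable B -> measurable D -> B `&` D = set0 ->
  nu (B `|` D) = nu B + nu D.
Proof.
move=> mB mD BD; apply: (mulfI (lt0r_neq0 c0)); rewrite mulrDr.
have h : (fun k => I (fun x => \1_B x * r k x) + I (fun x => \1_D x * r k x)) @ U -->
    c * nu B + c * nu D by apply: cvgD; exact: nu_cvg.
apply: (ultra_lim_eq (nu_cvg (measurableU _ _ mB mD)) h); apply: filterE => k /=.
rewrite -bm_intD; [|by apply: bmM => //; exact: bm_indic..].
apply: eq_Rintegral => x _; rewrite -mulrDl; congr (_ * _).
rewrite !indicE in_setU -natrD; congr (_%:R).
case: (boolP (x \in B)) => //; case: (boolP (x \in D)) => //.
by rewrite !inE => Dx Bx; have : (B `&` D) x by []; rewrite BD.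
Qed.

Let nu_cvg0 (B : nat -> set (borel E)) : (forall n, measurable (B n)) ->
  (forall n, B n.+1 `<=` B n) -> \bigcap_n B n = set0 ->
  forall e, 0 < e -> exists n, nu (B n) <= e.
Proof.
move=> mB BS B0 e e0.
have C0 : 0 <= C by apply: le_trans (rC 0%N); apply: Rintegral_ge0 => x _; rewrite mulr_ge0.
pose dl := e * c / (C + 1).
have C1 : 0 < C + 1 by rewrite ltr_wpDl.
have dl0 : 0 < dl by rewrite divr_gt0// mulr_gt0.
have BSn n k : (n <= k)%N -> B k `<=` B n.
  by move=> nk; rewrite -(subnK nk); elim: (k - n)%N => [//|l IH] x /BS; exact: IH.
have cB : pi \o B @ \oo --> pi (\bigcap_n B n).
  apply: nonincreasing_cvg_mu => //.
  - by rewrite ltey_eq fin_num_measure.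
  - exact: bigcapT_measurable.
  - by move=> n k nk; apply/subsetPset; exact: BSn.
rewrite B0 measure0 in cB.
have ed : 0 < e * c * dl by apply: mulr_gt0 => //; exact: mulr_gt0.
have /fine_cvgP[_ /cvgrPdist_le/(_ _ ed)[n _ nP]] := cB.
exists n; have := nP n (leqnn n); rewrite /= sub0r normrN ger0_norm ?fine_ge0// => pn.
rewrite -(ler_pM2l c0).
have cc : (fun=> c * e) @ U --> c * e by exact: cvg_cst.
apply: (ultra_lim_le (nu_cvg (mB n)) cc); apply: filterE => k /=.
apply: (le_trans (set_bound k (mB n) dl0)).
have h1 : dl * C <= e * c.
  by rewrite /dl mulrAC ler_pdivrMr// ler_wpM2l ?mulr_ge0 ?ltW// ltrDl.
have h2 : fine (pi (B n)) / dl <= e * c by rewrite ler_pdivrMr.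
by rewrite ler_pdivrMr//; lra.
Qed.

(** By [set_bound] the limit of the masses with density [r k] is continuous at the empty set, hence
    a measure. Divided by its total mass [c] it becomes a probability, the only kind of measure
    about which [separating] speaks. *)
Lemma weak_limit : exists P : probability (borel E) R,
  forall g, bm g -> (fun k => I (fun x => g x * r k x)) @ U --> c * \int[P]_x g x.
Proof.
have [P PE] := content_probability nu_ge0 nuT nuU nu_cvg0.
exists P => g bg; have [mg [M gM]] := bg; have [l gl] := lim_prod bg.
suff -> : c * \int[P]_x g x = l by [].
have C0 : 0 <= C by apply: le_trans (rC 0%N); apply: Rintegral_ge0 => x _; rewrite mulr_ge0.
pose K := (C + 1) / 2 + c.
have K0 : 0 < K by rewrite ltr_wpDl// divr_ge0// addr_ge0.
apply/eqP; rewrite -subr_eq0 -normr_le0; apply/ler_addgt0Pr => e e0; rewrite add0r.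
pose et := e / K; have et0 : 0 < et by exact: divr_gt0.
have [Bs [mBs Bsg]] := osc_sets mg gM et0.
have [J [t [rep [mt rep_t tB]]]] := signature_cells (point : borel E) mBs.
pose gs x := \sum_a g (rep a) * \1_(t @^-1` [set a]) x.
have gsE x : gs x = g (rep (t x)).
  rewrite /gs (bigD1 (t x))//= indicE mem_set// mulr1 big1 ?addr0// => a ax.
  by rewrite indicE memNset ?mulr0// => /esym/eqP; exact/negP.
have ggs x : `|g x - gs x| <= et.
  by rewrite gsE; apply: Bsg; apply: tB; rewrite rep_t.
have bgs_ a : bm (fun x => g (rep a) * \1_(t @^-1` [set a]) x) by apply: bmZ; exact: bm_indic.
have [bgs _] := bm_sum pi (index_enum J) bgs_; rewrite -/gs in bgs.
have cgs : (fun k => I (fun x => gs x * r k x)) @ U --> c * \int[P]_x gs x.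
  have [_ ->] := bm_sum P (index_enum J) bgs_; rewrite mulr_sumr.
  have h : (fun k => \sum_a g (rep a) * I (fun x => \1_(t @^-1` [set a]) x * r k x)) @ U -->
      \sum_a c * \int[P]_x (g (rep a) * \1_(t @^-1` [set a]) x).
    apply: cvg_finite_sum => a _; rewrite bm_intZ; last exact: bm_indic.
    rewrite bm_indicI// PE// mulrCA; apply: cvgM; first exact: cvg_cst.
    exact: nu_cvg.
  apply: cvg_trans h; apply: near_eq_cvg; apply: filterE => k /=.
  have bk a : bm (fun x => g (rep a) * (\1_(t @^-1` [set a]) x * r k x)).
    by apply: bmZ; apply: bmM => //; exact: bm_indic.
  transitivity (I (fun x => \sum_a g (rep a) * (\1_(t @^-1` [set a]) x * r k x))).
    have [_ ->] := bm_sum pi (index_enum J) bk.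
    by apply: eq_bigr => a _; rewrite bm_intZ//; apply: bmM => //; exact: bm_indic.
  by apply: eq_Rintegral => x _; rewrite /gs mulr_suml; apply: eq_bigr => a _; rewrite mulrA.
have bd : bm (fun x => g x - gs x) by exact: bmB.
have h1 : `|l - c * \int[P]_x gs x| <= et * ((C + 1) / 2).
  have hl : (fun k => `|I (fun x => g x * r k x) - I (fun x => gs x * r k x)|) @ U -->
      `|l - c * \int[P]_x gs x| by apply: cvg_norm; exact: cvgB.
  have hr : (fun=> et * ((C + 1) / 2)) @ U --> et * ((C + 1) / 2) by exact: cvg_cst.
  apply: (ultra_lim_le hl hr); apply: filterE => k /=.
  have -> : I (fun x => g x * r k x) - I (fun x => gs x * r k x) =
      I (fun x => (g x - gs x) * r k x).
    rewrite -mulN1r -bm_intZ; last exact: bmM.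
    rewrite -bm_intD; [|exact: bmM|by apply: bmZ; exact: bmM].
    by apply: eq_Rintegral => x _; ring.
  exact: prod_le.
have h2 : `|\int[P]_x g x - \int[P]_x gs x| <= et.
  have -> : \int[P]_x g x - \int[P]_x gs x = \int[P]_x (g x - gs x).
    rewrite -mulN1r -bm_intZ// -bm_intD//; last exact: bmZ.
    by apply: eq_Rintegral => x _; ring.
  exact: bm_int_norm.
have eK : et * K = e by rewrite divfK// gt_eqF.
have {}h2 : `|c * \int[P]_x g x - c * \int[P]_x gs x| <= c * et.
  by rewrite -mulrBr normrM gtr0_norm// ler_pM2l.
move: h1 h2 eK; rewrite /K mulrDr; set a := c * \int[P]_x gs x; set b := c * _.
by rewrite !ler_norml => /andP[? ?] /andP[? ?] ?; apply/andP; split; lra.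
Qed.

End weak_limit.

Section span_dense.
Context {R : realType} {E : ptopologicalType}.
Variable A : operator (R := R) E.
Hypothesis A_bounded : forall f g, A (f, g) ->
  bounded_continuous f /\ bounded_continuous g.
Hypothesis A_separating : separating (domain A).
Variable pi : probability (borel E) R.
Local Notation I f := (\int[pi]_x f x).
Local Notation bm := (@bounded_measurable R E).

Section minimizing.
Variables (h : borel E -> R) (H : R).
Hypotheses (mh : measurable_fun setT h) (hH : forall x, `|h x| <= H).

Let bh : bm h. Proof. by split=> //; exists H. Qed.

Let V f := exists g, span A f g.

Let bV f : V f -> bm f.
Proof. by move=> [g /(span_bounded A_bounded)[bf _]]; exact: bm_continuous. Qed.

Let q f := I (fun x => (h x - f x) * (h x - f x)).

Let q_ge0 f : 0 <= q f.
Proof. by apply: Rintegral_ge0 => x _; rewrite -expr2 sqr_ge0. Qed.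

Let d2 := inf (q @` [set f | V f]).

Let V0 : V (cst 0). Proof. by exists (cst 0); exact: span_cst. Qed.

Let has_inf_q : has_inf (q @` [set f | V f]).
Proof.
split; first by exists (q (cst 0)), (cst 0).
by exists 0 => _ [f _ <-].
Qed.

Let d2_le f : V f -> d2 <= q f.
Proof. by move=> Vf; apply: ge_inf; [exact: has_inf_q.2|exists f]. Qed.

Let minimizing k : exists f, V f /\ q f <= d2 + k.+1%:R^-1.
Proof.
have [|_ [f Vf <-] qf] := @inf_adherent _ _ k.+1%:R^-1 _ has_inf_q.
  by rewrite invr_gt0.
by exists f; split=> //; exact: ltW.
Qed.

(** Adding [t * phi] to an almost minimizer lowers [q] by at most [1 / (k + 1)]; [t] is taken to be
    [dl] and [- dl]. The bound is uniform over [phi] of bounded L2 norm, as needed when [phi] is the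
    moving [f k] itself. *)
Let near_orthogonal f phi N k dl : V f -> V phi -> q f <= d2 + k.+1%:R^-1 ->
  I (fun x => phi x * phi x) <= N -> 0 < dl ->
  `|I (fun x => (h x - f x) * phi x)| <= (k.+1%:R^-1 / dl + dl * N) / 2.
Proof.
move=> Vf Vphi qf phiN dl0.
have bf := bV Vf; have bphi := bV Vphi.
have br : bm (fun x => h x - f x) by exact: bmB.
pose Pr := I (fun x => (h x - f x) * phi x).
have key t : 2 * t * Pr <= k.+1%:R^-1 + t ^+ 2 * N.
  have Vt : V (fun x => f x + t * phi x).
    have [g fg] := Vf; have [g' pg'] := Vphi.
    by exists (fun x => g x + t * g' x); exact: spanD fg (spanZ t pg').
  have := d2_le Vt; rewrite /q.
  have -> : (fun x => (h x - (f x + t * phi x)) * (h x - (f x + t * phi x))) =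
     (fun x => (h x - f x) * (h x - f x) +
       ((- 2 * t) * ((h x - f x) * phi x) + t ^+ 2 * (phi x * phi x))).
    by apply/funext => x; ring.
  rewrite bm_intD; [|exact: bmM|by apply: bmD; apply: bmZ; exact: bmM].
  rewrite bm_intD; [|by apply: bmZ; exact: bmM..].
  rewrite !bm_intZ; [|exact: bmM..]; rewrite -/Pr.
  have : t ^+ 2 * I (fun x => phi x * phi x) <= t ^+ 2 * N by rewrite ler_wpM2l ?sqr_ge0.
  rewrite -/(q f); move: qf; set a := q f; set b := t ^+ 2 * N.
  have -> : -2 * t * Pr = - (2 * t * Pr) by ring.
  move: (2 * t * Pr) (t ^+ 2 * I (fun x => phi x * phi x)) (k.+1%:R^-1) => e z i.
  by rewrite /=; move: (d2) => dd; lra.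
have k1 := key dl; have k2 := key (- dl).
rewrite ler_norml -(ler_pM2l dl0) -[X in _ && X](ler_pM2l dl0).
have -> : dl * ((k.+1%:R^-1 / dl + dl * N) / 2) = (k.+1%:R^-1 + dl ^+ 2 * N) / 2.
  by move: (k.+1%:R^-1) => i; field; exact: lt0r_neq0.
have -> : dl * - ((k.+1%:R^-1 / dl + dl * N) / 2) = - ((k.+1%:R^-1 + dl ^+ 2 * N) / 2).
  by move: (k.+1%:R^-1) => i; field; exact: lt0r_neq0.
rewrite sqrrN in k2; move: k1 k2.
change (2 * dl * Pr <= k.+1%:R^-1 + dl ^+ 2 * N ->
  2 * - dl * Pr <= k.+1%:R^-1 + dl ^+ 2 * N ->
  - ((k.+1%:R^-1 + dl ^+ 2 * N) / 2) <= dl * Pr <= (k.+1%:R^-1 + dl ^+ 2 * N) / 2).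
have -> : 2 * dl * Pr = 2 * (dl * Pr) by ring.
have -> : 2 * - dl * Pr = - 2 * (dl * Pr) by ring.
move: (dl * Pr) (k.+1%:R^-1) (dl ^+ 2 * N) => a b c h1 h2.
by apply/andP; split; lra.
Qed.

(** A projection in L2 without completeness. Along a minimizing sequence the residual [rho k]
    becomes orthogonal to the span. Its positive and negative parts have limit measures of equal
    mass, since constants are in the span, and with equal integrals over the domain; by separation
    they coincide, so the integral of [h * rho k] tends to 0. As [q (f k)] is the integral of
    [h * rho k - rho k * f k], it tends to 0 too. *)
Lemma span_dense_bounded e : 0 < e ->
  exists f g, span A f g /\ I (fun x => `|h x - f x|) <= e.
Proof.
move=> e0; have /choice[f fP] := minimizing.
pose rho k x := h x - f k x; pose C := d2 + 1.
have Vf k : V (f k) by exact: (fP k).1.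
have bf k : bm (f k) by exact: bV.
have brho k : bm (rho k) by exact: bmB.
have ik1 k : k.+1%:R^-1 <= 1 :> R by rewrite invf_le1// ler1n.
have qC k : q (f k) <= C by apply: (le_trans (fP k).2); rewrite lerD2l.
(* From [|r| <= e / 2 + r ^+ 2 / (2 * e)]: it is enough to reach [q (f k) <= e ^+ 2]. *)
have abs_q k : I (fun x => `|rho k x|) <= e / 2 + (2 * e)^-1 * q (f k).
  rewrite -bm_intZ; last exact: (bmM (brho k) (brho k)).
  rewrite -[X in X + _](probability_Rintegral_cst pi) -bm_intD; last 2 first.
  - exact: bm_cst.
  - by apply: bmZ; exact: (bmM (brho k) (brho k)).
  apply: bm_le => [||x]; last 1 first.
  - rewrite -/(rho k x) -subr_ge0.
    have -> : e / 2 + (2 * e)^-1 * (rho k x * rho k x) - `|rho k x| =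
        (2 * e)^-1 * (e - `|rho k x|) ^+ 2.
      have -> : rho k x * rho k x = `|rho k x| ^+ 2 by rewrite -normrX ger0_norm ?sqr_ge0.
      by field; rewrite gt_eqF.
    by rewrite mulr_ge0 ?sqr_ge0// invr_ge0 mulr_ge0// ltW.
  - have [mr [M rM]] := brho k; split; first exact: measurableT_comp.
    by exists M => x; rewrite normr_id.
  - by apply: bmD; [exact: bm_cst|apply: bmZ; exact: (bmM (brho k) (brho k))].
suff [k qk] : exists k, q (f k) <= e ^+ 2.
  have [g fg] := Vf k; exists (f k), g; split=> //.
  apply: (le_trans (abs_q k)).
  have : (2 * e)^-1 * q (f k) <= (2 * e)^-1 * e ^+ 2.
    by rewrite ler_wpM2l// invr_ge0 mulr_ge0// ltW.
  have -> : (2 * e)^-1 * e ^+ 2 = e / 2 by field; rewrite gt_eqF.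
  by lra.
have orth N et : 0 <= N -> 0 < et -> exists K, forall k, (K <= k)%N ->
    forall phi, V phi -> I (fun x => phi x * phi x) <= N ->
    `|I (fun x => rho k x * phi x)| <= et.
  move=> N0 et0; pose dl := et / (N + 1).
  have N1 : 0 < N + 1 by rewrite ltr_wpDl.
  have dl0 : 0 < dl by exact: divr_gt0.
  exists (Num.bound (et * dl)^-1) => k Kk phi Vphi phiN.
  apply: (le_trans (near_orthogonal (Vf k) Vphi (fP k).2 phiN dl0)).
  have h1 : dl * N <= et by rewrite /dl mulrAC ler_pdivrMr// ler_wpM2l ?ltW// ltrDl.
  have h2 : k.+1%:R^-1 / dl <= et.
    rewrite (ler_pdivrMr _ _ dl0) invf_ple ?posrE ?ltr0n//; last exact: mulr_gt0.
    apply: le_trans (ltW (archi_boundP _)) _; first by rewrite invr_ge0; apply/ltW/mulr_gt0.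
    by rewrite ler_nat; exact: leqW.
  by move: (k.+1%:R^-1 / dl) (dl * N) h1 h2 => a b; lra.
have [U [UU Uoo]] := ultrafilter_nat.
have FU : ProperFilter U by exact: ultra_proper.
have H0 : 0 <= H by exact: le_trans (normr_ge0 _) (hH point).
have C0 : 0 <= C by exact: le_trans (q_ge0 (f 0%N)) (qC 0%N).
have orthV phi : V phi -> (fun k => I (fun x => rho k x * phi x)) @ U --> (0 : R).
  move=> Vphi; apply/cvgrPdist_le => et et0.
  have bphi := bV Vphi.
  have [K KP] := orth `|I (fun x => phi x * phi x)| et (normr_ge0 _) et0.
  apply: Uoo; exists K => //= k Kk; rewrite sub0r normrN; apply: KP => //.
  exact: ler_norm.
pose sgn_part (s : R) k x := Num.max (s * rho k x) 0.
have bsp s k : bm (sgn_part s k) by apply: bm_pos; exact: bmZ.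
have sp0 s k x : 0 <= sgn_part s k x by rewrite le_max lexx orbT.
have spE k x : rho k x = sgn_part 1 k x - sgn_part (-1) k x.
  rewrite /sgn_part mul1r mulN1r; case: (leP (rho k x) 0) => r0.
    by rewrite (max_idPl _) ?oppr_ge0// sub0r opprK.
  by rewrite (max_idPr _) ?oppr_le0 ?ltW// subr0.
have spC s k : `|s| = 1 -> I (fun x => sgn_part s k x * sgn_part s k x) <= C.
  move=> s1; apply: le_trans (qC k); apply: bm_le => [||x].
  - exact: bmM.
  - exact: (bmM (brho k) (brho k)).
  rewrite -/(rho k x) /sgn_part; case: (leP (s * rho k x) 0) => r0.
    by rewrite mul0r -expr2 sqr_ge0.
  by rewrite -!expr2 exprMn -[s ^+ 2]real_normK ?num_real// s1 expr1n mul1r.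
have [cp cpP] : exists l : R, (fun k => I (sgn_part 1 k)) @ U --> l.
  apply: (@ultra_cvg _ _ U UU _ (C + 1)) => k.
  rewrite ger0_norm; last by apply: Rintegral_ge0.
  rewrite -[X in _ + X](probability_Rintegral_cst pi).
  apply: (@le_trans _ _ (I (fun x => sgn_part 1 k x * sgn_part 1 k x + cst 1 x))).
    apply: bm_le => // [|x]; first by apply: bmD; [exact: bmM|exact: bm_cst].
    by rewrite /=; have := sp0 1 k x; set y := sgn_part 1 k x; nra.
  rewrite bm_intD; [|exact: bmM|exact: bm_cst].
  by rewrite lerD2r; apply: spC; rewrite normr1.
have cnP : (fun k => I (sgn_part (-1) k)) @ U --> cp.
  have V1 : V (cst 1) by exists (cst 0); exact: span_cst.
  have hc : (fun k => I (sgn_part 1 k) - I (fun x => rho k x * cst 1 x)) @ U --> cp - 0.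
    by apply: cvgB => //; exact: orthV.
  rewrite subr0 in hc; apply: cvg_trans hc; apply: near_eq_cvg; apply: filterE => k /=.
  have b1 : bm (fun x => rho k x * 1) by apply: bmM => //; exact: bm_cst.
  rewrite -bm_intB//; apply: eq_Rintegral => x _; rewrite spE; ring.
suff hrho : (fun k => I (fun x => h x * rho k x)) @ U --> (0 : R).
  have e2 : 0 < e ^+ 2 / 2 by rewrite divr_gt0 ?exprn_gt0.
  have HC : 0 <= 2 * (H ^+ 2 + C) by rewrite mulr_ge0// addr_ge0// sqr_ge0.
  have [K KP] := orth _ _ HC e2.
  move/cvgrPdist_le : hrho => /(_ _ e2) h1.
  have h2 : U [set k | (K <= k)%N] by apply: Uoo; exists K.
  have [k [/= hk Kk]] := filter_ex (filterI h1 h2); exists k.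
  rewrite sub0r normrN in hk.
  have fN : I (fun x => f k x * f k x) <= 2 * (H ^+ 2 + C).
    apply: (@le_trans _ _ (I (fun x => 2 * (H ^+ 2 + rho k x * rho k x)))).
      apply: bm_le; [exact: bmM| |move=> x].
        by apply: bmZ; apply: bmD; [exact: bm_cst|exact: bmM].
      have : h x ^+ 2 <= H ^+ 2.
        by rewrite -[h x ^+ 2]real_normK ?num_real// lerXn2r ?nnegrE.
      rewrite /rho; set a := h x; set b := f k x; move=> aH.
      by have := sqr_ge0 (2 * a - b); nra.
    rewrite bm_intZ; last by apply: bmD; [exact: bm_cst|exact: bmM].
    rewrite bm_intD; [|exact: bm_cst|exact: bmM].
    by rewrite probability_Rintegral_cst ler_wpM2l// lerD2l; exact: qC.
  have := KP k Kk (f k) (Vf k) fN.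
  have -> : q (f k) = I (fun x => h x * rho k x) - I (fun x => rho k x * f k x).
    rewrite -mulN1r -bm_intZ; last exact: bmM.
    rewrite -bm_intD; [|exact: bmM|by apply: bmZ; exact: bmM].
    by apply: eq_Rintegral => x _; rewrite /rho; ring.
  move: hk; move: (\int[pi]_x (h x * rho k x)) (\int[pi]_x (rho k x * f k x)) => a b.
  by rewrite !ler_norml => /andP[? ?] /andP[? ?]; lra.
(* If the common mass vanishes there is no probability to form, but then both parts tend to 0 in L1
   and [h] is bounded. *)
have [cp0|cp0] := leP cp 0.
  have cp00 : cp = 0.
    apply: le_anti; rewrite cp0/=.
    have h0 : (fun=> 0 : R) @ U --> (0 : R) by exact: cvg_cst.
    by apply: (ultra_lim_le h0 cpP); apply: filterE => k /=; exact: Rintegral_ge0.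
  rewrite cp00 in cpP cnP.
  apply/cvgrPdist_le => et et0.
  have et1 : 0 < et / (2 * (H + 1)) by rewrite divr_gt0// mulr_gt0// ltr_wpDl.
  move/cvgrPdist_le: cpP => /(_ _ et1); move/cvgrPdist_le: cnP => /(_ _ et1).
  apply: filterS2 => k; rewrite !sub0r !normrN.
  move=> /(le_trans (ler_norm _)) h1 /(le_trans (ler_norm _)) h2.
  have bh1 : bm (fun x => H * (sgn_part 1 k x + sgn_part (-1) k x)).
    by apply: bmZ; exact: bmD.
  have h3 : `|I (fun x => h x * rho k x)| <= H * (I (sgn_part 1 k) + I (sgn_part (-1) k)).
    rewrite -bm_intD// -bm_intZ; last exact: bmD.
    have b1 : bm (fun x => h x * rho k x) by exact: bmM.
    have pt x : `|h x * rho k x| <= H * (sgn_part 1 k x + sgn_part (-1) k x).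
      rewrite normrM ler_pM// spE; apply: le_trans (ler_normB _ _) _.
      by rewrite !ger0_norm.
    rewrite ler_norml; apply/andP; split; last first.
      by apply: bm_le => // x; exact: le_trans (ler_norm _) (pt x).
    apply: (@le_trans _ _ (I (fun x => -1 * (H * (sgn_part 1 k x + sgn_part (-1) k x))))).
      by rewrite (bm_intZ _ (-1) bh1) mulN1r.
    apply: bm_le => // [|x]; first exact: bmZ.
    by have := pt x; rewrite mulN1r ler_norml => /andP[].
  apply: (le_trans h3); apply: (@le_trans _ _ (H * (et / (2 * (H + 1)) * 2))).
    by rewrite ler_wpM2l//; lra.
  have -> : et / (2 * (H + 1)) * 2 = et / (H + 1) by field; rewrite gt_eqF// ltr_wpDl.
  by rewrite mulrA ler_pdivrMr ?ltr_wpDl// mulrC ler_wpM2l ?ltW// ltrDl.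
have [Pp PpE] := weak_limit (bsp 1) (sp0 1) (fun k => spC 1 k (normr1 R)) UU cp0 cpP.
have [Pn PnE] := weak_limit (bsp (-1)) (sp0 (-1)) (fun k => spC (-1) k (normrN1 R)) UU cp0 cnP.
have diff g : bm g -> (fun k => I (fun x => g x * rho k x)) @ U -->
    cp * \int[Pp]_x g x - cp * \int[Pn]_x g x.
  move=> bg; have hh : (fun k => I (fun x => g x * sgn_part 1 k x) -
      I (fun x => g x * sgn_part (-1) k x)) @ U -->
      cp * \int[Pp]_x g x - cp * \int[Pn]_x g x by exact: (cvgB (PpE g bg) (PnE g bg)).
  apply: cvg_trans hh; apply: near_eq_cvg; apply: filterE => k /=.
  have b1 : bm (fun x => g x * sgn_part 1 k x) by exact: bmM.
  have b2 : bm (fun x => g x * sgn_part (-1) k x) by exact: bmM.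
  by rewrite -bm_intB//; apply: eq_Rintegral => x _; rewrite spE; ring.
have PpPn B : measurable B -> Pp B = Pn B.
  apply: A_separating => phi [g Aphi].
  have Vphi : V phi by exists g; exact: span_in.
  have h1 := diff phi (bV Vphi); have h2 := orthV phi Vphi.
  have : cp * \int[Pp]_x phi x - cp * \int[Pn]_x phi x = 0.
    apply: (ultra_lim_eq h1 h2); apply: filterE => k /=.
    by apply: eq_Rintegral => x _; rewrite mulrC.
  by rewrite -mulrBr => /eqP; rewrite mulf_eq0 gt_eqF//= subr_eq0 => /eqP.
have -> : 0 = cp * \int[Pp]_x h x - cp * \int[Pn]_x h x :> R.
  rewrite -mulrBr (_ : \int[Pp]_x h x = \int[Pn]_x h x) ?subrr ?mulr0//.
  congr fine; apply: eq_measure_integral => B mB _; exact: PpPn.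
exact: diff.
Qed.

End minimizing.

Lemma span_dense h e : pi.-integrable setT (EFin \o h) -> 0 < e ->
  exists f g, span A f g /\ I (fun x => `|h x - f x|) <= e.
Proof.
move=> ih e0; have e2 : 0 < e / 2 by rewrite divr_gt0.
have [Bs [s [mBs sB is_ hs]]] := L1_sets ih e2.
have [J [t [rep [mt rep_t tB]]]] := signature_cells (point : borel E) mBs.
have ms : measurable_fun setT s by apply/measurable_EFinP; exact: measurable_int is_.
pose H := \sum_a `|s (rep a)|.
have sH x : `|s x| <= H.
  have -> : s x = s (rep (t x)) by apply: sB; apply: tB; rewrite rep_t.
  by rewrite /H (bigD1 (t x))//= lerDl sumr_ge0.
have [f [g [fg sf]]] := span_dense_bounded ms sH e2.
exists f, g; split=> //.
have bf : bm f by have [bf _] := span_bounded A_bounded fg; exact: bm_continuous.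
have bs : bm s by split=> //; exists H.
have i1 : pi.-integrable setT (EFin \o (fun x => `|h x - s x|)).
  by have := integrable_norm (integrableB measurableT ih is_); apply: (eq_integrable measurableT).
have i2 : pi.-integrable setT (EFin \o (fun x => `|s x - f x|)).
  have := integrable_norm (integrableB measurableT is_ (bm_integrable pi bf)).
  by apply: (eq_integrable measurableT).
have i3 : pi.-integrable setT (EFin \o (fun x => `|h x - f x|)).
  have := integrable_norm (integrableB measurableT ih (bm_integrable pi bf)).
  by apply: (eq_integrable measurableT).
have i4 : pi.-integrable setT (EFin \o (fun x => `|h x - s x| + `|s x - f x|)).
  by have := integrableD measurableT i1 i2; apply: (eq_integrable measurableT).
apply: (@le_trans _ _ (I (fun x => `|h x - s x| + `|s x - f x|))).
  apply: le_Rintegral => // x _.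
  by rewrite (_ : h x - f x = (h x - s x) + (s x - f x)) ?ler_normD//; ring.
by rewrite RintegralD//; lra.
Qed.

End span_dense.

(** * Recovering a process from its bits *)

Section almost_everywhere.
Context {R : realType} {d} {Om : measurableType d} (P : probability Om R).

Lemma ae_intro (V : set Om) (Q : Om -> Prop) : measurable V -> P V = 0%E ->
  (forall z, ~ V z -> Q z) -> {ae P, forall z, Q z}.
Proof.
by move=> mV PV h; exists V; split=> // z /= nQ; apply: contrapT => /h.
Qed.

Lemma ae_measure0 (V : set Om) : measurable V -> {ae P, forall z, ~ V z} -> P V = 0%E.
Proof.
move=> mV [W [mW PW VW]]; apply/eqP; rewrite eq_le measure_ge0 andbT -PW.
by apply: le_measure; rewrite ?inE// => z Vz; apply: VW => /= /(_ Vz).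
Qed.

Lemma ae_le (V W : set Om) : measurable V -> measurable W ->
  {ae P, forall z, V z -> W z} -> (P V <= P W)%E.
Proof.
move=> mV mW VW; have h : P (V `\` W) = 0%E.
  apply: ae_measure0; first exact: measurableD.
  by apply: filterS VW => z VWz [/VWz].
have mVW : measurable (V `&` W) by exact: measurableI.
have -> : P V = (P (V `\` W) + P (V `&` W))%E by exact: measureDI.
by rewrite [P (V `\` W)]h add0e; apply: le_measure; rewrite ?inE.
Qed.

Lemma ae_converse (V W : set Om) : measurable V -> measurable W ->
  {ae P, forall z, W z -> V z} -> P V = P W -> {ae P, forall z, V z -> W z}.
Proof.
move=> mV mW WV PE; apply: (@ae_intro (V `\` W)); first exact: measurableD.
  have e : P (V `&` W) = P W.
    apply/eqP; rewrite eq_le; apply/andP; split.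
      by apply: le_measure; rewrite ?inE//; exact: measurableI.
    apply: ae_le => //; first exact: measurableI.
    by apply: filterS WV => z WVz Wz; split=> //; exact: WVz.
  have -> : P (V `\` W) = (P V - P (V `&` W))%E.
    by apply: measureD => //; rewrite ltey_eq fin_num_measure.
  by rewrite e PE subee// fin_num_measure.
by move=> z nVW Vz; apply: contrapT => nW; apply: nVW.
Qed.

End almost_everywhere.

Section grid.
Context {R : realType}.

(** Rounded down, unlike [time_index]: only bits at times up to [t] are read, which keeps the
    decoded process adapted. *)
Definition grid n (t : R) : R := (Num.floor (t * 2 ^+ n))%:~R * tick n.

Lemma grid_le n t : grid n t <= t.
Proof. by rewrite /grid ler_pdivrMr ?exprn_gt0//; exact: floor_le. Qed.

Lemma grid_gt n t : t < grid n t + tick n.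
Proof.
rewrite -[X in _ + X]mul1r -mulrDl ltr_pdivlMr ?exprn_gt0//.
have := floorD1_gt (t * 2 ^+ n); rewrite intrD; exact.
Qed.

Lemma grid_ge0 n t : 0 <= t -> 0 <= grid n t.
Proof.
move=> t0; rewrite /grid mulr_ge0//; last by apply/ltW/tick_gt0.
by rewrite ler0z floor_ge0 mulr_ge0// exprn_ge0.
Qed.

End grid.

Section bits_at_time.
Context {R : realType} {E : ptopologicalType} {d} {Om : measurableType d}.
Variables (P : probability Om R) (xi : set E -> set Om) (mu : probability (borel E) R).
Local Notation mb B := (measurable (B : set (borel E))).
Hypotheses (mxi : forall B, measurable (xi B))
  (xiE : forall B, mb B -> P (xi B) = mu B)
  (xiI : forall B B', mb B -> mb B' -> P (xi B `&` xi B') = mu (B `&` B')).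

Lemma xiT : {ae P, forall z, xi setT z}.
Proof.
apply: (@ae_intro _ _ _ _ (~` xi setT)) => [||z]; first exact: measurableC.
  by rewrite probability_setC// xiE// probability_setT subee.
exact: contrapT.
Qed.

Lemma xi_subset B B' : mb B -> mb B' -> B `<=` B' -> {ae P, forall z, xi B z -> xi B' z}.
Proof.
move=> mB mB' BB'; apply: (@ae_intro _ _ _ _ (xi B `\` xi B')) => [||z].
- exact: measurableD.
- have -> : P (xi B `\` xi B') = (P (xi B) - P (xi B `&` xi B'))%E.
    by apply: measureD => //; rewrite ltey_eq fin_num_measure.
  by rewrite xiI// xiE// (setIidl BB') subee// fin_num_measure.
- by move=> nV Bz; apply: contrapT => nB'; apply: nV.
Qed.

Lemma xi_disjoint B B' : mb B -> mb B' -> B `&` B' = set0 ->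
  {ae P, forall z, ~ (xi B z /\ xi B' z)}.
Proof.
move=> mB mB' BB'; apply: (@ae_intro _ _ _ _ (xi B `&` xi B')) => [||z//].
  exact: measurableI.
by rewrite xiI// BB' measure0.
Qed.

Lemma xiD B B' : mb B -> mb B' -> {ae P, forall z, xi B z -> ~ xi B' z -> xi (B `\` B') z}.
Proof.
move=> mB mB'; have mD : mb (B `\` B') by exact: measurableD.
suff : {ae P, forall z, (xi B `\` xi B') z -> xi (B `\` B') z}.
  by apply: filterS => z h Bz nB'z; exact: h.
apply: ae_converse => //; first exact: measurableD.
- have h1 := xi_subset mD mB (@subDsetl _ B B').
  have h2 := xi_disjoint mD mB' (setDKI _ _).
  by apply: filterS2 h1 h2 => z h1 h2 Dz; split; [exact: h1|move=> Bz; apply: h2].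
- have -> : P (xi B `\` xi B') = (P (xi B) - P (xi B `&` xi B'))%E.
    by apply: measureD => //; rewrite ltey_eq fin_num_measure.
  rewrite xiI// !xiE//; apply/esym; apply: measureD => //.
  by rewrite ltey_eq fin_num_measure.
Qed.

(** On the exceptional event the bit of every remainder [D N] is almost surely set, and [mu (D N)]
    tends to 0. *)
Lemma xi_bigcup (B : nat -> set E) : (forall n, mb (B n)) ->
  {ae P, forall z, xi (\bigcup_n B n) z -> exists n, xi (B n) z}.
Proof.
move=> mB; pose D N := (\bigcup_n B n) `\` \big[setU/set0]_(i < N) B i.
have mU : mb (\bigcup_n B n) by exact: bigcupT_measurable.
have mD N : mb (D N) by apply: measurableD => //; exact: bigsetU_measurable.
have DE N : D N.+1 = D N `\` B N.
  rewrite /D big_ord_recr /=; apply/seteqP; split=> [x [Ux n]|x [[Ux n] nB]].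
    by split; [split=> // h; apply: n; left|move=> h; apply: n; right].
  by split=> // -[].
pose V := xi (\bigcup_n B n) `\` \bigcup_n xi (B n).
have mV : measurable V by apply: measurableD => //; exact: bigcupT_measurable.
apply: (ae_intro mV) => [|z nV Uz]; last first.
  by apply: contrapT => h; apply: nV; split=> // -[n _ Bz]; apply: h; exists n.
have VD N : (P V <= mu (D N))%E.
  rewrite -xiE//; apply: ae_le => //.
  elim: N => [|N IH].
    by apply: aeW => z [Uz _]; rewrite /D big_ord0 setD0.
  apply: filterS2 IH (xiD (mD N) (mB N)) => z IH h Vz; rewrite DE; apply: h.
    exact: IH.
  by case: Vz => _ nB Bz; apply: nB; exists N.
have DS N : D N.+1 `<=` D N by rewrite DE => x [].
have DSn n k : (n <= k)%N -> D k `<=` D n.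
  by move=> nk; rewrite -(subnK nk); elim: (k - n)%N => [//|l IH] x /DS; exact: IH.
have D0 : \bigcap_N D N = set0.
  apply/seteqP; split=> // x Dx; have [[i _ Bx] _] := Dx 0%N I.
  by have [_] := Dx i.+1 I; apply; rewrite -bigcup_mkord; exists i => /=.
have cD : mu \o D @ \oo --> mu (\bigcap_N D N).
  apply: nonincreasing_cvg_mu => //.
  - by rewrite ltey_eq fin_num_measure.
  - exact: bigcapT_measurable.
  - by move=> n k nk; apply/subsetPset; exact: DSn.
rewrite D0 measure0 in cD; apply/eqP; rewrite eq_le measure_ge0 andbT.
have <- := cvg_lim _ cD => //.
by apply: lime_ge; [exact: cvgP cD|exact: nearW].
Qed.

(* Up to null sets the bits at a fixed time form a sigma-complete ultrafilter,
   so that agreement with membership on open sets propagates. *)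
Lemma xi_borel (X : Om -> E) :
  (forall B, open B -> {ae P, forall z, xi B z <-> B (X z)}) ->
  forall B, mb B -> {ae P, forall z, xi B z <-> B (X z)}.
Proof.
move=> Xo B mB; suff [] : mb B /\ {ae P, forall z, xi B z <-> B (X z)} by [].
move: B mB; apply: smallest_sub; last first.
  by move=> O oO; split; [exact: sub_sigma_algebra|exact: Xo].
split.
- split=> //; have := xi_disjoint measurable0 measurable0 (setI0 set0).
  by apply: filterS => z h; split=> // x0; apply: h.
- move=> B [mB hB]; rewrite setTD; have mC : mb (~` B) by exact: measurableC.
  split=> //; have h1 := xi_disjoint mB mC (setICr B); have h2 := xiD measurableT mB.
  rewrite setTD in h2.
  apply: filterS2 (filterI hB xiT) (filterI h1 h2) => z [hBz Tz] [h1z h2z].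
  split=> [Cz /= /hBz Bz|nB]; first exact: h1z.
  by apply: h2z => // /hBz.
- move=> B hB; have mU : mb (\bigcup_n B n) by apply: bigcupT_measurable => n; have [] := hB n.
  split=> //.
  have h1 : {ae P, forall z, forall n, xi (B n) z <-> B n (X z)}.
    by apply: ae_foralln => n; have [] := hB n.
  have h2 : {ae P, forall z, forall n, xi (B n) z -> xi (\bigcup_n B n) z}.
    apply: ae_foralln => n; apply: xi_subset => //; first by have [] := hB n.
    by move=> x Bx; exists n.
  have h3 : {ae P, forall z, xi (\bigcup_n B n) z -> exists n, xi (B n) z}.
    by apply: xi_bigcup => n; have [] := hB n.
  apply: filterS2 h1 (filterI h2 h3) => z g1 [g2 g3]; split.
    by move=> /g3[n /g1]; exists n.
  by move=> [n _ /g1]; exact: g2.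
Qed.

End bits_at_time.

Lemma tickS {R : realType} n : tick n = tick n.+1 + tick n.+1 :> R.
Proof. by rewrite /tick exprS invfM -mulrDl -[2^-1]mul1r -splitr mul1r. Qed.

Lemma tick_decr {R : realType} n k : (n <= k)%N -> tick k <= tick n :> R.
Proof.
by move=> nk; rewrite lef_pV2 ?posrE ?exprn_gt0// ler_weXn2l// ler1n.
Qed.

Lemma separable_sequence {R : realType} {E : completeMetricType R} :
  separable_space E -> exists ctr : nat -> E, forall x (e : R), 0 < e ->
    exists i, ball (ctr i) e x.
Proof.
move=> [D cD dD]; have [D0|[f]] := pfcard_geP cD.
  have := dD setT; rewrite D0 setI0 => /(_ _ openT)[|x]; last by [].
  by exists point.
exists f => x e e0; have [y [xy Dy]] : (interior (ball x e) `&` D) !=set0.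
  apply: dD; last exact: open_interior.
  by exists x; exact: nbhsx_ballx.
have [i _ fi] := 'surj_f Dy.
by exists i; rewrite fi; apply: ball_sym; exact: interior_subset.
Qed.

Section cauchy_sequences.
Context {R : realType} {E : completeMetricType R}.
Implicit Types (x : nat -> E).

Lemma cvg_tick x : cvg (x k @[k --> \oo]) <->
  forall n, exists N, forall k, (N <= k)%N -> ball (x N) (tick n : R) (x k).
Proof.
split=> [/cvg_ex[l xl] n|h].
  have [N _ hN] := cvg_ball xl (@tick_gt0 R n.+1).
  exists N => k Nk; rewrite tickS; apply: (@ball_triangle _ _ l).
    by apply: ball_sym; apply: hN => /=.
  exact: hN.
apply: cauchy_cvg; apply: cauchy_exP => e e0.
have [n nP] := tick_small e0; have [N hN] := h n.
exists (x N); exists N => // k Nk /=; apply: le_ball (hN k Nk); exact: nP.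
Qed.

(** Membership of the limit in an open set becomes a countable combination of conditions on balls
    about the terms. *)
Lemma lim_open x (O : set E) : cvg (x k @[k --> \oo]) -> open O ->
  (O (lim (x k @[k --> \oo])) <->
   exists n N, forall k, (N <= k)%N -> ball (x k) (tick n : R) `<=` O).
Proof.
move=> cx oO; set l := lim _; have xl : x k @[k --> \oo] --> l by exact: cx.
split=> [Ol|[n [N h]]].
  have /nbhs_ballP[e /= e0 eO] : nbhs l O by apply: open_nbhs_nbhs.
  have [n nP] := tick_small e0.
  have [N _ hN] := cvg_ball xl (@tick_gt0 R n.+1).
  exists n.+1, N => k Nk y xy; apply: eO; apply: (le_ball (nP n (leqnn n))).
  by rewrite tickS; apply: ball_triangle xy; exact: hN.
have [M _ hM] := cvg_ball xl (@tick_gt0 R n).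
apply: (h (maxn N M) (leq_maxl _ _)); apply: ball_sym; apply: hM => /=; exact: leq_maxr.
Qed.

(** The terms come from one sequence [ctr], so every condition is one on the indices and no
    measurability of balls is involved; where the sequence diverges the limit is the default
    [point]. *)
Lemma measurable_lim_index {d} {S : measurableType d} (ctr : nat -> E) (a : nat -> S -> nat) :
  (forall k (V : set nat), measurable (a k @^-1` V)) ->
  measurable_fun setT (fun s => lim (ctr (a k s) @[k --> \oo]) : borel E).
Proof.
move=> ma; pose K := [set s | cvg (ctr (a k s) @[k --> \oo])].
have mK : measurable K.
  rewrite (_ : K = \bigcap_n \bigcup_N \bigcap_(k in [set k | (N <= k)%N])
    [set s | ball (ctr (a N s)) (tick n : R) (ctr (a k s))]).
    apply: bigcapT_measurable => n; apply: bigcupT_measurable => N.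
    apply: bigcap_measurable; first by exists N => /=.
    move=> k _; rewrite (_ : [set s | _] = \bigcup_i (a N @^-1` [set i] `&`
      a k @^-1` [set j | ball (ctr i) (tick n : R) (ctr j)])).
      by apply: bigcupT_measurable => i; apply: measurableI; exact: ma.
    apply/seteqP; split=> [s h|s [i _ [/= <-]]//].
    by exists (a N s).
  apply/seteqP; split=> s.
    by move=> /cvg_tick h n _; have [N hN] := h n; exists N => // k /= Nk; exact: hN.
  by move=> h; apply/cvg_tick => n; have [N _ hN] := h n I; exists N => k Nk; exact: hN.
apply: (@measurability _ _ S (borel E) setT _ (@open E)) => //.
move=> _ [] O oO <-; rewrite setTI.
pose W := \bigcup_n \bigcup_N \bigcap_(k in [set k | (N <= k)%N])
  (a k @^-1` [set i | ball (ctr i) (tick n : R) `<=` O]).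
have mW : measurable W.
  apply: bigcupT_measurable => n; apply: bigcupT_measurable => N.
  by apply: bigcap_measurable => [|k _]; [exists N => /=|exact: ma].
rewrite (_ : _ @^-1` O = (K `&` W) `|` (~` K `&` [set _ | O point])).
  apply: measurableU; first exact: measurableI.
  apply: measurableI; first exact: measurableC.
  have [Op|Op] := pselect (O point).
    by rewrite (_ : [set _ | _] = setT)//; apply/seteqP; split.
  by rewrite (_ : [set _ | _] = set0)//; apply/seteqP; split.
have WP s : K s -> (O (lim (ctr (a k s) @[k --> \oo])) <-> W s).
  move=> Ks; split=> [/(iffLR (lim_open Ks oO))[n [N h]]|[n _ [N _ h]]].
    by exists n => //; exists N => // k /=; exact: h.
  by apply/(lim_open Ks oO); exists n, N => k Nk; exact: h.
apply/seteqP; split=> s /=.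
  have [Ks|nKs] := pselect (K s); first by move=> /(WP s Ks) Ws; left.
  by rewrite (dvgP nKs) => Op; right.
by case=> [[Ks /(WP s Ks)]|[nKs Op]]//; rewrite (dvgP nKs).
Qed.

End cauchy_sequences.

Lemma measurable_find {d} {S : measurableType d} (p : nat -> set S) N a (V : set nat) :
  (forall i, measurable (p i)) ->
  measurable ((fun s => find (fun i => `[< p i s >]) (iota a N)) @^-1` V).
Proof.
move=> mp; have mc (Q : Prop) : measurable [set _ : S | Q].
  have [q|q] := pselect Q.
    by rewrite (_ : [set _ | _] = setT)//; apply/seteqP; split.
  by rewrite (_ : [set _ | _] = set0)//; apply/seteqP; split.
elim: N a V => [|N IH] a V; first exact: (mc (V 0%N)).
rewrite (_ : _ @^-1` V = (p a `&` [set _ | V 0%N]) `|` (~` p a `&`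
   (fun s => find (fun i => `[< p i s >]) (iota a.+1 N)) @^-1` [set n | V n.+1])).
  apply: measurableU; first by apply: measurableI => //; exact: mc.
  by apply: measurableI; [exact: measurableC|exact: IH].
apply/seteqP; split=> s /=; case: asboolP => ps.
- by left.
- by right.
- by case=> -[].
- by case=> -[].
Qed.

(** * Decoding a point of the space from its bits *)

Section decoding.
Context {R : realType} {E : completeMetricType R} {d} {Om : measurableType d}.
Variables (P : probability Om R) (xi : R -> set E -> set Om).
Variable mu : R -> probability (borel E) R.
Local Notation mb B := (measurable (B : set (borel E))).
(** The last two conditions are uniform in time: at each scale [mu_dominated] selects finitely many
    balls that serve all [t], and [xi_continuous] gives a common delay over which their bits are
    likely to persist. *)
Hypotheses (mxi : forall t B, measurable (xi t B))
  (xiE : forall t B, 0 <= t -> mb B -> P (xi t B) = mu t B)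
  (xiI : forall t B B', 0 <= t -> mb B -> mb B' ->
    P (xi t B `&` xi t B') = mu t (B `&` B'))
  (mu_dominated : forall V : nat -> set E, (forall n, mb (V n)) ->
    (forall n, V n.+1 `<=` V n) -> \bigcap_n V n = set0 ->
    forall e : R, 0 < e -> exists n, forall t, 0 <= t -> fine (mu t (V n)) <= e)
  (xi_continuous : forall B (e : R), mb B -> 0 < e -> exists2 dl, 0 < dl &
    forall s t, 0 <= s -> s <= t -> t <= s + dl -> fine (P (xi s B `\` xi t B)) <= e).
Hypothesis E_separable : separable_space E.

Let ctr : nat -> E := sval (cid (separable_sequence E_separable)).
Let ctrP x e : 0 < e -> exists i, ball (ctr i) e x.
Proof. by move: x e; exact: (svalP (cid (separable_sequence E_separable))). Qed.

Definition cover k i : set E := interior (ball (ctr i) (tick k)).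

Let cover_open k i : open (cover k i).
Proof. exact: open_interior. Qed.

Let mcover k i : mb (cover k i).
Proof. exact: sub_sigma_algebra. Qed.

Let cover_ball k i : cover k i `<=` ball (ctr i) (tick k).
Proof. exact: interior_subset. Qed.

Let coverP k x : exists i, cover k i x.
Proof.
have [i ix] := ctrP x (tick_gt0 k.+1); exists i; apply/nbhs_ballP.
exists (tick k.+1) => /=; first exact: tick_gt0.
by move=> y xy; rewrite tickS; exact: ball_triangle xy.
Qed.

Let size_exists k : exists N, forall t, 0 <= t ->
  fine (mu t (~` \big[setU/set0]_(i < N) cover k i)) <= tick k.
Proof.
apply: (mu_dominated (V := fun N => ~` \big[setU/set0]_(i < N) cover k i)).
- by move=> N; apply: measurableC; apply: bigsetU_measurable.
- by move=> N; apply: subsetC; rewrite big_ord_recr; left.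
- apply/seteqP; split=> // x Vx; have [i xi_] := coverP k x.
  by have := Vx i.+1 I; apply; rewrite -bigcup_mkord; exists i => /=.
- exact: tick_gt0.
Qed.

Let N k := sval (cid (size_exists k)).
Let NP k t : 0 <= t -> fine (mu t (~` \big[setU/set0]_(i < N k) cover k i)) <= tick k.
Proof. by move: t; exact: (svalP (cid (size_exists k))). Qed.

(** The bound is divided by [(N k).+1] so that the [N k] bits together are lost with probability at
    most [tick k]. *)
Let level_exists k : exists n, forall i, (i < N k)%N -> forall s t, 0 <= s -> s <= t ->
  t <= s + tick n -> fine (P (xi s (cover k i) `\` xi t (cover k i))) <= tick k / (N k).+1%:R.
Proof.
have e0 : 0 < tick k / (N k).+1%:R :> R by rewrite divr_gt0// tick_gt0.
have /choice[n nP] i : exists n, forall n', (n <= n')%N -> forall s t, 0 <= s -> s <= t ->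
    t <= s + tick n' -> fine (P (xi s (cover k i) `\` xi t (cover k i))) <= tick k / (N k).+1%:R.
  have [dl dl0 h] := xi_continuous (mcover k i) e0.
  have [n nP] := tick_small dl0; exists n => n' nn' s t s0 st ts; apply: h => //.
  by apply: (le_trans ts); rewrite lerD2l; exact: nP.
exists (\max_(i < N k) n i) => i iN; apply: (nP i).
exact: (leq_bigmax (Ordinal iN)).
Qed.

Let M k := sval (cid (level_exists k)).
Let MP k i : (i < N k)%N -> forall s t, 0 <= s -> s <= t -> t <= s + tick (M k) ->
  fine (P (xi s (cover k i) `\` xi t (cover k i))) <= tick k / (N k).+1%:R.
Proof. by move: i; exact: (svalP (cid (level_exists k))). Qed.

(** Equal to [N k] when no bit is set; this happens only on [missed k t]. *)
Definition first_bit k t z :=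
  find (fun i => `[< xi (grid (M k) t) (cover k i) z >]) (iota 0 (N k)).

Definition decode t z : E := lim (ctr (first_bit k t z) @[k --> \oo]).

Let missed k t := ~` \big[setU/set0]_(i < N k) xi (grid (M k) t) (cover k i).
Let lost k t := \big[setU/set0]_(i < N k)
  (xi (grid (M k) t) (cover k i) `\` xi t (cover k i)).

Let first_bitP k t z : ~ missed k t z -> ~ lost k t z -> xi t (cover k (first_bit k t z)) z.
Proof.
rewrite /missed -(bigcup_mkord (N k) (fun i => xi (grid (M k) t) (cover k i))) => /contrapT[i /= iN xi_i] nl.
set p := fun i => `[< xi (grid (M k) t) (cover k i) z >].
have hp : has p (iota 0 (N k)) by apply/hasP; exists i; [rewrite mem_iota|apply/asboolP].
have fN : (first_bit k t z < N k)%N by move: hp; rewrite has_find size_iota.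
have := nth_find 0 hp; rewrite nth_iota// add0n => /asboolP xf.
apply: contrapT => nx; apply: nl; rewrite /lost
  -(bigcup_mkord (N k) (fun i => xi (grid (M k) t) (cover k i) `\` xi t (cover k i))).
by exists (first_bit k t z).
Qed.

Let measurable_missed k t : measurable (missed k t).
Proof. by apply: measurableC; apply: bigsetU_measurable. Qed.

Let measurable_lost k t : measurable (lost k t).
Proof. by apply: bigsetU_measurable => i _; exact: measurableD. Qed.

Let missed_le k t : 0 <= t -> (P (missed k t) <= (tick k)%:E)%E.
Proof.
move=> t0; have s0 : 0 <= grid (M k) t by exact: grid_ge0.
set s := grid (M k) t in s0 *; pose V := \big[setU/set0]_(i < N k) cover k i.
have mV : mb V by apply: bigsetU_measurable.
have mVC : mb (~` V) by exact: measurableC.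
rewrite (@le_trans _ _ (P (xi s (~` V))))//; last first.
  by rewrite xiE// -[leLHS]fineK ?fin_num_measure// lee_fin; exact: NP.
apply: ae_le => //.
have h1 := xiT (mxi s) (fun B mB => xiE s0 mB).
have h2 := xiD (mxi s) (fun B mB => xiE s0 mB) (fun B B' mB mB' => xiI s0 mB mB') measurableT mV.
pose B n := if (n < N k)%N then cover k n else set0.
have mB n : mb (B n) by rewrite /B; case: ifP.
have BE : \bigcup_n B n = V.
  rewrite /V -bigcup_mkord; apply/seteqP; split=> x [n].
    by rewrite /B; case: ifP => // nN _ h; exists n.
  by move=> /= nN h; exists n => //; rewrite /B nN.
have h3 := xi_bigcup (mxi s) (fun B mB => xiE s0 mB) (fun B B' mB mB' => xiI s0 mB mB') mB.
have h4 := xi_disjoint (mxi s) (fun B B' mB mB' => xiI s0 mB mB')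
  measurable0 measurable0 (setI0 set0).
rewrite BE in h3; rewrite setTD in h2.
apply: filterS2 (filterI h1 h2) (filterI h3 h4) => z [Tz h2z] [h3z h4z] mz.
apply: h2z => // /h3z[n]; rewrite /B; case: ifP => [nN Bz|_ x0]; last exact: h4z.
by apply: mz; rewrite -(bigcup_mkord (N k) (fun i => xi s (cover k i))); exists n.
Qed.

Let lost_le k t : 0 <= t -> (P (lost k t) <= (tick k)%:E)%E.
Proof.
move=> t0; apply: (@le_trans _ _ (\sum_(i < N k) P (xi (grid (M k) t) (cover k i) `\` xi t (cover k i)))%E).
  apply: (Boole_inequality P (A := fun i => xi (grid (M k) t) (cover k i) `\` xi t (cover k i))).
  by move=> i _; exact: measurableD.
apply: (@le_trans _ _ (\sum_(i < N k) (tick k / (N k).+1%:R)%:E)%E).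
  apply: lee_sum => i _; rewrite -[leLHS]fineK ?fin_num_measure//; last exact: measurableD.
  rewrite lee_fin; apply: MP => //; [exact: grid_ge0|exact: grid_le|exact/ltW/grid_gt].
have share (a : R) n : 0 <= a -> a / n.+1%:R *+ n <= a.
  by move=> a0; rewrite -mulr_natr mulrAC -mulrA ler_piMr// ler_pdivrMr// mul1r ler_nat//.
rewrite sumEFin lee_fin sumr_const card_ord; apply: share; exact/ltW/tick_gt0.
Qed.

(** Borel-Cantelli: at scale [k] the chosen ball is wrong with probability at most [2 * tick k]. *)
Let eventually_kept t : 0 <= t ->
  {ae P, forall z, exists n, forall k, (n <= k)%N -> xi t (cover k (first_bit k t z)) z}.
Proof.
move=> t0; pose V k := missed k t `|` lost k t.
have mV k : measurable (V k) by exact: measurableU.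
have PV k : (P (V k) <= (4 / (2 ^ k.+1)%:R)%:E)%E.
  rewrite (@le_trans _ _ (P (missed k t) + P (lost k t))%E)//.
    by apply: measureU2; [exact: measurable_missed|exact: measurable_lost].
  apply: (le_trans (leeD (missed_le k t0) (lost_le k t0))).
  rewrite -EFinD lee_fin natrX (_ : 4 = 2 + 2 :> R)//; last by ring.
  rewrite mulrDl exprS invfM mulrA divff ?mul1r//.
have h : P (lim_sup_set V) = 0%E.
  apply: lim_sup_set_cvg0 => //; apply: (@le_lt_trans _ _ 4%:E); last exact: ltry.
  apply: (le_trans _ (@epsilon_trick0 R 4 xpredT _)) => //.
  by apply: lee_nneseries => k _ //; exact: PV.
apply: (ae_intro _ h) => [|z nz].
  apply: bigcapT_measurable => n; apply: bigcup_measurable => k _; exact: mV.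
apply: contrapT => h'; apply: nz => n _; apply: contrapT => h''; apply: h'.
exists n => k nk; apply: first_bitP => b; apply: h''; exists k => //; [by left|by right].
Qed.

Lemma decode_bits t B : 0 <= t -> mb B -> {ae P, forall z, xi t B z <-> B (decode t z)}.
Proof.
move=> t0; have xE B' mB' := @xiE t B' t0 mB'.
have xI B1 B2 mB1 mB2 := @xiI t B1 B2 t0 mB1 mB2.
apply: (xi_borel (mxi t) xE xI); move: B => _ O oO.
have mO : mb O by exact: sub_sigma_algebra.
(* [O] as a countable union of covers whose ball remains in [O] after enlargement by a factor 4; the
   margin absorbs the distance from the cover to the decoded point. *)
pose V (p : nat) : set E := let: (n, i) := odflt (0, 0)%N (unpickle p) in
  if pselect (ball (ctr i) (4 * tick n) `<=` O) then cover n i else set0.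
have mV p : mb (V p).
  rewrite /V; case: (odflt _ _) => n i; case: pselect => h /=; first exact: mcover.
  exact: measurable0.
have VE : \bigcup_p V p = O.
  apply/seteqP; split=> [x [p _]|x Ox].
    rewrite /V; case: (odflt _ _) => n i; case: pselect => // h /cover_ball ix.
    by apply: h; apply: le_ball ix; have := @tick_gt0 R n; lra.
  have /nbhs_ballP[e /= e0 eO] : nbhs x O by apply: open_nbhs_nbhs.
  have e5 : 0 < e / 5 by rewrite divr_gt0.
  have [n nP] := tick_small e5; have [i ix] := coverP n x.
  exists (pickle (n, i)) => //; rewrite /V pickleK /=; case: pselect => // -[] y iy.
  apply: eO; apply: (@le_ball _ _ _ (tick n + 4 * tick n)).
    have := nP n (leqnn n); lra.
  by apply: ball_triangle iy; apply: ball_sym; exact: cover_ball.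
have h1 : {ae P, forall z, forall k i l j, cover k i `&` cover l j = set0 ->
    ~ (xi t (cover k i) z /\ xi t (cover l j) z)}.
  apply: ae_foralln => k; apply: ae_foralln => i; apply: ae_foralln => l; apply: ae_foralln => j.
  have [h|h] := pselect (cover k i `&` cover l j = set0); last by apply: aeW => z.
  have := xi_disjoint (mxi t) xI (mcover k i) (mcover l j) h.
  by apply: filterS => z hz _.
have h2 : {ae P, forall z, forall k i, cover k i `<=` O -> xi t (cover k i) z -> xi t O z}.
  apply: ae_foralln => k; apply: ae_foralln => i.
  have [h|h] := pselect (cover k i `<=` O); last by apply: aeW => z.
  have := xi_subset (mxi t) xE xI (mcover k i) mO h.
  by apply: filterS => z hz _.
have h3 := xi_bigcup (mxi t) xE xI mV; rewrite VE in h3.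
have h4 := xi_disjoint (mxi t) xI measurable0 measurable0 (setI0 set0).
apply: filterS2 (filterI (eventually_kept t0) h1) (filterI h2 (filterI h3 h4)) =>
  z [[n0 kept] h1z] [h2z [h3z h4z]] {h1 h2 h3 h4}.
pose a k := first_bit k t z.
(* Bits of disjoint sets almost surely exclude each other, so two covers with set bits intersect and
   their centers are close; the kept centers therefore form a Cauchy sequence. *)
have meet k i l j : xi t (cover k i) z -> xi t (cover l j) z ->
    ball (ctr i) (tick k + tick l) (ctr j).
  move=> hk hl; have [y [yk yl]] : (cover k i `&` cover l j) !=set0.
    by apply/set0P/eqP => /h1z; apply.
  by apply: (@ball_triangle _ _ y); [exact: cover_ball|apply: ball_sym; exact: cover_ball].
have cX : cvg (ctr (a k) @[k --> \oo]).
  apply/cvg_tick => n; exists (maxn n0 n.+1) => k kn; rewrite geq_max in kn.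
  have /andP[k1 k2] := kn.
  apply: (le_ball _ (meet _ _ _ _ (kept _ (leq_maxl n0 n.+1)) (kept _ k1))).
  by rewrite [leRHS]tickS lerD// tick_decr// leq_maxr.
have XE : decode t z = lim (ctr (a k) @[k --> \oo]) by [].
have near k : (n0 <= k)%N -> ball (ctr (a k)) (3 * tick k) (decode t z).
  move=> k0; have [l1 _ hl] := cvg_ball cX (@tick_gt0 R k).
  pose l := maxn l1 k; apply: (@le_ball _ _ _ (tick k + tick l + tick k)).
    have := @tick_decr R k l (leq_maxr _ _); lra.
  apply: (@ball_triangle _ _ (ctr (a l))).
    by apply: meet; apply: kept => //; apply: (leq_trans k0); exact: leq_maxr.
  by apply: ball_sym; apply: hl => /=; exact: leq_maxl.
split=> [xO|XO].
  have [p] := h3z xO; rewrite /V; case: (odflt _ _) => n i; case: pselect => [iO|nO h]; last first.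
    by case: (h4z).
  move=> /= hi; apply: iO; pose k := maxn n0 n.+2.
  have kk := kept k (leq_maxl _ _).
  apply: (@le_ball _ _ _ (tick n + tick k + 3 * tick k)).
    have := @tick_decr R n.+2 k (leq_maxr _ _); have := @tickS R n; have := @tickS R n.+1; have := @tick_gt0 R n; lra.
  by apply: ball_triangle (near k (leq_maxl _ _)); exact: meet.
have /nbhs_ballP[e /= e0 eO] : nbhs (decode t z) O by apply: open_nbhs_nbhs.
have e4 : 0 < e / 4 by rewrite divr_gt0.
have [n nP] := tick_small e4; pose k := maxn n0 n.
apply: (h2z k (a k)); last by apply: kept; exact: leq_maxl.
move=> y /cover_ball ky; apply: eO; apply: (@le_ball _ _ _ (3 * tick k + tick k)).
  have := nP k (leq_maxr _ _); lra.
by apply: ball_triangle ky; apply: ball_sym; apply: near; exact: leq_maxl.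
Qed.

(** Time and path both depend on the parameter; taking the parameter to be the pair of them gives
    progressive measurability. *)
Lemma measurable_decode {d'} {S : measurableType d'} (c : S -> R) (o : S -> Om) :
  (forall n B, mb B -> measurable [set s | xi (grid n (c s)) B (o s)]) ->
  measurable_fun setT (fun s => decode (c s) (o s) : borel E).
Proof.
move=> h; apply: (@measurable_lim_index _ _ _ _ ctr (fun k s => first_bit k (c s) (o s))).
move=> k V; pose p i := [set s | xi (grid (M k) (c s)) (cover k i) (o s)].
have mp i : measurable (p i) by exact: h.
exact: (measurable_find (N k) 0 V mp).
Qed.

Lemma decode_exists : exists X : R -> Om -> E,
  (forall t B, 0 <= t -> mb B -> {ae P, forall z, xi t B z <-> B (X t z)}) /\
  (forall d' (S : measurableType d') (c : S -> R) (o : S -> Om),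
    (forall n B, mb B -> measurable [set s | xi (grid n (c s)) B (o s)]) ->
    measurable_fun setT (fun s => X (c s) (o s) : borel E)).
Proof. by exists decode; split; [exact: decode_bits|move=> d' S c o; exact: measurable_decode]. Qed.

End decoding.

(** * The martingale problem *)

Lemma mixture_exists {R : realType} {d} {T : measurableType d} n
    (c : 'I_n -> R) (pi : 'I_n -> probability T R) :
  (forall j, 0 <= c j) -> \sum_j c j = 1 ->
  exists mu : probability T R, forall B, measurable B ->
    mu B = (\sum_j c j * fine (pi j B))%:E.
Proof.
move=> c0 c1; have pi_fin j B : measurable B -> pi j B \is a fin_num.
  by move=> mB; rewrite fin_num_measure.
apply: content_probability => [B mB||B B' mB mB' BB'|V mV VS V0 e e0].
- by apply: sumr_ge0 => j _; rewrite mulr_ge0// fine_ge0.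
- by rewrite -[RHS]c1; apply: eq_bigr => j _; rewrite probability_setT mulr1.
- rewrite -big_split; apply: eq_bigr => j _ /=; rewrite -mulrDr; congr (_ * _).
  have -> : pi j (B `|` B') = (pi j B + pi j B')%E by apply: measureU.
  by rewrite fineD// pi_fin.
have /choice[k kP] j : exists k, forall n, (k <= n)%N -> fine (pi j (V n)) <= e.
  have cV : pi j \o V @ \oo --> pi j (\bigcap_n V n).
    apply: nonincreasing_cvg_mu => //.
    - by rewrite ltey_eq fin_num_measure.
    - exact: bigcapT_measurable.
    - move=> k l kl; apply/subsetPset; rewrite -(subnK kl).
      by elim: (l - k)%N => [//|i IH] x /VS; exact: IH.
  rewrite V0 measure0 in cV.
  have /fine_cvgP[_ /cvgrPdist_le/(_ _ e0)[k _ kP]] := cV.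
  exists k => l kl; have := kP l kl.
  by rewrite /= sub0r normrN; exact: le_trans (ler_norm _).
exists (\max_j k j); rewrite -[leRHS]mul1r -c1 mulr_suml; apply: ler_sum => j _.
by apply: ler_wpM2l => //; apply: kP; exact: leq_bigmax.
Qed.

Lemma ge0_integral_event_law {R : realType} {d d'} {Om : measurableType d}
    {T : measurableType d'} (P : probability Om R) (V : set Om) (X : Om -> T)
    (mu : probability T R) (c : R) :
  measurable V -> measurable_fun setT X -> 0 <= c ->
  (forall B, measurable B -> P (V `&` X @^-1` B) = (c%:E * mu B)%E) ->
  forall h : T -> \bar R, measurable_fun setT h -> (forall x, 0 <= h x)%E ->
  (\int[P]_z (h (X z) * (\1_V z)%:E) = c%:E * \int[mu]_x h x)%E.
Proof.
move=> mV mX c0 PVX h mh h0.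
have Voo : (P V < +oo)%E by rewrite ltey_eq fin_num_measure.
pose nu : {finite_measure set Om -> \bar R} := mfrestr mV Voo.
pose k : {nonneg R} := NngNum c0.
transitivity (\int[nu]_z h (X z))%E.
  apply/esym; apply: density_integral_ge0 => //.
  - apply: (@bounded_integrable _ _ _ P _ 1) => [|x]; first exact: measurable_indic.
    by rewrite indicE; case: (_ \in _); rewrite ?normr1 ?normr0.
  - by move=> W mW; rewrite integral_indic// setIC.
  - exact: measurableT_comp.
rewrite -(ge0_integral_mscale mu measurableT k mh) => [|x _]; last exact: h0.
apply: ge0_integral_law => // B mB.
by rewrite /= /mfrestr /mrestr setIC PVX.
Qed.

Lemma measurable_Rintegral_param {R : realType} {d1 d2} {T1 : measurableType d1}
    {T2 : measurableType d2} (mu : {sigma_finite_measure set T2 -> \bar R})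
    (f : T1 * T2 -> R) (V : set T2) : measurable V -> measurable_fun setT f ->
  measurable_fun setT (fun x => \int[mu]_(y in V) f (x, y)).
Proof.
move=> mV mf; pose F : T1 * T2 -> \bar R := (EFin \o f) \_ (setT `*` V).
have mTV : measurable (setT `*` V : set (T1 * T2)) by exact: measurableX.
have mF : measurable_fun setT F.
  by apply/(measurable_restrictT _ mTV)/measurable_funTS/measurable_EFinP.
have FE x y : F (x, y) = ((fun y => (f (x, y))%:E) \_ V) y.
  by rewrite /F /patch in_setX /= in_setT.
have IE x : (\int[mu]_(y in V) (f (x, y))%:E =
    fubini_F mu (F ^\+)%E x - fubini_F mu (F ^\-)%E x)%E.
  rewrite integral_mkcond integralE /fubini_F; congr (_ - _)%E.
    by apply: eq_integral => y _; rewrite !funeposE FE.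
  by apply: eq_integral => y _; rewrite !funenegE FE.
rewrite (_ : (fun x => _) = fine \o (fun x => fubini_F mu (F ^\+)%E x - fubini_F mu (F ^\-)%E x)%E).
  apply: measurableT_comp => //.
  by apply: emeasurable_funB; apply: measurable_fun_fubini_tonelli_F => //;
    [exact: measurable_funepos|exact: measurable_funeneg].
by apply/funext => x /=; rewrite -IE.
Qed.

Lemma step_approx {R : realType} {E : ptopologicalType} {m : nat}
    (w : 'I_m.+1 -> E -> R) (e : R) : (forall j, bounded_measurable (w j)) -> 0 < e ->
  exists S : seq (R * 'I_m.+1 * set E),
    (forall u, List.In u S -> measurable (u.2 : set (borel E))) /\
    forall j x, `|w j x - step_fun S j x| <= e.
Proof.
move=> bw e0.
have /choice[S SP] j : exists S : seq (R * 'I_m.+1 * set E),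
    [/\ forall u, List.In u S -> measurable (u.2 : set (borel E)),
      forall i x, i != j -> step_fun S i x = 0 &
      forall x, `|w j x - step_fun S j x| <= e].
  have [mw [M wM]] := bw j.
  have [Bs [mBs wBs]] := osc_sets mw wM e0.
  have [J [c [rep [mc rep_c cB]]]] := signature_cells (point : borel E) mBs.
  exists [seq (w j (rep a), j, c @^-1` [set a]) | a <- enum J]; split.
  - by move=> u /In_mapP[a [_ <-]]; exact: mc.
  - move=> i x ij; rewrite /step_fun big_map big1// => a _ /=.
    by rewrite (negbTE ij) mulr0 mul0r.
  move=> x; rewrite /step_fun big_map /= (bigD1_seq (c x)) ?mem_enum ?enum_uniq//=.
  rewrite big1 => [|a ac]; last first.
    by rewrite indicE memNset ?mulr0//= => h; rewrite -h eqxx in ac.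
  rewrite eqxx mulr1 addr0 indicE mem_set// mulr1.
  by apply: wBs; apply: cB; rewrite rep_c.
exists (flatten [seq S j | j <- enum 'I_m.+1]); split.
  by move=> u /In_flatten_map[j [_]]; have [h _ _] := SP j; exact: h.
move=> j x; suff -> : step_fun (flatten [seq S j | j <- enum 'I_m.+1]) j x = step_fun (S j) j x.
  by have [_ _] := SP j; apply.
rewrite /step_fun big_flatten big_map /= (bigD1_seq j) ?mem_enum ?enum_uniq//=.
rewrite [X in _ + X]big1 ?addr0// => i ij; have [_ + _] := SP i; apply.
by rewrite eq_sym.
Qed.

Lemma probability_partition {R : realType} {d} {Om : measurableType d} (P : probability Om R)
    {I : finType} (y : Om -> I) (V : set Om) : measurable V ->
  (forall j, measurable (y @^-1` [set j])) ->
  fine (P V) = \sum_j fine (P (V `&` y @^-1` [set j])).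
Proof.
move=> mV my; have mj j : measurable (V `&` y @^-1` [set j]) by exact: measurableI.
have {1}-> : V = \bigcup_(j in [set` index_enum I]) (V `&` y @^-1` [set j]).
  apply/seteqP; split=> [z Vz|z [j _ []]//].
  by exists (y z); rewrite /= ?mem_index_enum.
rewrite measure_fin_bigcup//.
  by rewrite -fsbig_seq ?index_enum_uniq// -sum_fine// => j _; rewrite fin_num_measure.
by move=> i j _ _ [z [[_ /= <-] [_ /= <-]]].
Qed.

Lemma sum_share {R : realType} n (a : R) : \sum_(j < n.+1) a / n.+1%:R = a.
Proof.
have e : a / n.+1%:R *+ n.+1 = a by rewrite -mulr_natr mulfVK.
by rewrite sumr_const card_ord.
Qed.

(** * The laws of the bits and the process decoded from them *)

Section bit_process.
Context {R : realType} {E : completeMetricType R} {m : nat}.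
Variables (A : operator (R := R) E) (q : 'I_m.+1 -> 'I_m.+1 -> E -> R).
Hypotheses (E_separable : separable_space E)
  (A_bounded : forall f g, A (f, g) -> bounded_continuous f /\ bounded_continuous g)
  (A_separating : separating (domain A)).
Variables (pi : 'I_m.+1 -> probability (borel E) R).
Context {d : measure_display} {Omega : measurableType d}.
Variables (P : probability Omega R) (Q : 'M[R]_m.+1) (p : 'I_m.+1 -> R).
Variable Y : R -> Omega -> 'I_m.+1.
Hypothesis Y_markov : markov_chain P Q p Y.
Local Notation path := (g_sigma_algebraType (@bit_algebra _ Omega (R * set E)%type)).
Variables (P' : probability path R)
  (D : set Omega -> seq (R * set E) -> R -> ('I_m.+1 -> E -> R) -> R).
Local Notation mb B := (measurable (B : set (borel E))).
Local Notation bits C rects := (bit_event C rects : set path).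
Hypotheses
  (P'_merge : forall C t B B' rects, measurable C ->
    P' (bit_event C [:: (t, B), (t, B') & rects]) =
    P' (bit_event C ((t, B `&` B') :: rects)))
  (P'_state : forall C t B, 0 <= t -> natural_filtration Y t C -> mb B ->
    fine (P' (bit_event C [:: (t, B)])) =
    \sum_j fine (P (C `&` Y t @^-1` [set j])) * fine (pi j B))
  (D_lipschitz : forall w gw s t C rects, jspan A w gw -> past Y s C rects -> s <= t ->
    `|D C rects t w - D C rects s w| <= (t - s) * norm1 pi (jump q w gw))
  (D_step : forall C rects t w S, measurable C -> 0 <= t ->
    (forall j, (pi j).-integrable setT (EFin \o w j)) ->
    (forall u, List.In u S -> mb u.2) ->
    `|D C rects t w - \sum_(u <- S) u.1.1 *
        fine (P' (bit_event (C `&` Y t @^-1` [set u.1.2]) ((t, u.2) :: rects)))| <=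
    norm1 pi (fun j x => w j x - step_fun S j x)).

Lemma measurable_bits C rects : measurable C -> measurable (bits C rects).
Proof. by move=> mC; apply: sub_sigma_algebra; exact: bit_event_algebra. Qed.

Lemma bits_state C t rects : measurable C -> 0 <= t ->
  fine (P' (bit_event C rects)) =
  \sum_j fine (P' (bit_event (C `&` Y t @^-1` [set j]) rects)).
Proof.
move=> mC t0; have mj j : measurable (C `&` Y t @^-1` [set j]).
  by apply: measurableI => //; exact: (state_measurable Y_markov).
rewrite (@probability_partition _ _ _ P' _ (fun z => Y t z.1)); last 2 first.
- exact: measurable_bits.
- move=> j; rewrite (_ : _ @^-1` _ = bits (Y t @^-1` [set j]) [::]).
    by apply: measurable_bits; exact: (state_measurable Y_markov).
  by apply/seteqP; split=> [z|z []].
apply: eq_bigr => j _; congr (fine (P' _)).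
by apply/seteqP; split=> [z [[Cz h] /= Yz]|z [[Cz Yz] h]].
Qed.

Let past_setT t : natural_filtration Y t setT.
Proof.
by have [n0 nC _] := natural_filtration_sigma Y t; have := nC _ n0; rewrite setD0.
Qed.

Lemma law_exists t : 0 <= t -> exists mu : probability (borel E) R,
  forall B, mb B -> P' (bit_event setT [:: (t, B)]) = mu B /\
    mu B = (\sum_j fine (P (Y t @^-1` [set j])) * fine (pi j B))%:E.
Proof.
move=> t0.
have [mu muE] : exists mu : probability (borel E) R, forall B, mb B ->
    mu B = (\sum_j fine (P (Y t @^-1` [set j])) * fine (pi j B))%:E.
  apply: mixture_exists => [j|]; first exact: fine_ge0.
  have := probability_partition P measurableT (fun j => state_measurable Y_markov j t0).
  by rewrite probability_setT /= => ->; apply: eq_bigr => j _; rewrite setTI.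
exists mu => B mB; split; last exact: muE.
rewrite muE// -[LHS]fineK; last by rewrite fin_num_measure//; exact: measurable_bits.
rewrite (P'_state t0 (@past_setT t) mB); congr (_%:E); apply: eq_bigr => j _.
by rewrite setTI.
Qed.

(** The indicator of [B] is replaced by span elements [w] within [e / 4] in the norm [norm1], for
    which [D] is Lipschitz in time. The loss is a difference of two probabilities that [(s, B)]
    holds together with [(r, B)], for [r] equal to [s] and to [t]; each is within [e / 4] of [D] at
    [r], and [D] moves by at most [e / 2]. *)
Lemma modulus B (e : R) : mb B -> 0 < e -> exists2 dl, 0 < dl & forall s t,
  0 <= s -> s <= t -> t <= s + dl ->
  fine (P' (bits setT [:: (s, B)] `\` bits setT [:: (t, B)])) <= e.
Proof.
move=> mB e0.
have iB j : (pi j).-integrable setT (EFin \o (\1_B : E -> R)).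
  apply: (@bounded_integrable _ _ _ (pi j) _ 1) => [|x]; first exact: measurable_indic.
  by rewrite indicE; case: (_ \in _); rewrite ?normr1 ?normr0.
pose eta := e / 4 / m.+1%:R.
have eta0 : 0 < eta by rewrite !divr_gt0.
have /choice[w /choice[gw wg]] j : exists w gw, span A w gw /\
    \int[pi j]_x `|\1_B x - w x| <= eta.
  by have [w [gw [? ?]]] := span_dense A_bounded A_separating (iB j) eta0; exists w, gw.
have wj : jspan A w gw by move=> j; exact: (wg j).1.
pose K := norm1 pi (jump q w gw).
have K0 : 0 <= K by apply: sumr_ge0 => j _; exact: Rintegral_ge0.
have K1 : 0 < 2 * (K + 1) by rewrite mulr_gt0// ltr_wpDl.
exists (e / (2 * (K + 1))); first exact: divr_gt0.
move=> s t s0 st tdl; have t0 := le_trans s0 st.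
pose S : seq (R * 'I_m.+1 * set E) := [seq (1, j, B) | j <- index_enum 'I_m.+1].
have mS u : List.In u S -> mb u.2 by move=> /In_mapP[j [_ <-]].
have SE j x : step_fun S j x = \1_B x.
  rewrite /step_fun big_map /= (bigD1 j)//=.
  rewrite big1 => [|i ij]; first by rewrite eqxx !mul1r addr0.
  by rewrite eq_sym (negbTE ij) mulr0 mul0r.
have iw j : (pi j).-integrable setT (EFin \o w j) by exact: (jspan_integrable A_bounded).
have wS : norm1 pi (fun j x => w j x - step_fun S j x) <= e / 4.
  rewrite /norm1 (@le_trans _ _ (\sum_(j < m.+1) eta))//; last first.
    by rewrite sum_share.
  apply: ler_sum => j _; apply: le_trans (wg j).2; rewrite le_eqVlt; apply/orP; left.
  by apply/eqP; apply: eq_Rintegral => x _; rewrite SE distrC.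
have Dr r : 0 <= r -> `|D setT [:: (s, B)] r w -
    fine (P' (bit_event setT [:: (r, B); (s, B)]))| <= e / 4.
  move=> r0; apply: le_trans wS; have := D_step [:: (s, B)] measurableT r0 iw mS.
  rewrite {1}/S big_map /=.
  rewrite (bits_state [:: (r, B); (s, B)] measurableT r0).
  by under [X in _ - X]eq_bigr do rewrite mul1r.
have ps : past Y s setT [:: (s, B)].
  by split=> // tB; rewrite inE => /eqP ->.
have := D_lipschitz wj ps st; rewrite -/K => DL.
have h1 := Dr s s0; have h2 := Dr t t0.
have m1 := @measurable_bits setT [:: (s, B)] measurableT.
have m2 := @measurable_bits setT [:: (t, B)] measurableT.
have -> : P' (bits setT [:: (s, B)] `\` bits setT [:: (t, B)]) =
    (P' (bits setT [:: (s, B)]) - P' (bits setT [:: (s, B)] `&` bits setT [:: (t, B)]))%E.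
  by apply: measureD => //; rewrite ltey_eq fin_num_measure.
rewrite fineB ?fin_num_measure//; last exact: measurableI.
have -> : bits setT [:: (s, B)] `&` bits setT [:: (t, B)] = bits setT [:: (t, B); (s, B)].
  apply/seteqP; split=> [z [[_ /=]]|z [_ /=]]; rewrite ?andbT.
    by move=> h [_]; rewrite /= andbT => h'; split=> //=; rewrite h' h.
  by move=> /andP[h h']; split; split=> //=; rewrite ?h ?h'.
(* The test at [s] is doubled, so that both probabilities contain the bit [(s, B)] on which [D] is
   conditioned. *)
have sE : P' (bits setT [:: (s, B)]) = P' (bits setT [:: (s, B); (s, B)]).
  by rewrite [RHS]P'_merge// setIid.
rewrite sE.
have dK : (t - s) * K <= e / 2.
  apply: (@le_trans _ _ (e / (2 * (K + 1)) * (K + 1))).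
    apply: ler_pM => //; [by rewrite subr_ge0|by rewrite lerBlDl|lra].
  by rewrite invfM mulrA mulfVK// gt_eqF// ltr_wpDl.
move: h1 h2 DL; rewrite !ler_norml => /andP[h1 _] /andP[_ h2] /andP[h3 _]; lra.
Qed.

Lemma process_exists : exists X : R -> path -> E,
  (forall t B, 0 <= t -> mb B ->
    {ae P', forall z, bits setT [:: (t, B)] z <-> B (X t z)}) /\
  (forall d' (S : measurableType d') (c : S -> R) (o : S -> path),
    (forall n B, mb B -> measurable [set s | bits setT [:: (grid n (c s), B)] (o s)]) ->
    measurable_fun setT (fun s => X (c s) (o s) : borel E)).
Proof.
have /choice[mu muP] t : exists mu : probability (borel E) R, 0 <= t ->
  forall B, mb B -> P' (bit_event setT [:: (t, B)]) = mu B /\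
    mu B = (\sum_j fine (P (Y t @^-1` [set j])) * fine (pi j B))%:E.
  have [t0|t0] := pselect (0 <= t); last by exists (pi ord0).
  by have [mu h] := law_exists t0; exists mu.
apply: (@decode_exists _ _ _ _ P' (fun t B => bits setT [:: (t, B)]) mu).
- by move=> t B; exact: measurable_bits.
- by move=> t B t0 mB; have [] := muP t t0 B mB.
- move=> t B B' t0 mB mB'; have mBB' : mb (B `&` B') by exact: measurableI.
  have [<- _] := muP t t0 _ mBB'; rewrite -(P'_merge t B B' [::] measurableT); congr (P' _).
  apply/seteqP; split=> [z [[_ /=]]|z [_ /=]]; rewrite ?andbT.
    by move=> h [_]; rewrite /= andbT => h'; split=> //=; rewrite h' h.
  by move=> /andP[h h']; split; split=> //=; rewrite ?h ?h'.
(* All the laws are mixtures of the finitely many [pi j], so continuity at the empty set is uniform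
   in time. *)
- move=> V mV VS V0 e e0.
  have e1 : 0 < e / m.+1%:R by rewrite divr_gt0.
  have /choice[k kP] j : exists k, forall n, (k <= n)%N -> fine (pi j (V n)) <= e / m.+1%:R.
    have cV : pi j \o V @ \oo --> pi j (\bigcap_n V n).
      apply: nonincreasing_cvg_mu => //.
      - by rewrite ltey_eq fin_num_measure.
      - exact: bigcapT_measurable.
      - move=> k l kl; apply/subsetPset; rewrite -(subnK kl).
        by elim: (l - k)%N => [//|i IH] x /VS; exact: IH.
    rewrite V0 measure0 in cV.
    have /fine_cvgP[_ /cvgrPdist_le/(_ _ e1)[k _ kP]] := cV.
    exists k => l kl; have := kP l kl.
    by rewrite /= sub0r normrN; exact: le_trans (ler_norm _).
  exists (\max_j k j) => t t0; have [_ ->] := muP t t0 _ (mV (\max_j k j)).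
  apply: (@le_trans _ _ (\sum_(j < m.+1) e / m.+1%:R)).
    apply: ler_sum => j _; rewrite -[leRHS]mul1r.
    apply: ler_pM; rewrite ?fine_ge0//; last by apply: kP; exact: leq_bigmax.
    by rewrite -lee_fin fineK ?probability_le1 ?fin_num_measure//; exact: (state_measurable Y_markov).
  by rewrite sum_share.
- exact: modulus.
- exact: E_separable.
Qed.

End bit_process.

Lemma ae_measureE {R : realType} {d} {Om : measurableType d} (P : probability Om R)
    (V W : set Om) : measurable V -> measurable W ->
  {ae P, forall z, V z <-> W z} -> P V = P W.
Proof.
move=> mV mW VW; apply/eqP; rewrite eq_le; apply/andP; split; apply: ae_le => //.
  by apply: filterS VW => z [].
by apply: filterS VW => z [].
Qed.

Section clamped_times.
Context {R : realType}.

(** Makes a process on [[0, t]] total in time, so that its measurability can be stated on a whole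
    product space. *)
Definition clamp (t r : R) : R := Num.max 0 (Num.min r t).

Lemma clamp_ge0 t r : 0 <= clamp t r.
Proof. by rewrite le_max lexx. Qed.

Lemma clamp_le t r : 0 <= t -> clamp t r <= t.
Proof. by move=> t0; rewrite ge_max t0 ge_min lexx orbT. Qed.

Lemma clampE t r : 0 <= r -> r <= t -> clamp t r = r.
Proof. by move=> r0 rt; rewrite /clamp min_l// max_r. Qed.

Lemma measurable_clamp t : measurable_fun setT (clamp t : measurableTypeR R -> measurableTypeR R).
Proof.
apply: measurable_maxr; first exact: measurable_cst.
by apply: measurable_minr => //; exact: measurable_id.
Qed.

Lemma grid_itv n k (c : R) : k%:R * tick n <= c -> c < k.+1%:R * tick n ->
  grid n c = k%:R * tick n.
Proof.
move=> h1 h2; rewrite /grid; congr (_ * _).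
rewrite (_ : Num.floor (c * 2 ^+ n) = k%:Z) ?mulrz_nat//; apply: floor_def.
rewrite -ler_pdivrMr ?exprn_gt0// -[k%:~R]/(k%:R) h1 /=.
by rewrite -ltr_pdivlMr ?exprn_gt0// intrD -[k%:~R]/(k%:R) natr1.
Qed.

Lemma grid_nat n (c : R) : 0 <= c ->
  exists k, k%:R * tick n <= c /\ c < k.+1%:R * tick n.
Proof.
move=> c0; have f0 : 0 <= Num.floor (c * 2 ^+ n).
  by rewrite floor_ge0 mulr_ge0// exprn_ge0.
exists `|Num.floor (c * 2 ^+ n)|%N; split.
  by rewrite natr_absz ger0_norm//; exact: grid_le.
by rewrite -addn1 natrD natr_absz ger0_norm// mulrDl mul1r; exact: grid_gt.
Qed.

Lemma measurable_dyadic {d} {S : measurableType d} t n (F : nat -> set S) : 0 <= t ->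
  (forall k, k%:R * tick n <= t -> measurable (F k)) ->
  measurable [set s : measurableTypeR R * S | exists k,
    [/\ k%:R * tick n <= clamp t s.1, clamp t s.1 < k.+1%:R * tick n & F k s.2]].
Proof.
move=> t0 mF.
rewrite (_ : [set s | _] = \bigcup_(k in [set k | k%:R * tick n <= t])
    ((clamp t @^-1` `[k%:R * tick n, k.+1%:R * tick n[) `*` F k)).
  apply: bigcup_measurable => k kt; apply: measurableX; last exact: mF.
  rewrite -[X in measurable X]setTI; apply: measurable_clamp => //; exact: measurable_itv.
apply/seteqP; split=> [s [k [h1 h2 Fk]]|s [k _ [/=]]].
  exists k; first exact: le_trans h1 (clamp_le _ t0).
  by split=> //=; rewrite in_itv /= h1.
by rewrite in_itv /= => /andP[h1 h2] Fk; exists k.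
Qed.

End clamped_times.

Lemma measurable_section {E : ptopologicalType} {m : nat} j (B : set (borel (E * 'I_m.+1)%type)) : measurable B ->
  measurable ([set x | B (x, j)] : set (borel E)).
Proof.
have mp : measurable_fun setT ((fun x => (x, j)) : borel E -> borel (E * 'I_m.+1)%type).
  apply: (@measurability _ _ (borel E) (borel (E * 'I_m.+1)%type) setT _
    (@open (E * 'I_m.+1)%type)) => //.
  move=> _ [] O oO <-; rewrite setTI; apply: sub_sigma_algebra.
  have cp : continuous (fun x : E => (x, j)).
    move=> x V [[V1 V2] /= [h1 h2] h]; apply: filterS h1 => y0 V1y.
    by apply: h; split=> //=; exact: nbhs_singleton h2.
  by move/continuousP : cp; apply.
by move=> mB; rewrite -[X in measurable X]setTI; exact: mp.
Qed.

Section finite_state.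
Context {R : realType} {E : ptopologicalType} {m : nat} {d} {S : measurableType d}.
Variables (X : S -> E) (y : S -> 'I_m.+1).
Hypotheses (mX : measurable_fun setT (X : S -> borel E))
  (my : forall j, measurable (y @^-1` [set j])).

Lemma measurable_pair_state :
  measurable_fun setT ((fun s => (X s, y s)) : S -> borel (E * 'I_m.+1)%type).
Proof.
move=> _ B mB; rewrite setTI.
rewrite (_ : _ @^-1` B = \bigcup_(j in [set: 'I_m.+1])
    (y @^-1` [set j] `&` X @^-1` [set x | B (x, j)])).
  apply: fin_bigcup_measurable => [|j _]; first exact: finite_finset.
  apply: measurableI; first exact: my.
  rewrite -[X in measurable X]setTI; apply: mX => //; exact: measurable_section.
apply/seteqP; split=> [s Bs|s [j _ [/= <-]]//].
by exists (y s).
Qed.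

Lemma measurable_state_fun (phi : 'I_m.+1 -> E -> R) :
  (forall j, measurable_fun setT (phi j : borel E -> R)) ->
  measurable_fun setT (fun s => phi (y s) (X s)).
Proof.
move=> mphi _ B mB; rewrite setTI.
rewrite (_ : _ @^-1` B = \bigcup_(j in [set: 'I_m.+1])
    (y @^-1` [set j] `&` X @^-1` (phi j @^-1` B))).
  apply: fin_bigcup_measurable => [|j _]; first exact: finite_finset.
  apply: measurableI; first exact: my.
  rewrite -[X in measurable X]setTI; apply: mX => //.
  by rewrite -[X in measurable X]setTI; exact: mphi.
apply/seteqP; split=> [s Bs|s [j _ [/= <-]]//].
by exists (y s).
Qed.

End finite_state.

(** Over [n] equal steps of an interval of length [L] the increments add up to at most
    [L * (e + L * K / n)], which is arbitrarily small. *)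
Lemma quasi_constant {R : realType} (Phi : R -> R) s t : s <= t ->
  (forall e, 0 < e -> exists2 K, 0 <= K & forall r r', s <= r -> r <= r' -> r' <= t ->
    `|Phi r' - Phi r| <= (r' - r) * (e + (r' - r) * K)) ->
  Phi t = Phi s.
Proof.
move=> st h; apply/eqP; rewrite -subr_eq0 -normr_le0; apply/ler_addgt0Pl => e e0.
rewrite addr0; pose L := t - s; have L0 : 0 <= L by rewrite subr_ge0.
have L1 : 0 < 2 * (L + 1) by rewrite mulr_gt0// ltr_wpDl.
have e1 : 0 < e / (2 * (L + 1)) by exact: divr_gt0.
have [K K0 hK] := h _ e1.
pose n := Num.bound (L * K / (e / (2 * (L + 1)))).
have n0 : (0 : R) < n.+1%:R by [].
pose r i : R := s + i%:R * (L / n.+1%:R).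
have r0 : r 0%N = s by rewrite /r mul0r addr0.
have rn : r n.+1 = t by rewrite /r mulrCA divff ?mulr1 ?pnatr_eq0// /L addrC subrK.
have dr i : r i.+1 - r i = L / n.+1%:R by rewrite /r -natr1; ring.
have d0 : 0 <= L / n.+1%:R by rewrite divr_ge0.
have rs i : s <= r i by rewrite lerDl mulr_ge0.
have rt i : (i <= n.+1)%N -> r i <= t.
  by move=> ir; rewrite -rn lerD2l ler_wpM2r// ler_nat.
have step i : (i < n.+1)%N -> `|Phi (r i.+1) - Phi (r i)| <=
    L / n.+1%:R * (e / (2 * (L + 1)) + e / (2 * (L + 1))).
  move=> ir; have rr : r i <= r i.+1 by rewrite -subr_ge0 dr.
  apply: le_trans (hK _ _ (rs i) rr (rt _ ir)) _; rewrite dr ler_wpM2l// lerD2l.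
  rewrite mulrAC ler_pdivrMr// [leRHS]mulrC -ler_pdivrMr//.
  apply: (le_trans (ltW (archi_boundP _))); last by rewrite ler_nat.
  by apply: divr_ge0; [exact: mulr_ge0|exact: ltW].
have sum k : (k <= n.+1)%N -> `|Phi (r k) - Phi s| <=
    k%:R * (L / n.+1%:R * (e / (2 * (L + 1)) + e / (2 * (L + 1)))).
  elim: k => [_|k IH kn]; first by rewrite r0 subrr normr0 mul0r.
  rewrite -[Phi (r k.+1) - _](subrKA (Phi (r k))) -natr1 mulrDl mul1r [leRHS]addrC.
  by apply: (le_trans (ler_normD _ _)); apply: lerD; [exact: step|exact/IH/ltnW].
have := sum n.+1 (leqnn _); rewrite rn => /le_trans; apply.
rewrite mulrA (mulrCA n.+1%:R) divff ?mulr1 ?pnatr_eq0//.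
apply: (@le_trans _ _ ((L + 1) * (e / (2 * (L + 1)) + e / (2 * (L + 1))))).
  by rewrite ler_wpM2r ?addr_ge0 ?ltW// ltr_pwDr.
have L2 : L + 1 != 0 by rewrite gt_eqF// ltr_wpDl.
by rewrite le_eqVlt; apply/orP; left; apply/eqP; field.
Qed.

Section event_integral.
Context {R : realType} {d} {Om : measurableType d}.
Variable (P : probability Om R).
Implicit Types (V : set Om) (f : Om -> R).

Definition event_int V f : R := \int[P]_z (\1_V z * f z).

Lemma event_integrable V f : measurable V -> P.-integrable setT (EFin \o f) ->
  P.-integrable setT (fun z => (\1_V z * f z)%:E).
Proof.
move=> mV fi; have mf := measurable_int _ fi.
apply: (le_integrable _ _ _ fi) => //.
  apply/measurable_EFinP; apply: measurable_funM; first exact: measurable_indic.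
  exact/measurable_EFinP.
move=> z _ /=; rewrite lee_fin normrM indicE; case: (_ \in _).
  by rewrite normr1 mul1r.
by rewrite normr0 mul0r.
Qed.

Lemma event_intE V f : measurable V -> P.-integrable setT (EFin \o f) ->
  (\int[P]_(z in V) (f z)%:E = (event_int V f)%:E)%E.
Proof.
move=> mV fi; rewrite /event_int /Rintegral fineK; last first.
  exact: integrable_fin_num (event_integrable mV fi).
rewrite [LHS]integral_mkcond; apply: eq_integral => z _.
by rewrite /patch indicE; case: (_ \in _); rewrite ?mul1r ?mul0r.
Qed.

Lemma event_intD V f g : measurable V -> P.-integrable setT (EFin \o f) ->
  P.-integrable setT (EFin \o g) ->
  event_int V (fun z => f z + g z) = event_int V f + event_int V g.
Proof.
move=> mV fi gi; rewrite -[RHS]RintegralD//; [|exact: event_integrable..].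
by apply: eq_Rintegral => z _; rewrite mulrDr.
Qed.

Lemma event_intZ V r f : measurable V -> P.-integrable setT (EFin \o f) ->
  event_int V (fun z => r * f z) = r * event_int V f.
Proof.
move=> mV fi; have /= <- := RintegralZl r measurableT (event_integrable mV fi).
by apply: eq_Rintegral => z _; rewrite mulrCA.
Qed.

Lemma event_intB V f g : measurable V -> P.-integrable setT (EFin \o f) ->
  P.-integrable setT (EFin \o g) ->
  event_int V (fun z => f z - g z) = event_int V f - event_int V g.
Proof.
move=> mV fi gi; rewrite -[RHS]RintegralB//; [|exact: event_integrable..].
by apply: eq_Rintegral => z _; rewrite mulrBr.
Qed.

Lemma event_int_norm V f K : measurable V -> P.-integrable setT (EFin \o f) ->
  (\int[P]_z `|f z|%:E <= K%:E)%E -> `|event_int V f| <= K.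
Proof.
move=> mV fi fK; have iV := event_integrable mV fi.
apply: (le_trans (le_normr_Rintegral measurableT iV)).
have in1 : P.-integrable setT (fun z => `|f z|%:E).
  by have := integrable_norm fi; apply: (eq_integrable measurableT).
rewrite -lee_fin; apply: le_trans fK; rewrite /Rintegral fineK; last first.
  by have := integrable_fin_num measurableT (integrable_norm iV).
apply: ge0_le_integral => //.
- by have := measurable_int _ (integrable_norm iV).
- exact: measurable_int in1.
move=> z _; rewrite lee_fin normrM indicE; case: (_ \in _).
  by rewrite normr1 mul1r.
by rewrite normr0 mul0r.
Qed.

Lemma event_int_indic V W : measurable V -> measurable W ->
  event_int V \1_W = fine (P (V `&` W)).
Proof.
move=> mV mW; rewrite /event_int (_ : (fun z => _) = \1_(V `&` W)); last first.
  by rewrite indicI.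
by rewrite /Rintegral integral_indic ?setIT//; exact: measurableI.
Qed.

End event_integral.

Lemma integral_eq_dynkin {R : realType} {d} {Om : measurableType d}
    (P : probability Om R) (G : set_system Om) (f g : Om -> R) :
  setI_closed G -> G setT -> <<s G>> `<=` measurable ->
  P.-integrable setT (EFin \o f) -> P.-integrable setT (EFin \o g) ->
  (forall V, G V -> event_int P V f = event_int P V g) ->
  forall V, <<s G>> V -> (\int[P]_(z in V) (f z)%:E = \int[P]_(z in V) (g z)%:E)%E.
Proof.
move=> GI GT mG fi gi fg V.
have fgT := fg _ GT.
apply: (@dynkin_induction _ (g_sigma_algebraType G) G
  [set V | (\int[P]_(z in V) (f z)%:E = \int[P]_(z in V) (g z)%:E)%E]) => //=.
- by rewrite !event_intE// fgT.
- move=> W GW /=; have mW : measurable (W : set Om) by apply: mG; exact: sub_sigma_algebra.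
  by rewrite !event_intE// fg.
- move=> W /mG mW; rewrite !event_intE//; last 2 first.
  + exact: measurableC.
  + exact: measurableC.
  move=> [fgW]; congr (_%:E).
  have compl h : P.-integrable setT (EFin \o h) ->
      event_int P (~` W) h = event_int P setT h - event_int P W h.
    move=> hi; rewrite /event_int -RintegralB//; [|exact: event_integrable..].
    apply: eq_Rintegral => z _; rewrite !indicE in_setT -mulrBl in_setC.
    by case: (z \in W); rewrite ?subrr ?subr0.
  by rewrite !compl// fgT fgW.
- move=> F mF tF fgF.
  have mF' k : measurable (F k : set Om) by apply: mG; exact: mF.
  have mU : d.-measurable (\bigcup_k F k : set Om) by exact: bigcupT_measurable.
  rewrite !integral_bigcup//; first by apply: eq_eseriesr => k _; exact: fgF.
  + exact: (integrableS measurableT).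
  + exact: (integrableS measurableT).
Qed.

Lemma subr_exchange {R : realType} (a b c e : R) : a - c = b - e -> a - b = c - e.
Proof. lra. Qed.

Lemma subr_exchangeB {R : realType} (a b c e f : R) : b - a = f - e ->
  b - c - f = a - c - e.
Proof. lra. Qed.

(** * The decoded process solves the martingale problem *)

Section bit_solution.
Context {R : realType} {E : completeMetricType R} {m : nat}.
Variables (A : operator (R := R) E) (q : 'I_m.+1 -> 'I_m.+1 -> E -> R).
Hypotheses
  (A_bounded : forall f g, A (f, g) -> bounded_continuous f /\ bounded_continuous g)
  (A_separating : separating (domain A)).
Variables (Q : 'M[R]_m.+1) (pi : 'I_m.+1 -> probability (borel E) R).
Hypotheses (Q_row : forall i, \sum_j Q i j = 0)
  (pi_A : forall i f g, A (f, g) ->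
    \int[pi i]_x g x = \sum_j Q i j * \int[pi j]_x f x)
  (q_int : forall i j, i != j -> (pi i).-integrable setT (EFin \o q i j))
  (pi_q : forall i j f, i != j -> bounded_continuous f ->
    \int[pi i]_x (q i j x * f x) = Q i j * \int[pi j]_x f x).
Context {d : measure_display} {Omega : measurableType d}.
Variables (P : probability Omega R) (p : 'I_m.+1 -> R).
Variable Y : R -> Omega -> 'I_m.+1.
Hypotheses (Y_markov : markov_chain P Q p Y) (Y_cadlag : forall w, cadlag (Y ^~ w)).
Local Notation path := (g_sigma_algebraType (@bit_algebra _ Omega (R * set E)%type)).
Variables (P' : probability path R)
  (D : set Omega -> seq (R * set E) -> R -> ('I_m.+1 -> E -> R) -> R).
Local Notation mb B := (measurable (B : set (borel E))).
Local Notation bits C rects := (bit_event C rects : set path).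
Local Notation J := (jump q).
Hypotheses
  (P'_bits0 : forall C, measurable C -> P' (bit_event C [::]) = P C)
  (P'_state : forall C t B, 0 <= t -> natural_filtration Y t C -> mb B ->
    fine (P' (bit_event C [:: (t, B)])) =
    \sum_j fine (P (C `&` Y t @^-1` [set j])) * fine (pi j B))
  (D_lipschitz : forall w gw s t C rects, jspan A w gw -> past Y s C rects -> s <= t ->
    `|D C rects t w - D C rects s w| <= (t - s) * norm1 pi (J w gw))
  (D_drift : forall w gw G gG s t C rects, jspan A w gw -> jspan A G gG ->
    past Y s C rects -> s <= t ->
    `|D C rects t w - D C rects s w - (t - s) * D C rects s G| <=
    (t - s) * (norm1 pi (fun j x => J w gw j x - G j x) + (t - s) * norm1 pi (J G gG)))
  (D_step : forall C rects t w S, measurable C -> 0 <= t ->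
    (forall j, (pi j).-integrable setT (EFin \o w j)) ->
    (forall u, List.In u S -> mb u.2) ->
    `|D C rects t w - \sum_(u <- S) u.1.1 *
        fine (P' (bit_event (C `&` Y t @^-1` [set u.1.2]) ((t, u.2) :: rects)))| <=
    norm1 pi (fun j x => w j x - step_fun S j x)).
Variable X : R -> path -> E.
Hypotheses
  (X_bits : forall t B, 0 <= t -> mb B ->
    {ae P', forall z, bits setT [:: (t, B)] z <-> B (X t z)})
  (X_measurable : forall d' (S : measurableType d') (c : S -> R) (o : S -> path),
    (forall n B, mb B -> measurable [set s | bits setT [:: (grid n (c s), B)] (o s)]) ->
    measurable_fun setT (fun s => X (c s) (o s) : borel E)).

Local Notation state t z := (Y t z.1).

Let m_bits C rects : measurable C -> measurable (bits C rects).
Proof. exact: measurable_bits. Qed.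

Definition past_events s : set_system path :=
  [set V | exists C rects, past Y s C rects /\ V = bits C rects].

(** The filtration of the bits and of [Y], rather than that of the decoded process: it is for such
    events that the drift estimates are known. *)
Definition history s := <<s past_events s>>.

Local Notation pathF t := (g_sigma_algebraType (past_events t)).

Let past_measurable s C (rects : seq (R * set E)) : past Y s C rects -> measurable C.
Proof. by move=> [_ FC _]; exact: (natural_filtration_measurable Y_markov FC). Qed.

Let past_setT t : natural_filtration Y t setT.
Proof.
by have [n0 nC _] := natural_filtration_sigma Y t; have := nC _ n0; rewrite setD0.
Qed.

Let pastS s t C (rects : seq (R * set E)) : past Y s C rects -> s <= t -> past Y t C rects.
Proof.
move=> [s0 FC h] st; split; first exact: le_trans st.
  exact: natural_filtrationS FC.
by move=> tB /h[h1 h2]; split=> //; exact: le_trans st.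
Qed.

Lemma past_events_setI s : setI_closed (past_events s).
Proof.
move=> _ _ [C [r [[s0 FC h] ->]]] [C' [r' [[_ FC' h'] ->]]].
exists (C `&` C'), (r ++ r'); split.
  split=> //; first exact: natural_filtrationI.
  by move=> tB; rewrite mem_cat => /orP[/h|/h'].
apply/seteqP; split=> [z [[Cz hz] [C'z hz']]|z [[Cz C'z]]].
  by split=> //=; rewrite all_cat hz hz'.
by rewrite /= all_cat => /andP[hz hz'].
Qed.

Lemma history_filtration : filtration history.
Proof.
split=> [t _|t _|s t s0 st].
- exact: smallest_sigma_algebra.
- apply: smallest_sub; first exact: sigma_algebra_measurable.
  by move=> _ [C [r [h ->]]]; apply: m_bits; exact: past_measurable h.
- apply: sub_smallest2r; first exact: smallest_sigma_algebra.
  by move=> _ [C [r [h ->]]]; exists C, r; split=> //; exact: pastS h st.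
Qed.

Let pathF_state t r j : 0 <= r -> r <= t ->
  measurable ([set z : pathF t | state r z = j] : set (pathF t)).
Proof.
move=> r0 rt; apply: sub_sigma_algebra; exists (Y r @^-1` [set j]), [::]; split.
  by split=> //; [exact: le_trans rt|exact: natural_filtration_state].
by apply/seteqP; split=> [z|z []].
Qed.

Let pathF_bit t r B : 0 <= r -> r <= t ->
  measurable ([set z : pathF t | bits setT [:: (r, B)] z] : set (pathF t)).
Proof.
move=> r0 rt; apply: sub_sigma_algebra; exists setT, [:: (r, B)]; split=> //.
by split=> // [|tB]; [exact: le_trans rt|rewrite inE => /eqP ->].
Qed.

(** At each level the clamped time lies in a dyadic interval whose left end is at most [t], so
    decoding reads only bits that belong to [history t]. *)
Lemma X_progressive t : 0 <= t ->
  measurable_fun setT (fun s : measurableTypeR R * pathF t => X (clamp t s.1) s.2 : borel E).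
Proof.
move=> t0; apply: (@X_measurable _ (measurableTypeR R * pathF t)%type (fun s => clamp t s.1) snd) => n B mB.
pose F k : set (pathF t) := [set z | bits setT [:: (k%:R * tick n : R, B)] z].
have mF k : k%:R * tick n <= t -> measurable (F k).
  by move=> kt; apply: pathF_bit => //; rewrite mulr_ge0// ltW// tick_gt0.
have := measurable_dyadic t0 mF; congr measurable.
apply/seteqP; split=> [s [k [h1 h2]]|s /= h]; first by rewrite /F /= (grid_itv h1 h2).
have [k [h1 h2]] := grid_nat n (clamp_ge0 t s.1).
by exists k; split=> //; rewrite /F /= -(grid_itv h1 h2).
Qed.

(** Right continuity calls for an approximation from the right, and the next dyadic time may exceed
    [t]. Cutting it at [t] keeps it in the past; when the clamped time is [t] itself the cut time is
    exact. *)
Lemma state_progressive t j : 0 <= t ->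
  measurable [set s : measurableTypeR R * pathF t | state (clamp t s.1) s.2 = j].
Proof.
move=> t0; pose later k n : R := Num.min t (k.+1%:R * tick n).
have later0 k n : 0 <= later k n.
  by rewrite le_min t0 mulr_ge0// ltW// tick_gt0.
have later_t k n : later k n <= t by rewrite ge_min lexx.
rewrite (_ : [set s | _] = \bigcup_N \bigcap_(n in [set n | (N <= n)%N])
  [set s : measurableTypeR R * pathF t | exists k,
    [/\ k%:R * tick n <= clamp t s.1, clamp t s.1 < k.+1%:R * tick n &
        state (later k n) s.2 = j]]).
  apply: bigcupT_measurable => N; apply: bigcap_measurable => [|n _]; first by exists N => /=.
  by apply: (@measurable_dyadic R _ (pathF t) t n (fun k => [set z | state (later k n) z = j])) => // k _; exact: pathF_state.
have right_cont (s : measurableTypeR R * pathF t) : exists N, forall n, (N <= n)%N -> forall k, k%:R * tick n <= clamp t s.1 ->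
    clamp t s.1 < k.+1%:R * tick n -> state (later k n) s.2 = state (clamp t s.1) s.2.
  have [ct|tc] := ltP (clamp t s.1) t; last first.
    exists 0%N => n _ k h1 h2; have cE : clamp t s.1 = t.
      by apply/eqP; rewrite eq_le tc clamp_le.
    by rewrite /later cE min_l// -{1}cE ltW.
  have [Yr _] := Y_cadlag s.2.1.
  have : \forall u \near (clamp t s.1)^'+, Y u s.2.1 = Y (clamp t s.1) s.2.1.
    by apply: (Yr _ (clamp_ge0 _ _) [set Y (clamp t s.1) s.2.1]).
  case=> del /= del0 h; have [N NP] := tick_small (divr_gt0 del0 (ltr0Sn R 1)).
  exists N => n Nn k h1 h2; have lc : clamp t s.1 < later k n by rewrite lt_min ct.
  apply: h => //=; rewrite ltr0_norm ?subr_lt0// opprB.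
  have : later k n <= k.+1%:R * tick n by rewrite ge_min lexx orbT.
  rewrite -natr1 mulrDl mul1r => h3.
  have := NP n Nn; have := del0; rewrite /= in h1 *; lra.
apply/seteqP; split=> [s /= sj|s [N _ h]].
  have [N NP] := right_cont s; exists N => // n /= Nn.
  have [k [h1 h2]] := grid_nat n (clamp_ge0 t s.1).
  by exists k; split=> //; rewrite (NP n Nn).
have [M MP] := right_cont s.
have [k [h1 h2 /=]] := h (maxn N M) (leq_maxl _ _).
by rewrite (MP _ (leq_maxr N M) k h1 h2).
Qed.

Lemma X_adapted t : 0 <= t -> measurable_fun setT (X t : pathF t -> borel E).
Proof.
move=> t0; have := measurableT_comp (X_progressive t0) (@measurable_pair1 _ _ (measurableTypeR R) (pathF t) t).
by apply: eq_measurable_fun => z _ /=; rewrite clampE.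
Qed.

Lemma X_random t : 0 <= t -> measurable_fun setT (X t : path -> borel E).
Proof.
move=> t0 _ B mB; have [_ h _] := history_filtration; rewrite setTI.
by apply: (h t t0); have := X_adapted t0 measurableT mB; rewrite setTI.
Qed.

Let state_random t j : 0 <= t -> measurable ([set z : path | state t z = j] : set path).
Proof.
move=> t0; have [_ h _] := history_filtration.
by apply: (h t t0); exact: pathF_state.
Qed.

Lemma law_event C t B : 0 <= t -> natural_filtration Y t C -> mb B ->
  fine (P' (bits C [::] `&` X t @^-1` B)) =
  \sum_j fine (P (C `&` Y t @^-1` [set j])) * fine (pi j B).
Proof.
move=> t0 FC mB; rewrite -(P'_state t0 FC mB); congr fine.
have mC := natural_filtration_measurable Y_markov FC.
have mX : measurable (X t @^-1` B) by rewrite -[X in measurable X]setTI; exact: X_random.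
apply: ae_measureE; [by apply: measurableI => //; exact: m_bits|exact: m_bits|].
apply: filterS (X_bits t0 mB) => z XB; split=> [[[Cz _] Bz]|[Cz /= h]].
  by split=> //; have [] := XB.2 Bz.
by split=> //; apply/XB; split.
Qed.

Lemma law_state t j B : 0 <= t -> mb B ->
  P' ([set z : path | state t z = j] `&` X t @^-1` B) =
  ((fine (P (Y t @^-1` [set j])))%:E * pi j B)%E.
Proof.
move=> t0 mB; have Fj : natural_filtration Y t (Y t @^-1` [set j]) by exact: natural_filtration_state.
have mX : measurable (X t @^-1` B) by rewrite -[X in measurable X]setTI; exact: X_random.
have := law_event t0 Fj mB.
rewrite (_ : bits (Y t @^-1` [set j]) [::] = [set z : path | state t z = j]); last first.
  by apply/seteqP; split=> [z []|z].
rewrite (bigD1 j)//= setIid big1 ?addr0 => [h|i ij]; last first.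
  rewrite (_ : _ `&` _ = set0) ?measure0 ?mul0r//.
  by apply/seteqP; split=> // w [/= -> /eqP]; rewrite eq_sym (negbTE ij).
rewrite -[LHS]fineK; last first.
  by rewrite fin_num_measure//; apply: measurableI => //; exact: state_random.
by rewrite h EFinM; congr (_ * _)%E; rewrite fineK// fin_num_measure.
Qed.

(** On the event that the state is [j], the law of [X t] is [pi j] times the probability of that
    state, which is at most 1. L1 estimates under the [pi j] thus hold for the process at every
    time. *)
Lemma state_integral_le t (phi : 'I_m.+1 -> E -> R) : 0 <= t ->
  (forall j, (pi j).-integrable setT (EFin \o phi j)) ->
  (\int[P']_z `|phi (state t z) (X t z)|%:E <= (norm1 pi phi)%:E)%E.
Proof.
move=> t0 iphi; have mphi j := measurable_int _ (iphi j).
have mnphi j : measurable_fun setT (fun x : borel E => `|phi j x|%:E).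
  by apply/measurable_EFinP; apply: measurableT_comp => //; apply/measurable_EFinP; exact: mphi.
have h j : (\int[P']_z (`|phi j (X t z)|%:E * (\1_[set z : path | state t z = j] z)%:E) =
    (fine (P (Y t @^-1` [set j])))%:E * \int[pi j]_x `|phi j x|%:E)%E.
  apply: (ge0_integral_event_law (state_random j t0) (X_random t0) _ _ (mnphi j)) => //.
    exact: fine_ge0.
  by move=> B mB; exact: law_state.
have -> : (\int[P']_z `|phi (state t z) (X t z)|%:E =
    \int[P']_z \sum_j (`|phi j (X t z)|%:E * (\1_[set z : path | state t z = j] z)%:E))%E.
  apply: eq_integral => z _; rewrite (bigD1 (state t z))//= big1 ?adde0.
    by rewrite indicE mem_set// mule1.
  by move=> j jz; rewrite indicE memNset ?mule0// => /esym /eqP; rewrite (negbTE jz).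
rewrite ge0_integral_sum//; last first.
  move=> j; apply: emeasurable_funM.
    by apply: (measurableT_comp (mnphi j)); exact: X_random.
  by apply/measurable_EFinP; apply: measurable_indic; exact: state_random.
rewrite /norm1 -sumEFin; apply: lee_sum => j _; rewrite h.
have fi : (\int[pi j]_x `|phi j x|%:E)%E \is a fin_num.
  by have := integrable_fin_num measurableT (integrable_norm (iphi j)).
rewrite /Rintegral (fineK fi) -[leRHS]mul1e.
apply: lee_wpmul2r; first by apply: integral_ge0.
have mj := state_measurable Y_markov j t0.
by rewrite fineK ?fin_num_measure//; exact: probability_le1.
Qed.

Lemma state_measurable_fun t (phi : 'I_m.+1 -> E -> R) : 0 <= t ->
  (forall j, measurable_fun setT (phi j : borel E -> R)) ->
  measurable_fun setT (fun z : path => phi (state t z) (X t z)).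
Proof.
move=> t0 mphi; apply: (measurable_state_fun (X_random t0) _ mphi) => j.
exact: state_random.
Qed.

Lemma state_integrable t (phi : 'I_m.+1 -> E -> R) : 0 <= t ->
  (forall j, (pi j).-integrable setT (EFin \o phi j)) ->
  P'.-integrable setT (fun z => (phi (state t z) (X t z))%:E).
Proof.
move=> t0 iphi; apply/integrableP; split.
  apply/measurable_EFinP; apply: (state_measurable_fun t0) => j.
  by apply/measurable_EFinP; exact: measurable_int (iphi j).
exact: le_lt_trans (state_integral_le t0 iphi) (ltry _).
Qed.

Let bm_state t (w : 'I_m.+1 -> E -> R) : 0 <= t -> (forall j, bounded_measurable (w j)) ->
  P'.-integrable setT (fun z => (w (state t z) (X t z))%:E).
Proof. by move=> t0 bw; apply: state_integrable => // j; exact: bm_integrable. Qed.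

Let state_bits C rects t j B : measurable C -> 0 <= t -> mb B ->
  P' (bits (C `&` Y t @^-1` [set j]) ((t, B) :: rects)) =
  P' (bits C rects `&` ([set z : path | state t z = j] `&` X t @^-1` B)).
Proof.
move=> mC t0 mB; have mX : measurable (X t @^-1` B).
  by rewrite -[X in measurable X]setTI; exact: X_random.
have mj := state_random j t0.
apply: ae_measureE.
- by apply: m_bits; apply: measurableI => //; exact: (state_measurable Y_markov).
- by apply: measurableI; [exact: m_bits|exact: measurableI].
apply: filterS (X_bits t0 mB) => z XB; split=> [[[Cz Yz] /= /andP[Bz rz]]|[[Cz rz] [Yz Bz]]].
  by split=> //; split=> //; apply/XB; split=> //=; rewrite Bz.
split; first by split.
by rewrite /= rz andbT; have [_ /=] := XB.2 Bz; rewrite andbT.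
Qed.

Let step_fun_expectation C rects t S : measurable C -> 0 <= t ->
  (forall u, List.In u S -> mb u.2) ->
  event_int P' (bits C rects) (fun z => step_fun S (state t z) (X t z)) =
  \sum_(u <- S) u.1.1 *
    fine (P' (bit_event (C `&` Y t @^-1` [set u.1.2]) ((t, u.2) :: rects))).
Proof.
move=> mC t0; elim: S => [_|u S IH mS].
  rewrite big_nil /event_int (_ : (fun z => _) = cst 0) ?Rintegral_cst ?mul0r//.
  by apply/funext => z /=; rewrite /step_fun big_nil mulr0.
have mH := m_bits rects mC.
have mu : mb u.2 by apply: mS; left.
have mX : measurable (X t @^-1` u.2) by rewrite -[X in measurable X]setTI; exact: X_random.
pose V := [set z : path | state t z = u.1.2] `&` X t @^-1` u.2.
have mV : measurable V by apply: measurableI => //; exact: state_random.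
have iV : P'.-integrable setT (EFin \o (\1_V : path -> R)).
  apply: (@bounded_integrable _ _ _ P' _ 1) => [|x]; first exact: measurable_indic.
  by rewrite indicE; case: (_ \in _); rewrite ?normr1 ?normr0.
have mS' v : List.In v S -> mb v.2 by move=> vS; apply: mS; right.
have iS : P'.-integrable setT (EFin \o (fun z => step_fun S (state t z) (X t z))).
  by apply: state_integrable => // j; exact: step_fun_integrable.
have iuV : P'.-integrable setT (EFin \o (fun z => u.1.1 * \1_V z)).
  by have := integrableZl measurableT u.1.1 iV; apply: (eq_integrable measurableT).
rewrite big_cons -IH// state_bits// -event_int_indic// -event_intZ// -event_intD//.
apply: eq_Rintegral => z _; congr (_ * _); rewrite /step_fun big_cons; congr (_ + _).
rewrite -mulrA; congr (_ * _); rewrite -natrM mulnb /=; congr (nat_of_bool _)%:R.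
by apply/andP/idP => [[/eqP zu /set_mem h]|/set_mem[/= -> /mem_set h]]; [apply/mem_set|rewrite eqxx].
Qed.

(** For a step function the bit probabilities are expectations of the process by [X_bits], and
    [D_step] compares [D] with them; bounded functions are uniform limits of step functions. *)
Lemma D_expectation C rects t w : measurable C -> 0 <= t ->
  (forall j, bounded_measurable (w j)) ->
  D C rects t w = event_int P' (bits C rects) (fun z => w (state t z) (X t z)).
Proof.
move=> mC t0 bw; apply/eqP; rewrite -subr_eq0 -normr_le0; apply/ler_addgt0Pl => e e0.
(* One share of [e] for each of the [m.+1] states in the L1 error, and one for the error of the
   expectation. *)
rewrite addr0; have e1 : 0 < e / m.+2%:R by exact: divr_gt0.
have [S [mS wS]] := step_approx bw e1.
have iw j : (pi j).-integrable setT (EFin \o w j) by exact: bm_integrable.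
have iS j : (pi j).-integrable setT (EFin \o step_fun S j) by exact: step_fun_integrable.
have iwS j : (pi j).-integrable setT (EFin \o (fun x => w j x - step_fun S j x)).
  by have := integrableB measurableT (iw j) (iS j); apply: (eq_integrable measurableT).
have wS1 : norm1 pi (fun j x => w j x - step_fun S j x) <= \sum_(j < m.+1) e / m.+2%:R.
  apply: ler_sum => j _.
  have <- : \int[pi j]_x (e / m.+2%:R) = e / m.+2%:R by exact: probability_Rintegral_cst.
  apply: le_Rintegral => //.
  - by have := integrable_norm (iwS j); apply: (eq_integrable measurableT).
  - exact: (@bounded_integrable _ _ _ (pi j) _ `|e / m.+2%:R|).
have h1 := le_trans (D_step rects mC t0 iw mS) wS1.
rewrite -step_fun_expectation// in h1.
have mH := m_bits rects mC.
have h2 : `|event_int P' (bits C rects) (fun z => w (state t z) (X t z)) -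
    event_int P' (bits C rects) (fun z => step_fun S (state t z) (X t z))| <= e / m.+2%:R.
  have i1 := state_integrable t0 iw; have i2 := state_integrable t0 iS.
  rewrite -event_intB//; apply: event_int_norm => //.
    by have := integrableB measurableT i1 i2; apply: (eq_integrable measurableT).
  rewrite (@le_trans _ _ (\int[P']_z (e / m.+2%:R)%:E)%E)//; last first.
    rewrite integral_cst// -[leRHS]mule1; apply: lee_wpmul2l; last exact: probability_le1.
    by rewrite lee_fin ltW.
  apply: ge0_le_integral => //.
  - apply/measurable_EFinP; apply: measurableT_comp => //.
    by apply: measurable_funB; apply/measurable_EFinP; [exact: measurable_int i1|exact: measurable_int i2].
  - by move=> z _; rewrite lee_fin wS.
have eE : e = \sum_(j < m.+1) e / m.+2%:R + e / m.+2%:R.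
  by rewrite -[LHS](sum_share m.+1) big_ord_recr.
rewrite [leRHS]eE -[D _ _ _ _ - _](subrKA
  (event_int P' (bits C rects) (fun z => step_fun S (state t z) (X t z)))).
by apply: (le_trans (ler_normD _ _)); apply: lerD; [exact: h1|rewrite distrC].
Qed.

Let span_bm (w gw : 'I_m.+1 -> E -> R) : jspan A w gw -> forall j, bounded_measurable (w j).
Proof. by move=> wg j; apply: bm_continuous; have [] := span_bounded A_bounded (wg j). Qed.

Let J_int w gw j : jspan A w gw -> (pi j).-integrable setT (EFin \o J w gw j).
Proof. by move=> wg; have [] := jump_pi A_bounded Q_row pi_A q_int pi_q j wg. Qed.

Lemma state_fun_progressive t (phi : 'I_m.+1 -> E -> R) : 0 <= t ->
  (forall j, measurable_fun setT (phi j : borel E -> R)) ->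
  measurable_fun setT (fun s : measurableTypeR R * pathF t =>
    phi (state (clamp t s.1) s.2) (X (clamp t s.1) s.2)).
Proof.
move=> t0 mphi; apply: (measurable_state_fun (X_progressive t0) _ mphi) => j.
exact: state_progressive.
Qed.

Let pathF_id t : 0 <= t -> measurable_fun setT (fun s : measurableTypeR R * path =>
  (s.1, s.2) : measurableTypeR R * pathF t).
Proof.
move=> t0; apply/measurable_fun_pairP; split; first exact: measurable_fst.
have [_ h _] := history_filtration.
move=> _ B mB.
exact: (@measurable_snd _ _ (measurableTypeR R) path measurableT B (h t t0 B mB)).
Qed.

Let flux V w gw t u := event_int P' V
  (fun z => J w gw (state (clamp t u) z) (X (clamp t u) z)).

Let flux_measurable V w gw t : measurable V -> jspan A w gw -> 0 <= t ->
  measurable_fun setT (flux V w gw t : measurableTypeR R -> R).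
Proof.
move=> mV wg t0.
apply: (measurable_Rintegral_param P' (f := fun s : measurableTypeR R * path =>
  \1_V s.2 * J w gw (state (clamp t s.1) s.2) (X (clamp t s.1) s.2))) => //.
apply: measurable_funM.
  have m1 : measurable_fun setT (\1_V : path -> R) by exact: measurable_indic.
  exact: (measurableT_comp m1 (@measurable_snd _ _ (measurableTypeR R) path)).
have mJ j : measurable_fun setT (J w gw j : borel E -> R).
  by apply/measurable_EFinP; exact: measurable_int (J_int j wg).
exact: (measurableT_comp (state_fun_progressive t0 mJ) (pathF_id t0)).
Qed.

Let flux_le V w gw t u : measurable V -> jspan A w gw -> `|flux V w gw t u| <= norm1 pi (J w gw).
Proof.
move=> mV wg; have c0 := clamp_ge0 t u.
by apply: event_int_norm => //; [apply: state_integrable|apply: state_integral_le] => // j; exact: J_int.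
Qed.

Let flux_integrable V w gw t : measurable V -> jspan A w gw -> 0 <= t ->
  lebesgue_measure.-integrable `[0, t] (EFin \o flux V w gw t).
Proof.
move=> mV wg t0; apply: measurable_bounded_integrable => //.
- by rewrite /= lebesgue_measure_itv /=; case: ifP => _; rewrite ?ltry// -EFinB ltry.
- by apply: measurable_funTS; exact: flux_measurable.
exists (norm1 pi (J w gw)); split; first by rewrite num_real.
by move=> x Kx u _ /=; apply: le_trans (ltW Kx); exact: flux_le.
Qed.

(** The difference of the two sides, as a function of the end time, falls under [quasi_constant]. On
    a short interval [D_drift] compares the increment of [D] with a span element [G] that is
    L1-close to [J w gw], and the Lipschitz bound compares the integral of the flux with the same
    quantity; the two errors explain the constant [2 * K]. *)
Lemma drift_integral C rects w gw s t : jspan A w gw -> past Y s C rects -> s <= t ->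
  D C rects t w - D C rects s w =
  \int[lebesgue_measure]_(u in `[0, t]) flux (bits C rects) w gw t u -
  \int[lebesgue_measure]_(u in `[0, s]) flux (bits C rects) w gw t u.
Proof.
move=> wg sC st; have [s0 _ _] := sC; have t0 := le_trans s0 st.
have mC := past_measurable sC; have mV := m_bits rects mC.
pose b := flux (bits C rects) w gw t.
have ib := flux_integrable mV wg t0.
pose Phi r := D C rects r w - \int[lebesgue_measure]_(u in `[0, r]) b u.
suff : Phi t = Phi s by exact: subr_exchange.
apply: quasi_constant => // e e0.
have e1 : 0 < e / 2 / m.+1%:R by rewrite !divr_gt0.
have /choice[G /choice[gG Gg]] j : exists G gG, span A G gG /\
    \int[pi j]_x `|J w gw j x - G x| <= e / 2 / m.+1%:R.
  by have [G [gG [? ?]]] := span_dense A_bounded A_separating (J_int j wg) e1; exists G, gG.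
have Gj : jspan A G gG by move=> j; exact: (Gg j).1.
have GE : norm1 pi (fun j x => J w gw j x - G j x) <= e / 2.
  by rewrite -[leRHS](sum_share m); apply: ler_sum => j _; exact: (Gg j).2.
pose K := norm1 pi (J G gG).
have K0 : 0 <= K by apply: sumr_ge0 => j _; exact: Rintegral_ge0.
exists (2 * K); first by rewrite mulr_ge0.
move=> r r' sr rr rt; have r0 := le_trans s0 sr; have r'0 := le_trans r0 rr.
have rC := pastS sC sr.
have ib' : lebesgue_measure.-integrable `[0, r'] (EFin \o b).
  apply: (integrableS _ _ _ ib) => // u /=.
  by rewrite !in_itv /= => /andP[-> /= ur]; exact: le_trans rt.
have d1 : \int[lebesgue_measure]_(u in `[0, r']) b u - \int[lebesgue_measure]_(u in `[0, r]) b u =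
    \int[lebesgue_measure]_(u in `]r, r']) b u.
  by apply: Rintegral_itvB => //; rewrite bnd_simp.
have leb : (lebesgue_measure `]r, r'] = (r' - r)%:E :> \bar R)%E.
  rewrite lebesgue_measure_itv /=; case: ifPn => [_|]; first by rewrite -EFinB.
  by rewrite lte_fin -leNgt => h; have rE : r' = r; [by apply/eqP; rewrite eq_le h rr|rewrite rE subrr].
have b1 u : u \in `]r, r'] -> `|b u - D C rects r G| <= e / 2 + (r' - r) * K.
  rewrite in_itv /= => /andP[ru ur]; have u0 : 0 <= u by exact: le_trans (ltW ru).
  have uE : clamp t u = u by rewrite clampE//; exact: le_trans rt.
  have h1 : `|b u - D C rects u G| <= e / 2.
    rewrite (D_expectation rects mC u0 (span_bm Gj)) /b /flux uE.
    have iJ := state_integrable u0 (fun j => J_int j wg).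
    have iG := bm_state u0 (span_bm Gj).
    have iJG j : (pi j).-integrable setT (EFin \o (fun x => J w gw j x - G j x)).
      have := integrableB measurableT (J_int j wg) (bm_integrable (pi j) (span_bm Gj j)).
      exact: (eq_integrable measurableT).
    rewrite -event_intB//; apply: event_int_norm => //.
      by have := integrableB measurableT iJ iG; apply: (eq_integrable measurableT).
    by apply: le_trans (state_integral_le u0 iJG) _; rewrite lee_fin.
  have h2 : `|D C rects u G - D C rects r G| <= (r' - r) * K.
    apply: le_trans (D_lipschitz Gj rC (ltW ru)) _.
    by rewrite ler_wpM2r// lerD2r.
  rewrite -[b u - _](subrKA (D C rects u G)).
  by apply: (le_trans (ler_normD _ _)); exact: lerD.
have iI : lebesgue_measure.-integrable `]r, r'] (EFin \o b).
  apply: (integrableS _ _ _ ib') => // u /=.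
  by rewrite !in_itv /= => /andP[ru ->]; rewrite andbT; exact: le_trans (ltW ru).
have ic k : lebesgue_measure.-integrable `]r, r'] (EFin \o cst (k : R)).
  apply: measurable_bounded_integrable => //; first by rewrite /= leb ltry.
  by exists `|k|; split; [rewrite num_real|move=> x kx u _ /=; exact: ltW].
have cE k : \int[lebesgue_measure]_(u in `]r, r']) k = (r' - r) * k.
  by rewrite Rintegral_cst//= leb mulrC.
have d2 : `|\int[lebesgue_measure]_(u in `]r, r']) b u - (r' - r) * D C rects r G| <=
    (r' - r) * (e / 2 + (r' - r) * K).
  rewrite -(cE (D C rects r G)) -(cE (e / 2 + (r' - r) * K)) -RintegralB//; last exact: ic.
  have ibc : lebesgue_measure.-integrable `]r, r'] (EFin \o (fun u => b u - D C rects r G)).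
    have h : lebesgue_measure.-integrable `]r, r'] ((EFin \o b) \- (EFin \o cst (D C rects r G)))%E.
      by apply: integrableB => //; exact: ic.
    by apply: eq_integrable h => //; exact: measurable_itv.
  apply: (le_trans (le_normr_Rintegral _ ibc)) => //; apply: le_Rintegral => //.
    by have := integrable_norm ibc; apply: eq_integrable.
  exact: ic.
have d3 := D_drift wg Gj rC rr; rewrite -/K in d3.
have d4 : (r' - r) * norm1 pi (fun j x => J w gw j x - G j x) <= (r' - r) * (e / 2).
  by rewrite ler_wpM2l ?subr_ge0.
rewrite mulrDr in d3; rewrite mulrDr in d2.
rewrite mulrDr (_ : (r' - r) * ((r' - r) * (2 * K)) = 2 * ((r' - r) * ((r' - r) * K))); last by ring.
have -> : (r' - r) * e = 2 * ((r' - r) * (e / 2)) by field.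
have -> : Phi r' - Phi r = D C rects r' w - D C rects r w - \int[lebesgue_measure]_(u in `]r, r']) b u.
  by rewrite /Phi -d1; ring.
move: d2 d3 d4; move: ((r' - r) * (e / 2)) ((r' - r) * ((r' - r) * K)) ((r' - r) * D C rects r G)
  ((r' - r) * norm1 _ _) (D C rects r' w) (D C rects r w) (Rintegral _ _ _) => a1 a2 a3 a4 a5 a6 a7.
by rewrite !ler_norml => /andP[? ?] /andP[? ?] ?; apply/andP; split; lra.
Qed.

Let flow w gw u z := J w gw (state u z) (X u z).

Let flow_jointly w gw t : jspan A w gw -> 0 <= t -> measurable_fun
  (`[0, t] `*` setT : set (measurableTypeR R * path)) (fun s => flow w gw s.1 s.2).
Proof.
move=> wg t0; have mJ j : measurable_fun setT (J w gw j : borel E -> R).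
  by apply/measurable_EFinP; exact: measurable_int (J_int j wg).
have := measurableT_comp (state_fun_progressive t0 mJ) (pathF_id t0).
move/(@measurable_funTS _ _ _ _ (`[0, t] `*` setT)).
apply: eq_measurable_fun => s; rewrite inE => -[/= + _]; rewrite in_itv /= => /andP[s0 st].
by rewrite /flow clampE.
Qed.

Let flow_le w gw t u : jspan A w gw -> u \in `[0, t] ->
  (\int[P']_z `|flow w gw u z|%:E <= (norm1 pi (J w gw))%:E)%E.
Proof.
move=> wg; rewrite in_itv /= => /andP[u0 _].
by apply: state_integral_le => // j; exact: J_int.
Qed.

(** Integer horizons suffice, which leaves a countable union of null sets. *)
Lemma flow_locally_integrable w gw : jspan A w gw -> {ae P', forall z, forall t, 0 <= t ->
  lebesgue_measure.-integrable `[0, t] (fun u => (flow w gw u z)%:E)}.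
Proof.
move=> wg; have h : {ae P', forall z, forall n : nat,
    lebesgue_measure.-integrable `[0, n%:R] (fun u => (flow w gw u z)%:E)}.
  apply: ae_foralln => n; apply: (fubini_time_ae (flow_jointly wg (ler0n R n))) => u.
  exact: flow_le.
case: h => W [mW W0 hW]; exists W; split=> // z nz; apply: hW => h; apply: nz => t t0.
have := h (Num.bound t).
apply: integrableS => // u /=; rewrite !in_itv /= => /andP[-> /= ut].
by apply: (le_trans ut); apply: ltW; exact: archi_boundP.
Qed.

Let time_flow w gw t z := \int[lebesgue_measure]_(u in `[0, t]) flow w gw u z.

Let time_flow_integrable w gw t : jspan A w gw -> 0 <= t ->
  P'.-integrable setT (fun z => (time_flow w gw t z)%:E).
Proof.
move=> wg t0; apply: (fubini_time_integrable (flow_jointly wg t0)) => u.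
exact: flow_le.
Qed.

Let time_flow_event V w gw t t' : measurable V -> jspan A w gw -> 0 <= t -> t <= t' ->
  event_int P' V (time_flow w gw t) =
  \int[lebesgue_measure]_(u in `[0, t]) flux V w gw t' u.
Proof.
move=> mV wg t0 tt'; pose phi u z := \1_V z * flow w gw u z.
have mphi : measurable_fun (`[0, t] `*` setT : set (measurableTypeR R * path))
    (fun s => phi s.1 s.2).
  apply: measurable_funM; last exact: flow_jointly.
  have m1 : measurable_fun setT (\1_V : path -> R) by exact: measurable_indic.
  apply: measurable_funTS.
  exact: (measurableT_comp m1 (@measurable_snd _ _ (measurableTypeR R) path)).
have phiK u : u \in `[0, t] -> (\int[P']_z `|phi u z|%:E <= (norm1 pi (J w gw))%:E)%E.
  move=> ut; apply: le_trans (flow_le wg ut).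
  have iu : P'.-integrable setT (fun z => (flow w gw u z)%:E).
    move: ut; rewrite in_itv /= => /andP[u0 _].
    by apply: state_integrable => // j; exact: J_int.
  apply: ge0_le_integral => //.
  - by have := measurable_int _ (integrable_norm (event_integrable mV iu)).
  - by have := measurable_int _ (integrable_norm iu).
  move=> z _; rewrite lee_fin /phi normrM indicE; case: (_ \in _).
    by rewrite normr1 mul1r.
  by rewrite normr0 mul0r.
have := fubini_time mphi phiK; set lhs := (X in X = _ -> _) => FE.
have -> : event_int P' V (time_flow w gw t) = lhs.
  apply: eq_Rintegral => z _; rewrite /phi indicE; case: (_ \in _).
    by rewrite mul1r; apply: eq_Rintegral => u _; rewrite mul1r.
  rewrite mul0r; under eq_Rintegral do rewrite mul0r.
  by rewrite Rintegral_cst// mul0r.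
rewrite FE; apply: eq_Rintegral => u; rewrite inE /= in_itv /= => /andP[u0 ut].
by rewrite /flux /event_int clampE//; exact: le_trans tt'.
Qed.

Definition compensated w gw t z : R :=
  w (state t z) (X t z) - w (state 0 z) (X 0 z) - time_flow w gw t z.

Let compensated_integrable w gw t : jspan A w gw -> 0 <= t ->
  P'.-integrable setT (EFin \o compensated w gw t).
Proof.
move=> wg t0; have i1 := bm_state t0 (span_bm wg); have i2 := bm_state (lexx 0) (span_bm wg).
have := integrableB measurableT (integrableB measurableT i1 i2) (time_flow_integrable wg t0).
exact: (eq_integrable measurableT).
Qed.

(** On the generating events the identity is [drift_integral], after the exchange of expectation and
    time integral. These events are stable under intersection, so Dynkin's theorem extends it to
    [history s]. *)
Lemma compensated_martingale w gw : jspan A w gw ->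
  martingale P' history (compensated w gw).
Proof.
move=> wg; have wm j : measurable_fun setT (w j : borel E -> R) by have [] := span_bm wg j.
have adapted t : 0 <= t ->
    measurable_wrt (history t) (compensated w gw t : path -> measurableTypeR R).
  move=> t0 B mB; suff mM : measurable_fun setT (compensated w gw t : pathF t -> measurableTypeR R).
    by have := mM measurableT B mB; rewrite setTI.
  have mstate r : 0 <= r -> r <= t -> measurable_fun setT (fun z : pathF t => w (state r z) (X r z)).
    move=> r0 rt; apply: measurable_state_fun => //; last by move=> j; exact: pathF_state.
    have := measurableT_comp (X_progressive t0) (@measurable_pair1 _ _ (measurableTypeR R) (pathF t) r).
    by apply: eq_measurable_fun => z _ /=; rewrite clampE.
  apply: measurable_funB.
    by apply: measurable_funB; apply: mstate.
  have mJ j : measurable_fun setT (J w gw j : borel E -> R).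
    by apply/measurable_EFinP; exact: measurable_int (J_int j wg).
  have mswap := measurableT_comp (state_fun_progressive t0 mJ)
    (@measurable_swap _ _ (pathF t) (measurableTypeR R)).
  have := measurable_Rintegral_param lebesgue_measure (measurable_itv `[0, t]) mswap.
  apply: eq_measurable_fun => z _; apply: eq_Rintegral => u.
  by rewrite inE /= in_itv /= => /andP[u0 ut]; rewrite /flow clampE.
split=> [t t0|s t s0 st].
  by split; [exact: adapted|exact: compensated_integrable].
have t0 := le_trans s0 st; split; [exact: adapted|exact: compensated_integrable|].
move=> V sV; apply/esym; move: V sV; apply: integral_eq_dynkin.
- exact: past_events_setI.
- exists setT, [::]; split; last by apply/seteqP; split.
  by split=> //.
- by have [_ h _] := history_filtration; exact: h.
- exact: compensated_integrable.
- exact: compensated_integrable.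
move=> _ [C [rects [sC ->]]]; have mC := past_measurable sC; have mV := m_bits rects mC.
have i0 := bm_state (lexx 0) (span_bm wg).
have compE r : 0 <= r -> r <= t -> event_int P' (bits C rects) (compensated w gw r) =
    D C rects r w - event_int P' (bits C rects) (fun z => w (state 0 z) (X 0 z)) -
    \int[lebesgue_measure]_(u in `[0, r]) flux (bits C rects) w gw t u.
  move=> r0 rt; have ir := bm_state r0 (span_bm wg).
  rewrite (D_expectation rects mC r0 (span_bm wg)) -(time_flow_event mV wg r0 rt).
  rewrite /compensated event_intB//; last 2 first.
  - by have := integrableB measurableT ir i0; apply: (eq_integrable measurableT).
  - exact: time_flow_integrable.
  by rewrite event_intB.
rewrite !compE//; have := drift_integral wg sC st.
move: (D _ _ _ _) (D _ _ _ _) (event_int _ _ _) (Rintegral _ _ _) (Rintegral _ _ _) => a b c e f h.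
exact: subr_exchangeB.
Qed.

Local Notation process := (fun t (z : path) => (X t z, state t z)).

Let process_progressive t : 0 <= t ->
  measurable_fun setT (fun s : measurableTypeR R * pathF t =>
    process (clamp t s.1) s.2 : borel (E * 'I_m.+1)%type).
Proof.
move=> t0; apply: (measurable_pair_state (X_progressive t0)) => j.
exact: state_progressive.
Qed.

Lemma process_measurable_jointly : measurable_process process.
Proof.
move=> _ B mB.
rewrite (_ : _ `&` _ = \bigcup_n ((`[0, n%:R] `*` setT) `&`
    (fun s : measurableTypeR R * path => process (clamp n%:R s.1) s.2) @^-1` B)).
  apply: bigcupT_measurable => n; apply: measurableI.
    by apply: measurableX => //; exact: measurable_itv.
  rewrite -[X in measurable X]setTI.
  exact: (measurableT_comp (process_progressive (ler0n R n)) (pathF_id (ler0n R n))).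
apply/seteqP; split=> [s [[/= s0 _] Bs]|s [n _ [[/= sn _] Bs]]].
  move: s0; rewrite in_itv /= andbT => s0.
  have sb : s.1 <= (Num.bound s.1)%:R by apply/ltW/archi_boundP.
  exists (Num.bound s.1) => //; split; first by split=> //=; rewrite in_itv /= s0.
  by rewrite /= clampE.
move: sn; rewrite in_itv /= => /andP[s0 sn].
by split; [split=> //=; rewrite in_itv /= s0|rewrite /= clampE in Bs].
Qed.

Lemma process_solves (B : operator (R := R) (E * 'I_m.+1)%type) :
  (forall f g, B (f, g) -> exists w gw, [/\ jspan A w gw,
    f = (fun z => w z.2 z.1) & g = (fun z => J w gw z.2 z.1)]) ->
  solves_mp P' B process.
Proof.
move=> BJ; split; first exact: process_measurable_jointly.
exists history; split; first exact: history_filtration.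
  move=> t t0 V mV; have := measurableT_comp (process_progressive t0)
    (@measurable_pair1 _ _ (measurableTypeR R) (pathF t) t).
  move/(_ measurableT V mV); rewrite setTI; congr (history t); apply/seteqP.
  by split=> z /=; rewrite clampE.
move=> f g /BJ[w [gw [wg -> ->]]]; split; first exact: flow_locally_integrable.
exact: compensated_martingale.
Qed.

Lemma process_initial_law (B : set (borel (E * 'I_m.+1)%type)) : measurable B ->
  P' (process 0 @^-1` B) = (\sum_i (p i)%:E * pi i [set x | B (x, i)])%E.
Proof.
move=> mB; have mZ : measurable (process 0 @^-1` B).
  rewrite -[X in measurable X]setTI; apply: measurable_pair_state => //.
    exact: X_random.
  by move=> j; exact: state_random.
have mj j : measurable ([set z : path | state 0 z = j] : set path) by exact: state_random.
rewrite -[LHS]fineK ?fin_num_measure//.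
rewrite (probability_partition P' mZ mj) -sumEFin; apply: eq_bigr => j _.
have [_ Y0 _] := Y_markov; have := law_state j (lexx 0) (measurable_section j mB).
rewrite Y0 /= => <-; rewrite (_ : _ `&` _ = [set z : path | state 0 z = j] `&`
    X 0 @^-1` [set x | B (x, j)]).
  rewrite fineK// fin_num_measure//; apply: measurableI => //.
  rewrite -[X in measurable X]setTI; apply: X_random => //; exact: measurable_section.
by apply/seteqP; split=> [z [/= Bz zj]|z [/= zj Bz]]; split=> //=; rewrite -?zj// zj.
Qed.

Let natural_lift t V : natural_filtration (fun t (z : path) => state t z) t V ->
  exists2 C, natural_filtration Y t C & V = bits C [::].
Proof.
move: V; apply: smallest_sub.
  have [n0 nC nU] := natural_filtration_sigma Y t; split.
  - by exists set0 => //; apply/seteqP; split=> z // [].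
  - move=> V [C FC ->]; exists (setT `\` C); first exact: nC.
    by apply/seteqP; split=> z [h1 h2]; split=> //; [split=> // h; apply: h2|move=> [h _]; apply h1.2].
  - move=> F FF; have /choice[C CP] n : exists C, natural_filtration Y t C /\ F n = bits C [::].
      by have [C ? ?] := FF n; exists C.
    exists (\bigcup_n C n); first by apply: nU => n; have [] := CP n.
    apply/seteqP; split=> [z [n _]|z [[n _ Cz] _]].
      by have [_ ->] := CP n => -[Cz _]; split=> //; exists n.
    by exists n => //; have [_ ->] := CP n.
move=> _ [s [B [s0 st mB ->]]]; exists (Y s @^-1` B).
  by apply: sub_sigma_algebra; exists s, B.
by apply/seteqP; split=> [z|z []].
Qed.

(** Every event of the filtration of [Y] on the path space comes from [Omega], where [law_event]
    computes the left side. The candidate is a function of the state alone, hence a step function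
    with all its sets equal to [setT]. *)
Lemma process_filter t (G : set (borel E)) : 0 <= t -> measurable G ->
  cond_expectation P' (natural_filtration (fun t (z : path) => state t z) t)
    (\1_(X t @^-1` G)) (fun z => fine (pi (state t z) G)).
Proof.
move=> t0 mG; pose phi j (x : E) : R := fine (pi j G) * \1_[set: E] x.
have bphi j : bounded_measurable (phi j) by apply: bmZ; apply: bm_indic.
have phiE j x : phi j x = fine (pi j G) by rewrite /phi indicE in_setT mulr1.
have iphi := bm_state t0 bphi.
have iW : P'.-integrable setT (EFin \o (fun z : path => fine (pi (state t z) G))).
  by apply: eq_integrable iphi => // z _ /=; rewrite phiE.
have mX : measurable (X t @^-1` G) by rewrite -[X in measurable X]setTI; exact: X_random.
have iX : P'.-integrable setT (EFin \o (\1_(X t @^-1` G) : path -> R)).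
  apply: (@bounded_integrable _ _ _ P' _ 1) => [|x]; first exact: measurable_indic.
  by rewrite indicE; case: (_ \in _); rewrite ?normr1 ?normr0.
split=> //.
- move=> B _; rewrite (_ : _ @^-1` B = \bigcup_(j in [set j | B (fine (pi j G))])
      [set z : path | state t z = j]); last first.
    apply/seteqP; split=> [z Bz|z [j /= Bj /= zj]]; last by rewrite /= zj.
    by exists (state t z).
  apply: (@fin_bigcup_measurable _ (g_sigma_algebraType [set V : set path | exists s (B : set (borel 'I_m.+1)),
     [/\ 0 <= s, s <= t, measurable B & V = (fun z => state s z) @^-1` B]])).
    exact: finite_finset.
  move=> j _; apply: sub_sigma_algebra; exists t, [set j]; split=> //.
  exact: measurable_state.
move=> V /natural_lift[C FC ->].
have mC := natural_filtration_measurable Y_markov FC.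
have mV := m_bits [::] mC.
rewrite !event_intE//; congr (_%:E).
rewrite event_int_indic// law_event//.
pose S : seq (R * 'I_m.+1 * set E) := [seq (fine (pi j G), j, setT) | j <- index_enum 'I_m.+1].
have mS u : List.In u S -> mb u.2 by move=> /In_mapP[j [_ <-]]; exact: measurableT.
have -> : event_int P' (bits C [::]) (fun z => fine (pi (state t z) G)) =
    event_int P' (bits C [::]) (fun z => step_fun S (state t z) (X t z)).
  apply: eq_Rintegral => z _; congr (_ * _); rewrite /step_fun big_map /=.
  rewrite (bigD1 (state t z))//= big1 => [|j jz].
    by rewrite eqxx mulr1 indicE in_setT mulr1 addr0.
  by rewrite eq_sym (negbTE jz) mulr0 mul0r.
rewrite step_fun_expectation// big_map /=; apply: eq_bigr => j _.
rewrite [RHS]mulrC; congr (_ * _).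
have FCj : natural_filtration Y t (C `&` Y t @^-1` [set j]).
  by apply: natural_filtrationI => //; exact: natural_filtration_state.
rewrite (P'_state t0 FCj measurableT) (bigD1 j)//= -setIA setIid probability_setT mulr1.
rewrite big1 ?addr0// => k kj; rewrite (_ : _ `&` _ = set0) ?measure0 ?mul0r//.
by apply/seteqP; split=> // w [[_ /= ->] /= /eqP]; rewrite eq_sym (negbTE kj).
Qed.

Lemma process_path_law : same_path_law P' P (fun t (z : path) => state t z) Y.
Proof.
move=> C pC; have mC : measurable [set w | C (Y ^~ w)].
  move: C pC; apply: smallest_sub.
    split=> [|C mC|F mF].
    - by rewrite (_ : [set w | _] = set0)//; apply/seteqP; split.
    - rewrite (_ : [set w | _] = ~` [set w | C (Y ^~ w)]); first exact: measurableC.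
      by apply/seteqP; split=> [w []//|w nC]; split=> //; exact: Y_cadlag.
    - rewrite (_ : [set w | _] = \bigcup_n [set w | F n (Y ^~ w)]).
        exact: bigcupT_measurable.
      by apply/seteqP; split=> w [n _ h]; exists n.
  move=> _ [t [B [t0 mB ->]]]; have [mY _ _] := Y_markov.
  have := mY t t0 measurableT B mB; rewrite setTI; congr measurable.
  by apply/seteqP; split=> [w Bw|w []//]; split=> //; exact: Y_cadlag.
rewrite -(P'_bits0 mC); congr (P' _).
by apply/seteqP; split=> [z Cz|z []].
Qed.

End bit_solution.

Theorem theorem2p10 (R : realType) (E : completeMetricType R)
  (E_separable : separable_space E)
  (A : operator (R := R) E) (m : nat) (Q : 'M[R]_m.+1)
  (xi : 'I_m -> 'cV[R]_m.+1)
  (varpi : probability (borel E) R)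
  (vark : 'I_m -> {charge set (borel E) -> \bar R})
  (lam : 'I_m -> R) (eta : 'I_m -> E -> R)
  (A_mapping : mapping_condition A)
  (setting : standing_setting A Q xi varpi vark lam eta)
  (p : 'I_m.+1 -> R) (p_ge0 : forall i, 0 <= p i) (p_sum : \sum_i p i = 1)
  (d : measure_display) (Omega : measurableType d) (P : probability Omega R)
  (Yt : R -> Omega -> 'I_m.+1)
  (Yt_cadlag : forall w, cadlag (Yt ^~ w))
  (Yt_markov : markov_chain P Q p Yt) :
  exists (d' : measure_display) (Omega' : measurableType d')
         (P' : probability Omega' R)
         (X : R -> Omega' -> E) (Y : R -> Omega' -> 'I_m.+1),
    [/\ solves_mp_from P' (joint_operator A Q xi eta)
          (joint_law xi varpi eta p) (fun t w => (X t w, Y t w)),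
        forall w, cadlag (Y ^~ w),
        same_path_law P' P Y Yt &
        forall t (G : set (borel E)), 0 <= t -> measurable G ->
          cond_expectation P' (natural_filtration Y t) (\1_(X t @^-1` G))
            (fun w => fine (alpha xi varpi eta (Y t w) G))].
Proof.
have [pi [piE pi_A q_int pi_q]] := alpha_measures setting.
have A_bounded := ss_operator setting.
have [[_ A_mul A_separating] _ [psi [_ _ _ _ [mu [la [la_ge0 A_lim]]]]]] := A_mapping.
have [Q_off Q_row] := ss_generator setting.
have q_ge0 i j x : i != j -> 0 <= jump_rate Q xi eta i j x.
  move=> ij; rewrite divr_ge0 ?mulr_ge0 ?Q_off//; exact/ltW/(ss_alpha_gt0 setting).
have [P' [D [[P'0 P'_merge] P'_state D_lip D_drift D_step]]] := coupled_limit
  A_bounded A_mul la_ge0 A_lim q_ge0 Q_row pi_A q_int pi_q Yt_markov Yt_cadlag.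
have [X [X_bits X_measurable]] := process_exists E_separable A_bounded A_separating
  Yt_markov P'_merge P'_state D_lip D_step.
do 2 eexists; exists P', X, (fun t z => Yt t z.1); split.
- split.
    apply: (process_solves A_bounded A_separating Q_row pi_A q_int pi_q Yt_markov Yt_cadlag
      P'_state D_lip D_drift D_step X_bits X_measurable).
    move=> f g [f1 [g1 [f2 [Afg /= -> ->]]]].
    (* The components of a product function are multiples of [f1] by the values of [f2], so they lie
       in the span. *)
    exists (fun j x => f2 j * f1 x), (fun j x => f2 j * g1 x); split.
    + by move=> j; apply: spanZ; exact: span_in.
    + by apply/funext => z; rewrite mulrC.
    + apply/funext => z; rewrite /jump; congr (_ + _); apply: eq_bigr => j _.
      by rewrite /= ![f2 _ * _]mulrC.
  move=> B mB; rewrite (process_initial_law Yt_markov P'_state X_bits X_measurable mB).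
  apply: eq_bigr => i _; rewrite piE//; exact: measurable_section.
- by move=> z; exact: Yt_cadlag.
- exact: (@process_path_law R E m Q d Omega P p Yt Yt_markov Yt_cadlag P' P'0).
move=> t G t0 mG.
have := process_filter Yt_markov P'_state X_bits X_measurable t0 mG.
by under [X in cond_expectation _ _ _ X]eq_fun do rewrite piE//.
Qed.
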